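(* Let $(M,g)$ and $(M',g')$ be Riemannian symmetric spaces with fixed-sign curvature operator. Let $L=\mathfrak{k}\oplus\mathfrak{p}$ and $L'=\mathfrak{k}'\oplus\mathfrak{p}'$ be the L$^*$-algebras (with their orthogonal decompositions) associated to the universal covers $\widetilde{M}$ and $\widetilde{M'}$. If there exists an isomorphism of L$^*$-algebras between $L$ and $L'$ which intertwines the orthogonal decompositions $L=\mathfrak{k}\oplus\mathfrak{p}$ and $L'=\mathfrak{k}'\oplus\mathfrak{p}'$ (i.e. maps $\mathfrak{k}$ onto $\mathfrak{k}'$ and $\mathfrak{p}$ onto $\mathfrak{p}'$), then $M$ and $M'$ are locally isomorphic.
   Context: Conventions. A Riemannian manifold is a connected smooth manifold modeled on a real Hilbert space (of finite or infinite dimension) endowed with a smooth Riemannian metric $g$. A Riemannian symmetric space is a Riemannian manifold such that for each point $p\in M$ there is an (involutive) isometry $\sigma_p$ of $M$ with $\sigma_p(p)=p$ and $d_p\sigma_p=-\mathrm{Id}$. The universal cover carries the pulled-back metric and is again a Riemannian symmetric space. Locally isomorphic means that some point of $M$ and some point of $M'$ (equivalently, by homogeneity, any points) have isometric open neighborhoods. A Killing field is a smooth vector field whose flow consists of isometries. Curvature operator. $R$ is the Riemann 4-tensor with the sign convention that the sectional curvature of orthonormal $u,v$ is $-R(u,v,u,v)$. On the algebraic exterior square $\wedge^2 T_pM$, identified with the finite rank skew-symmetric operators via $X\wedge Y\colon Z\mapsto g(X,Z)Y-g(Y,Z)X$, put $\langle A,B\rangle_g=\mathrm{trace}({}^tAB)$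 for $A$ a bounded operator on $T_pM$ and $B\in\wedge^2T_pM$. The curvature operator is the linear map $C\colon\wedge^2T_pM\to \mathrm{L}(T_pM)$, with values in skew-symmetric operators, such that $\langle C(X\wedge Y),Z\wedge T\rangle_g=-R(X,Y,Z,T)$. It is nonpositive (resp. nonnegative) if $\langle C(U),U\rangle_g\le 0$ (resp. $\ge0$) for all $U$; that is, $\sum_{i,j}R(X_i,Y_i,X_j,Y_j)\ge0$ (resp. $\le 0$) for all finite families $(X_i),(Y_i)$ in $T_pM$. Fixed-sign means nonpositive or nonnegative. L$^*$-algebras. An L$^*$-algebra is a (real or complex) Lie algebra $L$ with a structure of Hilbert space such that there is a map $x\mapsto x^*$ with $\langle[x,y],z\rangle=\langle y,[x^*,z]\rangle$ for all $x,y,z\in L$. An isomorphism of L$^*$-algebras is a Lie algebra isomorphism that is an isometry and intertwines the maps $*$. Associated L$^*$-algebra. Let $N$ be a simply-connected Riemannian symmetric space with fixed-sign curvature operator and $p\in N$. The Lie algebra $\mathfrak{g}$ of Killing fields decomposes as $\mathfrak{q}\oplus\mathfrak{p}$, where $\mathfrak{q}$ is the set of Killing fields vanishing at $p$ and $\mathfrak{p}$ is the set of Killing fields whose covariant derivative vanishes at $p$; $X\mapsto X(p)$ identifies $\mathfrak{p}$ with $T_pN$, and $[\mathfrak{p},\mathfrak{p}]\subseteq\mathfrak{q}$, $[\mathfrak{q},\mathfrak{p}]\subseteq\mathfrak{p}$, $R(X,Y,Z,T)=g([Z,[X,Y]],T)$ for $X,Y,Z,T\in\mathfrak{p}$. Let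 $[\mathfrak{p},\mathfrak{p}]$ be the linear span of brackets. For $U,V=\sum_j[Z_j,T_j]\in[\mathfrak{p},\mathfrak{p}]$ set $\langle U,V\rangle=-\sum_jg([U,Z_j],T_j)$ if the curvature operator is nonpositive and $\langle U,V\rangle=\sum_jg([U,Z_j],T_j)$ if it is nonnegative; set $\langle\,,\rangle=g$ on $\mathfrak{p}$ and $\mathfrak{p}\perp[\mathfrak{p},\mathfrak{p}]$. This is a scalar product; let $\mathfrak{k}$ be the completion of $[\mathfrak{p},\mathfrak{p}]$. The Lie bracket of $[\mathfrak{p},\mathfrak{p}]\oplus\mathfrak{p}$ extends continuously to $L=\mathfrak{k}\oplus\mathfrak{p}$, which is an L$^*$-algebra with $U^*=-U$ for $U\in\mathfrak{k}$ and, for $X\in\mathfrak{p}$, $X^*=X$ in the nonpositive case and $X^*=-X$ in the nonnegative case. This $L=\mathfrak{k}\oplus\mathfrak{p}$ is the L$^*$-algebra associated to $N$. *)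

(* Defs.v *)
From HB Require Import structures.
From mathcomp Require Import all_boot all_order all_algebra sesquilinear.
From mathcomp Require Import all_classical all_reals all_analysis.

Set Implicit Arguments.
Unset Strict Implicit.
Unset Printing Implicit Defensive.

Import Order.TTheory GRing.Theory Num.Theory.
Import numFieldNormedType.Exports.

Local Open Scope classical_set_scope.
Local Open Scope ring_scope.

Record hilbert (R : realType) := Hilbert {
  hilbert_sort :> completeNormedModType R;
  inner : {dot hilbert_sort for idfun};
  inner_norm : forall x, inner x x = `|x| ^+ 2 }.

(* f is differentiable (in the sense of Frechet) on the open set U and its
   tangent map (x, v) |-> 'd f x v is of class C^(n-1) on U x E. For a fixed n
   this is slightly weaker than the usual C^n (the differential is only
   required to be strongly continuous when n = 1), but it implies the usual
   C^(n-1), so that smoothness is the usual notion for maps between Banach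
   spaces. *)
Fixpoint diff_class (R : realType) (n : nat) (E F : normedModType R)
    (U : set E) (f : E -> F) {struct n} : Prop :=
  match n with
  | 0 => forall x, U x -> {for x, continuous f}
  | n.+1 => (forall x, U x -> differentiable f x) /\
      @diff_class R n (E * E)%type F (U `*` setT) (fun z => 'd f (z.1) z.2)
  end.

Definition smooth_on (R : realType) (E F : normedModType R)
    (U : set E) (f : E -> F) : Prop :=
  forall n, diff_class n U f.

(* The atlas is indexed by the points of the manifold: chart q is a chart
   around q with domain chart_dom q. Every atlas has a subatlas of this form
   (up to repetitions), which defines the same smooth structure. The values of
   chart q off chart_dom q, and of chart_inv q off the image of chart q, are
   irrelevant. *)
Record manifold (R : realType) (H : hilbert R) := Manifold {
  manifold_sort :> topologicalType;
  chart_dom : manifold_sort -> set manifold_sort;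
  chart : manifold_sort -> manifold_sort -> H;
  chart_inv : manifold_sort -> H -> manifold_sort;
  manifold_hausdorff : hausdorff_space manifold_sort;
  manifold_connected : connected [set: manifold_sort];
  chart_dom_center : forall a, chart_dom a a;
  chart_dom_open : forall a, open (chart_dom a);
  chart_image_open : forall a, open (chart a @` chart_dom a);
  chartK : forall a q, chart_dom a q -> chart_inv a (chart a q) = q;
  chart_continuous : forall a q, chart_dom a q ->
    {for q, continuous (chart a)};
  chart_inv_continuous : forall a x, (chart a @` chart_dom a) x ->
    {for x, continuous (chart_inv a)};
  chart_transition_smooth : forall a b,
    smooth_on (chart a @` (chart_dom a `&` chart_dom b))
              (chart b \o chart_inv a) }.

Arguments chart_dom {R H} _ _ _.
Arguments chart {R H} _ _ _.
Arguments chart_inv {R H} _ _ _.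

Section Manifold.
Context (R : realType) (H : hilbert R) (M : manifold H).

Definition chart_image (a : M) : set H := chart M a @` chart_dom M a.

(* The tangent space of M at q is H, a tangent vector being given by its
   coordinates in the chart around q. Thus a vector field is a function
   M -> H, and transport a b q maps the coordinates in the chart around a of a
   tangent vector at q to its coordinates in the chart around b. *)
Definition transport (a b q : M) : H -> H :=
  'd (chart M b \o chart_inv M a) (chart M a q).

Definition local_field (a : M) (X : M -> H) (x : H) : H :=
  let q := chart_inv M a x in transport q a q (X q).

Definition smooth_field (X : M -> H) : Prop :=
  forall a, smooth_on (chart_image a) (local_field a X).

Definition field_bracket (X Y : M -> H) (q : M) : H :=
  'd (local_field q Y) (chart M q q) (X q)
  - 'd (local_field q X) (chart M q q) (Y q).

Definition local_form (g : M -> H -> H -> R) (a : M) (x u v : H) : R^o :=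
  let q := chart_inv M a x in g q (transport a q q u) (transport a q q v).

End Manifold.

Section Maps.
Context (R : realType) (H H' : hilbert R) (M : manifold H) (M' : manifold H').

Definition tangent_map (f : M -> M') (q : M) : H -> H' :=
  'd (chart M' (f q) \o f \o chart_inv M q) (chart M q q).

Definition smooth_map_on (U : set M) (f : M -> M') : Prop :=
  (forall q, U q -> {for q, continuous f}) /\
  forall a b, smooth_on (chart M a @` (U `&` chart_dom M a `&`
                                       f @^-1` chart_dom M' b))
                        (chart M' b \o f \o chart_inv M a).

End Maps.

(* The metric is strong: each scalar product on a tangent space induces the
   topology of the model space (its continuity follows from smoothness). *)
Record riemannian (R : realType) (H : hilbert R) := Riemannian {
  riemannian_manifold :> manifold H;
  metric : riemannian_manifold -> {dot H for idfun};
  metric_strong : forall q, exists2 c : R, 0 < c &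
    forall u, c * `|u| ^+ 2 <= metric q u u;
  metric_smooth : forall a : riemannian_manifold,
    smooth_on (chart_image a `*` setT `*` setT : set (H * H * H)%type)
      (fun z => local_form metric a z.1.1 z.1.2 z.2) }.

Arguments metric {R H} _ _.

(* f and f' are mutually inverse isometries between the open sets U and V. *)
Definition isometry_between (R : realType) (H H' : hilbert R)
    (M : riemannian H) (M' : riemannian H') (U : set M) (V : set M')
    (f : M -> M') (f' : M' -> M) : Prop :=
  [/\ open U /\ open V,
      (forall q, U q -> V (f q) /\ f' (f q) = q) /\
        (forall q, V q -> U (f' q) /\ f (f' q) = q),
      smooth_map_on U f /\ smooth_map_on V f' &
      forall q u v, U q ->
        metric M' (f q) (tangent_map f q u) (tangent_map f q v)
        = metric M q u v].

Definition locally_isomorphic (R : realType) (H H' : hilbert R)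
    (M : riemannian H) (M' : riemannian H') : Prop :=
  exists (U : set M) (V : set M') (f : M -> M') (f' : M' -> M),
    U !=set0 /\ isometry_between U V f f'.

Section Riemannian.
Context (R : realType) (H : hilbert R) (M : riemannian H).

Definition symmetric_space : Prop :=
  forall p : M, exists s : M -> M,
    [/\ isometry_between setT setT s s, s p = p &
        forall v, tangent_map s p v = - v].

(* Koszul formula, in the chart around a. *)
Definition christoffel (a : M) (x u v : H) : H :=
  let g := local_form (metric M) a in
  xget 0 [set z | forall w, 2%:R * g x z w =
    'd (fun y => g y v w) x u + 'd (fun y => g y u w) x v
    - 'd (fun y => g y u v) x w].

Definition covariant_derivative (X : M -> H) (p : M) (v : H) : H :=
  'd (local_field p X) (chart M p p) v + christoffel p (chart M p p) v (X p).

Definition riemann_endo (p : M) (u v w : H) : H :=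
  let G := christoffel p in
  let x := chart M p p in
  'd (fun y => G y v w) x u - 'd (fun y => G y u w) x v
  + G x u (G x v w) - G x v (G x u w).

(* With this sign the sectional curvature of orthonormal u, v is
   - riemann p u v u v. *)
Definition riemann (p : M) (X Y Z T : H) : R :=
  metric M p (riemann_endo p X Y Z) T.

(* trace (tA B) for B = \sum_j Z_j /\ T_j, where
   (Z /\ T) W = g(Z, W) T - g(T, W) Z: the trace of the rank one operator
   W |-> g(Z, W) (tA T) is g(Z, tA T) = g(A Z, T). *)
Definition wedge_pairing (p : M) (A : H -> H) (n : nat) (Z T : 'I_n -> H) : R :=
  \sum_j (metric M p (A (Z j)) (T j) - metric M p (A (T j)) (Z j)).

(* The skew-symmetric operator C(\sum_i X_i /\ Y_i): since
   <A, Z /\ T> = 2 g(A Z, T) for A skew-symmetric, the condition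
   <C(X /\ Y), Z /\ T> = - R(X, Y, Z, T) reads C(X /\ Y) = - R(X, Y) / 2. *)
Definition curvature_operator (p : M) (n : nat) (X Y : 'I_n -> H) (Z : H) : H :=
  - \sum_i 2%:R^-1 *: riemann_endo p (X i) (Y i) Z.

End Riemannian.

Inductive curvature_sign := Nonpositive | Nonnegative.

Definition has_curvature_sign (R : realType) (H : hilbert R)
    (M : riemannian H) (eps : curvature_sign) : Prop :=
  forall (p : M) (n : nat) (X Y : 'I_n -> H),
    let c := wedge_pairing p (curvature_operator p X Y) X Y in
    match eps with Nonpositive => c <= 0 | Nonnegative => 0 <= c end.

Definition fixed_sign (R : realType) (H : hilbert R) (M : riemannian H) : Prop :=
  exists eps, has_curvature_sign M eps.

Definition simply_connected (R : realType) (T : topologicalType) : Prop :=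
  (forall x y : T, exists c : R -> T,
    [/\ {within `[0, 1], continuous c}, c 0 = x & c 1 = y]) /\
  (forall c : R -> T, {within `[0, 1], continuous c} -> c 0 = c 1 ->
    exists h : R * R -> T,
      [/\ {within `[0, 1] `*` `[0, 1], continuous h},
          forall s, 0 <= s <= 1 -> h (s, 0) = c s /\ h (s, 1) = c 0 &
          forall t, 0 <= t <= 1 -> h (0, t) = c 0 /\ h (1, t) = c 0]).

(* A covering map which is isometric on each sheet over an evenly covered
   open set, i.e. the metric of N is the pull-back of the metric of M. *)
Definition riemannian_covering (R : realType) (H : hilbert R)
    (N M : riemannian H) (pi : N -> M) : Prop :=
  (forall x : M, exists q, pi q = x) /\
  forall x : M, exists (U : set M) (I : Type) (V : I -> set N) (s : I -> M -> N),
    [/\ U x, pi @^-1` U = \bigcup_i V i,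
        trivIset setT V &
        forall i, isometry_between (V i) U pi (s i)].

Definition universal_covering (R : realType) (H : hilbert R)
    (N M : riemannian H) (pi : N -> M) : Prop :=
  simply_connected R N /\ riemannian_covering pi.

Section Killing.
Context (R : realType) (H : hilbert R) (N : riemannian H).

(* The flow is complete: Killing fields of a symmetric space are complete. *)
Definition killing_field (X : N -> H) : Prop :=
  smooth_field X /\
  exists phi : R -> N -> N,
    [/\ forall q, phi 0 q = q,
        forall s t q, phi (s + t) q = phi s (phi t q),
        forall t, isometry_between setT setT (phi t) (phi (- t)),
        forall q, continuous (fun t => phi t q) &
        forall t q, is_derive (t : R^o) 1
          (fun s => chart N (phi t q) (phi s q)) (X (phi t q))].

Definition transvection (p : N) (X : N -> H) : Prop :=
  killing_field X /\ forall v, covariant_derivative X p v = 0.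

Definition transvection_brackets (p : N) (U : N -> H) : Prop :=
  exists (n : nat) (X Y : 'I_n -> N -> H),
    (forall i, transvection p (X i) /\ transvection p (Y i)) /\
    U = \sum_i field_bracket (X i) (Y i).

Definition transvection_algebra (p : N) (A : N -> H) : Prop :=
  exists U X, [/\ transvection_brackets p U, transvection p X & A = U + X].

End Killing.

Record Lstar_algebra (R : realType) := LstarAlgebra {
  Lstar_hilbert :> hilbert R;
  lie : Lstar_hilbert -> Lstar_hilbert -> Lstar_hilbert;
  star : Lstar_hilbert -> Lstar_hilbert;
  lie_linearl : forall z, linear (fun x => lie x z);
  lie_linearr : forall x, linear (lie x);
  lie_alternating : forall x, lie x x = 0;
  lie_jacobi : forall x y z,
    lie x (lie y z) + lie y (lie z x) + lie z (lie x y) = 0;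
  lie_star : forall x y z,
    inner Lstar_hilbert (lie x y) z = inner Lstar_hilbert y (lie (star x) z) }.

Arguments lie {R} _ _ _.
Arguments star {R} _ _.

Definition Lstar_isomorphism (R : realType) (L L' : Lstar_algebra R)
    (F : L -> L') : Prop :=
  [/\ linear F /\ bijective F,
      forall x y, F (lie L x y) = lie L' (F x) (F y),
      forall x y, inner L' (F x) (F y) = inner L x y &
      forall x, F (star L x) = star L' (F x)].

(* L = K + P is the L*-algebra associated to N and p, with its decomposition.
   It is characterized, up to unique isomorphism, as the completion of
   [p, p] + p, iota being the embedding of [p, p] + p into L; the values of
   iota outside [p, p] + p are irrelevant. The scalar product on [p, p] is
   prescribed against the brackets [Z, T], which span it. *)
Definition associated_Lstar (R : realType) (H : hilbert R) (N : riemannian H)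
    (p : N) (L : Lstar_algebra R) (K P : set L) : Prop :=
  exists (eps : curvature_sign) (iota : (N -> H) -> L),
  [/\ has_curvature_sign N eps,
      (forall (a : R) A B, transvection_algebra p A -> transvection_algebra p B ->
          iota (a *: A + B) = a *: iota A + iota B) /\
        (forall A B, transvection_algebra p A -> transvection_algebra p B ->
          iota (field_bracket A B) = lie L (iota A) (iota B)) /\
        continuous (fun z : L * L => lie L z.1 z.2),
      [/\ K = closure (iota @` [set U | transvection_brackets p U]),
          P = iota @` [set X | transvection p X],
          forall z, exists U X, [/\ K U, P X & z = U + X] &
          forall U X, K U -> P X -> inner L U X = 0],
      (forall X Y, transvection p X -> transvection p Y ->
          inner L (iota X) (iota Y) = metric N p (X p) (Y p)) /\
        (forall U Z T, transvection_brackets p U ->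
          transvection p Z -> transvection p T ->
          let c := metric N p (field_bracket U Z p) (T p) in
          inner L (iota U) (iota (field_bracket Z T)) =
            match eps with Nonpositive => - c | Nonnegative => c end) &
      forall U X, K U -> P X ->
        star L (U + X) =
          match eps with Nonpositive => - U + X | Nonnegative => - U - X end].

(* Main.v *)
(** Through each tangent vector v of N at p there is a transvection X_v: a Killing field with value v
and vanishing covariant derivative at p. Its flow on N is lifted from M, where it is a product of two
point reflections along the geodesic with velocity v. The fields X_v trivialize the tangent bundle
near p, and in this trivialization the brackets [X_v, X_w] and the metric satisfy linear differential
equations, whose coefficients come from the triple brackets [[X_v, X_w], X_z](p). An isomorphism of
L*-algebras preserving the decompositions restricts to a linear isometry phi from T_p N to T_p' N'. It
intertwines the triple brackets because +-g([U, Z], T) is a scalar product on [p, p]; the two signs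
agree because the isomorphism intertwines the involutions, unless p = 0. Let b and b' be the
trivializations at p and p'. By uniqueness for linear differential equations along the rays from p,
the total differential equation Df = b'(f) o phi o b^-1 is integrable, and its solution f is an
isometry from a neighborhood of p to a neighborhood of p'. It descends to M and M', since coverings are
local isometries. *)
Require Import Defs.
From HB Require Import structures.
From mathcomp Require Import all_boot all_order all_algebra sesquilinear.
From mathcomp Require Import all_classical all_reals all_analysis.
From mathcomp Require Import ring lra.

Set Implicit Arguments.
Unset Strict Implicit.
Unset Printing Implicit Defensive.

Import Order.TTheory GRing.Theory Num.Theory.
Import numFieldNormedType.Exports.

Local Open Scope classical_set_scope.
Local Open Scope ring_scope.

(** The symmetries are given on [M], while [L] is built from Killing fields of the cover, and
    nothing is known about how a point reflection depends on its centre. A product of reflections is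
    therefore a flow without known regularity in time, and local compactness cannot help since [H]
    may be infinite dimensional. The substitute is rigidity: the second derivative of an isometry,
    and of a Killing field, is an explicit function of its 1-jet through the Christoffel symbols.
    Hence an isometry whose 1-jet at one point is close to the identity is close to it, with linear
    control, near every other point. This gives the joint continuity of the flow that lifting
    requires, and it makes [Phi t x - x] additive in [t] up to a bilinear error, so that a generator
    exists. Smoothness of the generator comes from the same identity, since its 1-jet satisfies a
    closed first-order system. Operator norms are replaced throughout by bounds on jointly smooth
    maps that are linear in one argument, and Gronwall's inequality by a contraction argument for
    families of curves. *)

Lemma le_of_eq (R : numDomainType) (a b : R) : a = b -> a <= b.
Proof. by move->. Qed.

Lemma ler_pM3 (R : numDomainType) (M a b A B : R) :
 0 <= M -> 0 <= a -> 0 <= b -> a <= A -> b <= B -> M * a * b <= M * A * B.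
Proof. by move=> M0 a0 b0 aA bB; rewrite ler_pM ?mulr_ge0 ?ler_wpM2l. Qed.

Local Notation Ck := diff_class.

Tactic Notation "via" uconstr(t) := refine (le_trans t _).

(* [lra] reads the whole context: clearing the other hypotheses makes it several times faster.
  It fails when a section hypothesis has been cleared. *)
Ltac lin :=
 repeat match goal with H : ?T |- _ =>
  lazymatch T with is_true _ => fail | _ = _ => fail | _ => clear H end end; lra.

(** * Identities between linear combinations, by reflection *)

Section ModuleReflection.
Context (R : comPzRingType).

Inductive mexpr : Type :=
| MVar of nat | MZero | MAdd of mexpr & mexpr | MOpp of mexpr
| MScale of R & mexpr.

Fixpoint mden (V : lmodType R) (env : seq V) (e : mexpr) : V :=
 match e with
 | MVar n => nth 0 env n
 | MZero => 0
 | MAdd a b => mden env a + mden env b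
 | MOpp a => - mden env a
 | MScale c a => c *: mden env a
 end.

(** [eqn] instead of [==], so that the comparison of two numerals reduces under the [cbv] call of
    the tactic [module] and only identities in the scalar ring remain. *)
Fixpoint mcoef (e : mexpr) (i : nat) : R :=
 match e with
 | MVar n => if eqn i n then 1 else 0
 | MZero => 0
 | MAdd a b => mcoef a i + mcoef b i
 | MOpp a => - mcoef a i
 | MScale c a => c * mcoef a i
 end.

(** A recursive conjunction rather than a quantification over indices: for a concrete environment it
    unfolds to finitely many goals for [ring]. *)
Fixpoint mcoef_eq (n : nat) (e f : mexpr) : Prop :=
 match n with
 | 0 => True
 | n'.+1 => mcoef e n' = mcoef f n' /\ mcoef_eq n' e f
 end.

Lemma mdenE (V : lmodType R) (env : seq V) e :
 mden env e = \sum_(i < size env) mcoef e i *: nth 0 env i.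
Proof.
elim: e => [n||a IHa b IHb|a IHa|c a IHa] /=; rewrite ?IHa ?IHb.
- under eq_bigr => i _ do rewrite eqnE.
 have [ltn|gen] := ltnP n (size env).
  rewrite (bigD1 (Ordinal ltn)) //= eqxx scale1r big1 ?addr0 // => i ni.
  by rewrite ifN ?scale0r.
 rewrite nth_default // big1 // => i; rewrite ifN ?scale0r //.
 by rewrite neq_ltn (leq_trans (ltn_ord i)).
- by rewrite big1 // => i _; rewrite scale0r.
- by rewrite -big_split /=; apply: eq_bigr => i _; rewrite scalerDl.
- by rewrite -sumrN; apply: eq_bigr => i _; rewrite scaleNr.
- by rewrite scaler_sumr; apply: eq_bigr => i; rewrite scalerA.
Qed.

Lemma module_eq (V : lmodType R) (env : seq V) e f :
 mcoef_eq (size env) e f -> mden env e = mden env f.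
Proof.
rewrite !mdenE; move: (size env) => n.
elim: n => [|n IH] /= h; first by rewrite !big_ord0.
by rewrite !big_ord_recr h.1 IH //; exact: h.2.
Qed.

End ModuleReflection.

Ltac mod_mem x l :=
 lazymatch l with
 | nil => constr:(false)
 | x :: _ => constr:(true)
 | _ :: ?l' => mod_mem x l'
 end.
Ltac mod_index x l :=
 lazymatch l with
 | x :: _ => constr:(O)
 | _ :: ?l' => let n := mod_index x l' in constr:(S n)
 end.
Ltac mod_atoms e l :=
 lazymatch e with
 | GRing.add ?a ?b => let l := mod_atoms a l in mod_atoms b l
 | GRing.opp ?a => mod_atoms a l
 | GRing.scale _ ?a => mod_atoms a l
 | GRing.zero => l
 | _ => lazymatch mod_mem e l with true => l | false => constr:(e :: l) end
 end.
Ltac mod_reify R e l :=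
 lazymatch e with
 | GRing.add ?a ?b =>
  let x := mod_reify R a l in let y := mod_reify R b l in constr:(MAdd x y)
 | GRing.opp ?a => let x := mod_reify R a l in constr:(MOpp x)
 | GRing.scale ?c ?a => let x := mod_reify R a l in constr:(@MScale R c x)
 | GRing.zero => constr:(MZero R)
 | _ => let n := mod_index e l in constr:(MVar R n)
 end.
(* Proves equalities between linear combinations, by [ring] on the coefficients. *)
Ltac module R :=
 lazymatch goal with
 | |- @eq ?T ?a ?b =>
  let l := mod_atoms a (@nil T) in let l := mod_atoms b l in
  let x := mod_reify R a l in let y := mod_reify R b l in
  apply: (@module_eq R _ l x y); cbv [mcoef_eq mcoef eqn size];
  repeat (split; first by ring); exact: I
 end.

(** * Calculus in normed spaces *)
Section RealInduction.
Context (R : realType).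

(** The supremum of the points up to which [P] holds is itself reached by the third hypothesis, and
    the second one pushes it further unless it is [b]. This replaces compactness of intervals in the
    mean value inequality, in the continuation of isometries along segments and in the lifting of
    flows. *)
Lemma real_induction (P : R -> Prop) (a b : R) : P a ->
 (forall t, a <= t < b -> (forall s, a <= s <= t -> P s) ->
  exists2 d : R, 0 < d & forall s, t < s < t + d -> P s) ->
 (forall t, a < t <= b -> (forall s, a <= s < t -> P s) -> P t) ->
 forall t, a <= t <= b -> P t.
Proof.
move=> Pa Pr Pl.
have [ab|ba] := leP a b; last by move=> t /andP[h1 h2]; lin.
pose S : set R := [set t | a <= t <= b /\ forall s, a <= s <= t -> P s].
have Sa : S a.
 split; first by rewrite lexx.
 by move=> s h; have -> : s = a by lin.
have ubS : ubound S b by move=> t [/andP[]].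
have hS : has_sup S by split; [exists a|exists b].
have am : a <= sup S by apply: (ub_le_sup _ Sa); exists b.
have mb : sup S <= b by apply: ge_sup => //; exists a.
have ltm s : a <= s < sup S -> P s.
 move=> /andP[h1 h2]; have e0 : 0 < sup S - s by lin.
 have [t [_ Pt] lt_t] := sup_adherent e0 hS.
 by apply: Pt; lin.
have Pm s : a <= s <= sup S -> P s.
 move=> /andP[h1 h2].
 have [h3|h3] : s < sup S \/ s = sup S by lin.
  by apply: ltm; lin.
 have [h4|h4] : a = s \/ a < s by lin.
  by rewrite -h4.
 apply: Pl; first by lin.
 by move=> r hr; apply: ltm; lin.
suff eqm : sup S = b by move=> t; rewrite -eqm => /Pm.
apply/eqP; rewrite eq_le mb leNgt; apply/negP => lt_mb.
have [d d0 Pd] : exists2 d : R, 0 < d & forall s, sup S < s < sup S + d -> P s.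
 by apply: Pr => //; lin.
(* The halved step stays strictly inside the interval where [Pd] gives [P]; a point of [S] beyond
   the supremum is the contradiction. *)
have : S (Num.min (sup S + d / 2) b).
 have [h1 h2] : Num.min (sup S + d / 2) b <= sup S + d / 2 /\
   Num.min (sup S + d / 2) b <= b by rewrite !ge_min !lexx orbT.
 have h3 : a <= Num.min (sup S + d / 2) b by rewrite le_min; lin.
 split; first by rewrite h3.
 move=> s hs; have [h4|h4] := leP s (sup S); first by apply: Pm; lin.
 by apply: Pd; lin.
move=> /ub_le_sup -/(_ _)/=.
have hu : has_ubound S by exists b.
by move=> /(_ hu); rewrite ge_min => /orP[|]; lin.
Qed.

End RealInduction.

Section Frechet.
Context {R : realType}.
Implicit Types E F G : normedModType R.

Lemma bounded_by_nonneg E F (L : E -> F) :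
 (exists C : R, forall h, `|L h| <= C * `|h|) -> exists2 C : R, 0 < C & forall h, `|L h| <= C * `|h|.
Proof.
move=> [C LC]; exists (`|C| + 1); first by have := normr_ge0 C; lin.
move=> h; via (LC h); apply: ler_wpM2r => //.
by have := ler_norm C; lin.
Qed.

Lemma lin_add E F (L : E -> F) u v : linear L -> L (u + v) = L u + L v.
Proof. by move=> l; have := l 1 u v; rewrite !scale1r. Qed.

Lemma lin_zero E F (L : E -> F) : linear L -> L 0 = 0.
Proof. by move=> l; have h := lin_add 0 0 l; rewrite addr0 in h; apply: (addrI (L 0)); rewrite addr0. Qed.

Lemma lin_scale E F (L : E -> F) a v : linear L -> L (a *: v) = a *: L v.
Proof. by move=> l; have := l a v 0; rewrite !addr0 (lin_zero l) addr0. Qed.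

Lemma lin_opp E F (L : E -> F) v : linear L -> L (- v) = - L v.
Proof. by move=> l; rewrite -[- v]scaleN1r lin_scale // scaleN1r. Qed.

Lemma lin_sub E F (L : E -> F) u v : linear L -> L (u - v) = L u - L v.
Proof. by move=> l; rewrite lin_add // lin_opp. Qed.

Lemma linear_boundP E F (L : {linear E -> F}) :
 continuous L <-> exists C : R, forall h, `|L h| <= C * `|h|.
Proof.
split.
 move=> /(linear_bounded_continuous L)/linear_boundedP/pinfty_ex_gt0[C _ ?].
 by exists C.
move=> [C LC]; apply/(linear_bounded_continuous L)/linear_boundedP; exists C.
split; first exact: num_real.
move=> D CD h; via (LC h); by rewrite ler_wpM2r // ltW.
Qed.

Lemma nbhs0_normP E (P : E -> Prop) : (\forall h \near 0, P h) <->
 exists2 d : R, 0 < d & forall h, `|h| < d -> P h.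
Proof.
split.
 move=> /nbhs_normP[d /= d0 dP]; exists d => // h hd; apply: dP.
 by rewrite /ball_/= sub0r normrN.
move=> [d d0 dP]; apply/nbhs_normP; exists d => // h.
by rewrite /ball_/= sub0r normrN => /dP.
Qed.

(** An epsilon-delta form that carries linearity and boundedness of the candidate, so that
    differentials can be plain functions and no little-o has to be manipulated later. *)
Lemma is_diffP E F (f : E -> F) x (L : E -> F) :
 is_diff x f L <->
 [/\ linear L, exists C : R, forall h, `|L h| <= C * `|h| &
  forall e : R, 0 < e -> exists2 d : R, 0 < d &
   forall h, `|h| < d -> `|f (x + h) - f x - L h| <= e * `|h|].
Proof.
split.
 move=> [df <-]; split; first exact: linearP.
  exact/linear_boundP/diff_continuous.
 move=> e e0; have := diff_locally df; move=> /eqaddoP/(_ _ e0)/nbhs0_normP[d d0 hd].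
 exists d => // h /hd; rewrite !fctE /= opprD addrA.
 by rewrite [h + x]addrC.
move=> [linL bL dL].
(* The candidate is packed as a linear map in order to invoke the uniqueness of differentials,
   [diff_unique]. *)
pose Lm := GRing.isLinear.Build R E F *:%R L linL.
pose L' : {linear E -> F} := HB.pack L Lm.
have cL : continuous L' by apply/linear_boundP.
have hL : f \o shift x = cst (f x) + L' +o_ 0 id.
 apply/eqaddoP => e e0; have [d d0 hd] := dL _ e0.
 apply/nbhs0_normP; exists d => // h /hd; rewrite /= !fctE opprD addrA.
 by rewrite [h + x]addrC.
have dv := diff_unique cL hL.
split; last exact: dv.
by apply/diff_locallyP; rewrite dv.
Qed.

Lemma diff_approx E F (f : E -> F) x : differentiable f x ->
 forall e : R, 0 < e -> exists2 d : R, 0 < d &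
   forall h, `|h| < d -> `|f (x + h) - f x - 'd f x h| <= e * `|h|.
Proof. by move=> /differentiableP /is_diffP[]. Qed.

Lemma diff_bounded E F (f : E -> F) x : differentiable f x ->
 exists2 C : R, 0 < C & forall h, `|'d f x h| <= C * `|h|.
Proof. by move=> /differentiableP /is_diffP[_ /bounded_by_nonneg]. Qed.

(** Most derivatives below come from second-order remainders whose constants are uniform in some
    parameter. One power of [|h|], taken below [e / (|C| + 1)], pays for [e]. *)
Lemma is_diff_quadratic E F (f : E -> F) x (L : E -> F) (C r : R) :
 linear L -> (exists C : R, forall h, `|L h| <= C * `|h|) -> 0 < r ->
 (forall h, `|h| < r -> `|f (x + h) - f x - L h| <= C * `|h| ^+ 2) ->
 is_diff x f L.
Proof.
move=> linL bL r0 hC; apply/is_diffP; split=> // e e0.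
have C1 : 0 < `|C| + 1 by [].
exists (Num.min r (e / (`|C| + 1))); first by rewrite lt_min r0 divr_gt0.
move=> h; rewrite lt_min => /andP[hr he]; via (hC _ hr).
rewrite mulrA; apply: ler_wpM2r => //.
apply: (@le_trans _ _ ((`|C| + 1) * `|h|)).
 by apply: ler_wpM2r => //; have := ler_norm C; lin.
by rewrite mulrC -ler_pdivlMr // ltW.
Qed.

Lemma is_diff_unique E F (f : E -> F) x (L L' : E -> F) :
 is_diff x f L -> is_diff x f L' -> L = L'.
Proof. by move=> [_ <-] [_ <-]. Qed.

Lemma is_diff_near E F (f g : E -> F) x (L : E -> F) :
 (\forall y \near x, f y = g y) -> is_diff x f L -> is_diff x g L.
Proof.
move=> fg /is_diffP[linL bL dL]; apply/is_diffP; split=> // e e0.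
have [d d0 hd] := dL _ e0; have fgx := nbhs_singleton fg.
move: fg => /nbhs_normP[d' /= d'0 hd'].
exists (Num.min d d'); first by rewrite lt_min d0.
move=> h; rewrite lt_min => /andP[h1 h2]; rewrite -fgx -hd'; first exact: hd.
by rewrite /ball_/= opprD addrA subrr sub0r normrN.
Qed.

Lemma diff_near E F (f g : E -> F) x : (\forall y \near x, f y = g y) ->
 differentiable f x -> differentiable g x /\ 'd g x = 'd f x :> (E -> F).
Proof.
by move=> fg /differentiableP /(is_diff_near fg)[].
Qed.

Lemma is_diff_linear E F (L : E -> F) x : linear L ->
 (exists C : R, forall h, `|L h| <= C * `|h|) -> is_diff x L L.
Proof.
move=> linL bL; apply/is_diffP; split=> // e e0; exists 1 => // h _.
have -> : L (x + h) = L h + L x by rewrite addrC -{1}[h]scale1r linL scale1r.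
by rewrite addrK subrr normr0 mulr_ge0 // ltW.
Qed.

End Frechet.

Section Curves.
Context {R : realType}.
Implicit Types E F G : normedModType R.

(** A velocity is stored as the differential of the curve, so that the chain rule and the pairing
    rule of [is_diff] apply unchanged to curves. *)
Definition cder F (y : R -> F) (t : R) (v : F) : Prop :=
 is_diff t y (fun h : R => h *: v).

Lemma cderP F (y : R -> F) t (v : F) : cder y t v <->
 forall e : R, 0 < e -> exists2 d : R, 0 < d &
  forall h : R, `|h| < d -> `|y (t + h) - y t - h *: v| <= e * `|h|.
Proof.
rewrite /cder is_diffP; split; first by case.
move=> h; split => //; first by move=> a u w; rewrite scalerDl scalerA.
by exists `|v| => k; rewrite normrZ mulrC.
Qed.

Lemma cder_is_derive F (y : R -> F) t (v : F) :
 cder y t v <-> is_derive t 1 y v.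
Proof.
split.
 move=> [dy yv]; split; first exact/derivable1_diffP.
 by rewrite deriveE // yv scale1r.
move=> [/derivable1_diffP dy yv]; split=> //.
by rewrite diff1E // derive1E yv.
Qed.

Lemma cder_unique F (y : R -> F) t (v w : F) :
 cder y t v -> cder y t w -> v = w.
Proof.
move=> /is_diff_unique h /h /(congr1 (fun f => f 1)).
by rewrite !scale1r.
Qed.

Lemma cder_continuous F (y : R -> F) t (v : F) :
 cder y t v -> {for t, continuous y}.
Proof. by case=> /differentiable_continuous. Qed.

Lemma cder_near F (y z : R -> F) (t : R) v :
 (\forall s \near t, y s = z s) -> cder y t v -> cder z t v.
Proof. exact: is_diff_near. Qed.

Lemma cder_eq F (y : R -> F) t (v w : F) : cder y t v -> v = w -> cder y t w.
Proof. by move=> ? <-. Qed.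

Lemma cder_comp E F (f : E -> F) (y : R -> E) t (v : E) :
 differentiable f (y t) -> cder y t v -> cder (f \o y) t ('d f (y t) v).
Proof.
move=> df [dy yv]; split; first exact: differentiable_comp.
by rewrite diff_comp // yv; apply/funext => h /=; rewrite linearZ.
Qed.

Lemma cder_is_diff E F (f L : E -> F) (y : R -> E) t (v : E) :
 is_diff (y t) f L -> cder y t v -> cder (f \o y) t (L v).
Proof. by move=> [df <-]; exact: cder_comp. Qed.

Lemma cder_cst F (a : F) t : cder (fun=> a) t 0.
Proof.
by apply/cderP => e e0; exists 1 => // h;
  rewrite scaler0 !subrr normr0 mulr_ge0 // ltW.
Qed.

Lemma cder_line F (a v : F) t : cder (fun s => a + s *: v) t v.
Proof.
apply/cderP => e e0; exists 1 => // h _.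
rewrite (_ : _ - _ - _ = 0); first by rewrite normr0 mulr_ge0 // ltW.
by module R.
Qed.

Lemma cderD F (y z : R -> F) t (v w : F) :
 cder y t v -> cder z t w -> cder (fun s => y s + z s) t (v + w).
Proof.
move=> hy hz; have : is_diff t (y + z) (fun h => h *: (v + w)).
 apply: (is_diff_eq (is_diffD hy hz)).
 by apply/funext => h; rewrite /= scalerDr.
by [].
Qed.

Lemma cderN F (y : R -> F) t (v : F) :
 cder y t v -> cder (fun s => - y s) t (- v).
Proof.
move=> hy; apply: (is_diff_eq (is_diffN hy)).
by apply/funext => h; rewrite scalerN.
Qed.

Lemma cderB F (y z : R -> F) t (v w : F) :
 cder y t v -> cder z t w -> cder (fun s => y s - z s) t (v - w).
Proof. by move=> hy hz; apply: cderD => //; apply: cderN. Qed.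

Lemma cder_pair E F (y : R -> E) (z : R -> F) t (v : E) (w : F) :
 cder y t v -> cder z t w -> cder (fun s => (y s, z s)) t (v, w).
Proof. by move=> hy hz; apply: (is_diff_eq (is_diff_pair hy hz)). Qed.

Lemma cder_linear E F (L : E -> F) (y : R -> E) t (v : E) : linear L ->
 (exists C : R, forall h, `|L h| <= C * `|h|) ->
 cder y t v -> cder (fun s => L (y s)) t (L v).
Proof. by move=> l b; apply: cder_is_diff; apply: is_diff_linear. Qed.

Lemma cderZ F (y : R -> F) (t c : R) (v : F) :
 cder y t v -> cder (fun s => c *: y s) t (c *: v).
Proof.
apply: (@cder_linear _ _ (fun x => c *: x)).
 by move=> a u w; rewrite scalerDr !scalerA mulrC.
by exists `|c| => h; rewrite normrZ.
Qed.

Lemma cder_reparam F (y : R -> F) (t a c : R) (v : F) :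
 cder y (a + c * t) v -> cder (fun s => y (a + c * s)) t (c *: v).
Proof.
move=> h; have hl : cder (fun s => a + c * s) t c.
 have := cder_line a c t; rewrite /cder => hh.
 by under eq_fun do rewrite mulrC.
exact: cder_is_diff y _ (fun s => a + c * s) t c h hl.
Qed.

(** A normed space offers no intermediate point, so the bound is propagated by real induction. The
    slack [e1] absorbs the remainder of the derivative in both the right and the left step. *)
Lemma mean_value F (y y' : R -> F) (a b K : R) : a <= b ->
 (forall t, a <= t <= b -> cder y t (y' t)) ->
 (forall t, a <= t <= b -> `|y' t| <= K) -> `|y b - y a| <= K * (b - a).
Proof.
move=> ab dy yK; apply/ler_addgt0Pr => e e0.
(* Small enough that [e1 * (b - a) <= e], also when [a = b]. *)
pose e1 := e / (b - a + 1); have ba1 : 0 < b - a + 1 by lin.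
have e10 : 0 < e1 by rewrite divr_gt0.
suff h t : a <= t <= b -> `|y t - y a| <= (K + e1) * (t - a).
 via (h b _); first by rewrite ab lexx.
 rewrite mulrDl lerD2l /e1 -[leRHS](divfK (lt0r_neq0 ba1)) ler_wpM2l //.
  exact: ltW.
 by lin.
have step s : a <= s <= b -> cder y s (y' s) -> exists2 d : R, 0 < d &
  forall h, `|h| < d -> `|y (s + h) - y s| <= (K + e1) * `|h|.
 move=> hs /cderP /(_ _ e10)[d d0 hd]; exists d => // k /hd hk.
 rewrite -[X in `|X|](subrK (k *: y' s)); via (ler_normD _ _).
 rewrite mulrDl addrC lerD // normrZ mulrC ler_wpM2r //; exact: yK.
move: t; apply: real_induction => [|t ht Pt|t ht Pt].
- by rewrite !subrr normr0 mulr0.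
- have htb : a <= t <= b by lin.
 have [d d0 hd] := step t htb (dy _ htb).
 exists d => // s hs; have hts : `|s - t| < d by rewrite ger0_norm; lin.
 have := hd _ hts; rewrite [t + _]addrC subrK (_ : `|s - t| = s - t); last first.
  by rewrite ger0_norm //; lin.
 have := Pt t; rewrite lexx => /(_ ltac:(lin)) h1 h2.
 by have := ler_distD (y t) (y s) (y a); rewrite !mulrBr in h1 h2 *; lin.
- have htb : a <= t <= b by lin.
 have [d d0 hd] := step t htb (dy _ htb).
 (* A point to the left of [t], within [d] of it but not before [a]. *)
 pose s := Num.max a (t - d / 2).
 have [hs1 hs2 hs3] : [/\ a <= s, t - d / 2 <= s & s < t].
  by rewrite /s !le_max !lexx orbT; split => //; rewrite gt_max; apply/andP; split; lin.
 have hts : `|s - t| < d by rewrite ltr0_norm; lin.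
 have := hd _ hts; rewrite [t + _]addrC subrK (_ : `|s - t| = t - s); last first.
  by rewrite ltr0_norm ?opprB //; lin.
 have h1 := Pt s ltac:(lin) => h2; rewrite distrC in h2.
 by have := ler_distD (y s) (y t) (y a); lin.
Qed.

Lemma half_expr_lt (e : R) : 0 < e -> exists n, 2^-1 ^+ n < e.
Proof.
move=> e0; have := @archi_boundP R e^-1 (ltW _); rewrite invr_gt0 => /(_ e0).
set n := Num.bound _ => hn; exists n; rewrite exprVn invf_plt ?posrE //.
by apply: (lt_trans hn); rewrite -natrX ltr_nat ltn_expl.
Qed.

(** The hypothesis improves any common bound [M] to [M / 2 + (d + K)], whose fixed point is
    [2 * (d + K)]; the a priori bound [B] starts the iteration. This plays the part of Gronwall's
    inequality, and the index set allows suprema over unit vectors where an operator norm would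
    otherwise appear. *)
Lemma family_contraction F (I : Type) (D D' : I -> R -> F) (d K : R) :
 (forall i t, 0 <= t <= 1 -> cder (D i) t (D' i t)) ->
 (exists B, forall i t, 0 <= t <= 1 -> `|D i t| <= B) ->
 (forall M, (forall i t, 0 <= t <= 1 -> `|D i t| <= M) ->
   forall i t, 0 <= t <= 1 -> `|D' i t| <= M / 2 + K) ->
 (forall i, `|D i 0| <= d) ->
 forall i t, 0 <= t <= 1 -> `|D i t| <= 2 * (d + K).
Proof.
move=> dD [B hB] hM hd.
have step M : (forall i t, 0 <= t <= 1 -> `|D i t| <= M) ->
  forall i t, 0 <= t <= 1 -> `|D i t| <= M / 2 + (d + K).
 move=> h i t /andP[t0 t1].
 have := mean_value t0 (fun s hs => dD i s ltac:(lin)) (fun s hs => hM M h i s ltac:(lin)).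
 have hp : 0 <= M / 2 + K.
  by apply: le_trans (hM M h i 0 _) => //; rewrite lexx ler01.
 have h0 := hd i; rewrite subr0 => h1.
 have h2 : (M / 2 + K) * t <= M / 2 + K by rewrite ler_piMr.
 by have := ler_normD (D i t - D i 0) (D i 0); rewrite subrK; lin.
(* Each use of [step] halves the excess of the bound over the fixed point. *)
have iterb n i t : 0 <= t <= 1 -> `|D i t| <= (B - 2 * (d + K)) * 2^-1 ^+ n + 2 * (d + K).
 elim: n i t => [|n IH] i t ht; first by rewrite expr0 mulr1 subrK; exact: hB.
 by apply: (le_trans (step _ IH i t ht)); rewrite exprSr; lin.
move=> i t ht; rewrite -subr_le0; apply: contraT; rewrite -ltNge => h.
pose C := `|B - 2 * (d + K)| + 1.
have C0 : 0 < C by rewrite /C.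
have [n hn] : exists n, 2^-1 ^+ n < (`|D i t| - 2 * (d + K)) / C.
 by apply: half_expr_lt; rewrite divr_gt0 // subr_gt0 -subr_lt0.
have := iterb n i t ht; rewrite ltr_pdivlMr // in hn.
have := ler_norm (B - 2 * (d + K)).
have q0 : 0 <= 2^-1 ^+ n :> R by [].
by rewrite /C in hn; nra.
Qed.

End Curves.

Lemma near_continuous_at (T U : topologicalType) (f g : T -> U) x :
 (\forall y \near x, f y = g y) -> {for x, continuous f} -> {for x, continuous g}.
Proof.
move=> fg cf; rewrite /prop_for /continuous_at -(nbhs_singleton fg).
exact: cvg_trans (near_eq_cvg fg) cf.
Qed.

(** * Closure properties of the smoothness classes *)

Section DiffClass.
Context {R : realType}.
Implicit Types E F G : normedModType R.

Lemma norm_pair_le E F (u : E) (v : F) r :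
 (`|(u, v)| <= r) = (`|u| <= r) && (`|v| <= r).
Proof. by rewrite ge_max. Qed.

Lemma norm_pair_lt E F (u : E) (v : F) r :
 (`|(u, v)| < r) = (`|u| < r) && (`|v| < r).
Proof. by rewrite gt_max. Qed.

Lemma norm_fst_le E F (z : E * F) : `|z.1| <= `|z|.
Proof. by case: z => u v; have := lexx `|(u, v)|; rewrite norm_pair_le => /andP[]. Qed.

Lemma norm_snd_le E F (z : E * F) : `|z.2| <= `|z|.
Proof. by case: z => u v; have := lexx `|(u, v)|; rewrite norm_pair_le => /andP[]. Qed.

Definition tangent E F (f : E -> F) (z : E * E) : F := 'd f (z.1) z.2.

Lemma Ck_sub n E F (U V : set E) (f : E -> F) :
 V `<=` U -> Ck n U f -> Ck n V f.
Proof.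
elim: n E F U V f => [|n IH] E F U V f VU /=; first by move=> h x /VU/h.
move=> [df cf]; split=> [x /VU/df//|]; apply: IH cf => z [/= /VU ?] //.
Qed.

(** Differentiability at a point refers to the whole space, so any sets [V] will do, open or not. *)
Lemma Ck_union n E F (U : set E) (f : E -> F) :
 (forall x, U x -> exists2 V : set E, V x & Ck n V f) -> Ck n U f.
Proof.
elim: n E F U f => [|n IH] E F U f /= h.
 by move=> x /h[V Vx hV]; exact: hV.
split=> [x /h[V Vx [hV _]]|]; first exact: hV.
apply: IH => -[x v] [/= /h[V Vx [_ hV]] _].
by exists (V `*` setT).
Qed.

Lemma openXT E (G : normedModType R) (U : set E) : open U -> open (U `*` [set: G]).
Proof. rewrite !openE => oU [x v] [/= Ux _]; exists (U, setT) => //=; split=> //.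
 exact: oU.
exact: filterT. Qed.

Lemma open_near E (U : set E) x : open U -> U x -> \forall y \near x, U y.
Proof. by move=> oU Ux; apply: open_nbhs_nbhs. Qed.

Lemma Ck_congr n E F (U : set E) (f g : E -> F) : open U ->
 (forall x, U x -> f x = g x) -> Ck n U f -> Ck n U g.
Proof.
elim: n E F U f g => [|n IH] E F U f g oU fg /= h.
 move=> x Ux; apply: near_continuous_at (h x Ux).
 by apply: filterS (open_near oU Ux).
have hd x : U x -> differentiable g x /\ 'd g x = 'd f x :> (E -> F).
 move=> Ux; apply: diff_near; last exact: h.1.
 by apply: filterS (open_near oU Ux).
split=> [x /hd[]//|]; apply: IH h.2; first exact: openXT.
by move=> [x v] [/= Ux _]; exact: esym (congr1 (fun L => L v) (hd x Ux).2).
Qed.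

Lemma Ck_pred n E F (U : set E) (f : E -> F) :
 Ck n.+1 U f -> Ck n U f.
Proof.
elim: n E F U f => [|n IH] E F U f [df cf].
 by move=> x /df/differentiable_continuous.
by split=> //; apply: IH.
Qed.

Lemma Ck_linear n E F (U : set E) (L : E -> F) : open U -> linear L ->
 (exists C : R, forall h, `|L h| <= C * `|h|) -> Ck n U L.
Proof.
elim: n E F U L => [|n IH] E F U L oU linL bL.
 by move=> x _; have [/differentiable_continuous] := is_diff_linear x linL bL.
split=> [x _|]; first by have [] := is_diff_linear x linL bL.
apply: (@Ck_congr _ _ _ _ (fun z => L z.2)); first exact: openXT.
 by move=> [x v] _ /=; have [_ ->] := is_diff_linear x linL bL.
apply: IH; first exact: openXT.
 by move=> a [u1 u2] [v1 v2] /=; rewrite linL.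
have [C C0 hC] := bounded_by_nonneg bL; exists C => -[u v] /=.
by via (hC v); apply: ler_wpM2l; [exact: ltW|exact: (norm_snd_le (u, v))].
Qed.

(** Pairing and composition are proved in one induction: the tangent map of [g \o f] is [tangent g]
    after the pair of [f] and [tangent f], so composition at one level uses pairing at the level
    below. *)
Lemma Ck_pair_comp n :
 (forall E F G (U : set E) (f : E -> F) (g : E -> G), open U ->
   Ck n U f -> Ck n U g -> Ck n U (fun x => (f x, g x))) /\
 (forall E F G (U : set E) (V : set F) (f : E -> F) (g : F -> G), open U ->
   (forall x, U x -> V (f x)) ->
   Ck n U f -> Ck n V g -> Ck n U (g \o f)).
Proof.
elim: n => [|n [IHp IHc]]; split=> [E F G U f g oU hf hg|E F G U V f g oU UV hf hg].
- by move=> x Ux; apply: cvg_pair; [exact: hf|exact: hg].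
- by move=> x Ux; apply: continuous_comp; [exact: hf|exact/hg/UV].
- split=> [x Ux|]; first by apply: differentiable_pair; [exact: hf.1|exact: hg.1].
 apply: Ck_congr (IHp _ _ _ _ _ _ _ hf.2 hg.2); [exact: openXT| |exact: openXT].
 by move=> [x v] [/= Ux _]; rewrite /tangent /= diff_pair //; [exact: hf.1|exact: hg.1].
- split=> [x Ux|].
  by apply: differentiable_comp; [exact: hf.1|exact/hg.1/UV].
 apply: (@Ck_congr _ _ _ _ (tangent g \o (fun z => (f z.1, tangent f z)))).
 + exact: openXT.
 + move=> [x v] [/= Ux _].
  by rewrite /tangent (diff_comp (hf.1 x Ux) (hg.1 _ (UV x Ux))).
 apply: (IHc _ _ _ _ _ _ _ _ _ _ hg.2); first exact: openXT.
  by move=> [x v] [/= Ux _]; split => //; exact: UV.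
 apply: (IHp _ _ _ _ _ _ _ _ hf.2); first exact: openXT.
 apply: (IHc _ _ _ _ U (fun z : E * E => z.1) f); first exact: openXT.
 + by move=> z [].
 + apply: Ck_linear; [exact: openXT|by move=> ? [? ?] []|].
  by exists 1 => h; rewrite mul1r norm_fst_le.
 + exact: Ck_pred hf.
Qed.

Section Closure.
Variable n : nat.

Lemma Ck_pair E F G (U : set E) (f : E -> F) (g : E -> G) : open U ->
 Ck n U f -> Ck n U g -> Ck n U (fun x => (f x, g x)).
Proof. exact: (Ck_pair_comp n).1. Qed.

Lemma Ck_comp E F G (U : set E) (V : set F) (f : E -> F) (g : F -> G) :
 open U -> (forall x, U x -> V (f x)) ->
 Ck n U f -> Ck n V g -> Ck n U (fun x => g (f x)).
Proof. exact: (Ck_pair_comp n).2. Qed.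

Lemma Ck_comp2 E F1 F2 G (U : set E) (V : set (F1 * F2)) (f1 : E -> F1)
  (f2 : E -> F2) (g : F1 -> F2 -> G) :
 open U -> Ck n V (fun z => g z.1 z.2) -> (forall x, U x -> V (f1 x, f2 x)) ->
 Ck n U f1 -> Ck n U f2 -> Ck n U (fun x => g (f1 x) (f2 x)).
Proof.
move=> oU hg UV h1 h2.
exact: Ck_comp oU UV (Ck_pair oU h1 h2) hg.
Qed.

Lemma Ck_comp3 E F1 F2 F3 G (U : set E) (V : set (F1 * (F2 * F3))) (f1 : E -> F1)
  (f2 : E -> F2) (f3 : E -> F3) (g : F1 -> F2 -> F3 -> G) :
 open U -> Ck n V (fun z => g z.1 z.2.1 z.2.2) ->
 (forall x, U x -> V (f1 x, (f2 x, f3 x))) ->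
 Ck n U f1 -> Ck n U f2 -> Ck n U f3 ->
 Ck n U (fun x => g (f1 x) (f2 x) (f3 x)).
Proof.
move=> oU hg UV h1 h2 h3.
exact: Ck_comp oU UV (Ck_pair oU h1 (Ck_pair oU h2 h3)) hg.
Qed.

Lemma Ck_lin_comp E F G (U : set E) (f : E -> F) (L : F -> G) : open U ->
 linear L -> (exists C : R, forall h, `|L h| <= C * `|h|) ->
 Ck n U f -> Ck n U (fun x => L (f x)).
Proof.
move=> oU lL bL hf; apply: (Ck_comp oU (V := setT)) => //.
by apply: Ck_linear => //; exact: openT.
Qed.

Lemma Ck_id E (U : set E) : open U -> Ck n U (fun x => x).
Proof. by move=> oU; apply: Ck_linear => //; exists 1 => h; rewrite mul1r. Qed.

Lemma Ck_fst E F G (U : set E) (f : E -> F * G) : open U ->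
 Ck n U f -> Ck n U (fun x => (f x).1).
Proof.
by move=> oU; apply: Ck_lin_comp => //; exists 1 => h; rewrite mul1r norm_fst_le.
Qed.

Lemma Ck_snd E F G (U : set E) (f : E -> F * G) : open U ->
 Ck n U f -> Ck n U (fun x => (f x).2).
Proof.
by move=> oU; apply: Ck_lin_comp => //; exists 1 => h; rewrite mul1r norm_snd_le.
Qed.

Lemma Ck_add E F (U : set E) (f g : E -> F) : open U ->
 Ck n U f -> Ck n U g -> Ck n U (fun x => f x + g x).
Proof.
move=> oU hf hg; apply: (Ck_lin_comp (L := fun z : F * F => z.1 + z.2) oU _ _
  (Ck_pair oU hf hg)).
 by move=> a [u1 u2] [v1 v2] /=; rewrite scalerDr addrACA.
exists 2 => z; via (ler_normD _ _).
by move: (norm_snd_le z) (norm_fst_le z); lin.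
Qed.

Lemma Ck_scale E F (U : set E) (f : E -> F) c : open U ->
 Ck n U f -> Ck n U (fun x => c *: f x).
Proof.
move=> oU; apply: (Ck_lin_comp (L := fun z => c *: z) oU).
 by move=> a u v; rewrite scalerDr !scalerA mulrC.
by exists `|c| => h; rewrite normrZ.
Qed.

Lemma Ck_opp E F (U : set E) (f : E -> F) : open U ->
 Ck n U f -> Ck n U (fun x => - f x).
Proof.
move=> oU; apply: (Ck_lin_comp (L := fun z => - z) oU).
 by move=> a u v; rewrite opprD scalerN.
by exists 1 => h; rewrite normrN mul1r.
Qed.

Lemma Ck_sub_fun E F (U : set E) (f g : E -> F) : open U ->
 Ck n U f -> Ck n U g -> Ck n U (fun x => f x - g x).
Proof. by move=> *; apply: Ck_add => //; exact: Ck_opp. Qed.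

End Closure.

Lemma Ck_cst n E F (U : set E) (a : F) : open U -> Ck n U (fun=> a).
Proof.
case: n => [|n] oU; first by move=> x _; exact: cvg_cst.
split=> [x _|]; first exact: differentiable_cst.
apply: (@Ck_congr _ _ _ _ (fun=> 0)); first exact: openXT.
 by move=> z _; rewrite -/(cst a) diff_cst.
apply: Ck_linear; [exact: openXT|by move=> ? ? ?; rewrite scaler0 addr0|].
by exists 0 => h; rewrite normr0.
Qed.

Lemma smooth_sub E F (U V : set E) (f : E -> F) :
 V `<=` U -> smooth_on U f -> smooth_on V f.
Proof. by move=> VU h n; apply: Ck_sub (h n). Qed.

Lemma smooth_union E F (U : set E) (f : E -> F) :
 (forall x, U x -> exists2 V : set E, V x & smooth_on V f) -> smooth_on U f.
Proof. by move=> h n; apply: Ck_union => x /h[V Vx hV]; exists V. Qed.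

Lemma smooth_congr E F (U : set E) (f g : E -> F) : open U ->
 (forall x, U x -> f x = g x) -> smooth_on U f -> smooth_on U g.
Proof. by move=> oU fg h n; apply: Ck_congr (h n). Qed.

Lemma smooth_diff E F (U : set E) (f : E -> F) x :
 smooth_on U f -> U x -> differentiable f x.
Proof. by move=> /(_ 1%N) [h _]; exact: h. Qed.

Lemma smooth_cont E F (U : set E) (f : E -> F) x :
 smooth_on U f -> U x -> {for x, continuous f}.
Proof. by move=> /(_ 0%N) h; exact: h. Qed.

Lemma smooth_tangent E F (U : set E) (f : E -> F) :
 smooth_on U f -> smooth_on (U `*` setT) (tangent f).
Proof. by move=> h n; have [] := h n.+1. Qed.

(** A bootstrap for maps that solve a first-order equation: their tangent map is an expression in
    the map itself, hence as regular as the map. *)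
Lemma Ck_from_tangent E F (U : set E) (f : E -> F) :
 (forall x, U x -> differentiable f x) ->
 (forall n, Ck n U f -> Ck n (U `*` setT) (tangent f)) -> smooth_on U f.
Proof.
move=> df hf; elim=> [|n IH]; first by move=> x /df/differentiable_continuous.
by split=> //; exact: hf.
Qed.

End DiffClass.

Ltac Ck_auto := repeat first
 [ assumption | apply: Ck_id | apply: Ck_cst
 | apply: Ck_pair | apply: Ck_fst | apply: Ck_snd
 | apply: Ck_sub_fun | apply: Ck_opp | apply: Ck_add
 | apply: Ck_scale ].

Section Taylor.
Context {R : realType}.
Implicit Types E F G : normedModType R.

Lemma diff_scale E F (f : E -> F) x a v : 'd f x (a *: v) = a *: 'd f x v.
Proof. exact: linearZ. Qed.

Lemma diff_add E F (f : E -> F) x u v : 'd f x (u + v) = 'd f x u + 'd f x v.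
Proof. exact: linearD. Qed.

Lemma diff_sub E F (f : E -> F) x u v : 'd f x (u - v) = 'd f x u - 'd f x v.
Proof. exact: linearB. Qed.

Lemma diff_opp E F (f : E -> F) x v : 'd f x (- v) = - 'd f x v.
Proof. exact: linearN. Qed.

Lemma diff_zero E F (f : E -> F) x : 'd f x 0 = 0.
Proof. exact: linear0. Qed.

Definition nball E (x : E) (r : R) : set E := [set y | `|y - x| < r].

Lemma nball_open E (x : E) r : open (nball x r).
Proof.
rewrite openE => y yx; apply/nbhs_normP; exists (r - `|y - x|) => /=.
 by rewrite subr_gt0.
move=> z; rewrite /nball /= => zy.
by have := ler_distD y z x; rewrite (distrC z y); lin.
Qed.

Lemma nballxx E (x : E) r : 0 < r -> nball x r x.
Proof. by rewrite /nball /= subrr normr0. Qed.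

Lemma nbhs_nball E x (U : set E) : nbhs x U <->
 exists2 r, 0 < r & nball x r `<=` U.
Proof.
split.
 move=> /nbhs_normP[r /= r0 rU]; exists r => // y yx; apply: rU.
 by rewrite /ball_/= distrC.
move=> [r r0 rU]; apply/nbhs_normP; exists r => // y yx; apply: rU.
by rewrite /nball /= distrC.
Qed.

Lemma nball_segment E (x y z : E) r t : nball x r y -> nball x r z -> 0 <= t <= 1 ->
 nball x r (y + t *: (z - y)).
Proof.
rewrite /nball /= => hy hz /andP[t0 t1].
have -> : y + t *: (z - y) - x = (1 - t) *: (y - x) + t *: (z - x) by module R.
apply: (le_lt_trans (ler_normD _ _)); rewrite !normrZ !ger0_norm; [|lin..].
have [->|t0'] := eqVneq t 0; first by lin.
have tp : 0 < t by lin.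
by have := ler_wpM2l (_ : 0 <= 1 - t) (ltW hy); have := mulr_gt0 tp (_ : 0 < r - `|z - x|); lin.
Qed.

(** Continuity at [(x, 0)] bounds [B] by 1 on small vectors, uniformly near [x]; homogeneity spreads
    this to all vectors. The constant is [2 / d] because the test vector has norm [d / 2]. *)
Lemma homogeneous_bound E G F (B : E -> G -> F) (x : E) (U : set E) :
 open U -> U x ->
 {for (x, 0), continuous (fun z => B z.1 z.2)} ->
 (forall y (a : R) v, U y -> B y (a *: v) = a *: B y v) ->
 exists r C : R, [/\ 0 < r, 0 < C, nball x r `<=` U &
  forall y v, nball x r y -> `|B y v| <= C * `|v|].
Proof.
move=> oU Ux cB hB.
have B0 y : U y -> B y 0 = 0 by move=> Uy; rewrite -(scale0r 0) hB // scale0r.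
have [r0 r00 hr0] : exists2 r, 0 < r & nball x r `<=` U.
 exact/nbhs_nball/open_nbhs_nbhs.
have /nbhs_nball[d d0 hd] : nbhs (x, 0) (fun z => `|B z.1 z.2| < 1).
 have h := cB _ (open_nbhs_nbhs (conj (nball_open (B x 0) 1) (nballxx _ ltr01))).
 have {h} h : nbhs (x, 0) (fun z => nball (B x 0) 1 (B z.1 z.2)) by [].
 by apply: filterS h => z; rewrite /nball /= (B0 _ Ux) subr0.
have rm : 0 < Num.min r0 d by rewrite lt_min r00.
exists (Num.min r0 d), (2 / d); split => //; first by rewrite divr_gt0.
 by move=> y; rewrite /nball /= lt_min => /andP[/hr0].
move=> y v; rewrite /nball /= lt_min => /andP[/hr0 Uy yd].
have [->|v0] := eqVneq v 0; first by rewrite B0 // !normr0 mulr0.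
have nv : 0 < `|v| by rewrite normr_gt0.
have := hd (y, (d / (2 * `|v|)) *: v).
rewrite /nball /= hB // => /(_ _).
have -> : `|(y, (d / (2 * `|v|)) *: v) - (x, 0)| < d.
 rewrite -[_ - _]/((y - x, (d / (2 * `|v|)) *: v - 0)) subr0.
 rewrite norm_pair_lt yd /= normrZ ger0_norm ?divr_ge0 ?mulr_ge0 ?ltW //.
 have -> : d / (2 * `|v|) * `|v| = d / 2 by field; rewrite gt_eqF.
 by lin.
have a0 : 0 < d / (2 * `|v|) by rewrite divr_gt0 // mulr_gt0.
move=> /(_ isT); rewrite normrZ (gtr0_norm a0) => /ltW.
rewrite mulrC -ler_pdivlMr ?divr_gt0 ?mulr_gt0 //.
by rewrite div1r invf_div mulrAC.
Qed.

(** The differential is bounded near [x] by [homogeneous_bound], and balls are convex, so the mean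
    value inequality applies along segments. *)
Lemma smooth_lipschitz E F (U : set E) (f : E -> F) (x : E) :
 open U -> smooth_on U f -> U x ->
 exists r C : R, [/\ 0 < r, 0 < C, nball x r `<=` U &
  forall y z, nball x r y -> nball x r z -> `|f z - f y| <= C * `|z - y|].
Proof.
move=> oU sf Ux.
have [|y a v Uy|r [C [r0 C0 rU hC]]] :=
  @homogeneous_bound _ _ _ (fun y v => 'd f y v) x U oU Ux.
- by have := smooth_cont (smooth_tangent sf) (conj Ux I : (U `*` setT) (x, 0)).
- by rewrite linearZ.
exists r, C; split=> // y z hy hz.
have hs t : 0 <= t <= 1 -> nball x r (y + t *: (z - y)) by exact: nball_segment.
have := @mean_value _ _ (fun t => f (y + t *: (z - y)))
  (fun t => 'd f (y + t *: (z - y)) (z - y)) 0 1 (C * `|z - y|) ler01.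
rewrite scale1r scale0r addr0 (addrC y) subrK subr0 mulr1; apply=> t ht.
 apply: (cder_comp _ (cder_line y (z - y) t)).
 exact: smooth_diff sf (rU _ (hs t ht)).
exact/hC/hs.
Qed.

(** The tangent map is Lipschitz near [(x, 0)]. Tested on vectors of norm [r / 2] and rescaled, this
    says that the differential is Lipschitz in the point, and the mean value inequality turns that
    into a quadratic remainder. *)
Lemma smooth_taylor E F (U : set E) (f : E -> F) (x : E) :
 open U -> smooth_on U f -> U x ->
 exists r C : R, [/\ 0 < r, 0 < C, nball x r `<=` U &
  forall y z, nball x r y -> nball x r z ->
   `|f z - f y - 'd f y (z - y)| <= C * `|z - y| ^+ 2].
Proof.
move=> oU sf Ux.
have [r [C [r0 C0 rU hC]]] :=
 smooth_lipschitz (openXT oU) (smooth_tangent sf) (conj Ux I : (U `*` setT) (x, 0)).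
have rU' : nball x r `<=` U.
 move=> y hy; have [] // : (U `*` [set: E]) (y, 0); apply: rU.
 by rewrite /nball /= -[_ - _]/((y - x, 0 - 0 : E)) norm_pair_lt hy subr0 normr0.
have dL y z v : nball x r y -> nball x r z ->
  `|'d f z v - 'd f y v| <= (2 * C / r) * `|z - y| * `|v|.
 move=> hy hz; have [->|v0] := eqVneq v 0; first by rewrite !diff_zero subrr !normr0 mulr0.
 have nv : 0 < `|v| by rewrite normr_gt0.
 pose a := r / (2 * `|v|); have a0 : 0 < a by rewrite divr_gt0 // mulr_gt0.
 have hb u : nball x r u -> nball (x, 0 : E) r (u, a *: v).
  move=> hu; rewrite /nball /= -[_ - _]/((u - x, a *: v - 0)) norm_pair_lt.
  rewrite [X in X && _]hu subr0 normrZ gtr0_norm //.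
  have -> : a * `|v| = r / 2 by rewrite /a; field; rewrite gt_eqF.
  by rewrite /=; lin.
 have := hC _ _ (hb _ hy) (hb _ hz); rewrite /tangent /= !diff_scale -scalerBr normrZ.
 rewrite -[_ - (y, _)]/((z - y, a *: v - a *: v)) subrr.
 have -> : `|(z - y, 0 : E)| = `|z - y| by rewrite prod_normE normr0 max_l.
 rewrite gtr0_norm // mulrC -ler_pdivlMr // => /le_trans; apply.
 by rewrite /a invf_div le_eqVlt; apply/orP; left; apply/eqP; field; rewrite ?gt_eqF //.
exists r, (2 * C / r); split=> // [|y z hy hz]; first by rewrite divr_gt0 ?mulr_gt0.
have hs t : 0 <= t <= 1 -> nball x r (y + t *: (z - y)) by exact: nball_segment.
have := @mean_value _ _ (fun t => f (y + t *: (z - y)) - (0 + t *: 'd f y (z - y)))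
  (fun t => 'd f (y + t *: (z - y)) (z - y) - 'd f y (z - y)) 0 1
  (2 * C / r * `|z - y| ^+ 2) ler01.
rewrite !scale1r !scale0r !addr0 !add0r subr0 (addrC y) subrK subr0 mulr1 addrAC.
apply=> t ht.
 apply: cderB; last exact: cder_line.
 apply: (cder_comp _ (cder_line y (z - y) t)).
 exact: smooth_diff sf (rU' _ (hs t ht)).
via (dL _ _ _ hy (hs t ht)); rewrite mulrA ler_wpM2r //.
apply: ler_wpM2l; first by apply: divr_ge0; [apply: mulr_ge0|]; lin.
rewrite addrC addKr normrZ ger0_norm; last by lin.
by rewrite ler_piMl //; lin.
Qed.

End Taylor.

Section Schwarz.
Context {R : realType}.
Implicit Types E F G : normedModType R.

Lemma is_diff_partial E G F (B : E * G -> F) x (v : G) :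
 differentiable B (x, v) ->
 is_diff x (fun y => B (y, v)) (fun h => 'd B (x, v) (h, 0)).
Proof.
move=> dB; have h : is_diff x (fun y : E => (y, v)) (fun h => (h, 0)).
 by apply: (is_diff_eq (is_diff_pair (is_diff_id x) (is_diff_cst v x))).
exact: is_diff_comp h (differentiableP dB).
Qed.

Let Delta E F (f : E -> F) (x : E) (s : R) (u v : E) : F :=
 f (x + s *: u + s *: v) - f (x + s *: u) - f (x + s *: v) + f x.

Let DeltaC E F (f : E -> F) (x : E) s (u v : E) :
 Delta f x s u v = Delta f x s v u.
Proof.
rewrite /Delta [x + s *: u + _]addrAC; congr (_ + _).
by rewrite -!addrA; congr (_ + _); rewrite addrC.
Qed.

(** The mean value inequality is applied in the direction [v] to the increment in the direction [u].
    The error in its derivative is controlled by the Taylor bound of the tangent map at [(x, v)],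
    which leaves an error of order [s ^+ 3]. *)
Lemma second_difference E F (U : set E) (f : E -> F) (x : E) :
 open U -> smooth_on U f -> U x -> exists2 r : R, 0 < r &
 forall u v : E, `|u| < r -> `|v| < r -> exists2 K : R, 0 < K & forall s : R, 0 < s < 1 ->
  `|Delta f x s u v - (s ^+ 2) *: 'd (fun y => 'd f y v) x u| <= K * s ^+ 3.
Proof.
move=> oU sf Ux; have [r [C [r0 C0 rU hC]]] :=
 smooth_taylor (openXT oU) (smooth_tangent sf) (conj Ux I : (U `*` setT) (x, 0)).
exists (r / 2) => [|u v ur vr]; first by rewrite divr_gt0.
pose n := `|u| + `|v| + 1; have n0 : 0 < n.
 by rewrite /n; have := normr_ge0 u; have := normr_ge0 v; lin.
have inb y w : `|y| < r -> `|w| < r -> nball (x, 0 : E) r (x + y, w).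
 move=> yr wr; rewrite /nball /= -[_ - _]/((x + y - x, w - 0)) norm_pair_lt.
 by rewrite addrC addKr yr subr0.
have rU' w : `|w| < r -> U (x + w).
 move=> wr; have z0 : `|0 : E| < r by rewrite normr0.
 by have [] : (U `*` [set: E]) (x + w, 0) by apply/rU/inb.
have vr' : `|v| < r by lin.
have sl s (t : R) : 0 < s < 1 -> 0 <= t <= 1 -> `|s *: u + (t * s) *: v| <= s * n /\
  `|s *: u + (t * s) *: v| < r /\ `|(t * s) *: v| <= s * n /\ `|(t * s) *: v| < r.
 move=> hs ht; have h1 : `|(t * s) *: v| <= s * `|v|.
  rewrite normrZ ger0_norm; last by rewrite mulr_ge0 //; lin.
  by apply: ler_wpM2r => //; apply: ler_piMl; lin.
 have h2 : `|s *: u| = s * `|u| by rewrite normrZ gtr0_norm; lin.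
 have h3 := ler_normD (s *: u) ((t * s) *: v).
 have h4 : s * `|u| <= `|u| by apply: ler_piMl => //; lin.
 have h5 : s * `|v| <= `|v| by apply: ler_piMl => //; lin.
 have h6 : 0 <= s * `|u| by apply: mulr_ge0 => //; lin.
 by rewrite /n !mulrDr; do !split; lin.
pose L := 'd (fun y => 'd f y v) x.
pose D2 (s t : R) := 'd f (x + (s *: u + (t * s) *: v)) v - 'd f (x + (t * s) *: v) v.
(* Between [(x, v)] and [(x + w, v)] only the first component moves, so the Taylor bound of
   [tangent f] involves a partial derivative only. *)
have hb w : `|w| < r -> `|'d f (x + w) v - 'd f x v - L w| <= C * `|w| ^+ 2.
 move=> wr; have := hC (x, v) (x + w, v).
 rewrite -[(x + w, _) - _]/((x + w - x, v - v)) subrr (addrC x) addrK -(addrC x).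
 have dT : differentiable (tangent f) (x, v) by apply: (smooth_diff (smooth_tangent sf)).
 have [d1 e1] := is_diff_partial dT.
 rewrite -[X in _ - X](congr1 (fun L => L w) e1) prod_normE normr0 max_l //; apply.
  by have := inb 0 v; rewrite addr0 normr0; apply.
 exact: inb.
have est (s t : R) : 0 < s < 1 -> 0 <= t <= 1 ->
  `|D2 s t - s *: L u| <= 2 * C * n ^+ 2 * s ^+ 2.
 move=> hs ht; have [h1 [h2 [h3 h4]]] := sl s t hs ht.
 have Ls : L (s *: u + (t * s) *: v) = s *: L u + L ((t * s) *: v).
  by rewrite /L diff_add diff_scale.
 have -> : D2 s t - s *: L u =
   ('d f (x + (s *: u + (t * s) *: v)) v - 'd f x v - L (s *: u + (t * s) *: v))
   - ('d f (x + (t * s) *: v) v - 'd f x v - L ((t * s) *: v)).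
  by rewrite Ls /D2; module R.
 via (ler_normB _ _).
 have q w : `|w| < r -> `|w| <= s * n ->
   `|'d f (x + w) v - 'd f x v - L w| <= C * (s * n) ^+ 2.
  move=> wr wn; apply/(le_trans (hb _ wr))/ler_wpM2l; first exact: ltW.
  by rewrite ler_sqr ?nnegrE // mulr_ge0 //; lin.
 by have := q _ h2 h1; have := q _ h4 h3; rewrite exprMn; lin.
exists (2 * C * n ^+ 2) => [|s hs]; first by rewrite !mulr_gt0.
rewrite /Delta.
set K := 2 * C * _ in est *.
have := @mean_value _ _
 (fun t => f (x + s *: u + (0 + t * s) *: v) - f (x + (0 + t * s) *: v)
   - (0 + t *: (s ^+ 2 *: L u)))
 (fun t => s *: D2 s t - s ^+ 2 *: L u) 0 1 (K * s ^+ 3) ler01.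
rewrite !scale1r !scale0r !add0r subr0 mul1r mul0r scale0r !addr0 subr0 mulr1.
have -> : forall a b c' d e : F, a - b - e - (c' - d) = a - c' - b + d - e.
 by move=> *; module R.
apply=> t ht; last first.
 have -> : s *: D2 s t - s ^+ 2 *: L u = s *: (D2 s t - s *: L u) by module R.
 rewrite normrZ gtr0_norm; last by lin.
 rewrite [K * _]mulrC exprS -mulrA [_ * K]mulrC; apply: ler_wpM2l; first by lin.
 exact: est.
apply: cderB; last exact: cder_line.
have line (a : E) : cder (fun t : R => a + (0 + t * s) *: v) t (s *: v).
 have := cder_line a (s *: v) t; apply: cder_near.
 by near=> t'; rewrite scalerA add0r.
have [_ [h1 [_ h2]]] := sl s t hs ht.
rewrite scalerBr -!diff_scale; apply: cderB.
 have e : x + (s *: u + (t * s) *: v) = x + s *: u + (0 + t * s) *: v by module R.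
 by rewrite e; apply: (cder_comp (f := f) _ (line _)); rewrite -e; exact/(smooth_diff sf)/rU'.
have e : x + (t * s) *: v = x + (0 + t * s) *: v by module R.
by rewrite e; apply: (cder_comp (f := f) _ (line _)); rewrite -e; exact/(smooth_diff sf)/rU'.
Unshelve. all: by end_near. Qed.

Lemma diff_diff_scale E F (U : set E) (f : E -> F) (x u v : E) a :
 open U -> smooth_on U f -> U x ->
 'd (fun y => 'd f y (a *: v)) x u = a *: 'd (fun y => 'd f y v) x u.
Proof.
move=> oU sf Ux; have dT : differentiable (tangent f) (x, v).
 by apply: (smooth_diff (smooth_tangent sf)).
have [d1 _] := is_diff_partial dT.
have -> : (fun y => 'd f y (a *: v)) = (fun y => a *: tangent f (y, v)).
 by apply/funext => y; rewrite diff_scale.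
have e := congr1 (fun L : E -> F => L u) (diffZ a d1); exact: e.
Qed.

(** Second differences are symmetric in the two vectors, and both iterated derivatives are their
    limits after division by [s ^+ 2]. *)
Lemma diff_sym E F (U : set E) (f : E -> F) (x u v : E) :
 open U -> smooth_on U f -> U x ->
 'd (fun y => 'd f y v) x u = 'd (fun y => 'd f y u) x v.
Proof.
move=> oU sf Ux; have [r r0 hr] := second_difference oU sf Ux.
pose n := `|u| + `|v| + 1; have n0 : 0 < n.
 by rewrite /n; have := normr_ge0 u; have := normr_ge0 v; lin.
(* Rescaling by [a] brings both vectors within the radius of [second_difference] and multiplies both
   iterated derivatives by [a * a]. *)
pose a := r / n; have a0 : 0 < a by rewrite divr_gt0.
have ar (w : E) : `|w| < n -> `|a *: w| < r.
 by move=> wn; rewrite normrZ gtr0_norm // /a mulrAC ltr_pdivrMr // ltr_pM2l.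
have un : `|u| < n by rewrite /n; have := normr_ge0 v; lin.
have vn : `|v| < n by rewrite /n; have := normr_ge0 u; lin.
suff : 'd (fun y => 'd f y (a *: v)) x (a *: u) = 'd (fun y => 'd f y (a *: u)) x (a *: v).
 have s p q : 'd (fun y => 'd f y (a *: p)) x (a *: q) = (a * a) *: 'd (fun y => 'd f y p) x q.
  apply: (etrans (diff_diff_scale (a *: q) p a oU sf Ux)); rewrite -scalerA.
  exact: (congr1 (fun w => a *: w) (diff_scale _ _ _ _)).
 move=> h; have /(congr1 (fun w => (a * a)^-1 *: w)) := etrans (esym (s v u)) (etrans h (s u v)).
 by rewrite !scalerA mulVf ?scale1r // mulf_neq0 // gt_eqF.
have [C C0 hC] := hr _ _ (ar _ un) (ar _ vn).
have [C' C'0 hC'] := hr _ _ (ar _ vn) (ar _ un).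
move: (a *: u) (a *: v) hC hC' => {ar un vn a0 a n0 n}u {}v hC hC'.
apply/eqP; rewrite -subr_eq0 -normr_le0; apply/ler_addgt0Pr => e e0; rewrite add0r.
(* [(C + C') * s <= e] makes the total error at most [e] after division by [s ^+ 2]. *)
pose s := Num.min 2^-1 (e / (C + C')).
have CC : 0 < C + C' by lin.
have s0 : 0 < s by rewrite lt_min divr_gt0 // invr_gt0 ltr0n.
have [s1 se] : s <= 2^-1 /\ s <= e / (C + C') by rewrite !ge_min !lexx ?orbT.
have h2 := hC' s ltac:(lin).
rewrite DeltaC in h2.
have s2 : 0 < s ^+ 2 by rewrite exprn_gt0.
rewrite -(ler_pM2l s2) -[X in X * `|_|](gtr0_norm s2) -normrZ.
apply: (@le_trans _ _ ((C + C') * s ^+ 3)); last first.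
 rewrite (_ : _ * s ^+ 3 = s ^+ 2 * (s * (C + C'))); last by ring.
 by apply: ler_wpM2l; [exact: ltW|rewrite -ler_pdivlMr].
rewrite mulrDl; apply: le_trans (lerD (hC s ltac:(lin)) h2).
apply: (le_trans _ (ler_normB _ _)); rewrite -normrN le_eqVlt; apply/orP; left.
apply/eqP; congr (`|_|); module R.
Qed.

End Schwarz.

(** * Hilbert spaces and differential equations *)
Section Completeness.
Context {R : realType}.

(** Only sequences with geometrically decreasing steps occur below. As a property of a normed space
    it passes to products, as the geodesic equation requires when it is written as a first-order
    system. *)
Definition cauchy_complete (E : normedModType R) : Prop := forall (u : nat -> E) (C : R),
 (forall n, `|u n.+1 - u n| <= C * 2^-1 ^+ n) ->
 exists l, forall n, `|u n - l| <= 2 * C * 2^-1 ^+ n.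

Lemma complete_cauchy (E : completeNormedModType R) : cauchy_complete E.
Proof.
move=> u C hu.
have C0 : 0 <= C by have := hu 0%N; rewrite mulr1; apply: le_trans.
have geo n k : `|u (n + k)%N - u n| <= 2 * C * 2^-1 ^+ n - 2 * C * 2^-1 ^+ (n + k).
 elim: k => [|k IH]; first by rewrite addn0 !subrr normr0.
 rewrite addnS; have := hu (n + k)%N; have := ler_distD (u (n + k)%N) (u (n + k).+1) (u n).
 by rewrite exprS; lin.
have q0 n : 0 <= 2^-1 ^+ n :> R by [].
have bnd n m : (n <= m)%N -> `|u m - u n| <= 2 * C * 2^-1 ^+ n.
 move=> /subnKC <-; via (geo _ _).
 by have := mulr_ge0 C0 (q0 (n + (m - n))%N); lin.
have cu : cvg (u @ \oo).
 apply/cauchy_cvgP/cauchyP => e e0.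
 have e1 : 0 < e / (2 * C + 1) by apply: divr_gt0 => //; lin.
 have [n hn] := half_expr_lt e1.
 exists (u n); exists n => // m /= nm; rewrite -ball_normE /= distrC.
 apply: (le_lt_trans (bnd _ _ nm)).
 rewrite ltr_pdivlMr in hn; last by lin.
 by have := q0 n; nra.
exists (lim (u @ \oo)) => n.
have : `|u m - u n| @[m --> \oo] --> `|lim (u @ \oo) - u n|.
 by apply: cvg_norm; apply: cvgB => //; exact: cvg_cst.
rewrite distrC => h; apply: (cvgr_to_le h); exists n => // m; exact: bnd.
Qed.

Lemma cauchy_complete_prod (E F : normedModType R) :
 cauchy_complete E -> cauchy_complete F -> cauchy_complete (E * F)%type.
Proof.
move=> cE cF u C hu.
have [|l hl] := cE (fst \o u) C.
 by move=> n; apply: le_trans (hu n); exact: (norm_fst_le (u n.+1 - u n)).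
have [|m hm] := cF (snd \o u) C.
 by move=> n; apply: le_trans (hu n); exact: (norm_snd_le (u n.+1 - u n)).
exists (l, m) => n; rewrite (surjective_pairing (u n)).
by rewrite norm_pair_le hl hm.
Qed.

(** Again a property that passes to products; the interval around 0 is open but of any length. *)
Definition has_primitives (E : normedModType R) : Prop := forall (c : R -> E) (T : R),
 continuous c -> 0 < T -> exists J : R -> E, J 0 = 0 /\ forall t, `|t| < T -> cder J t (c t).

Lemma has_primitives_prod (E F : normedModType R) :
 has_primitives E -> has_primitives F -> has_primitives (E * F)%type.
Proof.
move=> pE pF c T cc T0.
have [|J [J0 hJ]] := pE (fst \o c) T _ T0.
 by move=> t; apply: continuous_comp; [exact: cc|exact: cvg_fst].
have [|K [K0 hK]] := pF (snd \o c) T _ T0.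
 by move=> t; apply: continuous_comp; [exact: cc|exact: cvg_snd].
exists (fun t => (J t, K t)); rewrite J0 K0; split=> // t tT.
by apply: cder_pair; [exact: hJ|exact: hK].
Qed.

(** The integral starts at [- T], so that the fundamental theorem applies on both sides of 0; the
    value at 0 is subtracted afterwards. *)
Lemma real_primitive (c : R -> R) (T : R) : continuous c -> 0 < T ->
 exists J : R -> R, J 0 = 0 /\ forall t, `|t| < T -> cder J t (c t).
Proof.
move=> cc T0.
pose J x := (\int[lebesgue_measure]_(t in [set` `[- T, x]]) (c t))%R.
have hJ t : `|t| < T -> cder J t (c t).
 move=> tT; have /andP[t1 t2] : - T < t < T by rewrite -ltr_norml.
 have ci : lebesgue_measure.-integrable `[- T, T] (EFin \o c).
  apply: continuous_compact_integrable; first exact: segment_compact.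
  by apply: continuous_subspaceT => x; exact: cc.
 have [dJ eJ] := continuous_FTC1_closed t2 ci t1 (cc t).
 apply/cder_is_derive; split; first exact: dJ.
 by rewrite -derive1E; exact: eJ.
exists (fun t => J t - J 0); split=> [|t tT]; first by rewrite subrr.
by apply: cder_eq; [apply: cderB (hJ _ tT) (cder_cst _ _)|rewrite subr0].
Qed.

End Completeness.

Section Inner.
Context {R : realType}.
Implicit Types H : hilbert R.

Section Form.
Context (V : lmodType R) (a : V -> V -> R).
Hypothesis (al : forall w, linear (fun v => a v w)) (as_ : forall v w, a v w = a w v).

Lemma form_addl u v w : a (u + v) w = a u w + a v w.
Proof. by have := al w 1 u v; rewrite !scale1r. Qed.

Lemma form0l w : a 0 w = 0.
Proof. by have := form_addl 0 0 w; rewrite addr0; lin. Qed.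

Lemma form_scalel c v w : a (c *: v) w = c * a v w.
Proof. by have := al w c v 0; rewrite !addr0 form0l addr0. Qed.

Lemma form_oppl v w : a (- v) w = - a v w.
Proof. by rewrite -scaleN1r form_scalel mulN1r. Qed.

Lemma form_subl u v w : a (u - v) w = a u w - a v w.
Proof. by rewrite form_addl form_oppl. Qed.

Lemma form_addr u v w : a w (u + v) = a w u + a w v.
Proof. by rewrite as_ form_addl !(as_ w). Qed.

Lemma form_scaler c v w : a w (c *: v) = c * a w v.
Proof. by rewrite as_ form_scalel (as_ w). Qed.

Lemma form_oppr v w : a w (- v) = - a w v.
Proof. by rewrite as_ form_oppl (as_ w). Qed.

Lemma form_subr u v w : a w (u - v) = a w u - a w v.
Proof. by rewrite form_addr form_oppr. Qed.

(** Degenerate forms are allowed: if [a v v = 0], a nonzero [a u v] would make the form negative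
    somewhere. *)
Lemma form_cauchy_schwarz u v : (forall w, 0 <= a w w) -> (a u v) ^+ 2 <= a u u * a v v.
Proof.
move=> a0; have [h|h] := eqVneq (a v v) 0.
 have [->|h'] := eqVneq (a u v) 0; first by rewrite h mulr0 expr0n.
 (* The coefficient is chosen so that the form takes the value -1 on this vector. *)
 have := a0 (u - ((a u u + 1) / (2 * a u v)) *: v).
 rewrite !(form_subl, form_subr, form_scalel, form_scaler) h (as_ v u).
 have -> : (a u u + 1) / (2 * a u v) * a u v = (a u u + 1) / 2 by field.
 lin.
have vv : 0 < a v v by rewrite lt_def h a0.
have := a0 (u - (a u v / a v v) *: v).
rewrite !(form_subl, form_subr, form_scalel, form_scaler) (as_ v u).
have -> : a u u - a u v / a v v * a u v - (a u v / a v v * a u v - a u v / a v v * (a u v / a v v * a v v))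
 = (a u u * a v v - a u v ^+ 2) / a v v by field.
by rewrite pmulr_lge0 ?invr_gt0 // subr_ge0.
Qed.

End Form.

Lemma dot_linear (V : lmodType R) (a : {dot V for idfun}) w : linear (fun v => a v w).
Proof. by move=> c u v; rewrite linearPl. Qed.

Lemma dot_sym (V : lmodType R) (a : {dot V for idfun}) v w : a v w = a w v.
Proof. by rewrite hermC mul1r. Qed.

Lemma dot_gt0 (V : lmodType R) (a : {dot V for idfun}) v : v != 0 -> 0 < a v v.
Proof. exact: neq0_dnorm_gt0. Qed.

Lemma dot_ge0 (V : lmodType R) (a : {dot V for idfun}) v : 0 <= a v v.
Proof.
have [->|/(dot_gt0 a)/ltW//] := eqVneq v 0.
by lin.
Qed.

Lemma inner_le H u v : `|inner H u v| <= `|u| * `|v|.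
Proof.
rewrite -ler_sqr ?nnegrE // exprMn -!inner_norm -normrX ger0_norm ?sqr_ge0 //.
by apply: form_cauchy_schwarz; [exact: dot_linear|exact: dot_sym|exact: dot_ge0].
Qed.

(** The vector minimizes [J]. By the parallelogram identity and coercivity, near-minimizers are
    close to each other, so a minimizing sequence converges. The form is any bounded coercive one,
    which covers the metrics of the manifold as well as [inner]. *)
Lemma riesz H (a : H -> H -> R) (ell : H -> R) (c C K : R) :
 (forall w, linear (fun v => a v w)) -> (forall v w, a v w = a w v) ->
 0 < c -> (forall u, c * `|u| ^+ 2 <= a u u) ->
 (forall u, a u u <= C * `|u| ^+ 2) ->
 (forall k u v, ell (k *: u + v) = k * ell u + ell v) ->
 (forall u, `|ell u| <= K * `|u|) ->
 exists z, forall w, a z w = ell w.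
Proof.
move=> al as_ c0 ca aC le bl.
have el0 : ell 0 = 0 by have := le 1 0 0; rewrite scaler0 addr0; lin.
have elD u v : ell (u + v) = ell u + ell v by have := le 1 u v; rewrite scale1r mul1r.
have elZ k u : ell (k *: u) = k * ell u by have := le k u 0; rewrite !addr0 el0 addr0.
have expand := (form_addl al, form_addr al as_, form_oppl al, form_oppr al as_,
 form_scalel al, form_scaler al as_, elD, elZ).
pose J u := a u u - 2 * ell u.
have K0 : 0 <= K \/ forall u : H, `|u| = 0.
 have [h|h] := leP 0 K; [by left|right => u]; apply/eqP; rewrite eq_le normr_ge0 andbT.
 by have := bl u; have := normr_ge0 (ell u); have := normr_ge0 u; nra.
(* Completing the square bounds [J] from below. *)
have Jlow u : - (K ^+ 2 / c) <= J u.
 have h1 := ca u; have h2 := bl u; have h3 := ler_norm (ell u); have h4 := normr_ge0 u.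
 have h5 : 0 <= (c * `|u| - K) ^+ 2 / c by rewrite divr_ge0 ?sqr_ge0 // ltW.
 have h6 : (c * `|u| - K) ^+ 2 / c = c * `|u| ^+ 2 - 2 * K * `|u| + K ^+ 2 / c.
  by field; rewrite gt_eqF.
 by rewrite /J; lin.
pose S := [set J u | u in [set: H]].
have hS : has_inf S by split; [exists (J 0), 0|exists (- (K ^+ 2 / c)) => _ [u _ <-]].
have Jinf u : inf S <= J u by apply: ge_inf; [exact: hS.2|exists u].
(* An excess of [(c / 8) * 4^-1 ^+ n] yields steps of size [2^-1 ^+ n], the rate that
   [cauchy_complete] asks for. *)
have near_min n : exists u, J u < inf S + (c / 8) * 4^-1 ^+ n.
 have e0 : 0 < (c / 8) * 4^-1 ^+ n by rewrite mulr_gt0 //; lin.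
 by have [_ [u _ <-] h] := inf_adherent e0 hS; exists u.
pose u n := sval (cid (near_min n)); have hu n : J (u n) < inf S + (c / 8) * 4^-1 ^+ n.
 exact: (svalP (cid (near_min n))).
(* parallelogram identity *)
have para v w : J v + J w - 2 * J (2^-1 *: (v + w)) = 2^-1 * a (v - w) (v - w).
 by rewrite /J !expand (as_ w v); lin.
have [|z hz] := @complete_cauchy R H u 1.
 move=> n; rewrite mul1r -ler_sqr ?nnegrE //.
 have h1 := para (u n.+1) (u n); have h2 := Jinf (2^-1 *: (u n.+1 + u n)).
 have h3 := hu n; have h4 := hu n.+1.
 rewrite exprS in h4; have h6 : 0 < 4^-1 ^+ n :> R by rewrite exprn_gt0.
 have -> : (2^-1 ^+ n) ^+ 2 = 4^-1 ^+ n :> R.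
  by rewrite -exprM mulnC exprM; congr (_ ^+ _); field.
 rewrite -(ler_pM2l c0); apply: (le_trans (ca (u n.+1 - u n))); nra.
exists z => w; apply/eqP; rewrite -subr_eq0 -sqrf_eq0 eq_le sqr_ge0 andbT.
set A := a w w; have a0 v : 0 <= a v v.
 by apply: le_trans (ca v); rewrite mulr_ge0 ?exprn_ge0 // ltW.
(* Comparing [J (u n)] with its value at [u n + (- e / D) *: w] bounds [D ^+ 2] by the excess [e]
   times [A]. *)
have hD n : (a (u n) w - ell w) ^+ 2 <= (c / 8) * 4^-1 ^+ n * A.
 set D := a (u n) w - ell w; set e := (c / 8) * _.
 have e0 : 0 < e by rewrite mulr_gt0 //; lin.
 have [->|D0] := eqVneq D 0; first by rewrite expr0n /=; apply: mulr_ge0; [exact: ltW|exact: a0].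
 move: (hu n) (Jinf (u n + (- e / D) *: w)); rewrite -/e /J !expand (as_ w (u n)) -/A.
 move=> h1 h2; have h3 : 0 <= e + (- e / D * (- e / D * A)) + 2 * (- e / D) * D.
  by rewrite /D in h1 h2 *; lin.
 have h4 : e + (- e / D * (- e / D * A)) + 2 * (- e / D) * D = e * (e * A - D ^+ 2) / D ^+ 2.
  by field.
 have D2 : 0 < D ^+ 2 by rewrite exprn_even_gt0.
 by move: h3; rewrite h4 pmulr_lge0 ?invr_gt0 // pmulr_rge0 // subr_ge0.
have hz2 n : a (z - u n) w ^+ 2 <= 4 * `|C| * 4^-1 ^+ n * A.
 apply/(le_trans (form_cauchy_schwarz al as_ (z - u n) w a0))/ler_wpM2r; first exact: a0.
 via (aC _); apply: (@le_trans _ _ (`|C| * `|z - u n| ^+ 2)).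
  by apply: ler_wpM2r; rewrite ?exprn_ge0 // ler_norm.
 rewrite [4 * _]mulrC -mulrA; apply: ler_wpM2l => //.
 have := hz n; rewrite distrC mulr1 => h.
 have -> : 4 * 4^-1 ^+ n = (2 * 2^-1 ^+ n) ^+ 2 :> R.
  rewrite exprMn -exprM mulnC exprM; congr (_ * _); first by ring.
  by congr (_ ^+ _); rewrite expr2; field.
 by rewrite ler_sqr ?nnegrE // mulr_ge0 // exprn_ge0.
apply/ler_addgt0Pr => e e0; rewrite add0r.
(* [c / 4] and [8 * |C|] are twice the constants of [hD] and [hz2], since the square of a sum costs
   a factor 2. *)
pose B := (c / 4 + 8 * `|C|) * A + 1.
have B0 : 0 < B by rewrite /B; have := a0 w; rewrite -/A; have := normr_ge0 C; nra.
have [n hn] := half_expr_lt (divr_gt0 e0 B0).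
have q4 : 4^-1 ^+ n <= 2^-1 ^+ n :> R.
 by apply: lerXn2r; rewrite ?nnegrE //; lin.
have h1 := hD n; have h2 := hz2 n; rewrite form_subl // in h2.
have h3 : (a z w - ell w) ^+ 2 <= 2 * (a (u n) w - ell w) ^+ 2 + 2 * (a z w - a (u n) w) ^+ 2.
 by have := sqr_ge0 ((a (u n) w - ell w) - (a z w - a (u n) w)); nra.
apply/(le_trans h3)/(@le_trans _ _ (4^-1 ^+ n * B)).
 by rewrite /B; have : 0 <= 4^-1 ^+ n :> R by [rewrite exprn_ge0]; lin.
apply: (@le_trans _ _ (2^-1 ^+ n * B)); first by apply: ler_wpM2r; rewrite // ltW.
by rewrite -ler_pdivlMr // ltW.
Qed.

End Inner.

Section Primitives.
Context {R : realType}.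
Implicit Types H : hilbert R.

Lemma mean_value0 (F : normedModType R) (y y' : R -> F) (K t : R) :
 (forall s, `|s| <= `|t| -> cder y s (y' s)) ->
 (forall s, `|s| <= `|t| -> `|y' s| <= K) -> `|y t - y 0| <= K * `|t|.
Proof.
move=> dy yK; have [t0|t0] := leP 0 t.
 rewrite (ger0_norm t0) -[in leRHS](subr0 t); apply: mean_value => // s hs.
  by apply: dy; rewrite !ger0_norm //; lin.
 by apply: yK; rewrite !ger0_norm //; lin.
have := @mean_value _ _ (fun s => y (0 + (-1) * s)) (fun s => (-1) *: y' (0 + (-1) * s)) 0 (- t) K.
rewrite !add0r mulr0 mulN1r opprK subr0 (ltr0_norm t0); apply; first by lin.
 move=> s hs; apply: cder_reparam; apply: dy; rewrite add0r mulN1r normrN.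
 by rewrite ger0_norm ?(ltr0_norm t0); lin.
move=> s hs; rewrite normrZ normrN1 mul1r; apply: yK; rewrite add0r mulN1r normrN.
by rewrite ger0_norm ?(ltr0_norm t0); lin.
Qed.

Lemma continuousP (E F : normedModType R) (f : E -> F) x : {for x, continuous f} <->
 forall e : R, 0 < e -> exists2 d : R, 0 < d & forall y, `|y - x| < d -> `|f y - f x| < e.
Proof.
split=> [cf e e0|h].
 have : nbhs x (fun y => nball (f x) e (f y)).
  by apply: (cf (nball (f x) e)); apply/nbhs_nball; exists e.
 by move=> /nbhs_nball[d d0 hd]; exists d.
move=> A /nbhs_nball[e e0 he]; have [d d0 hd] := h e e0.
by apply/nbhs_nball; exists d => // y /hd /he.
Qed.

Lemma inner_linear H w : linear (fun v => inner H v w).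
Proof. exact: dot_linear. Qed.

Lemma innerC H v w : inner H v w = inner H w v.
Proof. exact: dot_sym. Qed.

Lemma norm_inner_le H v (K : R) : 0 <= K ->
 (forall w, inner H v w <= K * `|w|) -> `|v| <= K.
Proof.
move=> K0 /(_ v); rewrite inner_norm expr2.
have [->|v0] := eqVneq v 0; first by rewrite normr0.
by rewrite ler_pM2r // normr_gt0.
Qed.

(** The primitive is defined weakly: each coefficient [inner H (c t) w] has a real primitive, which
    is linear and bounded in [w], hence represented by a vector. Differentiability is then read off
    uniformly in [w]. *)
Lemma hilbert_primitives H : has_primitives H.
Proof.
move=> c T cc T0.
have prim w : exists J : R -> R, J 0 = 0 /\ forall t, `|t| < T -> cder J t (inner H (c t) w).
 apply: real_primitive => // t; apply/continuousP => e e0.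
 have [d d0 hd] := (continuousP _ _).1 (cc t) (e / (`|w| + 1)) ltac:(by rewrite divr_gt0 // ltr_wpDl).
 exists d => // s /hd; rewrite ltr_pdivlMr // => h.
 rewrite -(form_subl (@inner_linear H)); apply: (le_lt_trans (inner_le _ _)).
 by apply: le_lt_trans h; rewrite ler_wpM2l // lerDl.
pose J w := sval (cid (prim w)).
have J0 w : J w 0 = 0 by exact: (svalP (cid (prim w))).1.
have dJ w t : `|t| < T -> cder (J w) t (inner H (c t) w).
 exact: (svalP (cid (prim w))).2.
have rep t : `|t| < T -> exists z, forall w, inner H z w = J w t.
 move=> tT.
 have [B B0 hB] : exists2 B : R, 0 <= B & forall s, `|s| <= `|t| -> `|c s| <= B.
  have [//||x _ hx] := @EVT_max R (fun s => `|c s|) (- `|t|) `|t|.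
  - by rewrite ge0_cp ?lexx.
  - apply: continuous_subspaceT => s.
   by apply: continuous_comp; [exact: cc|exact: norm_continuous].
  by exists `|c x| => // s; rewrite ler_norml => hs; apply: hx; rewrite in_itv.
 apply: (@riesz _ H (inner H) (fun w => J w t) 1 1 (B * `|t|)) => //.
 - exact: inner_linear.
 - exact: innerC.
 - by move=> u; rewrite inner_norm mul1r.
 - by move=> u; rewrite inner_norm mul1r.
 - move=> k u v.
  pose D s : R^o := J (k *: u + v) s - (k * J u s + J v s).
  have : `|D t - D 0| <= 0 * `|t|.
   apply: (@mean_value0 R^o D (fun=> 0)) => s hs; last by rewrite normr0.
   have sT := le_lt_trans hs tT.
   have e : inner H (c s) (k *: u + v) - (k *: (inner H (c s) u) + inner H (c s) v) = 0.
    by rewrite (form_addr (@inner_linear H) (@innerC H)) (form_scaler (@inner_linear H) (@innerC H)) subrr.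
   rewrite -e; apply: (@cderB R^o); first exact: dJ.
   by apply: (@cderD R^o); [apply: (@cderZ R^o); exact: dJ|exact: dJ].
  by rewrite mul0r normr_le0 /D !J0 mulr0 addr0 !subr0 subr_eq0 => /eqP.
 - move=> u; have := @mean_value0 R^o (J u) (fun s => inner H (c s) u) (B * `|u|) t.
  rewrite J0 subr0 mulrAC; apply=> s hs; first by apply: dJ; apply: le_lt_trans tT.
  by apply: (le_trans (inner_le _ _)); apply: ler_wpM2r => //; exact: hB.
pose Z t := if pselect (`|t| < T) is left h then sval (cid (rep t h)) else 0.
have hZ t w : `|t| < T -> inner H (Z t) w = J w t.
 by rewrite /Z; case: pselect => // h _; exact: (svalP (cid (rep t h))).
exists Z; split.
 apply/eqP; rewrite -normr_le0; apply: norm_inner_le => // w.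
 by rewrite hZ ?normr0 // J0 mul0r.
move=> t tT; apply/cderP => e e0.
have [d d0 hd] := (continuousP _ _).1 (cc t) e e0.
exists (Num.min d (T - `|t|)); first by rewrite lt_min d0 subr_gt0.
move=> h; rewrite lt_min => /andP[h1 h2].
have inT s : `|s| <= `|h| -> `|t + s| < T.
 by move=> hs; apply: le_lt_trans (ler_normD _ _) _; lin.
apply: norm_inner_le => [|w]; first by rewrite mulr_ge0 // ltW.
rewrite !(form_subl (@inner_linear H)) (form_scalel (@inner_linear H)) !hZ //; last exact: inT.
pose D s : R^o := J w (t + 1 * s) - (0 + s *: (inner H (c t) w : R^o)).
have eD : D h - D 0 = J w (t + h) - J w t - h * inner H (c t) w.
 by rewrite /D !mul1r addr0 /GRing.scale /=; ring.
via (ler_norm _); rewrite -eD mulrAC.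
apply: (@mean_value0 R^o D (fun s => 1 *: (inner H (c (t + 1 * s)) w) - inner H (c t) w)) => s hs.
 apply: cderB; last exact: (@cder_line _ R^o).
 by apply: (@cder_reparam _ R^o (J w)); apply: dJ; rewrite mul1r; exact: inT.
rewrite scale1r mul1r -(form_subl (@inner_linear H)).
via (inner_le _ _); apply: ler_wpM2r => //; apply/ltW/hd.
by rewrite addrC addKr; exact: le_lt_trans h1.
Qed.

End Primitives.

Section Picard.
Context {R : realType} (E : normedModType R).
Hypotheses (completeE : cauchy_complete E) (primE : has_primitives E).

(** Freezing time outside [[- T, T]] makes all iterates continuous on the whole line with values in
    the ball, which avoids subspace topologies. *)
Definition clamp (T t : R) : R := Num.max (- T) (Num.min T t).

Lemma clamp_le (T t : R) : 0 <= T -> `|clamp T t| <= T.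
Proof.
move=> T0; rewrite ler_norml le_max lexx /= ge_max ge_min lexx andbT.
by lin.
Qed.

Lemma clamp_id (T t : R) : `|t| <= T -> clamp T t = t.
Proof.
by rewrite ler_norml => /andP[h1 h2]; rewrite /clamp min_r // max_r.
Qed.

Lemma clamp_lip (T s t : R) : 0 <= T -> `|clamp T s - clamp T t| <= `|s - t|.
Proof.
move=> T0; rewrite /clamp.
have [] := leP T s; have [] := leP T t; rewrite ?maxEle => h1 h2; repeat case: ifP => /=;
 move=> *; rewrite ler_norml; have := ler_norm (s - t); have := ler_norm (t - s);
 rewrite distrC; move: h1 h2; rewrite -?ltNge; lin || (move=> *; apply/andP; split; lin).
Qed.

Lemma clamp_continuous (T : R) : 0 <= T -> continuous (clamp T).
Proof.
move=> T0 t; apply/continuousP => e e0; exists e => // s st.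
by apply: le_lt_trans st; exact: clamp_lip.
Qed.

(** The integral operator halves uniform distances since [L * T <= 2^-1], and [K * T <= r] keeps its
    values in the ball. The iterates converge geometrically, uniformly in time, so the limit is
    continuous and is a fixed point. *)
Lemma picard (G : R -> E -> E) y0 (T r K L : R) : 0 < T -> 0 <= K -> 0 <= L ->
 (forall y : R -> E, continuous y -> (forall t, `|y t - y0| <= r) ->
   continuous (fun t => G t (y t))) ->
 (forall t y, `|y - y0| <= r -> `|G t y| <= K) ->
 (forall t y z, `|y - y0| <= r -> `|z - y0| <= r -> `|G t y - G t z| <= L * `|y - z|) ->
 K * T <= r -> L * T <= 2^-1 ->
 exists y : R -> E, y 0 = y0 /\
  forall t, `|t| < T -> `|y t - y0| <= r /\ cder y t (G t (y t)).
Proof.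
move=> T0 K0 L0 cG bG lG KT LT.
have r0 : 0 <= r by apply: le_trans KT; rewrite mulr_ge0 // ltW.
pose ok (y : R -> E) := continuous y /\ forall t, `|y t - y0| <= r.
(* The primitives live on a slightly larger interval, so that they are differentiable at [- T] and
   [T] as well. *)
have prim (y : {y : R -> E | ok y}) : exists J : R -> E, J 0 = 0 /\
  forall t, `|t| < T + 1 -> cder J t (G t (sval y t)).
 case: y => y [cy yr]; apply: primE; first exact: cG.
 by lin.
pose J y := sval (cid (prim y)).
have J0 y : J y 0 = 0 by exact: (svalP (cid (prim y))).1.
have dJ y t : `|t| <= T -> cder (J y) t (G t (sval y t)).
 by move=> tT; apply: (svalP (cid (prim y))).2; lin.
have Tge : 0 <= T by exact: ltW.
have step_ok y : ok (fun t => y0 + J y (clamp T t)).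
 split=> [t|t].
  apply: cvgD; first exact: cvg_cst.
  apply: (@continuous_comp _ _ _ (clamp T) (J y)); first exact: clamp_continuous.
  by apply: cder_continuous (dJ y _ _); exact: clamp_le.
 rewrite addrC addKr; have := @mean_value0 R E (J y) (fun s => G s (sval y s)) K (clamp T t).
 rewrite J0 subr0 => h; via (h _ _) => [s hs|s hs|].
 - by apply: dJ; apply: (le_trans hs); exact: clamp_le.
 - by apply: bG; exact: (svalP y).2.
 - by apply: le_trans KT; apply: ler_wpM2l => //; exact: clamp_le.
pose step y : {y : R -> E | ok y} := exist _ _ (step_ok y).
have diff y z D : (forall t, `|sval y t - sval z t| <= D) -> forall t,
  `|sval (step y) t - sval (step z) t| <= D / 2.
 move=> hD t /=; have D0 : 0 <= D by apply: le_trans (hD 0).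
 rewrite opprD addrACA subrr add0r.
 have := @mean_value0 R E (fun s => J y s - J z s) (fun s => G s (sval y s) - G s (sval z s))
  (L * D) (clamp T t).
 rewrite !J0 !subr0 => h; via (h _ _) => [s hs|s hs|].
 - have sT : `|s| <= T by exact/(le_trans hs)/clamp_le.
  by apply: cderB; apply: dJ.
 - via (lG _ _ _ ((svalP y).2 s) ((svalP z).2 s)).
  by apply: ler_wpM2l.
 - apply: (@le_trans _ _ (L * D * T)); last by nra.
  by apply: ler_wpM2l; [exact: mulr_ge0|exact: clamp_le].
have ok0 : ok (fun=> y0).
 by split=> [t|t]; [exact: cvg_cst|rewrite subrr normr0].
pose u n := iter n step (exist _ _ ok0).
have hu n t : `|sval (u n.+1) t - sval (u n) t| <= r * 2^-1 ^+ n.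
 elim: n t => [|n IH] t; first by rewrite expr0 mulr1; exact: (svalP (u 1%N)).2.
 by have := diff (u n.+1) (u n) _ IH t; rewrite exprSr mulrA.
have lim t : exists l, forall n, `|sval (u n) t - l| <= 2 * r * 2^-1 ^+ n.
 by apply: completeE => n; exact: hu.
pose y t := sval (cid (lim t)).
have hy t n : `|sval (u n) t - y t| <= 2 * r * 2^-1 ^+ n := svalP (cid (lim t)) n.
have small e : 0 < e -> exists n, 2 * r * 2^-1 ^+ n < e.
 move=> e0; have r1 : 0 < 2 * r + 1 by lin.
 have [n hn] := half_expr_lt (divr_gt0 e0 r1).
 exists n; rewrite ltr_pdivlMr in hn; last by lin.
 by have : 0 <= 2^-1 ^+ n :> R by [rewrite exprn_ge0]; nra.
have yok : ok y.
 split=> [t|t].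
  apply/continuousP => e e0; have e3 : 0 < e / 3 by lin.
  have [n hn] := small _ e3.
  have [d d0 hd] := (continuousP _ _).1 ((svalP (u n)).1 t) _ e3.
  exists d => // s /hd h; have h1 := hy s n; have h2 := hy t n.
  have h3 := ler_distD (sval (u n) s) (y s) (y t).
  have h4 := ler_distD (sval (u n) t) (sval (u n) s) (y t).
  by rewrite (distrC (y s) (sval (u n) s)) in h3; lin.
 apply/ler_addgt0Pr => e e0; have [n hn] := small _ e0.
 have h1 := hy t n; have h2 := (svalP (u n)).2 t.
 by have := ler_distD (sval (u n) t) (y t) y0; rewrite (distrC (y t) (sval _ _)); lin.
pose Y : {y : R -> E | ok y} := exist _ _ yok.
have fix_ t : y t = y0 + J Y (clamp T t).
 apply/eqP; rewrite -subr_eq0 -normr_le0; apply/ler_addgt0Pr => e e0; rewrite add0r.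
 have e2 : 0 < e / 2 by lin.
 have [n hn] := small _ e2.
 have h1 := diff (u n) Y _ (fun s => hy s n) t.
 have h2 := hy t n.+1; rewrite exprS in h2.
 have := ler_distD (sval (u n.+1) t) (y t) (y0 + J Y (clamp T t)).
 by rewrite (distrC (y t) (sval _ _)) /= in h1 h2 *; lin.
exists y; split; first by rewrite fix_ clamp_id ?normr0 // J0 addr0.
move=> t tT; split; first exact: yok.2.
have h : cder (fun s => y0 + J Y s) t (0 + G t (y t)).
 by apply: cderD; [exact: cder_cst|apply: dJ; exact: ltW].
rewrite add0r in h; apply: cder_near h.
apply/nbhs_nball; exists (T - `|t|); first by rewrite subr_gt0.
move=> s; rewrite /nball /= => hs; rewrite fix_ clamp_id //.
by have := ler_normD (s - t) t; rewrite subrK; lin.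
Qed.

End Picard.

(** * Smooth families of linear maps *)

Section WeakSmooth.
Context {R : realType}.
Implicit Types (H : hilbert R) (E F G : normedModType R).

Lemma scale_bound E F (f : E -> F) (r B : R) : 0 < r ->
 (forall a v, f (a *: v) = a *: f v) ->
 (forall v, `|v| < r -> `|f v| <= B) -> forall v, `|f v| <= (2 * B / r) * `|v|.
Proof.
move=> r0 fZ fB v; have [->|v0] := eqVneq v 0.
 by rewrite -(scale0r 0) fZ !scale0r !normr0 mulr0.
have nv : 0 < `|v| by rewrite normr_gt0.
have a0 : 0 < r / (2 * `|v|) by rewrite divr_gt0 // mulr_gt0.
have := fB ((r / (2 * `|v|)) *: v); rewrite fZ (normrZ _ v) (normrZ _ (f v)) (gtr0_norm a0).
have -> : r / (2 * `|v|) * `|v| = r / 2 by field; rewrite gt_eqF.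
move=> /(_ ltac:(lin)); rewrite mulrC -ler_pdivlMr // => /le_trans; apply.
by lin.
Qed.

Lemma diff_family_linear E G F (U : set E) (b : E -> G -> F) (x h : E) :
 open U -> U x -> (forall y, U y -> linear (b y)) ->
 (forall v, differentiable (fun y => b y v) x) ->
 linear (fun v => 'd (fun y => b y v) x h).
Proof.
move=> oU Ux lb db a u v; pose f y := a *: b y u + b y v.
have df : is_diff x f (fun h => a *: 'd (fun y => b y u) x h + 'd (fun y => b y v) x h).
 exact: (is_diffD (is_diffZ a (differentiableP (db u))) (differentiableP (db v))).
have [_ e] : is_diff x (fun y => b y (a *: u + v))
  (fun h => a *: 'd (fun y => b y u) x h + 'd (fun y => b y v) x h).
 apply: is_diff_near df; apply: filterS (open_near oU Ux) => y Uy.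
 by rewrite /f (lb y Uy).
by have e' := congr1 (fun L : E -> F => L h) e.
Qed.

Lemma smooth_partial E G F (U : set E) (b : E -> G -> F) (x : E) (v : G) :
 smooth_on (U `*` setT) (fun z => b z.1 z.2) -> U x ->
 differentiable (fun y => b y v) x /\
 forall h, 'd (fun y => b y v) x h = 'd (fun z => b z.1 z.2) (x, v) (h, 0).
Proof.
move=> sb Ux; have [d e] := is_diff_partial (smooth_diff sb (conj Ux I : (U `*` setT) (x, v))).
by split=> // h; have e' := congr1 (fun L : E -> F => L h) e.
Qed.

(** Smoothness near [(x, 0)] gives bounds, Lipschitz estimates and Taylor remainders for small [v];
    linearity in [v] extends each of them to all [v]. These are operator norm estimates for [b],
    obtained without a topology on operators. *)
Lemma bilinear_bound E G F (U : set E) (b : E -> G -> F) (x : E) :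
 open U -> U x -> smooth_on (U `*` setT) (fun z => b z.1 z.2) ->
 (forall y, U y -> linear (b y)) ->
 exists r C : R, [/\ 0 < r, 0 < C, nball x r `<=` U &
  forall y z, nball x r y -> nball x r z -> forall v,
  [/\ `|b y v| <= C * `|v|, `|b z v - b y v| <= C * `|z - y| * `|v|,
   forall h, `|'d (fun y => b y v) y h| <= C * `|h| * `|v| &
   `|b z v - b y v - 'd (fun y => b y v) y (z - y)| <= C * `|z - y| ^+ 2 * `|v|]].
Proof.
move=> oU Ux sb lb.
have bZ y a v : U y -> b y (a *: v) = a *: b y v.
 by move=> /lb h; exact: lin_scale.
have cb : {for (x, 0), continuous (fun z => b z.1 z.2)}.
 exact: smooth_cont sb (conj Ux I : (U `*` setT) (x, 0)).
have [r1 [C1 [r10 C10 rU1 h1]]] := homogeneous_bound oU Ux cb bZ.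
have [r2 [C2 [r20 C20 rU2 h2]]] :=
 smooth_lipschitz (openXT oU) sb (conj Ux I : (U `*` setT) (x, 0)).
have [r3 [C3 [r30 C30 rU3 h3]]] :=
 smooth_taylor (openXT oU) sb (conj Ux I : (U `*` setT) (x, 0)).
pose r := Num.min r1 (Num.min r2 r3).
have r0 : 0 < r by rewrite !lt_min r10 r20.
have [rr1 rr2 rr3] : [/\ r <= r1, r <= r2 & r <= r3] by rewrite !ge_min !lexx ?orbT.
pose C := C1 + 2 * C2 / r + 2 * C3 / r.
have p2 : 0 < 2 * C2 / r by rewrite divr_gt0 // mulr_gt0.
have p3 : 0 < 2 * C3 / r by rewrite divr_gt0 // mulr_gt0.
exists r, C; split=> //; first by rewrite /C; lin.
 by move=> y hy; apply: rU1; rewrite /nball /=; exact: lt_le_trans rr1.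
have inU y : nball x r y -> U y.
 by move=> hy; apply: rU1; rewrite /nball /=; exact: lt_le_trans rr1.
have inb s y v : r <= s -> nball x r y -> `|v| < r -> nball (x, 0 : G) s (y, v).
 move=> rs hy vr; rewrite /nball /= -[_ - _]/((y - x, v - 0)) norm_pair_lt subr0.
 by rewrite (lt_le_trans hy rs) (lt_le_trans vr rs).
have db y v : U y -> differentiable (fun z => b z.1 z.2) (y, v).
 by move=> Uy; apply: (smooth_diff sb).
have part y v h : U y -> 'd (fun y => b y v) y h = 'd (fun z => b z.1 z.2) (y, v) (h, 0).
 by move=> Uy; have [_ e] := is_diff_partial (db y v Uy); have e' := congr1 (fun L : E -> _ => L h) e; exact: e'.
have dZ y h a v : U y -> 'd (fun y => b y (a *: v)) y h = a *: 'd (fun y => b y v) y h.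
 move=> Uy; apply: (lin_scale _ _ (diff_family_linear h oU Uy lb _)) => w.
 exact: (smooth_partial w sb Uy).1.
have pn a : `|(a, 0 : G) : E * G| = `|a| by rewrite prod_normE normr0 max_l.
move=> y z hy hz v; have Uy := inU _ hy; have Uz := inU _ hz.
have lip y' z' w : nball x r y' -> nball x r z' -> `|w| < r -> `|b z' w - b y' w| <= C2 * `|z' - y'|.
 move=> hy' hz' wr; have := h2 _ _ (inb _ _ _ rr2 hy' wr) (inb _ _ _ rr2 hz' wr).
 by rewrite /= -[X in _ <= _ * `|X|]/((z' - y', w - w)) subrr pn.
split.
- via (h1 _ _ _); first exact: lt_le_trans rr1.
 by apply: ler_wpM2r => //; rewrite /C; lin.
- have h := @scale_bound _ _ (fun v => b z v - b y v) r (C2 * `|z - y|) r0.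
 via (h _ _ v) => [a w|w wr|].
 + by rewrite !bZ // scalerBr.
 + exact: lip.
 + apply: ler_wpM2r => //; rewrite mulrA mulrAC; apply: ler_wpM2r => //.
  by rewrite /C; lin.
- move=> h; have hh := @scale_bound _ _ (fun v => 'd (fun y => b y v) y h) r (C2 * `|h|) r0.
 via (hh _ _ v) => [a w|w wr|].
 + exact: dZ.
 + have [d1 _] := is_diff_partial (db y w Uy).
  have [h0|h0] := eqVneq h 0; first by rewrite h0 linear0 !normr0 mulr0.
  apply/ler_addgt0Pr => e e0.
  have nh : 0 < `|h| by rewrite normr_gt0.
  have [d d0 hd] := diff_approx d1 (divr_gt0 e0 nh).
  (* The increment must stay in the ball, for the Lipschitz bound, and within [d], for the
     approximation by the differential. *)
  pose s := (Num.min d (r - `|y - x|)) / (2 * `|h|).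
  have m0 : 0 < Num.min d (r - `|y - x|) by rewrite lt_min d0 subr_gt0.
  have s0 : 0 < s by rewrite divr_gt0 // mulr_gt0.
  have sh : `|s *: h| = Num.min d (r - `|y - x|) / 2.
   by rewrite normrZ (gtr0_norm s0) /s; field; rewrite gt_eqF.
  have [sd sr] : Num.min d (r - `|y - x|) <= d /\ Num.min d (r - `|y - x|) <= r - `|y - x|.
   by rewrite !ge_min !lexx ?orbT.
  have := hd (s *: h) ltac:(rewrite sh; lin).
  have ny : nball x r (y + s *: h).
   rewrite /nball /= addrAC; apply: (le_lt_trans (ler_normD _ _)).
   by rewrite sh; lin.
  have := lip y (y + s *: h) w hy ny wr; rewrite (addrC y) addrK -(addrC y) => q1 q2.
  have : `|s *: 'd (fun y => b y w) y h| <= s * (C2 * `|h| + e).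
   rewrite -diff_scale -[X in `|X|](subKr (b (y + s *: h) w - b y w)).
   via (ler_normB _ _); move: q1 q2; rewrite normrZ (gtr0_norm s0).
   have -> : e / `|h| * (s * `|h|) = s * e by field; rewrite gt_eqF.
   by rewrite mulrDr; lin.
  by rewrite normrZ (gtr0_norm s0) ler_pM2l.
 + apply: ler_wpM2r => //; rewrite mulrA mulrAC; apply: ler_wpM2r => //.
  by rewrite /C; lin.
- have hh := @scale_bound _ _ (fun v => b z v - b y v - 'd (fun y => b y v) y (z - y))
  r (C3 * `|z - y| ^+ 2) r0.
 via (hh _ _ v) => [a w|w wr|].
 + by rewrite !bZ // dZ // !scalerBr.
 + have := h3 _ _ (inb _ _ _ rr3 hy wr) (inb _ _ _ rr3 hz wr).
  by rewrite /= -[(z, w) - (y, w)]/((z - y, w - w)) subrr pn -part.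
 + apply: ler_wpM2r => //; rewrite mulrA mulrAC; apply: ler_wpM2r; first exact: exprn_ge0.
  by rewrite /C; lin.
Qed.

Lemma inner_inj H u v : (forall w, inner H u w = inner H v w) -> u = v.
Proof.
move=> h; apply/eqP; rewrite -subr_eq0 -normr_le0; apply: norm_inner_le => // w.
by rewrite (form_subl (@inner_linear R H)) h subrr.
Qed.

(** Weak regularity, jointly in the point and the test vector, is strong: [bilinear_bound] makes the
    remainder uniform over test vectors of bounded norm. The derivative is the Riesz vector of [k1],
    and the induction hypothesis applies to it with [k1] as the new kernel. *)
Lemma weak_smooth E H (U : set E) (k : E -> H -> R) (K : E -> H) : open U ->
 smooth_on (U `*` setT) (fun z => k z.1 z.2 : R^o) ->
 (forall z, U z -> forall w, inner H (K z) w = k z w) -> smooth_on U K.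
Proof.
move=> oU sk hK n; elim: n E U k K oU sk hK => [|n IH] E U k K oU sk hK.
 move=> x Ux; have lk y : U y -> linear (k y : H -> R^o).
  move=> Uy a u v; rewrite -!hK // (form_addr (@inner_linear R H) (@innerC R H)).
  by rewrite (form_scaler (@inner_linear R H) (@innerC R H)).
 have [r [C [r0 C0 rU hC]]] := bilinear_bound oU Ux sk lk.
 apply/continuousP => e e0; exists (Num.min r (e / (C + 1))).
  by rewrite lt_min r0 divr_gt0 //; lin.
 move=> y; rewrite lt_min => /andP[yr ye].
 apply: (@le_lt_trans _ _ (C * `|y - x|)); last first.
  by rewrite ltr_pdivlMr in ye; [have := normr_ge0 (y - x)|]; lin.
 apply: norm_inner_le => [|w]; first by apply: mulr_ge0 => //; exact: ltW.
 rewrite (form_subl (@inner_linear R H)) !hK //; last exact: rU.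
 have [_ h _ _] := hC x y (nballxx x r0) yr w.
 exact: le_trans (ler_norm _) h.
have lk y : U y -> linear (k y : H -> R^o).
 move=> Uy a u v; rewrite -!hK // (form_addr (@inner_linear R H) (@innerC R H)).
 by rewrite (form_scaler (@inner_linear R H) (@innerC R H)).
pose k1 (z : E * E) w : R := 'd (fun z => k z.1 z.2 : R^o) (z.1, w) (z.2, 0).
have ek1 x h w : U x -> 'd (fun y => k y w) x h = k1 (x, h) w.
 move=> Ux; have [_ e] := is_diff_partial (smooth_diff sk (conj Ux I : (U `*` setT) (x, w))).
 have e' := congr1 (fun L : E -> _ => L h) e; exact: e'.
have rep z : U z.1 -> exists v, forall w, inner H v w = k1 z w.
 case: z => x h /= Ux; have [r [C [r0 C0 rU hC]]] := bilinear_bound oU Ux sk lk.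
 have xr := nballxx x r0.
 apply: (@riesz _ H (inner H) (k1 (x, h)) 1 1 (C * `|h|)) => //.
 - exact: inner_linear.
 - exact: innerC.
 - by move=> u; rewrite inner_norm mul1r.
 - by move=> u; rewrite inner_norm mul1r.
 - move=> a u v; rewrite -!ek1 //.
  apply: (diff_family_linear h oU Ux lk) => w.
  exact: (smooth_partial w sk Ux).1.
 - move=> u; rewrite -ek1 //.
  by have [_ _ h1 _] := hC x x xr xr u; exact: h1.
pose K1 z := if pselect (U z.1) is left h then sval (cid (rep z h)) else 0.
have hK1 z w : U z.1 -> inner H (K1 z) w = k1 z w.
 by rewrite /K1; case: pselect => // h _; exact: (svalP (cid (rep z h))).
have dK x : U x -> is_diff x K (fun h => K1 (x, h)).
 move=> Ux; have [r [C [r0 C0 rU hC]]] := bilinear_bound oU Ux sk lk.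
 have xr := nballxx x r0.
 apply: (@is_diff_quadratic _ _ _ _ _ _ C r) => //.
 - move=> a u v; apply: inner_inj => w.
  rewrite (form_addl (@inner_linear R H)) (form_scalel (@inner_linear R H)) !hK1 //.
  by rewrite -!ek1 // diff_add diff_scale.
 - exists C => h; apply: norm_inner_le => [|w]; first by apply: mulr_ge0 => //; exact: ltW.
  rewrite hK1 // -ek1 //; have [_ _ h1 _] := hC x x xr xr w.
  exact: le_trans (ler_norm _) (h1 h).
 - move=> h hr; have xh : nball x r (x + h) by rewrite /nball /= addrC addKr.
  apply: norm_inner_le => [|w]; first by apply: mulr_ge0; rewrite // ltW.
  rewrite !(form_subl (@inner_linear R H)) !hK //; last exact: rU.
  rewrite hK1 // -ek1 //; have [_ _ _ h1] := hC x (x + h) xr xh w.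
  by rewrite (addrC x h) addrK (addrC h x) in h1; exact: le_trans (ler_norm _) h1.
split=> [x /dK[]//|].
apply: (@Ck_congr _ _ _ _ _ K1); first exact: openXT.
 by move=> [x h] [/= Ux _]; have [_ e] := dK x Ux; rewrite e.
apply: (IH _ _ k1); [exact: openXT| |by move=> z [Uz _] w; exact: hK1].
have oUU := openXT (openXT oU (G := E)) (G := H) => m.
apply: (Ck_comp oUU (V := (U `*` setT) `*` setT) _ _ (smooth_tangent sk m)
 (f := fun z : (E * E) * H => ((z.1.1, z.2), (z.1.2, 0 : H)))).
 by move=> z [[]].
by Ck_auto.
Qed.

(** The derivative of an inverse, [- b^-1 b' b^-1], is an expression in the inverse and the
    derivative of [b], so regularity bootstraps from the tangent map [T]. The local bound on [bi]
    makes the remainder quadratic. *)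
Lemma inverse_smooth E F G (U : set E) (b : E -> F -> G) (bi : E -> G -> F) : open U ->
 smooth_on (U `*` setT) (fun z => b z.1 z.2) -> (forall x, U x -> linear (b x)) ->
 (forall x v, U x -> bi x (b x v) = v) -> (forall x g, U x -> b x (bi x g) = g) ->
 (forall x, U x -> exists r C : R, [/\ 0 < r, 0 < C & forall y g, nball x r y -> U y -> `|bi y g| <= C * `|g|]) ->
 smooth_on (U `*` setT) (fun z => bi z.1 z.2).
Proof.
move=> oU sb lb biK bK bbi.
pose B1 x v h := 'd (fun z => b z.1 z.2) (x, v) (h, 0).
pose T (z : (E * G) * (E * G)) := bi z.1.1 (z.2.2 - B1 z.1.1 (bi z.1.1 z.1.2) z.2.1).
have lbi x : U x -> linear (bi x).
 by move=> Ux a u v; rewrite -{1}(bK x u) // -{1}(bK x v) // -lb // biK.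
have eB1 x v h : U x -> 'd (fun y => b y v) x h = B1 x v h.
 move=> Ux; have [_ e] := is_diff_partial (smooth_diff sb (conj Ux I : (U `*` setT) (x, v))).
 have e' := congr1 (fun L : E -> _ => L h) e; exact: e'.
have db z : (U `*` setT) z -> is_diff z (fun z => bi z.1 z.2) (fun h => T (z, h)).
 case: z => x g [/= Ux _].
 have [r1 [C1 [r10 C10 rU1 h1]]] := bilinear_bound oU Ux sb lb.
 have [r2 [C2 [r20 C20 h2]]] := bbi x Ux.
 have x1 := nballxx x r10.
 pose v := bi x g.
 have lT : linear (fun h => T ((x, g), h)).
  move=> a [h k] [h' k']; rewrite /T /= -(lbi x Ux); congr (bi x).
  have q (p p' m m' : G) : a *: p + p' - (a *: m + m') = a *: (p - m) + (p' - m') by module R.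
  by rewrite -/v -!eB1 // diff_add diff_scale; exact: q.
 have bT h : `|T ((x, g), h)| <= C2 * (1 + C1 * `|v|) * `|h|.
  via (h2 x _ (nballxx x r20) Ux) => /=; rewrite -mulrA; apply: ler_wpM2l; first exact: ltW.
  rewrite -eB1 // -/v; have [_ _ h3 _] := h1 x x x1 x1 v.
  via (ler_normB _ _); rewrite mulrDl mul1r; apply: lerD; first exact: norm_snd_le.
  via (h3 _); rewrite mulrAC; apply: ler_wpM2l; last exact: norm_fst_le.
  by apply: mulr_ge0 => //; exact: ltW.
 apply: (@is_diff_quadratic _ _ _ _ _ _
  (C2 * (C1 * `|v|) + C2 * (C1 * (C2 * (1 + C1 * `|v|)))) (Num.min r1 r2)) => //.
 - by eexists; exact: bT.
 - by rewrite lt_min r10.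
 move=> [h k]; rewrite norm_pair_lt !lt_min => /andP[/andP[hr1 hr2] _].
 have xh1 : nball x r1 (x + h) by rewrite /nball /= addrC addKr.
 have xh2 : nball x r2 (x + h) by rewrite /nball /= addrC addKr.
 have Uxh := rU1 _ xh1; rewrite /= -/v.
 set m := T _; set v' := bi (x + h) (g + k).
 pose rho := b (x + h) v - b x v - B1 x v h.
 (* The defect of the linearized solution: [rho] is quadratic by Taylor, and the other term is a
    product of two quantities of first order. *)
 have e1 : v' - v - m = - bi (x + h) (rho + (b (x + h) m - b x m)).
  have -> : rho + (b (x + h) m - b x m) = b (x + h) v + b (x + h) m - (g + k).
   rewrite /m /T /= (bK x) // -/v /rho -{1}(bK x g Ux) -/v; module R.
  by rewrite -(lin_add _ _ (lb _ Uxh)) (lin_sub _ _ (lbi _ Uxh)) biK // -/v'; module R.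
 have nh : `|h| <= `|(h, k)| := norm_fst_le (h, k).
 rewrite e1 normrN; via (h2 _ _ xh2 Uxh).
 rewrite -mulrDr -mulrA; apply: ler_wpM2l; first exact: ltW.
 via (ler_normD _ _); rewrite mulrDl; apply: lerD.
  have [_ _ _ q] := h1 x (x + h) x1 xh1 v; rewrite eB1 // (addrC x) addrK (addrC h) in q.
  via q; rewrite mulrAC; apply: ler_wpM2l.
   by apply: mulr_ge0 => //; exact: ltW.
  by rewrite ler_sqr ?nnegrE.
 have [_ q _ _] := h1 x (x + h) x1 xh1 m; rewrite (addrC x) addrK (addrC h) in q.
 via q; set A := C2 * (1 + _); set N := `|(h, k)|.
 have -> : C1 * A * N ^+ 2 = C1 * N * (A * N) by ring.
 apply: ler_pM => //; last exact: bT.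
  by apply: mulr_ge0 => //; exact: ltW.
 by apply: ler_wpM2l => //; exact: ltW.
apply: Ck_from_tangent => [z /db[]//|n cb].
apply: (@Ck_congr _ _ _ _ _ T); [exact/openXT/openXT| |].
 by move=> [z h] [/= Uz _]; have [_ e] := db z Uz; rewrite /tangent e.
have oUU := openXT (openXT oU (G := G)) (G := (E * G)%type).
have c1 : Ck n ((U `*` setT) `*` setT)
  (fun z : (E * G) * (E * G) => bi z.1.1 z.1.2).
 by apply: (Ck_comp2 oUU cb); [move=> z []|Ck_auto..].
have c2 : Ck n ((U `*` setT) `*` setT)
  (fun z : (E * G) * (E * G) => B1 z.1.1 (bi z.1.1 z.1.2) z.2.1).
 apply: (Ck_comp oUU (V := (U `*` setT) `*` setT) _ _ (smooth_tangent sb n)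
  (f := fun z : (E * G) * (E * G) => ((z.1.1, bi z.1.1 z.1.2), (z.2.1, 0 : F)))).
  by move=> z [[]].
 by Ck_auto.
by apply: (Ck_comp2 oUU cb); [move=> z [[]]|Ck_auto..].
Qed.

End WeakSmooth.

Section Families.
Context {R : realType}.
Implicit Types E F G : normedModType R.

(** A smooth family of bounded operators, encoded as a jointly smooth map that is linear in the last
    argument; boundedness follows from continuity at zero vectors. *)
Definition family1 E G F (U : set E) (b : E -> G -> F) : Prop :=
 [/\ open U, smooth_on (U `*` setT) (fun z => b z.1 z.2) & forall x, U x -> linear (b x)].

Definition family2 E G1 G2 F (U : set E) (b : E -> G1 -> G2 -> F) : Prop :=
 [/\ open U, smooth_on (U `*` setT) (fun z : E * (G1 * G2) => b z.1 z.2.1 z.2.2),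
  forall x v, U x -> linear (fun u => b x u v) &
  forall x u, U x -> linear (b x u)].

Lemma family1_bounded E G F (U : set E) (b : E -> G -> F) x : family1 U b -> U x ->
 exists C : R, forall v, `|b x v| <= C * `|v|.
Proof.
move=> [oU sb lb] Ux; have [r [C [r0 C0 rU hC]]] := bilinear_bound oU Ux sb lb.
by exists C => v; have [] := hC x x (nballxx x r0) (nballxx x r0) v.
Qed.

(** A Leibniz rule: the differential at [(x t, a t)] splits into the partial derivative in the point
    and, by linearity, the map [b (x t)] itself. *)
Lemma cder_family1 E G F (U : set E) (b : E -> G -> F) (x : R -> E) (a : R -> G) t x' a' :
 family1 U b -> U (x t) -> cder x t x' -> cder a t a' ->
 cder (fun s => b (x s) (a s)) t ('d (fun y => b y (a t)) (x t) x' + b (x t) a').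
Proof.
move=> fb Ux dx da; have [oU sb lb] := fb.
have db : differentiable (fun z => b z.1 z.2) (x t, a t) by exact: smooth_diff sb _.
have h0 := cder_comp db (cder_pair dx da).
apply: (cder_eq h0); set B := fun z => b z.1 z.2.
have -> : (x', a') = ((x', 0) : E * G) + (0, a').
 by rewrite -[RHS]/(x' + 0, 0 + a') addr0 add0r.
rewrite (diff_add B (x t, a t) (x', 0) (0, a')) -(smooth_partial _ sb Ux).2; congr (_ + _).
have h : is_diff (a t) (fun v : G => (x t, v)) (fun k => (0, k)).
 by apply: (is_diff_eq (is_diff_pair (is_diff_cst (x t) (a t)) (is_diff_id (a t)))).
have h2 : is_diff (a t) (b (x t)) (b (x t)).
 by apply: is_diff_linear; [exact: lb|exact: family1_bounded fb Ux].
by have e := congr1 (fun L : G -> F => L a') (is_diff_unique (is_diff_comp h (differentiableP db)) h2).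
Qed.

(** Moves the first vector into the base point, so that results on linear families serve for
    bilinear ones. *)
Lemma family2_uncurry E G1 G2 F (U : set E) (b : E -> G1 -> G2 -> F) : family2 U b ->
 family1 (U `*` [set: G1]) (fun (y : E * G1) v => b y.1 y.2 v).
Proof.
move=> [oU sb lb1 lb2]; split; [exact: openXT| |by move=> [x u] [/= Ux _]; exact: lb2].
move=> n; have oU' := openXT (openXT oU (G := G1)) (G := G2).
by apply: (Ck_comp3 oU' (sb n)); [move=> z [[]]|Ck_auto..].
Qed.

Lemma family2_fix E G1 G2 F (U : set E) (b : E -> G1 -> G2 -> F) v : family2 U b ->
 family1 U (fun y u => b y u v).
Proof.
move=> [oU sb lb1 lb2]; split=> //; last by move=> x Ux; exact: lb1.
move=> n; have oU' := openXT oU (G := G1).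
by apply: (Ck_comp3 oU' (sb n)); [move=> z []|Ck_auto..].
Qed.

(** Closes families under derivatives in the base point; the estimates then apply to the derivatives
    of metrics and of Christoffel symbols. *)
Lemma family1_diff E G F (U : set E) (b : E -> G -> F) : family1 U b ->
 family2 U (fun x v h => 'd (fun y => b y v) x h).
Proof.
move=> [oU sb lb]; split=> //; last 2 first.
- move=> x h Ux; apply: (diff_family_linear h oU Ux lb) => v.
 exact: (smooth_partial v sb Ux).1.
- by move=> x v Ux; exact: linearP.
move=> n; have oU' := openXT oU (G := (G * E)%type).
apply: (@Ck_congr _ _ _ _ _ (fun z : E * (G * E) =>
  tangent (fun z => b z.1 z.2) ((z.1, z.2.1), (z.2.2, 0)))) => //.
 by move=> z [Uz _]; rewrite (smooth_partial _ sb Uz).2.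
apply: (Ck_comp oU' _ _ (smooth_tangent sb n)
 (f := fun z : E * (G * E) => ((z.1, z.2.1), (z.2.2, 0)))); first by move=> z [].
by Ck_auto.
Qed.

Lemma family2_differentiable E G1 G2 F (U : set E) (b : E -> G1 -> G2 -> F) x u v :
 family2 U b -> U x -> differentiable (fun y => b y u v) x.
Proof.
move=> /(family2_fix v)[_ sb _] Ux.
exact: (@smooth_partial _ _ _ _ U (fun y u => b y u v) x u sb Ux).1.
Qed.

Lemma family1_differentiable E G F (U : set E) (b : E -> G -> F) x u :
 family1 U b -> U x -> differentiable (fun y => b y u) x.
Proof. by move=> [_ sb _] Ux; exact: (smooth_partial u sb Ux).1. Qed.

Lemma family2_smooth E G1 G2 F (U : set E) (b : E -> G1 -> G2 -> F) u v :
 family2 U b -> smooth_on U (fun y => b y u v).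
Proof.
move=> [oU sb _ _] n; by apply: (Ck_comp3 oU (sb n)); [|Ck_auto..].
Qed.

Lemma cder_family2 E G1 G2 F (U : set E) (b : E -> G1 -> G2 -> F)
  (x : R -> E) (a : R -> G1) (c : R -> G2) t x' a' c' :
 family2 U b -> U (x t) -> cder x t x' -> cder a t a' -> cder c t c' ->
 cder (fun s => b (x s) (a s) (c s)) t
  ('d (fun y => b y (a t) (c t)) (x t) x' + b (x t) a' (c t) + b (x t) (a t) c').
Proof.
move=> fb Ux dx da dc.
have f1 := family2_uncurry fb.
have /(_ (x t, a t)) df := family1_differentiable (c t) f1.
apply: (cder_eq (cder_family1 f1 _ (cder_pair dx da) dc)) => //=; congr (_ + _).
have Uxa : (U `*` [set: G1]) (x t, a t) by [].
apply: cder_unique (cder_family1 (family2_fix (c t) fb) Ux dx da).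
exact: (cder_comp (f := fun y : E * G1 => b y.1 y.2 (c t)) (df Uxa) (cder_pair dx da)).
Qed.

(** [bilinear_bound] for the uncurried family at [(x, 0)] covers small [u]; linearity in [u] does
    the rest, at the price of the factor [2 / r]. *)
Lemma family2_bound E G1 G2 F (U : set E) (b : E -> G1 -> G2 -> F) (x : E) :
 family2 U b -> U x ->
 exists r C : R, [/\ 0 < r, 0 < C, nball x r `<=` U &
  forall y z, nball x r y -> nball x r z -> forall u v,
  [/\ `|b y u v| <= C * `|u| * `|v|, `|b z u v - b y u v| <= C * `|z - y| * `|u| * `|v|,
   forall h, `|'d (fun y => b y u v) y h| <= C * `|h| * `|u| * `|v| &
   `|b z u v - b y u v - 'd (fun y => b y u v) y (z - y)| <= C * `|z - y| ^+ 2 * `|u| * `|v|]].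
Proof.
move=> fb Ux; have [oU sb lb1 lb2] := fb; have [oU' sb' lb'] := family2_uncurry fb.
have [r [C [r0 C0 rU hC]]] := bilinear_bound oU' (conj Ux I : (U `*` setT) (x, 0)) sb' lb'.
have rU' : nball x r `<=` U.
 move=> y hy; have [] // : (U `*` [set: G1]) (y, 0); apply: rU.
 by rewrite /nball /= -[_ - _]/(y - x, 0 - 0 : G1) norm_pair_lt hy subrr normr0.
have inb y u : nball x r y -> `|u| < r -> nball (x, 0 : G1) r (y, u).
 by move=> hy ur; rewrite /nball /= -[_ - _]/((y - x, u - 0)) norm_pair_lt subr0 hy.
have pn w : `|(w, 0 : G1) : E * G1| = `|w| by rewrite prod_normE normr0 max_l.
have part y u v h : U y ->
  'd (fun y => b y u v) y h = 'd (fun y : E * G1 => b y.1 y.2 v) (y, u) (h, 0).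
 move=> Uy; have [_ sb1 _] := family2_fix v fb.
 exact: (@smooth_partial _ _ _ _ U (fun y u => b y u v) y u sb1 Uy).2.
have dl y v h : U y -> linear (fun u => 'd (fun y => b y u v) y h).
 by move=> Uy; have [_ _ l _] := family1_diff (family2_fix v fb); exact: l.
have p : 0 < 2 * C / r by rewrite divr_gt0 // mulr_gt0.
exists r, (2 * C / r); split=> // y z hy hz u v; have Uy := rU' _ hy; have Uz := rU' _ hz.
have sc (f : G1 -> F) K : linear f -> (forall u, `|u| < r -> `|f u| <= C * K * `|v|) ->
  `|f u| <= 2 * C / r * K * `|u| * `|v|.
 move=> lf hf; have := scale_bound r0 (fun a u => lin_scale a u lf) hf u.
 by rewrite (_ : 2 * _ / r * `|u| = 2 * C / r * K * `|u| * `|v|) //; ring.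
have get w (wr : `|w| < r) := hC _ _ (inb y w hy wr) (inb z w hz wr) v.
have sub w : (z, w) - (y, w) = (z - y, 0) :> E * G1.
 by rewrite -[LHS]/(z - y, w - w) subrr.
split.
- have := sc (fun u => b y u v) 1; rewrite !mulr1; apply; first exact: lb1.
 by move=> w /get[].
- apply: (sc (fun u => b z u v - b y u v)) => [a u1 u2|w wr].
  by rewrite (lb1 z v Uz) (lb1 y v Uy); module R.
 by have [_ h _ _] := get w wr; rewrite sub pn in h.
- move=> h; apply: (sc (fun u => 'd (fun y => b y u v) y h)); first exact: dl.
 by move=> w wr; have [_ _ h1 _] := get w wr; rewrite part //; have := h1 (h, 0); rewrite pn.
- apply: (sc (fun u => b z u v - b y u v - 'd (fun y => b y u v) y (z - y))) => [a u1 u2|w wr].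
  rewrite (lb1 z v Uz) (lb1 y v Uy).
  have := dl y v (z - y) Uy a u1 u2; rewrite /= => ->; module R.
 by have [_ _ _ h] := get w wr; rewrite sub pn -part in h.
Qed.

Lemma family1_diff_lipschitz E G F (U : set E) (b : E -> G -> F) (x : E) :
 family1 U b -> U x ->
 exists r C : R, [/\ 0 < r, 0 < C, nball x r `<=` U &
  forall y z, nball x r y -> nball x r z -> forall v h,
  `|'d (fun y => b y v) z h - 'd (fun y => b y v) y h| <= C * `|z - y| * `|v| * `|h|].
Proof.
move=> fb Ux; have [r [C [r0 C0 rU hC]]] := family2_bound (family1_diff fb) Ux.
by exists r, C; split=> // y z hy hz v h; have [] := hC y z hy hz v h.
Qed.

Lemma family2_diff_lipschitz E G1 G2 F (U : set E) (b : E -> G1 -> G2 -> F) (x : E) :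
 family2 U b -> U x ->
 exists r C : R, [/\ 0 < r, 0 < C, nball x r `<=` U &
  forall y z, nball x r y -> nball x r z -> forall u v h,
  `|'d (fun y => b y u v) z h - 'd (fun y => b y u v) y h| <=
   C * `|z - y| * `|h| * `|u| * `|v|].
Proof.
move=> fb Ux; have [oU _ _ _] := fb.
have [r [C [r0 C0 rU hC]]] :=
 family1_diff_lipschitz (family2_uncurry fb) (conj Ux I : (U `*` setT) (x, 0)).
have inb y u : nball x r y -> `|u| < r -> nball (x, 0 : G1) r (y, u).
 by move=> hy ur; rewrite /nball /= -[_ - _]/((y - x, u - 0)) norm_pair_lt subr0 hy.
have rU' : nball x r `<=` U.
 move=> y hy; have [] // : (U `*` [set: G1]) (y, 0); apply: rU; apply: inb => //.
 by rewrite normr0.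
have pn w : `|(w, 0 : G1) : E * G1| = `|w| by rewrite prod_normE normr0 max_l.
have part y u v h : U y ->
  'd (fun y => b y u v) y h = 'd (fun y : E * G1 => b y.1 y.2 v) (y, u) (h, 0).
 move=> Uy; have [_ sb1 _] := family2_fix v fb.
 exact: (@smooth_partial _ _ _ _ U (fun y u => b y u v) y u sb1 Uy).2.
have dl y v h : U y -> linear (fun u => 'd (fun y => b y u v) y h).
 by move=> Uy; have [_ _ l _] := family1_diff (family2_fix v fb); exact: l.
have p : 0 < 2 * C / r by rewrite divr_gt0 // mulr_gt0.
exists r, (2 * C / r); split=> // y z hy hz u v h; have Uy := rU' _ hy; have Uz := rU' _ hz.
have := @scale_bound _ _ _ (fun u => 'd (fun y => b y u v) z h - 'd (fun y => b y u v) y h)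
 r (C * `|z - y| * `|v| * `|h|) r0 _ _ u.
rewrite (_ : 2 * _ / r * `|u| = 2 * C / r * `|z - y| * `|h| * `|u| * `|v|); last by ring.
apply=> [a w|w wr].
 rewrite (lin_scale a w (dl z v h Uz)) (lin_scale a w (dl y v h Uy)); module R.
have e : `|(z, w) - (y, w)| = `|z - y| by rewrite -[_ - _]/(z - y, w - w) subrr pn.
rewrite !part //; apply: (le_trans (hC _ _ (inb y w hy wr) (inb z w hz wr) v (h, 0))).
exact: (le_of_eq (f_equal2 (fun p q => C * p * `|v| * q) e (pn h))).
Qed.

End Families.

(** * Metrics and Killing fields in an open set *)
Section LocalMetric.
Context {R : realType} (H : hilbert R).

Definition local_metric (U : set H) (g : H -> H -> H -> R) : Prop :=
 [/\ family2 U (g : H -> H -> H -> R^o),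
  forall x u v, U x -> g x u v = g x v u &
  forall x, U x -> exists2 c : R, 0 < c & forall u, c * `|u| ^+ 2 <= g x u u].

(** The Koszul formula for an arbitrary metric on an open set; [christoffel] is its instance at
    [local_form], by conversion. *)
Definition christoffel_of (g : H -> H -> H -> R^o) (x u v : H) : H :=
 xget 0 [set z | forall w, 2%:R * g x z w =
  'd (fun y => g y v w) x u + 'd (fun y => g y u w) x v
  - 'd (fun y => g y u v) x w].

Definition dmetric (g : H -> H -> H -> R) (x h u v : H) : R :=
 'd (fun y => g y u v : R^o) x h.

Variables (U : set H) (g : H -> H -> H -> R).
Hypothesis gU : local_metric U g.

Let gR : H -> H -> H -> R^o := g.
Let fam : family2 U gR. Proof. by case: gU. Qed.
Let oU : open U. Proof. by case: fam. Qed.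

Lemma metric_sym x u v : U x -> g x u v = g x v u. Proof. by case: gU => _ h _; exact: h. Qed.

Lemma metric_linl x w : U x -> linear (fun v => g x v w : R^o).
Proof. by case: fam => _ _ h _ Ux; exact: h. Qed.

Lemma metric_linr x w : U x -> linear (fun v => g x w v : R^o).
Proof. by case: fam => _ _ _ h Ux; exact: h. Qed.

Lemma metricDl x u v w : U x -> g x (u + v) w = g x u w + g x v w.
Proof. by move=> Ux; exact: lin_add u v (metric_linl w Ux). Qed.
Lemma metricDr x u v w : U x -> g x w (u + v) = g x w u + g x w v.
Proof. by move=> Ux; exact: lin_add u v (metric_linr w Ux). Qed.
Lemma metricNl x v w : U x -> g x (- v) w = - g x v w.
Proof. by move=> Ux; exact: lin_opp v (metric_linl w Ux). Qed.
Lemma metricNr x v w : U x -> g x w (- v) = - g x w v.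
Proof. by move=> Ux; exact: lin_opp v (metric_linr w Ux). Qed.
Lemma metricZl x a v w : U x -> g x (a *: v) w = a * g x v w.
Proof. by move=> Ux; exact: lin_scale a v (metric_linl w Ux). Qed.

Lemma metric_inj x u v : U x -> (forall w, g x u w = g x v w) -> u = v.
Proof.
move=> Ux h; apply/eqP; rewrite -subr_eq0 -normr_eq0.
have [_ _ /(_ x Ux)[c c0 hc]] := gU; have := hc (u - v).
rewrite {1}metricDl // metricNl // h subrr pmulr_rle0 // => h1.
by rewrite -sqrf_eq0 eq_le h1 sqr_ge0.
Qed.

(** Coercivity at [x] persists nearby: within [c / (2 * C)] of [x] the metric changes by at most
    half of the constant [c]. *)
Lemma metric_bound x : U x -> exists r c C : R, [/\ 0 < r, 0 < c, 0 < C, nball x r `<=` U &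
 forall y, nball x r y -> forall u v,
  [/\ c * `|u| ^+ 2 <= g y u u & `|g y u v| <= C * `|u| * `|v|]].
Proof.
move=> Ux; have [r [C [r0 C0 rU hC]]] := family2_bound fam Ux.
have [_ _ /(_ x Ux)[c c0 hc]] := gU.
pose s := Num.min r (c / (2 * C)).
have s0 : 0 < s by rewrite lt_min r0 divr_gt0 // mulr_gt0.
have [sr sc] : s <= r /\ s <= c / (2 * C) by rewrite !ge_min !lexx orbT.
exists s, (c / 2), C; split=> //; first by rewrite divr_gt0.
 by move=> y hy; apply: rU; exact: lt_le_trans sr.
move=> y hy u v; have hy' : nball x r y by exact: lt_le_trans sr.
split; last by have [] := hC y y hy' hy' u v.
have [_ h _ _] := hC x y (nballxx x r0) hy' u u.
have hys : `|y - x| <= c / (2 * C) by apply: ltW; exact: lt_le_trans sc.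
have : C * `|y - x| * `|u| * `|u| <= c / 2 * `|u| ^+ 2.
 rewrite -[X in X <= _]mulrA; apply: ler_wpM2r; first exact: mulr_ge0.
 by rewrite mulrC -ler_pdivlMr //; apply: (le_trans hys); rewrite invfM mulrA.
have := hc u; move: h; rewrite ler_norml => /andP[h]; rewrite /gR in h; lra.
Qed.

Lemma metric_riesz x (ell : H -> R) (K : R) : U x ->
 (forall k u v, ell (k *: u + v) = k * ell u + ell v) ->
 (forall u, `|ell u| <= K * `|u|) -> exists z, forall w, g x z w = ell w.
Proof.
move=> Ux le bl; have [_ _ /(_ x Ux)[c c0 hc]] := gU.
have [r [c1 [C [r0 _ C0 _ hC]]]] := metric_bound Ux.
apply: (riesz (c := c) (C := C) (K := K)) => //.
- by move=> w; exact: metric_linl.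
- by move=> v w; exact: metric_sym.
- move=> u; have [_ h] := hC x (nballxx x r0) u u.
 by via (ler_norm _); rewrite mulrA.
Qed.

Let gop_ex x u : exists z, U x -> forall w, inner H z w = g x u w.
Proof.
have [Ux|nU] := pselect (U x); last by exists 0.
have [r [c1 [C [r0 _ C0 _ hC]]]] := metric_bound Ux.
have [||||||w|z hz] := @riesz _ H (inner H) (g x u) 1 1 (C * `|u|).
- exact: inner_linear.
- exact: innerC.
- exact: ltr01.
- by move=> w; rewrite inner_norm mul1r.
- by move=> w; rewrite inner_norm mul1r.
- exact: (metric_linr u Ux).
- by have [_ h] := hC x (nballxx x r0) u w.
by exists z.
Qed.

(** The operator of the metric at [x] relative to the fixed scalar product of [H]; [gop_inv] is its
    inverse. A vector defined through the metric is [gop_inv] applied to a vector defined through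
    [inner], to which [weak_smooth] applies. *)
Let gop x u := sval (cid (gop_ex x u)).
Let gopE x u w : U x -> inner H (gop x u) w = g x u w.
Proof. by move=> Ux; exact: (svalP (cid (gop_ex x u))). Qed.

Let gop_family : family1 U gop.
Proof.
split=> //.
 apply: (@weak_smooth _ _ _ _ (fun z w => gR z.1 z.2 w)); first exact: openXT.
  move=> n; have oU' := openXT (openXT oU (G := H)) (G := H).
  have [_ sb _ _] := fam.
  by apply: (Ck_comp3 oU' (sb n)); [move=> z [[]]|Ck_auto..].
 by move=> [x u] [/= Ux _] w; exact: gopE.
move=> x Ux a u v; apply: inner_inj => w.
rewrite (form_addl (@inner_linear R H)) (form_scalel (@inner_linear R H)) !gopE //.
by rewrite metricDl // metricZl.
Qed.

Let gop_inv_ex x k : exists z, U x -> forall w, g x z w = inner H k w.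
Proof.
have [Ux|nU] := pselect (U x); last by exists 0.
have [||z hz] := @metric_riesz x (inner H k) `|k| Ux.
- move=> a u v; rewrite (form_addr (@inner_linear R H) (@innerC R H)).
 by rewrite (form_scaler (@inner_linear R H) (@innerC R H)).
- by move=> u; exact: inner_le.
by exists z.
Qed.

Let gop_inv x k := sval (cid (gop_inv_ex x k)).
Let gop_invE x k w : U x -> g x (gop_inv x k) w = inner H k w.
Proof. by move=> Ux; exact: (svalP (cid (gop_inv_ex x k))). Qed.

Let gop_inv_smooth : smooth_on (U `*` setT) (fun z => gop_inv z.1 z.2).
Proof.
have [_ sb lb] := gop_family.
apply: (inverse_smooth oU sb lb) => [x v Ux|x k Ux|x Ux].
- by apply: (metric_inj Ux) => w; rewrite gop_invE // gopE.
- by apply: inner_inj => w; rewrite gopE // gop_invE.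
have [r [c [C [r0 c0 C0 rU hC]]]] := metric_bound Ux.
exists r, c^-1; split=> //; first by rewrite invr_gt0.
move=> y k hy Uy; rewrite -ler_pdivrMl ?invr_gt0 // invrK.
have [h _] := hC y hy (gop_inv y k) 0.
have [->|n0] := eqVneq (gop_inv y k) 0; first by rewrite normr0 mulr0.
have np : 0 < `|gop_inv y k| by rewrite normr_gt0.
rewrite -(ler_pM2r np) -mulrA; via h.
by rewrite gop_invE //; via (ler_norm _); exact: inner_le.
Qed.

Lemma dmetricDd x a h k u v : dmetric g x (a *: h + k) u v = a * dmetric g x h u v + dmetric g x k u v.
Proof. by rewrite /dmetric diff_add diff_scale. Qed.

Lemma dmetricDl x a h u v w : U x ->
 dmetric g x h (a *: u + v) w = a * dmetric g x h u w + dmetric g x h v w.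
Proof. by move=> Ux; have [_ _ l _] := family1_diff (family2_fix w fam); exact: l x h Ux a u v. Qed.

Lemma dmetric_sym x h u v : U x -> dmetric g x h u v = dmetric g x h v u.
Proof.
move=> Ux; have [_ e] := diff_near (f := fun y => gR y u v) (g := fun y => gR y v u) (x := x)
 (filterS (fun y Uy => metric_sym u v Uy) (open_near oU Ux)) (family2_differentiable _ _ fam Ux).
by have e' := congr1 (fun L : H -> R^o => L h) e; exact: esym e'.
Qed.

Lemma dmetricDr x a h u v w : U x ->
 dmetric g x h w (a *: u + v) = a * dmetric g x h w u + dmetric g x h w v.
Proof. by move=> Ux; rewrite !(dmetric_sym h w _ Ux) dmetricDl. Qed.

Lemma dmetric_bound x : U x -> exists C : R, 0 < C /\
 forall h u v, `|dmetric g x h u v| <= C * `|h| * `|u| * `|v|.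
Proof.
move=> Ux; have [r [C [r0 C0 rU hC]]] := family2_bound fam Ux; have x0 := nballxx x r0.
by exists C; split=> // h u v; have [_ _ h1 _] := hC x x x0 x0 u v; exact: h1.
Qed.

Let koszul x u v w : R :=
 2^-1 * (dmetric g x u v w + dmetric g x v u w - dmetric g x w u v).

Let koszul_ex x u v : U x -> exists z, forall w, g x z w = koszul x u v w.
Proof.
move=> Ux; have [C [C0 hC]] := dmetric_bound Ux.
apply: (@metric_riesz x (koszul x u v) (3 * C * `|u| * `|v|) Ux).
- by move=> k a b; rewrite /koszul !(dmetricDr _ _ _ _ _ Ux) dmetricDd; move: (dmetric g x) => D; ring.
- move=> w; have h1 := hC u v w; have h2 := hC v u w; have h3 := hC w u v.
 rewrite normrM ger0_norm // mulrC ler_pdivrMr //.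
 via (ler_normB _ _); have := ler_normD (dmetric g x u v w) (dmetric g x v u w).
 have : 0 <= C * `|u| * `|v| * `|w| by do 3! (apply: mulr_ge0 => //); exact: ltW.
 by lra.
Qed.

Local Notation Gam := (christoffel_of g).

Lemma christoffelE x u v w : U x -> 2 * g x (Gam x u v) w =
 dmetric g x u v w + dmetric g x v u w - dmetric g x w u v.
Proof.
move=> Ux; rewrite /christoffel_of; case: xgetP => [z _ hz|hn]; first exact: hz.
have [z hz] := koszul_ex u v Ux; exfalso; apply: (hn z) => w'.
apply: (etrans (congr1 (fun t => 2 * t) (hz w'))).
by rewrite mulrA mulfV ?mul1r.
Qed.

Lemma christoffel_unique x u v z : U x -> (forall w, 2 * g x z w =
 dmetric g x u v w + dmetric g x v u w - dmetric g x w u v) -> z = Gam x u v.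
Proof.
move=> Ux hz; apply: (metric_inj Ux) => w.
have := hz w; rewrite -(christoffelE u v w Ux) => h; apply: (mulfI _ h).
by [].
Qed.

Lemma christoffel_sym x u v : U x -> Gam x u v = Gam x v u.
Proof.
move=> Ux; apply: (christoffel_unique Ux) => w; rewrite (christoffelE _ _ _ Ux).
by rewrite (dmetric_sym w u v Ux) [X in X - _]addrC.
Qed.

Let christoffel_lin x v : U x -> linear (fun u => Gam x u v).
Proof.
move=> Ux a u1 u2; apply/esym/(christoffel_unique Ux) => w.
rewrite (metricDl _ _ _ Ux) (metricZl _ _ _ Ux).
rewrite !(dmetricDl _ _ _ _ _ Ux) dmetricDd.
move: (christoffelE u1 v w Ux) (christoffelE u2 v w Ux).
move: (dmetric g x) (Gam x) => D G.
move: (g x (G u1 v) w) (g x (G u2 v) w) => p q e1 e2.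
by rewrite mulrDr mulrCA e1 e2; ring.
Qed.

(** The Koszul form is represented by a vector [K] for the fixed scalar product, smooth by
    [weak_smooth]; then [gop_inv], smooth by [inverse_smooth], turns [K] into the Christoffel
    symbol. *)
Lemma christoffel_family : family2 U Gam.
Proof.
split; [exact: oU| |by move=> *; exact: christoffel_lin|]; last first.
 move=> x u Ux a v1 v2; rewrite !(christoffel_sym u _ Ux).
 exact: (christoffel_lin u Ux a v1 v2).
have [_ sb _ _] := fam.
have oU' : open (U `*` [set: H * H]) := openXT oU.
have kos_ex z : exists K, U z.1 -> forall w, inner H K w = koszul z.1 z.2.1 z.2.2 w.
 have [Ux|nU] := pselect (U z.1); last by exists 0.
 have [y hy] := koszul_ex z.2.1 z.2.2 Ux; exists (gop z.1 y) => _ w.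
 by rewrite gopE.
pose K z := sval (cid (kos_ex z)).
have KE z w : U z.1 -> inner H (K z) w = koszul z.1 z.2.1 z.2.2 w.
 by move=> Uz; exact: (svalP (cid (kos_ex z)) Uz w).
have sK : smooth_on (U `*` [set: H * H]) K.
 apply: (@weak_smooth _ _ _ _ (fun z w => koszul z.1 z.2.1 z.2.2 w)) => //; last first.
  by move=> z [Uz _] w; exact: KE.
 have oUU : open ((U `*` [set: H * H]) `*` [set: H]) by exact: openXT.
 have part (a b c : (H * (H * H)) * H -> H) :
   (forall n, Ck n (U `*` [set: H * H] `*` [set: H]) a) ->
   (forall n, Ck n (U `*` [set: H * H] `*` [set: H]) b) ->
   (forall n, Ck n (U `*` [set: H * H] `*` [set: H]) c) ->
   smooth_on ((U `*` [set: H * H]) `*` [set: H]) (fun z => dmetric g z.1.1 (c z) (a z) (b z)).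
  move=> ha hb hc n.
  apply: (@Ck_congr _ _ _ _ _ (fun z => tangent (fun z => gR z.1 z.2.1 z.2.2)
   ((z.1.1, (a z, b z)), (c z, 0))) _ oUU).
   move=> z [[Uz _] _].
   have [_ e] := is_diff_partial (B := fun z : H * (H * H) => gR z.1 z.2.1 z.2.2) (v := (a z, b z))
    (smooth_diff sb (conj Uz I : (U `*` setT) (z.1.1, (a z, b z)))).
   by have e' := congr1 (fun L : H -> R^o => L (c z)) e; exact: (esym e').
  apply: (Ck_comp oUU _ _ (smooth_tangent sb n)
   (f := fun z : (H * (H * H)) * H => ((z.1.1, (a z, b z)), (c z, 0)))).
   by move=> z [[Uz _] _].
  have := ha n; have := hb n; have := hc n => ? ? ?; by Ck_auto.
 move=> n; apply: (@Ck_scale _ n _ R^o) => //.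
 apply: (@Ck_sub_fun _ n _ R^o) => //; [apply: (@Ck_add _ n _ R^o) => //|];
  apply: part => m; by Ck_auto.
apply: (@smooth_congr _ _ _ _ (fun z => gop_inv z.1 (K z))) => //.
 move=> [x [u v]] [/= Ux _]; apply: (christoffel_unique Ux) => w.
 by rewrite gop_invE // (KE (x, (u, v)) w Ux) /koszul /= mulrA mulfV ?mul1r ?pnatr_eq0.
move=> n; apply: (Ck_comp2 oU' (gop_inv_smooth n)); [by move=> z []| |exact: sK].
by Ck_auto.
Qed.

End LocalMetric.

(** * Second derivatives of isometries and of Killing fields *)

Section IsometryIdentity.
Context {R : realType} (H H' : hilbert R).
Variables (U : set H) (g : H -> H -> H -> R) (U' : set H') (g' : H' -> H' -> H' -> R).
Hypotheses (gU : local_metric U g) (gU' : local_metric U' g').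

Definition local_isometry (V : set H) (F : H -> H') : Prop :=
 [/\ open V, smooth_on V F, V `<=` U, forall x, V x -> U' (F x) &
  forall x u v, V x -> g' (F x) ('d F x u) ('d F x v) = g x u v].

Lemma diff_smooth_family (V : set H) (F : H -> H') :
 open V -> smooth_on V F -> family1 V (fun x u => 'd F x u).
Proof.
by split=> [//||x Vx]; [exact: smooth_tangent|exact: linearP].
Qed.

(** An isometry preserves the Levi-Civita connection. The isometry equation is differentiated in
    three directions and combined as in the Koszul formula, which isolates the second derivative;
    surjectivity of the differential makes images of vectors enough to test against. The 1-jet of an
    isometry thus obeys a first-order system, the root of all rigidity below. *)
Lemma local_isometry_second_diff (V : set H) (F : H -> H') x u v :
 local_isometry V F -> V x -> (forall w, exists w', 'd F x w' = w) ->
 'd (fun y => 'd F y v) x u =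
 'd F x (christoffel_of g x u v) - christoffel_of g' (F x) ('d F x u) ('d F x v).
Proof.
move=> [oV sF VU FU iF] Vx surj; have Ux := VU _ Vx; have Ux' := FU _ Vx.
have [fam _ _] := gU; have [fam' _ _] := gU'.
pose D2 a b := 'd (fun y => 'd F y b) x a.
have D2s a b : D2 a b = D2 b a by exact: diff_sym a b oV sF Vx.
have dg w a b : dmetric g' (F x) ('d F x w) ('d F x a) ('d F x b)
  + g' (F x) (D2 w a) ('d F x b) + g' (F x) ('d F x a) (D2 w b) = dmetric g x w a b.
 have line : cder (fun s => x + s *: w) 0 w by exact: cder_line.
 have e0 : x + 0 *: w = x by rewrite scale0r addr0.
 have dF0 : cder (fun s => F (x + s *: w)) 0 ('d F x w).
  by rewrite -[in 'd F x w]e0; apply: (cder_comp (f := F) _ line); rewrite e0; exact: smooth_diff sF Vx.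
 have dDF k : cder (fun s => 'd F (x + s *: w) k) 0 (D2 w k).
  rewrite /D2 -[in 'd _ x w]e0; apply: (cder_comp _ line).
  by rewrite e0; exact: family1_differentiable (diff_smooth_family oV sF) Vx.
 have h1 : cder (fun s => g' (F (x + s *: w)) ('d F (x + s *: w) a) ('d F (x + s *: w) b)) 0
   (dmetric g' (F x) ('d F x w) ('d F x a) ('d F x b)
  + g' (F x) (D2 w a) ('d F x b) + g' (F x) ('d F x a) (D2 w b)).
  have := cder_family2 (t := 0) fam' _ dF0 (dDF a) (dDF b).
  by rewrite !e0; apply.
 have h2 : cder (fun s => g (x + s *: w) a b) 0 (dmetric g x w a b).
  have := cder_comp _ line; rewrite !e0; apply.
  exact: family2_differentiable fam Ux.
 apply: (cder_unique h1); apply: cder_near h2.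
 have : nbhs (0 : R) (fun s => V (x + s *: w)).
  have cl := cder_continuous line; rewrite /prop_for /continuous_at e0 in cl.
  by apply: (cl V); apply: open_near.
 by apply: filterS => s Vs; rewrite iF.
suff h : D2 u v = 'd F x (christoffel_of g x u v) -
  christoffel_of g' (F x) ('d F x u) ('d F x v) by exact: h.
clearbody D2; have sub_move (a b c : H') : a = b + c -> b = a - c by move=> ->; rewrite addrK.
apply: sub_move.
apply: (metric_inj gU' Ux') => w'; have [w <-] := surj w'.
rewrite iF // (metricDl gU' _ _ _ Ux').
move: (dg v u w) (dg u v w); have := dg w u v.
have := christoffelE gU u v w Ux.
have := christoffelE gU' ('d F x u) ('d F x v) ('d F x w) Ux'.
rewrite (D2s v u) (D2s w u) (D2s w v).
move: (metric_sym gU' ('d F x v) (D2 u w) Ux') (metric_sym gU' ('d F x u) (D2 v w) Ux').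
move: (dmetric g' (F x)) (dmetric g x) (christoffel_of g' (F x)) (christoffel_of g x) => G1 G2 G3 G4.
move: (g x (G4 u v) w) (D2 u v) (D2 u w) (D2 v w) => a b c d.
move: ('d F x u) ('d F x v) ('d F x w) => p q s; move: (g' (F x)) => B.
by lra.
Qed.

End IsometryIdentity.

Section KillingLocal.
Context {R : realType} (H : hilbert R).
Variables (U : set H) (g : H -> H -> H -> R).
Hypothesis gU : local_metric U g.

Local Notation Gam := (christoffel_of g).
Let fam : family2 U (g : H -> H -> H -> R^o). Proof. by case: gU. Qed.

(** The equation says that the Lie derivative of [g] along [W] vanishes, in coordinates. *)
Definition killing_on (V : set H) (W : H -> H) : Prop :=
 [/\ open V, smooth_on V W, V `<=` U &
  forall x u v, V x -> dmetric g x (W x) u v + g x ('d W x u) v + g x u ('d W x v) = 0].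

Definition local_bracket (X Y : H -> H) (x : H) : H := 'd Y x (X x) - 'd X x (Y x).

Definition ddmetric (x h k u v : H) : R := 'd (fun y => dmetric g y k u v : R^o) x h.

Lemma dmetric_differentiable x k u v : U x -> differentiable (fun y => dmetric g y k u v : R^o) x.
Proof. exact: family2_differentiable u k (family1_diff (family2_fix v fam)). Qed.

Lemma ddmetric_sym x h k u v : U x -> ddmetric x h k u v = ddmetric x k h u v.
Proof.
move=> Ux; have [oU _ _ _] := fam.
exact: diff_sym h k oU (family2_smooth u v fam) Ux.
Qed.

Lemma cder_line0 (V : set H) (x w : H) : open V -> V x ->
 [/\ cder (fun s => x + s *: w) 0 w, x + 0 *: w = x &
  nbhs (0 : R) (fun s => V (x + s *: w))].
Proof.
move=> oV Vx; have line := cder_line x w 0; have e0 : x + 0 *: w = x by rewrite scale0r addr0.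
split=> //; have cl := cder_continuous line; rewrite /prop_for /continuous_at e0 in cl.
by apply/(cl V)/open_near.
Qed.

Lemma killing_diff (V : set H) W x k u v : killing_on V W -> V x ->
 ddmetric x k (W x) u v + dmetric g x ('d W x k) u v
 + (dmetric g x k ('d W x u) v + g x ('d (fun y => 'd W y u) x k) v)
 + (dmetric g x k u ('d W x v) + g x u ('d (fun y => 'd W y v) x k)) = 0.
Proof.
move=> [oV sW VU hW] Vx; have Ux := VU _ Vx.
have [line e0 nV] := cder_line0 k oV Vx.
have dW : cder (fun s => W (x + s *: k)) 0 ('d W x k).
 by rewrite -[in 'd W x k]e0; apply: (cder_comp (f := W) _ line); rewrite e0; exact: smooth_diff sW Vx.
have dDW w : cder (fun s => 'd W (x + s *: k) w) 0 ('d (fun y => 'd W y w) x k).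
 rewrite -[in 'd _ x k]e0; apply: (cder_comp _ line).
 by rewrite e0; exact: family1_differentiable (diff_smooth_family oV sW) Vx.
have fdg := family1_diff (family2_fix v fam).
have h1 : cder (fun s => dmetric g (x + s *: k) (W (x + s *: k)) u v) 0
  (ddmetric x k (W x) u v + dmetric g x ('d W x k) u v).
 have := cder_family2 (t := 0) fdg _ line (cder_cst u 0) dW.
 rewrite !e0 => /(_ Ux) h; apply: (cder_eq h); congr (_ + _).
 have [_ _ l _] := fdg.
 exact: (etrans (congr1 (fun t => _ + t) (lin_zero (l x (W x) Ux))) (addr0 _)).
have h2 : cder (fun s => g (x + s *: k) ('d W (x + s *: k) u) v) 0
  (dmetric g x k ('d W x u) v + g x ('d (fun y => 'd W y u) x k) v).
 have := cder_family2 (t := 0) fam _ line (dDW u) (cder_cst v 0).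
 by rewrite !e0 => /(_ Ux) h; apply: (cder_eq h); rewrite (lin_zero (metric_linr gU _ Ux)) addr0.
have h3 : cder (fun s => g (x + s *: k) u ('d W (x + s *: k) v)) 0
  (dmetric g x k u ('d W x v) + g x u ('d (fun y => 'd W y v) x k)).
 have := cder_family2 (t := 0) fam _ line (cder_cst u 0) (dDW v).
 by rewrite !e0 => /(_ Ux) h; apply: (cder_eq h); rewrite (lin_zero (metric_linl gU _ Ux)) addr0.
apply: (@cder_unique _ R^o _ _ _ _ (cderD (cderD h1 h2) h3)).
apply: (cder_near _ (cder_cst (0) 0)); apply: filterS nV => s Vs.
by rewrite hW.
Qed.

End KillingLocal.

Section KillingAlgebra.
Context {R : realType} (H : hilbert R).

(** The scalar part of [killing_second_diff], with the geometric terms abstracted to variables.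
    Permuting the directions as in the Koszul formula leaves a single second derivative. *)
Lemma killing_second_diff_algebra u v w (D1 : H -> H -> H -> R) (B : H -> H -> R) (d1 d2 d3 f1 f2 f3 : R)
  w0 A0 Au Av Aw G0 G1 G2 G3 a b c a' b' c' :
 a' = a -> b' = b -> c' = c -> f1 = d1 -> f2 = d2 -> f3 = d3 -> B v b = B b v -> B u c = B c u ->
 D1 w u Av = D1 w Av u -> D1 u v Aw = D1 u Aw v -> D1 v u Aw = D1 v Aw u ->
 2 * (D1 w0 G0 w + B G3 w) = d1 + d2 - d3 ->
 2 * B G1 w = D1 Au v w + D1 v Au w - D1 w Au v ->
 2 * B G2 w = D1 u Av w + D1 Av u w - D1 w u Av ->
 2 * B G0 Aw = D1 u v Aw + D1 v u Aw - D1 Aw u v ->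
 D1 w0 G0 w + B A0 w + B G0 Aw = 0 ->
 f1 + D1 Au v w + (D1 u Av w + B a w) + (D1 u v Aw + B v b) = 0 ->
 f2 + D1 Av u w + (D1 v Au w + B a' w) + (D1 v u Aw + B u c) = 0 ->
 f3 + D1 Aw u v + (D1 w Au v + B b' v) + (D1 w u Av + B u c') = 0 ->
 B a w = B A0 w - B G1 w - B G2 w - B G3 w.
Proof.
move=> -> -> -> -> -> -> h1 h2 h3 h4 h5; rewrite h1 h2 h3 h4 h5 {h1 h2 h3 h4 h5}.
by lin.
Qed.

Lemma bracket_killing_algebra u v (D : H -> H -> H -> R) (B : H -> H -> R) d1 d2
  x0 y0 p1 p2 p3 p4 q1 q2 q3 q4 r1 r2 r3 r4 r5 r6 : d1 = d2 ->
 d1 + D r6 u v + (D x0 r3 v + B p1 v) + (D x0 u r4 + B u p2) = 0 ->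
 d2 + D r5 u v + (D y0 r1 v + B p3 v) + (D y0 u r2 + B u p4) = 0 ->
 D x0 r3 v + B q1 v + B r3 r2 = 0 -> D x0 u r4 + B r1 r4 + B u q2 = 0 ->
 D y0 r1 v + B q3 v + B r1 r4 = 0 -> D y0 u r2 + B r3 r2 + B u q4 = 0 ->
 D r6 u v - D r5 u v + (B p1 v + B q3 v - (B p3 v + B q1 v))
  + (B u p2 + B u q4 - (B u p4 + B u q2)) = 0.
Proof. by lin. Qed.

End KillingAlgebra.

Section KillingIdentities.
Context {R : realType} (H : hilbert R).
Variables (U : set H) (g : H -> H -> H -> R).
Hypothesis gU : local_metric U g.

Local Notation Gam := (christoffel_of g).
Let fam : family2 U (g : H -> H -> H -> R^o). Proof. by case: gU. Qed.

Lemma christoffel_diff x h u v w : U x ->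
 2 * (dmetric g x h (Gam x u v) w + g x ('d (fun y => Gam y u v) x h) w) =
 ddmetric g x h u v w + ddmetric g x h v u w - ddmetric g x h w u v.
Proof.
move=> Ux; have [oU _ _ _] := fam.
have [line e0 nU] := cder_line0 h oU Ux.
have dG : cder (fun s => Gam (x + s *: h) u v) 0 ('d (fun y => Gam y u v) x h).
 rewrite -[in 'd _ x h]e0; apply: (cder_comp _ line).
 by rewrite e0; exact: family2_differentiable (christoffel_family gU) Ux.
have h1 : cder (fun s => g (x + s *: h) (Gam (x + s *: h) u v) w) 0
  (dmetric g x h (Gam x u v) w + g x ('d (fun y => Gam y u v) x h) w).
 have := cder_family2 (t := 0) fam _ line dG (cder_cst w 0).
 rewrite !e0 => /(_ Ux) h1; apply: (cder_eq h1).
 exact: (etrans (congr1 (fun t => _ + t) (lin_zero (metric_linr gU _ Ux))) (addr0 _)).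
have dd k a b : cder (fun s => dmetric g (x + s *: h) k a b) 0 (ddmetric g x h k a b).
 rewrite /ddmetric -[in 'd _ x h]e0; apply: (cder_comp _ line).
 by rewrite e0; exact: (dmetric_differentiable gU).
apply: (@cder_unique _ R^o _ _ _ _ (cderZ 2 h1)); apply: cder_near (cderB (cderD (dd u v w) (dd v u w)) (dd w u v)).
by apply: filterS nU => s Us; exact: esym (christoffelE gU u v w Us).
Qed.

(** The linearization at the identity of [local_isometry_second_diff]; it makes a Killing field
    depend only on its 1-jet at a nearby point. *)
Lemma killing_second_diff (V : set H) W x u v : killing_on U g V W -> V x ->
 'd (fun y => 'd W y v) x u = 'd W x (Gam x u v) - Gam x ('d W x u) v
  - Gam x u ('d W x v) - 'd (fun y => Gam y u v) x (W x).
Proof.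
move=> kW Vx; have [oV sW VU hW] := kW; have Ux := VU _ Vx.
pose D2 a b := 'd (fun y => 'd W y b) x a.
have D2s a b : D2 a b = D2 b a by exact: diff_sym a b oV sW Vx.
have E k a b : ddmetric g x k (W x) a b + dmetric g x ('d W x k) a b
 + (dmetric g x k ('d W x a) b + g x (D2 k a) b)
 + (dmetric g x k a ('d W x b) + g x a (D2 k b)) = 0 by exact: (killing_diff gU _ _ _ kW Vx).
suff h : D2 u v = 'd W x (Gam x u v) - Gam x ('d W x u) v
  - Gam x u ('d W x v) - 'd (fun y => Gam y u v) x (W x) by exact: h.
clearbody D2; apply: (metric_inj gU Ux) => w.
have lin4 a b c d : g x (a - b - c - d) w = g x a w - g x b w - g x c w - g x d w.
 by rewrite !(metricDl gU _ _ _ Ux) !(metricNl gU _ _ Ux).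
apply: (etrans _ (esym (lin4 _ _ _ _))).
have s3 a b c := dmetric_sym gU a b c Ux.
have s4 a b c := ddmetric_sym gU (W x) a b c Ux.
exact: killing_second_diff_algebra H u v w (dmetric g x) (g x) _ _ _ _ _ _ (W x) _ _ _ _ _ _ _ _ _ _ _ _ _ _
 (D2s v u) (D2s w u) (D2s w v) (esym (s4 u v w)) (esym (s4 v u w)) (esym (s4 w u v)) (metric_sym gU v (D2 u w) Ux) (metric_sym gU u (D2 v w) Ux) (s3 _ _ _) (s3 _ _ _) (s3 _ _ _)
 (christoffel_diff (W x) u v w Ux) (christoffelE gU ('d W x u) v w Ux) (christoffelE gU u ('d W x v) w Ux) (christoffelE gU u v ('d W x w) Ux) (hW x (Gam x u v) w Vx) (E u v w) (E v u w) (E w u v).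
Qed.

Lemma bracket_smooth (V : set H) X Y : open V ->
 smooth_on V X -> smooth_on V Y -> smooth_on V (local_bracket X Y).
Proof.
move=> oV sX sY n; apply: Ck_sub_fun => //.
 apply: (Ck_comp oV _ _ (smooth_tangent sY n) (f := fun x => (x, X x))) => //.
 by have := sX n; Ck_auto.
apply: (Ck_comp oV _ _ (smooth_tangent sX n) (f := fun x => (x, Y x))) => //.
by Ck_auto.
Qed.

Lemma bracket_diff (V : set H) X Y x k : open V ->
 smooth_on V X -> smooth_on V Y -> V x ->
 'd (local_bracket X Y) x k = 'd (fun y => 'd Y y (X x)) x k + 'd Y x ('d X x k)
  - ('d (fun y => 'd X y (Y x)) x k + 'd X x ('d Y x k)).
Proof.
move=> oV sX sY Vx; have [line e0 nV] := cder_line0 k oV Vx.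
have dW (W : H -> H) : smooth_on V W -> cder (fun s => W (x + s *: k)) 0 ('d W x k).
 move=> sW; rewrite -[in 'd W x k]e0; apply: (cder_comp _ line).
 by rewrite e0; exact: smooth_diff sW Vx.
have h1 (W Z : H -> H) : smooth_on V W -> smooth_on V Z ->
  cder (fun s => 'd W (x + s *: k) (Z (x + s *: k))) 0
   ('d (fun y => 'd W y (Z x)) x k + 'd W x ('d Z x k)).
 move=> sW sZ; have := cder_family1 (t := 0) (diff_smooth_family oV sW) _ line (dW Z sZ).
 by rewrite !e0; apply.
exact: cder_unique (dW _ (bracket_smooth oV sX sY)) (cderB (h1 Y X sY sX) (h1 X Y sX sY)).
Qed.

(** Each Killing equation is differentiated along the other field. In the difference, the second
    derivatives of the metric cancel by symmetry, and the mixed terms cancel by the Killing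
    equations at displaced arguments. *)
Lemma bracket_killing (V : set H) X Y :
 killing_on U g V X -> killing_on U g V Y -> killing_on U g V (local_bracket X Y).
Proof.
move=> kX kY; have [oV sX VU hX] := kX; have [_ sY _ hY] := kY.
split; [exact: oV|exact: bracket_smooth|exact: VU|].
move=> x u v Vx; have Ux := VU _ Vx.
have bd k : 'd (local_bracket X Y) x k = 'd (fun y => 'd Y y k) x (X x) + 'd Y x ('d X x k)
  - ('d (fun y => 'd X y k) x (Y x) + 'd X x ('d Y x k)).
 have e1 : 'd (fun y => 'd Y y (X x)) x k = 'd (fun y => 'd Y y k) x (X x) by exact: diff_sym _ _ oV sY Vx.
 have e2 : 'd (fun y => 'd X y (Y x)) x k = 'd (fun y => 'd X y k) x (Y x) by exact: diff_sym _ _ oV sX Vx.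
 exact: (etrans (bracket_diff k oV sX sY Vx) (f_equal2 (fun a b : H => a + 'd Y x ('d X x k) - (b + 'd X x ('d Y x k))) e1 e2)).
have dz : dmetric g x (local_bracket X Y x) u v =
  dmetric g x ('d Y x (X x)) u v - dmetric g x ('d X x (Y x)) u v by exact: diff_sub.
have linl (a b c d w : H) : g x (a + b - (c + d)) w = g x a w + g x b w - (g x c w + g x d w).
 by rewrite !(metricDl gU _ _ _ Ux) (metricNl gU _ _ Ux) (metricDl gU _ _ _ Ux).
have linr (a b c d w : H) : g x w (a + b - (c + d)) = g x w a + g x w b - (g x w c + g x w d).
 by rewrite !(metricDr gU _ _ _ Ux) (metricNr gU _ _ Ux) (metricDr gU _ _ _ Ux).
apply: (etrans (f_equal3 (fun a b c => a + b + c) dz (congr1 (fun z => g x z v) (bd u))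
 (congr1 (fun z => g x u z) (bd v)))).
apply: (etrans (f_equal2 (fun b c => _ + b + c) (linl _ _ _ _ _) (linr _ _ _ _ _))) => {bd linl linr dz}.
exact: bracket_killing_algebra H u v (dmetric g x) (g x) _ _ (X x) (Y x) _ _ _ _ _ _ _ _ _ _ _ _ _ _ (ddmetric_sym gU (X x) (Y x) u v Ux) (killing_diff gU (X x) u v kY Vx) (killing_diff gU (Y x) u v kX Vx) (hX x ('d Y x u) v Vx) (hX x u ('d Y x v) Vx) (hY x ('d X x u) v Vx) (hY x u ('d X x v) Vx).
Qed.

End KillingIdentities.

Section JetControl.
Context {R : realType}.
Implicit Types E F : normedModType R.

(** Compactness of the unit interval, in the form of a local bound that can be enlarged; the proof
    is by real induction. *)
Lemma segment_bounded (Q : R -> R -> Prop) :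
 (forall t B B', B <= B' -> Q t B -> Q t B') ->
 (forall t : R, 0 <= t <= 1 -> exists2 d : R, 0 < d &
   exists B, forall s : R, 0 <= s <= 1 -> `|s - t| < d -> Q s B) ->
 exists B, forall t : R, 0 <= t <= 1 -> Q t B.
Proof.
move=> mono loc.
suff h (b : R) : 0 <= b <= 1 -> exists B, forall s : R, 0 <= s <= b -> Q s B.
 by apply: h; rewrite ler01 lexx.
have ext (s0 t d : R) : 0 < d -> (exists B, forall s : R, 0 <= s <= s0 -> Q s B) ->
  (exists B, forall s : R, 0 <= s <= 1 -> `|s - t| < d -> Q s B) -> t - d < s0 ->
  forall t' : R, t' < t + d -> t' <= 1 -> exists B, forall s : R, 0 <= s <= t' -> Q s B.
 move=> d0 [B hB] [B' hB'] hs0 t' ht' h1; exists (Num.max B B') => s hs.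
 have [h|h] := leP s s0.
  by apply: (mono _ B); [rewrite le_max lexx|apply: hB; lin].
 apply: (mono _ B'); first by rewrite le_max lexx orbT.
 by apply: hB'; [lin|rewrite ltr_norml; apply/andP; split; lin].
move: b; apply: real_induction => [|t ht Pt|t ht Pt].
- have [d d0 [B hB]] := loc 0 ltac:(lin); exists B => s hs.
 by apply: hB; [lin|rewrite (_ : s - 0 = 0) ?normr0 //; lin].
- have [d d0 hd] := loc t ltac:(lin).
 exists (Num.min d (1 - t)); first by rewrite lt_min d0; lin.
 move=> s /andP[ts]; rewrite -ltrBlDl lt_min => /andP[h1 h2].
 by apply: (ext t t d d0 (Pt t ltac:(lin)) hd); lin.
- have [d d0 hd] := loc t ltac:(lin).
 pose s0 := Num.max 0 (t - d / 2).
 have [h1 h2 h3] : [/\ 0 <= s0, t - d / 2 <= s0 & s0 < t].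
  by rewrite /s0 !le_max !lexx orbT; split => //; rewrite gt_max; apply/andP; split; lin.
 by apply: (ext s0 t d d0 (Pt s0 ltac:(lin)) hd); lin.
Qed.

Lemma unit_ball_bound E F (L : E -> F) M : (forall a v, L (a *: v) = a *: L v) ->
 (forall v, `|v| <= 1 -> `|L v| <= M) -> forall v, `|L v| <= M * `|v|.
Proof.
move=> hL hM v; have [->|v0] := eqVneq v 0.
 by have := hL 0 0; rewrite !scale0r => ->; rewrite !normr0 mulr0.
have nv : 0 < `|v| by rewrite normr_gt0.
have := hM (`|v|^-1 *: v); rewrite normrZ normfV normr_id mulVf ?gt_eqF // => /(_ (lexx _)).
by rewrite hL normrZ normfV normr_id ler_pdivrMl // mulrC.
Qed.

(** [family_contraction] for the curve [W], at index [None], together with the curves [A t k] for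
    all [k] in the unit ball. A value and an operator along a segment are thus controlled by one
    constant, as a 1-jet requires. *)
Lemma jet_control E F (W W' : R -> F) (A A' : R -> E -> F) (eta K : R) :
 (forall t : R, 0 <= t <= 1 -> cder W t (W' t)) ->
 (forall (t : R) k, 0 <= t <= 1 -> cder (A^~ k) t (A' t k)) ->
 (forall (t a : R) k, 0 <= t <= 1 -> A t (a *: k) = a *: A t k) ->
 (exists B, forall t : R, 0 <= t <= 1 -> `|W t| <= B /\ forall k, `|A t k| <= B * `|k|) ->
 (forall M t : R, 0 <= t <= 1 -> 0 <= M -> `|W t| <= M -> (forall k, `|A t k| <= M * `|k|) ->
   `|W' t| <= M / 2 + K /\ forall k, `|A' t k| <= (M / 2 + K) * `|k|) ->
 `|W 0| <= eta -> (forall k, `|A 0 k| <= eta * `|k|) ->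
 forall t : R, 0 <= t <= 1 ->
  `|W t| <= 2 * (eta + K) /\ forall k, `|A t k| <= 2 * (eta + K) * `|k|.
Proof.
move=> dW dA hA [B hB] hM hW0 hA0.
have [B0 K0] : 0 <= B /\ 0 <= B / 2 + K.
 have t0 : 0 <= (0 : R) <= 1 by lin.
 have [h1 h2] := hB 0 t0; have B0 : 0 <= B by apply: le_trans h1.
 by split=> //; have [h3 _] := hM B 0 t0 B0 h1 h2; apply: le_trans h3.
pose D (i : option {k : E | `|k| <= 1}) t := if i is Some k then A t (sval k) else W t.
pose D' (i : option {k : E | `|k| <= 1}) t := if i is Some k then A' t (sval k) else W' t.
have key i t : 0 <= t <= 1 -> `|D i t| <= 2 * (eta + K).
 move: i t; apply: (@family_contraction _ F _ D D').
 - by move=> [k|] t ht; [exact: dA|exact: dW].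
 - exists B => -[[k hk]|] t ht; have [h1 h2] := hB t ht => //=.
  by apply: (le_trans (h2 k)); rewrite ler_piMr.
 - move=> M hMi i t ht.
  have M0 : 0 <= M by apply: le_trans (hMi None t ht).
  have [||h1 h2] := hM M t ht M0; first exact: (hMi None t ht).
   apply: unit_ball_bound; first by move=> a v; exact: hA.
   by move=> v hv; exact: (hMi (Some (exist _ v hv)) t ht).
  case: i => [[k hk]|] //; via (h2 k); rewrite ler_piMr //.
  by apply: le_trans h1.
 - by move=> [[k hk]|] //=; apply: (le_trans (hA0 k)); rewrite ler_piMr //; apply: le_trans hW0.
move=> t ht; split; first exact: (key None t ht).
apply: unit_ball_bound; first by move=> a v; exact: hA.
by move=> v hv; exact: key (Some (exist _ v hv)) t ht.
Qed.

End JetControl.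

Section KillingControl.
Context {R : realType} (H : hilbert R).
Variables (U : set H) (g : H -> H -> H -> R).
Hypothesis gU : local_metric U g.

Local Notation Gam := (christoffel_of g).

Let norm_sub4_le (a b c d : H) : `|a - b - c - d| <= `|a| + `|b| + `|c| + `|d|.
Proof. by move: (ler_normB (a - b - c) d) (ler_normB (a - b) c) (ler_normB a b); lra. Qed.

Let killing_bound_algebra (C M h k n1 n2 n3 n4 m1 m2 m3 m4 : R) :
 0 < C -> 0 <= M -> 0 <= h -> 0 <= k -> h * (8 * C + 2) <= 1 ->
 m1 <= M * n4 -> m2 <= C * n1 * k -> m3 <= C * h * n2 -> m4 <= C * n3 * h * k ->
 n4 <= C * h * k -> n1 <= M * h -> n2 <= M * k -> n3 <= M ->
 m1 + m2 + m3 + m4 <= M / 2 * k.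
Proof.
move=> C0 M0 hn nk hr b1 b2 b3 b4 b5 b6 b7 hW.
have c1 : C * h * k * M <= M / 8 * k.
 have e : C * h <= 1 / 8 by lra.
 by have := ler_wpM2r (mulr_ge0 nk M0) e; lra.
have d1 : M * n4 <= C * h * k * M by have := ler_wpM2l M0 b5; lra.
have d2 : C * n1 * k <= C * h * k * M.
 by have := ler_wpM2l (mulr_ge0 (ltW C0) nk) b6; lra.
have d3 : C * h * n2 <= C * h * k * M.
 by have := ler_wpM2l (mulr_ge0 (ltW C0) hn) b7; lra.
have d4 : C * n3 * h * k <= C * h * k * M.
 by have := ler_wpM2l (mulr_ge0 (mulr_ge0 (ltW C0) hn) nk) hW; lra.
lra.
Qed.

Lemma cder_along (F : normedModType R) (V : set H) (W : H -> F) (x h : H) t :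
 smooth_on V W -> V (x + t *: h) ->
 cder (fun s => W (x + s *: h)) t ('d W (x + t *: h) h).
Proof.
move=> sW Vt; apply: (cder_comp _ (cder_line x h t)); exact: smooth_diff sW Vt.
Qed.

Lemma cder_along_diff (F : normedModType R) (V : set H) (W : H -> F) (x h k : H) t :
 open V -> smooth_on V W -> V (x + t *: h) ->
 cder (fun s => 'd W (x + s *: h) k) t ('d (fun y => 'd W y k) (x + t *: h) h).
Proof.
move=> oV sW Vt; apply: (cder_comp _ (cder_line x h t)).
by apply: (@smooth_partial _ _ _ _ V (fun y u => 'd W y u) _ k (smooth_tangent sW) Vt).1.
Qed.

Lemma diff_segment_bounded (F : normedModType R) (V : set H) (W : H -> F) (x h : H) :
 open V -> smooth_on V W -> (forall t : R, 0 <= t <= 1 -> V (x + t *: h)) ->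
 exists B, forall t : R, 0 <= t <= 1 ->
  `|W (x + t *: h)| <= B /\ forall k, `|'d W (x + t *: h) k| <= B * `|k|.
Proof.
move=> oV sW segV.
apply: (@segment_bounded _ (fun t B => `|W (x + t *: h)| <= B /\
  forall k, `|'d W (x + t *: h) k| <= B * `|k|)).
 move=> t B B' BB [h1 h2]; split; first exact: le_trans BB.
 by move=> k; apply: (le_trans (h2 k)); apply: ler_wpM2r.
move=> t ht; have Vt := segV t ht.
have [r [C [r0 C0 rV hC]]] := @bilinear_bound _ _ _ _ V (fun y v => 'd W y v) _ oV Vt
 (smooth_tangent sW) (fun y _ => linearP _).
have [r1 [C1 [r10 C10 r1V hC1]]] := smooth_lipschitz oV sW Vt.
have [d d0 hd] : exists2 d : R, 0 < d & forall s, `|s - t| < d ->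
  nball (x + t *: h) (Num.min r r1) (x + s *: h).
 exists (Num.min r r1 / (`|h| + 1)); first by rewrite divr_gt0 ?lt_min ?r0 //; have := normr_ge0 h; lra.
 move=> s; rewrite ltr_pdivlMr; last by have := normr_ge0 h; lra.
 move=> hs; rewrite /nball/= (_ : _ - _ = (s - t) *: h); last by module R.
 by rewrite normrZ; apply: le_lt_trans hs; apply: ler_wpM2l => //; lra.
exists d => //; exists (C + (C1 * r1 + `|W (x + t *: h)|)) => s hs /hd.
rewrite /nball/= lt_min => /andP[b1 b2].
have p1 : 0 <= C1 * r1 + `|W (x + t *: h)| by rewrite addr_ge0 // mulr_ge0 // ltW.
split.
 have l1 := hC1 _ _ ((nballxx (x + t *: h)) _ r10) b2.
 have l2 := ler_normD (W (x + s *: h) - W (x + t *: h)) (W (x + t *: h)).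
 rewrite subrK in l2.
 have l3 : C1 * `|x + s *: h - (x + t *: h)| <= C1 * r1 by rewrite ler_pM2l // ltW.
 by lra.
move=> k; have [h1 _ _ _] := hC _ _ b1 b1 k; via h1.
by apply: ler_wpM2r => //; lra.
Qed.

(** Along a segment from [x0] the 1-jet solves a linear system by [killing_second_diff], so
    [jet_control] applies without forcing term. The radius does not depend on the field. *)
Lemma killing_bound x0 : U x0 -> exists2 r, 0 < r & nball x0 r `<=` U /\
 forall V W eta, killing_on U g V W -> nball x0 r `<=` V ->
 `|W x0| <= eta -> (forall k, `|'d W x0 k| <= eta * `|k|) ->
 forall x, nball x0 r x -> `|W x| <= 2 * eta /\ forall k, `|'d W x k| <= 2 * eta * `|k|.
Proof.
move=> Ux; have [r1 [C [r10 C0 r1U hC]]] := family2_bound (christoffel_family gU) Ux.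
(* With [|h| * (8 * C + 2) <= 1], each of the four terms of the second derivative is at most [M / 8]
   per unit vector, and [|h| <= 1 / 2] handles the derivative of the value. *)
pose r := Num.min r1 (8 * C + 2)^-1.
have r0 : 0 < r by rewrite lt_min invr_gt0; lra.
have rr1 : nball x0 r `<=` nball x0 r1.
 by move=> y hy; apply: (lt_le_trans hy); rewrite /r ge_min lexx.
exists r => //; split; first by move=> y /rr1/r1U.
move=> V W eta kW rV hW0 hA0 x xr; have [oV sW VU _] := kW.
pose h := x - x0.
have seg (t : R) : 0 <= t <= 1 -> nball x0 r (x0 + t *: h).
 by move=> ht; apply: nball_segment => //; exact: nballxx.
have hr : `|h| * (8 * C + 2) <= 1.
 rewrite -ler_pdivlMr; last by lra.
 by rewrite mul1r ltW //; apply: (lt_le_trans xr); rewrite /r ge_min lexx orbT.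
have := @jet_control _ H H (fun t => W (x0 + t *: h)) (fun t => 'd W (x0 + t *: h) h)
 (fun t k => 'd W (x0 + t *: h) k) (fun t k => 'd (fun y => 'd W y k) (x0 + t *: h) h) eta 0.
rewrite !addr0 scale0r addr0 => /(_ _ _ _ _ _ hW0 hA0)-/(_ _ _ _ _ _ 1).
rewrite scale1r {2 4}/h [x0 + (x - x0)]addrC subrK; apply; last by rewrite ler01 lexx.
- by move=> t ht; apply: cder_along sW _; exact/rV/seg.
- by move=> t k ht; apply: cder_along_diff oV sW _; exact/rV/seg.
- by move=> t a k _; exact: diff_scale.
- by apply: (diff_segment_bounded oV sW) => t ht; exact/rV/seg.
move=> M t ht M0 hW hA; rewrite addr0.
split; first by apply: (le_trans (hA h)); nra.
move=> k; have sg := seg t ht; have sg1 := rr1 _ sg.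
rewrite (killing_second_diff gU h k kW (rV _ sg)).
have bG u v : `|Gam (x0 + t *: h) u v| <= C * `|u| * `|v| by have [] := hC _ _ sg1 sg1 u v.
have bdG u v w : `|'d (fun y => Gam y u v) (x0 + t *: h) w| <= C * `|w| * `|u| * `|v|.
 by have [_ _ b _] := hC _ _ sg1 sg1 u v; exact: b.
via (norm_sub4_le _ _ _ _).
exact: killing_bound_algebra C0 M0 (normr_ge0 h) (normr_ge0 k) hr (hA (Gam (x0 + t *: h) h k)) (bG ('d W (x0 + t *: h) h) k) (bG h ('d W (x0 + t *: h) k)) (bdG h k (W (x0 + t *: h))) (bG h k) (hA h) (hA k) hW.
Qed.

Let triple_algebra (s p m n z a b c d w : H) : w = z + p - (m + n) -> z = 0 -> p = - a ->
 m = b - a - c - d -> d = 0 -> n = - b -> s = - c -> w = - s.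
Proof. by move=> -> -> -> -> -> -> ->; module R. Qed.

(** This is the inclusion of [[[p, p], p]] in [p]. The bracket of two fields parallel at [x0]
    vanishes there by symmetry of the Christoffel symbols, and its bracket with a third one is again
    parallel by the second-order identity. *)
Lemma triple_bracket_parallel V X Y Z x0 : V x0 ->
 killing_on U g V X -> killing_on U g V Y -> killing_on U g V Z ->
 (forall k, 'd X x0 k = - Gam x0 k (X x0)) -> (forall k, 'd Y x0 k = - Gam x0 k (Y x0)) ->
 (forall k, 'd Z x0 k = - Gam x0 k (Z x0)) ->
 let W := local_bracket (local_bracket X Y) Z in
 forall k, 'd W x0 k = - Gam x0 k (W x0).
Proof.
move=> Vx kX kY kZ pX pY pZ W k; have [oV sX VU _] := kX; have [_ sY _ _] := kY.
have [_ sZ _ _] := kZ; have Ux := VU _ Vx.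
pose A := local_bracket X Y.
have A0 : A x0 = 0.
 have e : 'd Y x0 (X x0) - 'd X x0 (Y x0) = - Gam x0 (X x0) (Y x0) - - Gam x0 (Y x0) (X x0).
  exact: (f_equal2 (fun a b : H => a - b) (pY _) (pX _)).
 apply: (etrans e); rewrite (christoffel_sym gU (X x0) (Y x0) Ux); exact: subrr.
have eW : W x0 = - 'd A x0 (Z x0).
 
 have e : 'd Z x0 (A x0) = 0 by rewrite A0 diff_zero.
 exact: (etrans (congr1 (fun z => z - 'd A x0 (Z x0)) e) (sub0r _)).
have dG0 : 'd (fun y => Gam y k (Z x0)) x0 (A x0) = 0 by rewrite A0 diff_zero.
have dZ0 : 'd (fun y => 'd Z y (A x0)) x0 k = 0.
 have e : 'd (fun y => 'd Z y (A x0)) x0 k = 'd (fun y => 'd Z y k) x0 (A x0).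
  exact: (diff_sym _ _ oV sZ Vx).
 by apply: (etrans e); rewrite A0 diff_zero.
have e3 : 'd A x0 ('d Z x0 k) = - 'd A x0 (Gam x0 k (Z x0)).
 exact: (etrans (congr1 (fun z => 'd A x0 z) (pZ k)) (diff_opp _ _ _)).
have e4 : Gam x0 k (W x0) = - Gam x0 k ('d A x0 (Z x0)).
 have [_ _ _ l] := christoffel_family gU.
 exact: (etrans (congr1 (Gam x0 k) eW) (lin_opp _ (l x0 k Ux))).
exact: triple_algebra (bracket_diff k oV (bracket_smooth oV sX sY : smooth_on V A) sZ Vx) dZ0 (pZ _) (killing_second_diff gU k (Z x0) (bracket_killing gU kX kY : killing_on U g V A) Vx) dG0 e3 e4.
Qed.

End KillingControl.

(** * Charts and isometries *)
Section LocalIsometry.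
Context {R : realType}.

Lemma local_isometry_sub (H H' : hilbert R) (U : set H) g (U' : set H') g' (V V' : set H) F :
 open V' -> V' `<=` V -> local_isometry U g U' g' V F -> local_isometry U g U' g' V' F.
Proof.
move=> oV' V'V [oV sF VU FU iF]; split=> //.
- exact: smooth_sub sF.
- by move=> x /V'V/VU.
- by move=> x /V'V/FU.
- by move=> x u v /V'V; exact: iF.
Qed.

Lemma local_isometry_congr (H H' : hilbert R) (U : set H) g (U' : set H') g' (V : set H) F G :
 (forall x, V x -> F x = G x) -> local_isometry U g U' g' V F -> local_isometry U g U' g' V G.
Proof.
move=> FG [oV sF VU FU iF]; split; [exact: oV| |exact: VU| |].
- exact: smooth_congr sF.
- by move=> x Vx; rewrite -FG //; exact: FU.
move=> x u v Vx; have n : \forall y \near x, F y = G y.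
 by apply: filterS (open_near oV Vx) => y; exact: FG.
have [_ e] := diff_near n (smooth_diff sF Vx).
rewrite -FG //; apply: etrans (iF x u v Vx).
exact: (f_equal2 (fun a b => g' (F x) a b) (congr1 (fun L : H -> H' => L u) e)
 (congr1 (fun L : H -> H' => L v) e)).
Qed.

Lemma local_isometry_comp (H H' H'' : hilbert R) (U : set H) g (U' : set H') g' (U'' : set H'') g''
  (V : set H) (V' : set H') F G :
 local_isometry U g U' g' V F -> local_isometry U' g' U'' g'' V' G ->
 (forall x, V x -> V' (F x)) -> local_isometry U g U'' g'' V (fun x => G (F x)).
Proof.
move=> [oV sF VU FU iF] [oV' sG V'U' GU iG] FV; split=> //.
- by move=> n; apply: (Ck_comp oV FV (sF n) (sG n)).
- by move=> x /FV/GU.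
move=> x u v Vx.
have e w : 'd (fun x => G (F x)) x w = 'd G (F x) ('d F x w).
 exact: (congr1 (fun L : H -> H'' => L w) (diff_comp (smooth_diff sF Vx) (smooth_diff sG (FV x Vx)))).
apply: etrans (iF x u v Vx); apply: etrans (iG (F x) _ _ (FV x Vx)).
exact: (f_equal2 (fun a b => g'' (G (F x)) a b) (e u) (e v)).
Qed.

Lemma continuous_near (T S : topologicalType) (h : T -> S) x (A : set S) :
 {for x, continuous h} -> nbhs (h x) A -> \forall y \near x, A (h y).
Proof. by move=> ch /ch. Qed.

Lemma continuous_open_near (T S : topologicalType) (h : T -> S) x (A : set S) :
 {for x, continuous h} -> open A -> A (h x) -> \forall y \near x, A (h y).
Proof. by move=> ch oA Ax; exact/(continuous_near ch)/open_nbhs_nbhs. Qed.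

End LocalIsometry.

Section Charts.
Context {R : realType} {H : hilbert R} (M : manifold H).

Lemma chart_invP a x : chart_image a x -> chart_dom M a (chart_inv M a x) /\
 chart M a (chart_inv M a x) = x.
Proof. by move=> [q Dq <-]; rewrite chartK. Qed.

Lemma chart_imageP a q : chart_dom M a q -> chart_image a (chart M a q).
Proof. by exists q. Qed.

Lemma chart_inv_near a x (A : set M) : chart_image a x -> open A -> A (chart_inv M a x) ->
 \forall y \near x, A (chart_inv M a y).
Proof. by move=> Ox; exact/continuous_open_near/chart_inv_continuous. Qed.

Lemma chart_near a q (A : set H) : chart_dom M a q -> open A -> A (chart M a q) ->
 \forall r \near q, A (chart M a r).
Proof. by move=> Dq; exact/continuous_open_near/chart_continuous. Qed.

Lemma chart_image_sub (A : set M) a : A `<=` chart_dom M a ->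
 chart M a @` A = chart_image a `&` chart_inv M a @^-1` A.
Proof.
move=> AD; apply/seteqP; split=> [x [q Aq <-]|x [Ox Ax]].
 by split; [exact/chart_imageP/AD|rewrite /= chartK //; exact: AD].
by exists (chart_inv M a x) => //; have [] := chart_invP Ox.
Qed.

Lemma chart_image_open_sub (A : set M) a : open A -> A `<=` chart_dom M a ->
 open (chart M a @` A).
Proof.
move=> oA AD; rewrite chart_image_sub // openE => x [Ox Ax].
apply: filterI; first exact: (open_near (@chart_image_open _ _ M a) Ox).
exact: chart_inv_near.
Qed.

Definition overlap a b : set H := chart M a @` (chart_dom M a `&` chart_dom M b).

Lemma overlap_open a b : open (overlap a b).
Proof.
by apply: chart_image_open_sub => [|q []//]; apply: openI; exact: chart_dom_open.
Qed.

Definition transition a b (x : H) : H := chart M b (chart_inv M a x).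

Lemma transition_smooth a b : smooth_on (overlap a b) (transition a b).
Proof. exact: chart_transition_smooth M a b. Qed.

Lemma overlapP a b q : chart_dom M a q -> chart_dom M b q -> overlap a b (chart M a q).
Proof. by exists q. Qed.

Lemma transition_chart a b q : chart_dom M a q -> transition a b (chart M a q) = chart M b q.
Proof. by move=> Dq; rewrite /transition chartK. Qed.

Lemma transition_diff a b q : chart_dom M a q -> chart_dom M b q ->
 differentiable (transition a b) (chart M a q).
Proof. by move=> Da Db; exact/(smooth_diff (@transition_smooth a b))/overlapP. Qed.

Lemma transportE a b q v : transport a b q v = 'd (transition a b) (chart M a q) v.
Proof. by []. Qed.

Lemma transport_comp a b c q v : chart_dom M a q -> chart_dom M b q -> chart_dom M c q ->
 transport b c q (transport a b q v) = transport a c q v.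
Proof.
move=> Da Db Dc; have dab := transition_diff Da Db.
have dbc : differentiable (transition b c) (transition a b (chart M a q)).
 by rewrite transition_chart //; exact: transition_diff.
have n : \forall y \near chart M a q, (transition b c \o transition a b) y = transition a c y.
 apply: filterS (open_near (overlap_open a b) (overlapP Da Db)) => x [r [Dar Dbr] <-].
 by rewrite /= transition_chart // /transition !chartK.
have [_ e] := diff_near n (differentiable_comp dab dbc).
have e1 := congr1 (fun L => L v) (diff_comp dab dbc).
have e2 := congr1 (fun L => L v) e.
have e3 : 'd (transition b c) (chart M b q) (transport a b q v) =
  'd (transition b c) (transition a b (chart M a q)) (transport a b q v).
 by rewrite transition_chart.
exact: etrans e3 (etrans (esym e1) (esym e2)).
Qed.

Lemma transport_id a q v : chart_dom M a q -> transport a a q v = v.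
Proof.
move=> Da.
have n : \forall y \near chart M a q, y = transition a a y.
 apply: filterS (open_near (@chart_image_open _ _ M a) (chart_imageP Da)) => x Ox.
 by rewrite /transition; have [] := chart_invP Ox.
have d : is_diff (chart M a q) (@id H) (@id H).
 by apply: is_diff_linear => //; exists 1 => h; rewrite mul1r.
have [_ e] := is_diff_near n d; exact: (congr1 (fun L => L v) e).
Qed.

Lemma transportK a b q v : chart_dom M a q -> chart_dom M b q ->
 transport b a q (transport a b q v) = v.
Proof. by move=> Da Db; rewrite transport_comp // transport_id. Qed.

End Charts.

Section Representations.
Context {R : realType} {H H' : hilbert R} {M : manifold H} {M' : manifold H'}.

Definition rep a b (f : M -> M') (x : H) : H' := chart M' b (f (chart_inv M a x)).

Lemma rep_change a b c d (f : M -> M') q : {for q, continuous f} ->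
 chart_dom M a q -> chart_dom M c q -> chart_dom M' b (f q) -> chart_dom M' d (f q) ->
 \forall x \near chart M a q, [/\ overlap a c x, overlap b d (rep a b f x),
  rep a d f x = transition b d (rep a b f x) & rep a d f x = rep c d f (transition a c x)].
Proof.
move=> cf Da Dc Db Dd.
have n : \forall r \near q, [/\ chart_dom M a r, chart_dom M c r, chart_dom M' b (f r) & chart_dom M' d (f r)].
 near=> r; split; near: r.
 - exact: open_nbhs_nbhs (conj (@chart_dom_open _ _ M a) Da).
 - exact: open_nbhs_nbhs (conj (@chart_dom_open _ _ M c) Dc).
 - exact: (continuous_open_near cf (@chart_dom_open _ _ M' b) Db).
 - exact: (continuous_open_near cf (@chart_dom_open _ _ M' d) Dd).
have n2 : \forall x \near chart M a q, chart_image a x.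
 exact: (open_near (@chart_image_open _ _ M a)).
have n3 : \forall x \near chart M a q, [/\ chart_dom M a (chart_inv M a x),
  chart_dom M c (chart_inv M a x), chart_dom M' b (f (chart_inv M a x)) & chart_dom M' d (f (chart_inv M a x))].
 apply: (continuous_near (chart_inv_continuous (chart_imageP Da)) (A := fun r => [/\ chart_dom M a r,
   chart_dom M c r, chart_dom M' b (f r) & chart_dom M' d (f r)])).
 by rewrite chartK.
apply: filterS2 n2 n3 => x Ox [h1 h2 h3 h4]; have [_ ex] := chart_invP Ox.
split.
- by rewrite -ex; exact: overlapP.
- exact: overlapP.
- by rewrite /rep transition_chart.
- by rewrite /rep chartK.
Unshelve. all: by end_near.
Qed.

(** A change of charts multiplies the differential by [transport] on both sides; differentiability
    in one pair of charts is enough. *)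
Lemma rep_diff_change a b c d (f : M -> M') q : {for q, continuous f} ->
 chart_dom M a q -> chart_dom M c q -> chart_dom M' b (f q) -> chart_dom M' d (f q) ->
 differentiable (rep c b f) (chart M c q) ->
 differentiable (rep a d f) (chart M a q) /\
 forall v, 'd (rep a d f) (chart M a q) v =
  transport b d (f q) ('d (rep c b f) (chart M c q) (transport a c q v)).
Proof.
move=> cf Da Dc Db Dd df; have dac := transition_diff Da Dc.
have e0 : transition a c (chart M a q) = chart M c q by rewrite transition_chart.
have df' : differentiable (rep c b f) (transition a c (chart M a q)) by rewrite e0.
have e1 : rep c b f (transition a c (chart M a q)) = chart M' b (f q) by rewrite e0 /rep chartK.
have dbd : differentiable (transition b d) ((rep c b f \o transition a c) (chart M a q)).
 by rewrite /= e1; exact: transition_diff.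
have n : \forall x \near chart M a q,
  (transition b d \o (rep c b f \o transition a c)) x = rep a d f x.
 apply: filterS2 (rep_change cf Da Dc Db Dd) (rep_change cf Da Dc Db Db) => x [_ _ h _] [_ _ _ h'].
 by rewrite /= -h' h.
have dcb := differentiable_comp dac df'.
have [dr er] := diff_near n (differentiable_comp dcb dbd); split=> // v.
have e2 := congr1 (fun L : H -> H' => L v) er.
have e3 := congr1 (fun L : H -> H' => L v) (diff_comp dcb dbd).
have e4 := congr1 (fun L : H -> H' => L v) (diff_comp dac df').
apply/(etrans e2)/(etrans e3); rewrite transportE.
have -> : 'd (transition b d) ((rep c b f \o transition a c) (chart M a q)) =
  'd (transition b d) (chart M' b (f q)) :> (H' -> H') by rewrite /= e1.
congr ('d _ _ _); apply: (etrans e4) => /=; by rewrite e0.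
Qed.

End Representations.

Section LocalForm.
Context {R : realType} {H : hilbert R} (M : riemannian H).

Lemma transport_linear (a b q : M) : linear (transport a b q).
Proof. exact: linearP. Qed.

Lemma local_form_metric a : local_metric (chart_image a) (local_form (metric M) a).
Proof.
have oO := @chart_image_open _ _ M a.
split.
- split=> //.
 + move=> n.
  have oO' : open (chart_image a `*` [set: H * H]) by exact: openXT.
  apply: (Ck_comp oO' _ _ (@metric_smooth _ _ M a n) (f := fun z : H * (H * H) => (z.1, z.2.1, z.2.2))) => //.
  by Ck_auto.
 + move=> x v Ox k u1 u2; rewrite /local_form; set q := chart_inv M a x.
  have e : transport a q q (k *: u1 + u2) = k *: transport a q q u1 + transport a q q u2.
   exact: transport_linear.
  apply: (etrans (congr1 (fun z => metric M q z (transport a q q v)) e)).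
  exact: (dot_linear (metric M q)).
 + move=> x v Ox k u1 u2; rewrite /local_form; set q := chart_inv M a x.
  have e : transport a q q (k *: u1 + u2) = k *: transport a q q u1 + transport a q q u2.
   exact: transport_linear.
  apply: (etrans (congr1 (fun z => metric M q (transport a q q v) z) e)).
  rewrite !(dot_sym (metric M q) (transport a q q v)).
  exact: (dot_linear (metric M q)).
- by move=> x u v Ox; rewrite /local_form; exact: dot_sym.
move=> x Ox; set q := chart_inv M a x; have [Dq _] := chart_invP Ox.
have [c c0 hc] := metric_strong q.
(* [transport q a q] inverts [transport a q q], so a bound on it carries coercivity from the chart
   around [q] to the chart around [a]. *)
have [C C0 hC] := diff_bounded (transition_diff (chart_dom_center q) Dq).
exists (c / C ^+ 2); first by rewrite divr_gt0 // exprn_gt0.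
move=> u; apply: le_trans (hc _); rewrite -/q -mulrA ler_pM2l // ler_pdivrMl ?exprn_gt0 //.
have hu := hC (transport a q q u); rewrite -transportE transportK // in hu; last exact: chart_dom_center.
have CT : 0 <= C * `|transport a q q u| by rewrite mulr_ge0 // ltW.
by rewrite -[leRHS]exprMn lerXn2r ?nnegrE.
Qed.

Lemma christoffel_local (a : M) : christoffel a = christoffel_of (local_form (metric M) a).
Proof. by []. Qed.

Lemma local_form_chart a q u v : chart_dom M a q ->
 local_form (metric M) a (chart M a q) u v =
 metric M q (transport a q q u) (transport a q q v).
Proof. by move=> Dq; rewrite /local_form chartK. Qed.

(** All coordinate expressions come from one metric; as a consequence isometries pass between charts
    by composition. *)
Lemma transition_isometry a b :
 local_isometry (chart_image a) (local_form (metric M) a) (chart_image b) (local_form (metric M) b)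
  (overlap a b) (transition a b).
Proof.
split; first exact: overlap_open.
- exact: transition_smooth.
- by move=> x [q [Da Db] <-]; exact: chart_imageP.
- by move=> x [q [Da Db] <-]; rewrite transition_chart //; exact: chart_imageP.
move=> x u v [q [Da Db] <-]; rewrite transition_chart // !local_form_chart //.
have Dq := chart_dom_center q.
exact: (f_equal2 (fun z w => metric M q z w) (transport_comp u Da Db Dq) (transport_comp v Da Db Dq)).
Qed.

End LocalForm.

Section IsometricAt.
Context {R : realType}.

Definition rep_isometry (H H' : hilbert R) (M : riemannian H) (M' : riemannian H')
  (a : M) (b : M') (f : M -> M') (V : set H) : Prop :=
 local_isometry (chart_image a) (local_form (metric M) a)
  (chart_image b) (local_form (metric M') b) V (rep a b f).

(** A pointwise notion, in all charts at once, that is stable under composition without carrying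
    open sets along; [isometric_between] converts it back to [isometry_between]. *)
Definition isometric_at (H H' : hilbert R) (M : riemannian H) (M' : riemannian H')
  (f : M -> M') (q : M) : Prop :=
 {for q, continuous f} /\ forall a b, chart_dom M a q -> chart_dom M' b (f q) ->
  exists2 r, 0 < r & rep_isometry a b f (nball (chart M a q) r).

Context {H H' : hilbert R} {M : riemannian H} {M' : riemannian H'}.

(** One pair of charts suffices, because transition maps are themselves local isometries. *)
Lemma isometric_at_one (f : M -> M') (q : M) c (b : M') (V : set H) :
 {for q, continuous f} -> chart_dom M c q -> chart_dom M' b (f q) ->
 V (chart M c q) -> rep_isometry c b f V -> isometric_at f q.
Proof.
move=> cf Dc Db Vq iV; split=> // a d Da Dd; have [oV _ _ _ _] := iV.
have n3 : \forall x \near chart M a q, V (transition a c x).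
 apply: continuous_open_near => //; last by rewrite transition_chart.
 by apply/differentiable_continuous; exact: transition_diff.
have [r r0 hr] : exists2 r, 0 < r & forall x, nball (chart M a q) r x ->
  [/\ overlap a c x, V (transition a c x), overlap b d (rep c b f (transition a c x)) &
   transition b d (rep c b f (transition a c x)) = rep a d f x].
 have /nbhs_nball : \forall x \near chart M a q, [/\ overlap a c x, V (transition a c x),
   overlap b d (rep c b f (transition a c x)) &
   transition b d (rep c b f (transition a c x)) = rep a d f x].
  by apply: filterS3 (rep_change cf Da Dc Db Dd) (rep_change cf Da Dc Dd Db) n3 => x [h1 h2 h3 h4] [_ _ _ h5] h6; rewrite -h5.
 by [].
exists r => //; apply: (local_isometry_congr (F := fun x => transition b d (rep c b f (transition a c x)))).
 by move=> x /hr[].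
have i1 : local_isometry (chart_image a) (local_form (metric M) a) (chart_image c)
  (local_form (metric M) c) (nball (chart M a q) r) (transition a c).
 by apply: (local_isometry_sub _ _ (transition_isometry a c)); [exact: nball_open|move=> x /hr[]].
have i2 := local_isometry_comp i1 iV (fun x hx => let: And4 _ h _ _ := hr x hx in h).
exact: local_isometry_comp i2 (transition_isometry b d) (fun x hx => let: And4 _ _ h _ := hr x hx in h).
Qed.

Lemma isometric_at_near (f g : M -> M') q : (\forall r \near q, f r = g r) ->
 isometric_at f q -> isometric_at g q.
Proof.
move=> fg [cf iF]; have Dq := chart_dom_center q.
have [r r0 iV] := iF q (f q) Dq (chart_dom_center _).
have n : \forall x \near chart M q q, f (chart_inv M q x) = g (chart_inv M q x).
 by apply: (continuous_near (chart_inv_continuous (chart_imageP Dq)) (A := fun r => f r = g r)); rewrite chartK.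
have [r' r'0 hr'] := (nbhs_nball _ _).1 n.
have m1 : Num.min r r' <= r by rewrite ge_min lexx.
have m2 : Num.min r r' <= r' by rewrite ge_min lexx orbT.
apply: (@isometric_at_one g q q (f q) (nball (chart M q q) (Num.min r r'))) => //.
- exact: near_continuous_at cf.
- by rewrite -(nbhs_singleton fg); exact: chart_dom_center.
- by apply: nballxx; rewrite lt_min r0.
apply: (local_isometry_congr (F := rep q (f q) f)).
 by move=> x hx; rewrite /rep hr' //; exact: lt_le_trans m2.
by apply: (local_isometry_sub (nball_open _ _) _ iV) => x hx; exact: lt_le_trans m1.
Qed.

Lemma isometry_at (U : set M) (V : set M') f f' : isometry_between U V f f' ->
 forall q, U q -> isometric_at f q.
Proof.
move=> [[oU oV] [hU hV] [[cf sf] _] mf] q Uq.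
have Dq := chart_dom_center q; have Df := chart_dom_center (f q).
pose A := U `&` chart_dom M q `&` f @^-1` chart_dom M' (f q).
have AD : A `<=` chart_dom M q by move=> r [[]].
have oA : open A.
 rewrite openE => r [[Ur Dr] Fr]; apply: filterI; first apply: filterI.
 - exact: open_nbhs_nbhs.
 - exact: (open_nbhs_nbhs (conj (@chart_dom_open _ _ M q) Dr)).
 - exact: (continuous_open_near (cf r Ur) (@chart_dom_open _ _ M' (f q)) Fr).
apply: (@isometric_at_one f q q (f q) (chart M q @` A)) => //; first exact: cf.
 by exists q.
split; [exact: chart_image_open_sub|exact: sf| | |].
- by move=> x [r [[_ Dr] _] <-]; exact: chart_imageP.
- by move=> x [r [[_ Dr] Fr] <-]; rewrite /rep chartK //; exact: chart_imageP.
move=> x u v [r [[Ur Dr] Fr] <-].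
have e0 : rep q (f q) f (chart M q r) = chart M' (f q) (f r) by rewrite /rep chartK.
have Dr' := chart_dom_center r; have Dfr := chart_dom_center (f r).
have dr : differentiable (rep r (f r) f) (chart M r r).
 by apply: (smooth_diff (sf r (f r))); exists r.
have [_ dq] := rep_diff_change (cf r Ur) Dr Dr' Dfr Fr dr.
rewrite e0 !local_form_chart // -mf // !dq.
by congr (metric M' (f r) _ _); rewrite transportK.
Qed.

End IsometricAt.

Section IsometricAtTheory.
Context {R : realType}.

Lemma isometric_at_comp (H H' H'' : hilbert R) (M : riemannian H) (M' : riemannian H')
  (M'' : riemannian H'') (f : M -> M') (g : M' -> M'') q :
 isometric_at f q -> isometric_at g (f q) -> isometric_at (g \o f) q.
Proof.
move=> [cf hf] [cg hg]; have Dq := chart_dom_center q; have Df := chart_dom_center (f q).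
have Dg := chart_dom_center (g (f q)).
have [r r0 iF] := hf _ _ Dq Df; have [s s0 iG] := hg _ _ Df Dg.
have cgf : {for q, continuous (g \o f)} by apply: continuous_comp.
have [oV sF _ _ _] := iF.
have xr := nballxx (chart M q q) r0.
have n1 : \forall x \near chart M q q, nball (chart M' (f q) (f q)) s (rep q (f q) f x).
 apply: continuous_open_near; first exact: smooth_cont sF xr.
  exact: nball_open.
 by rewrite /rep chartK //; exact: nballxx.
have [d d0 hd] : exists2 d, 0 < d & nball (chart M q q) d `<=` [set x |
  [/\ nball (chart M q q) r x, nball (chart M' (f q) (f q)) s (rep q (f q) f x),
   overlap q q x & chart_dom M' (f q) (f (chart_inv M q x))]].
 apply/nbhs_nball.
 have n3 : \forall x \near chart M q q, chart_dom M' (f q) (f (chart_inv M q x)).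
  apply: (continuous_near (chart_inv_continuous (chart_imageP Dq)) (A := fun r => chart_dom M' (f q) (f r))).
  rewrite chartK //; exact: (continuous_open_near cf (@chart_dom_open _ _ M' (f q)) Df).
 by apply: filterS3 n1 (rep_change cf Dq Dq Df Df) (filterI n3 (open_near oV xr)) => x h1 [h2 _ _ _] [h3 h4].
apply: (@isometric_at_one _ _ _ _ _ _ q q (g (f q)) (nball (chart M q q) d)) => //.
 exact: nballxx.
apply: (local_isometry_congr (F := fun x => rep (f q) (g (f q)) g (rep q (f q) f x))).
 by move=> x /hd[_ _ _ h]; rewrite /rep /= chartK.
apply: (local_isometry_comp _ iG); last by move=> x /hd[].
by apply: (local_isometry_sub (nball_open _ _) _ iF) => x /hd[].
Qed.

Lemma isometric_at_id (H : hilbert R) (M : riemannian H) q : isometric_at (@id M) q.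
Proof.
have Dq := chart_dom_center q.
apply: (@isometric_at_one _ _ _ _ _ id q q q (chart_image q)) => //; first exact: chart_imageP.
apply: (local_isometry_congr (F := transition q q)) => //.
apply: (local_isometry_sub _ _ (transition_isometry q q)); first exact: chart_image_open.
by move=> x [r Dr <-]; exact: overlapP.
Qed.

Lemma isometric_between (H H' : hilbert R) (M : riemannian H) (M' : riemannian H')
  (U : set M) (V : set M') f f' : open U -> open V ->
 (forall q, U q -> V (f q) /\ f' (f q) = q) -> (forall q, V q -> U (f' q) /\ f (f' q) = q) ->
 (forall q, U q -> isometric_at f q) -> (forall q, V q -> isometric_at f' q) ->
 isometry_between U V f f'.
Proof.
move=> oU oV hU hV iU iV.
have smooth (K K' : hilbert R) (N : riemannian K) (N' : riemannian K') (A : set N) (h : N -> N') :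
  (forall q, A q -> isometric_at h q) -> smooth_map_on A h.
 move=> hA; split; first by move=> q /hA[].
 move=> a b; apply: smooth_union => x [q [[Aq Dq] Dh] <-].
 have [_ /(_ a b Dq Dh)[r r0 [_ sF _ _ _]]] := hA q Aq.
 by exists (nball (chart N a q) r) => //; exact: nballxx.
split=> //; first by split; exact: smooth.
move=> q u v Uq; have [_ h] := iU q Uq.
have Dq := chart_dom_center q; have Df := chart_dom_center (f q).
have [r r0 [_ _ _ _ iF]] := h q (f q) Dq Df.
have := iF (chart M q q) u v (nballxx _ r0).
rewrite {1}/rep chartK // !local_form_chart // => e.
apply: etrans (etrans e _).
 by congr (metric M' (f q) _ _); rewrite transport_id.
by congr (metric M q _ _); rewrite transport_id.
Qed.

Lemma local_isometry_inverse (H H' : hilbert R) (U : set H) g (U' : set H') g'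
  (V : set H) (V' : set H') F G : local_isometry U g U' g' V F ->
 open V' -> smooth_on V' G -> (forall y, V' y -> V (G y) /\ F (G y) = y) ->
 local_isometry U' g' U g V' G.
Proof.
move=> [oV sF VU FU iF] oV' sG FG; split; [exact: oV'|exact: sG| | |].
- by move=> y /FG[Vy <-]; exact: FU.
- by move=> y /FG[Vy _]; exact: VU.
move=> y u v V'y; have [Vy ey] := FG y V'y.
have n : \forall z \near y, z = (F \o G) z.
 by apply: filterS (open_near oV' V'y) => z /FG[_ e].
have d : is_diff y (@id H') (@id H').
 by apply: is_diff_linear => //; exists 1 => h; rewrite mul1r.
have [_ e] := is_diff_near n d.
have e1 w : 'd F (G y) ('d G y w) = w.
 have e2 := congr1 (fun L : H' -> H' => L w) (diff_comp (smooth_diff sG V'y) (smooth_diff sF Vy)).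
 exact: (etrans (esym e2) (congr1 (fun L : H' -> H' => L w) e)).
apply: (etrans (esym (iF (G y) _ _ Vy))).
exact: (f_equal3 (fun z a b => g' z a b) ey (e1 u) (e1 v)).
Qed.

(** [isometry_between] states the metric identity for [f] only; for the inverse it follows from the
    chain rule applied to [f] after [f']. *)
Lemma isometry_inv_at (H H' : hilbert R) (M : riemannian H) (M' : riemannian H')
  (U : set M) (V : set M') f f' : isometry_between U V f f' ->
 forall q, V q -> isometric_at f' q.
Proof.
move=> iF q Vq; have [[oU oV] [hU hV] [_ [cf' sf']] _] := iF; have [Uq eq] := hV q Vq.
have Dq := chart_dom_center q; have Df := chart_dom_center (f' q).
have Dff : chart_dom M' q (f (f' q)) by rewrite eq.
have [_ /(_ _ _ Df Dff)[r r0 iV]] := isometry_at iF Uq.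
pose A := V `&` chart_dom M' q `&` f' @^-1` chart_dom M (f' q).
have AD : A `<=` chart_dom M' q by move=> t [[]].
have oA : open A.
 rewrite openE => t [[Vt Dt] Ft]; apply: filterI; first apply: filterI.
 - exact: open_nbhs_nbhs.
 - exact: (open_nbhs_nbhs (conj (@chart_dom_open _ _ M' q) Dt)).
 - exact: (continuous_open_near (cf' t Vt) (@chart_dom_open _ _ M (f' q)) Ft).
have oB := chart_image_open_sub oA AD.
have Bq : (chart M' q @` A) (chart M' q q) by exists q.
have sG := sf' q (f' q) : smooth_on (chart M' q @` A) (rep q (f' q) f').
have n1 : \forall y \near chart M' q q, nball (chart M (f' q) (f' q)) r (rep q (f' q) f' y).
 apply: continuous_open_near; [exact: smooth_cont sG Bq|exact: nball_open|].
 by rewrite /rep chartK //; exact: nballxx.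
have [d d0 hd] : exists2 d, 0 < d & nball (chart M' q q) d `<=` [set y |
  (chart M' q @` A) y /\ nball (chart M (f' q) (f' q)) r (rep q (f' q) f' y)].
 by apply/nbhs_nball; apply: filterI n1; exact: open_near.
apply: (isometric_at_one (cf' q Vq) Dq Df (nballxx _ d0)).
apply: (local_isometry_inverse iV (nball_open _ _)); first by apply: smooth_sub sG => y /hd[].
move=> y /hd[[t [[Vt Dt] Ft] <-] h]; split=> //.
by rewrite /rep chartK chartK //; have [_ ->] := hV t Vt.
Qed.

Lemma isometry_sym (H H' : hilbert R) (M : riemannian H) (M' : riemannian H')
  (U : set M) (V : set M') f f' : isometry_between U V f f' -> isometry_between V U f' f.
Proof.
move=> iF; have [[oU oV] [hU hV] _ _] := iF.
by apply: isometric_between => //; [exact: isometry_inv_at iF|exact: isometry_at iF].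
Qed.

Lemma isometry_comp (H H' H'' : hilbert R) (M : riemannian H) (M' : riemannian H')
  (M'' : riemannian H'') (U : set M) (V : set M') (W : set M'') f f' h h' :
 isometry_between U V f f' -> isometry_between V W h h' ->
 isometry_between U W (h \o f) (f' \o h').
Proof.
move=> iF iG; have [[oU oV] [hU hV] _ _] := iF; have [[_ oW] [gV gW] _ _] := iG.
apply: isometric_between => // q.
- by move=> /hU[/gV[Wq e] e1]; rewrite /= e.
- by move=> /gW[/hV[Uq e] e1]; rewrite /= e.
- move=> Uq; apply: isometric_at_comp; first exact: isometry_at iF _ Uq.
 by apply: isometry_at iG _ _; have [] := hU q Uq.
- move=> Wq; apply: isometric_at_comp; first exact: isometry_inv_at iG _ Wq.
 by apply: isometry_inv_at iF _ _; have [] := gW q Wq.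
Qed.

Lemma isometry_sub (H H' : hilbert R) (M : riemannian H) (M' : riemannian H')
  (U U0 : set M) (V : set M') f f' : open U0 -> U0 `<=` U ->
 isometry_between U V f f' -> isometry_between U0 (V `&` f' @^-1` U0) f f'.
Proof.
move=> oU0 U0U iF; have [[oU oV] [hU hV] _ _] := iF.
apply: isometric_between => //.
- rewrite openE => q [Vq U0q]; apply: filterI; first exact: open_nbhs_nbhs.
 by have [c _] := isometry_inv_at iF Vq; exact: continuous_open_near.
- by move=> q U0q; have [Vq e] := hU q (U0U q U0q); rewrite /= e.
- by move=> q [/hV[_ e] U0q].
- by move=> q /U0U; exact: isometry_at iF _.
- by move=> q [Vq _]; exact: isometry_inv_at iF _ Vq.
Qed.

End IsometricAtTheory.

(** * Rigidity of isometries close to the identity *)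

Section IsometryControl.
Context {R : realType} (H : hilbert R).
Variables (U : set H) (g : H -> H -> H -> R).
Hypothesis gU : local_metric U g.

Local Notation Gam := (christoffel_of g).

Let isometry_second_algebra (a b c d e : H) x1 x2 x3 x4 :
 `|a - b| <= x1 -> `|b - c| <= x2 -> `|c - d| <= x3 -> `|d - e| <= x4 ->
 `|a - e| <= x1 + x2 + x3 + x4.
Proof.
by move: (ler_distD b a c) (ler_distD c a d) (ler_distD d a e); lra.
Qed.

Let mul_bound (c C0 M h k a b : R) : 0 <= c -> a * b <= C0 * h * (M * k) ->
 c * a * b <= c * C0 * M * h * k.
Proof. by move=> c0 /(ler_wpM2l c0); lra. Qed.

Let sum_bound (c C0 C M h k : R) : 0 <= M -> 0 <= h -> 0 <= k -> c * (3 + C0) <= C ->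
 c * M * h * k + c * M * h * k + c * M * h * k + c * C0 * M * h * k <= C * M * h * k.
Proof. by move=> M0 h0 k0 /(ler_wpM2r (mulr_ge0 (mulr_ge0 M0 h0) k0)); lra. Qed.

(** Comparing the metrics at [x] and [F x] bounds the differential. In [local_isometry_second_diff]
    the two Christoffel terms cancel when [F] is the identity, so the second derivative is bounded
    by the distance [M] of the 1-jet to that of the identity. *)
Lemma isometry_bounds x0 : U x0 -> exists rho C : R, [/\ 0 < rho, 0 < C, nball x0 rho `<=` U,
 forall y u v, nball x0 rho y -> `|Gam y u v| <= C * `|u| * `|v| &
 forall V F x, local_isometry U g U g V F -> V x -> nball x0 rho x -> nball x0 rho (F x) ->
  (forall k, `|'d F x k| <= C * `|k|) /\
  forall M, (forall w, exists w', 'd F x w' = w) ->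
   `|F x - x| <= M -> (forall k, `|'d F x k - k| <= M * `|k|) ->
   forall h k, `|'d (fun y => 'd F y k) x h| <= C * M * `|h| * `|k|].
Proof.
move=> Ux.
have [r1 [c1 [C1 [r10 c10 C10 r1U hg]]]] := metric_bound gU Ux.
have fG := christoffel_family gU.
have [r2 [C2 [r20 C20 r2U hG]]] := family2_bound fG Ux.
have [r3 r30 [m1 m2]] : exists2 r : R, 0 < r & r <= r1 /\ r <= r2.
 by exists (Num.min r1 r2); rewrite ?lt_min ?r10 // !ge_min !lexx orbT.
(* [C1 / c1] bounds the square of the norm of the differential, and adding 1 gives a bound for the
   norm itself; [C2 * (3 + C0)] is the sum of the four steps [b1] to [b4]. *)
pose C0 := C1 / c1 + 1; pose C := C0 + C2 * (3 + C0).
have q0 : 0 < C1 / c1 by rewrite divr_gt0.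
have C00 : 0 < C0 by rewrite /C0; lra.
have CC : C0 <= C by rewrite lerDl mulr_ge0; lra.
have CC' : C2 * (3 + C0) <= C by rewrite /C; lra.
have C2C : C2 <= C by apply: le_trans CC'; rewrite ler_peMr //; lra.
have in1 y : nball x0 r3 y -> nball x0 r1 y by move=> h; exact: lt_le_trans m1.
have in2 y : nball x0 r3 y -> nball x0 r2 y by move=> h; exact: lt_le_trans m2.
exists r3, C; split=> //; first by lra.
- by move=> y /in1/r1U.
- move=> y u v hy; have [b _ _ _] := hG y y (in2 y hy) (in2 y hy) u v.
 by apply: (le_trans b); rewrite -!mulrA ler_wpM2r // mulr_ge0.
move=> V F x iF Vx bx bF.
have dF k : `|'d F x k| <= C0 * `|k|.
 have [_ _ _ _ /(_ x k k Vx) e] := iF.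
 have [h1 _] := hg (F x) (in1 _ bF) ('d F x k) ('d F x k).
 have [_ h2] := hg x (in1 _ bx) k k.
 have h4 : `|'d F x k| ^+ 2 <= C1 / c1 * `|k| ^+ 2.
  rewrite mulrAC ler_pdivlMr // mulrC; via h1; rewrite e; via (ler_norm (g x k k)).
  by rewrite expr2 mulrA.
 have h5 : C1 / c1 * `|k| ^+ 2 <= (C0 * `|k|) ^+ 2.
  rewrite exprMn ler_wpM2r ?exprn_ge0 // /C0; move: (C1 / c1) q0 => z z0; nra.
 have CT : 0 <= C0 * `|k| by rewrite mulr_ge0 // ltW.
 by rewrite -(@ler_pXn2r _ 2) ?nnegrE //; exact: le_trans h5.
split; first by move=> k; apply: (le_trans (dF k)); rewrite ler_wpM2r.
move=> M surj hF hD h k.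
have M0 : 0 <= M by apply: le_trans hF.
have [hn kn] := (normr_ge0 h, normr_ge0 k).
have b x' u v : nball x0 r3 x' -> `|Gam x' u v| <= C2 * `|u| * `|v|.
 by move=> hx; have [b _ _ _] := hG x' x' (in2 _ hx) (in2 _ hx) u v.
have b1 : `|'d F x (Gam x h k) - Gam x h k| <= C2 * M * `|h| * `|k|.
 apply: (le_trans (hD _)); have := ler_wpM2l M0 (b x h k bx); lra.
have b2 : `|Gam x h k - Gam (F x) h k| <= C2 * M * `|h| * `|k|.
 have [_ b2 _ _] := hG x (F x) (in2 _ bx) (in2 _ bF) h k.
 rewrite distrC; apply: (le_trans b2); rewrite !ler_wpM2r // ler_wpM2l //; exact: ltW.
have [_ _ Gl Gr] := fG; have Uy := r1U _ (in1 _ bF).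
have b3 : `|Gam (F x) h k - Gam (F x) ('d F x h) k| <= C2 * M * `|h| * `|k|.
 have s : Gam (F x) h k - Gam (F x) ('d F x h) k = Gam (F x) (h - 'd F x h) k.
  exact: (esym (lin_sub _ _ (Gl (F x) k Uy))).
 rewrite s; via (b _ _ _ bF); rewrite ler_wpM2r // -mulrA ler_wpM2l //; first exact: ltW.
 by rewrite distrC; exact: hD.
have b4 : `|Gam (F x) ('d F x h) k - Gam (F x) ('d F x h) ('d F x k)| <= C2 * C0 * M * `|h| * `|k|.
 have s : Gam (F x) ('d F x h) k - Gam (F x) ('d F x h) ('d F x k) = Gam (F x) ('d F x h) (k - 'd F x k).
  exact: (esym (lin_sub _ _ (Gr (F x) ('d F x h) Uy))).
 rewrite s; via (b _ _ _ bF).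
 have n2 := hD k; rewrite distrC in n2.
 have := ler_pM (normr_ge0 ('d F x h)) (normr_ge0 (k - 'd F x k)) (dF h) n2.
 exact: mul_bound (ltW C20).
have := isometry_second_algebra b1 b2 b3 b4.
rewrite -(local_isometry_second_diff gU gU h k iF Vx surj) => E; via E; exact: sum_bound.
Qed.

(** Along a segment the distance of the 1-jet to the identity satisfies [jet_control] without
    forcing term, whence the factor 2. The constants serve all isometries, and
    [r * (2 * C + 2) < rho] leaves room for the images of segments. *)
Lemma isometry_control x0 : U x0 -> exists r rho C : R,
 [/\ 0 < r, 0 < C, r * (2 * C + 2) < rho & nball x0 rho `<=` U] /\
 (forall V F x, local_isometry U g U g V F -> V x -> nball x0 rho x -> nball x0 rho (F x) ->
  forall k, `|'d F x k| <= C * `|k|) /\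
 forall V F x1 x2 eta, local_isometry U g U g V F ->
  (forall x, V x -> forall w, exists w', 'd F x w' = w) ->
  nball x0 r x1 -> nball x0 r x2 ->
  (forall t : R, 0 <= t <= 1 -> V (x1 + t *: (x2 - x1)) /\ nball x0 rho (F (x1 + t *: (x2 - x1)))) ->
  `|F x1 - x1| <= eta -> (forall k, `|'d F x1 k - k| <= eta * `|k|) ->
  `|F x2 - x2| <= 2 * eta /\ forall k, `|'d F x2 k - k| <= 2 * eta * `|k|.
Proof.
move=> Ux; have [rho [C [rho0 C0 rhoU hG hF]]] := isometry_bounds Ux.
have [r r0 [hr1 hr2]] : exists2 r : R, 0 < r & r * (2 * C + 2) < rho /\ r * (4 * C + 4) <= 1.
 exists (Num.min (rho / (2 * C + 3)) (4 * C + 4)^-1).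
  by rewrite lt_min; apply/andP; split; [apply: divr_gt0|rewrite invr_gt0]; lra.
 have c1 : 0 < 2 * C + 3 by lra. have c2 : 0 < 4 * C + 4 by lra.
 have [h1 h2] : Num.min (rho / (2 * C + 3)) (4 * C + 4)^-1 <= rho / (2 * C + 3) /\
   Num.min (rho / (2 * C + 3)) (4 * C + 4)^-1 <= (4 * C + 4)^-1 by rewrite !ge_min !lexx orbT.
 have h0 : 0 < Num.min (rho / (2 * C + 3)) (4 * C + 4)^-1.
  by rewrite lt_min divr_gt0 // invr_gt0.
 move: (Num.min _ _) h0 h1 h2 => s s0; rewrite ler_pdivlMr // -[(4 * C + 4)^-1]mul1r ler_pdivlMr //.
 by split; lra.
have rrho : r <= rho by apply: ltW; apply: le_lt_trans hr1; rewrite ler_peMr; lra.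
exists r, rho, C; split=> //; split.
 by move=> V F x iF Vx bx bF; have [] := hF V F x iF Vx bx bF.
move=> V F x1 x2 eta iF surj bx1 bx2 seg hF1 hD1; pose h := x2 - x1.
have [oV sF VU _ _] := iF.
have bseg (t : R) : 0 <= t <= 1 -> nball x0 rho (x1 + t *: h).
 by move=> ht; apply: (lt_le_trans _ rrho); exact: (nball_segment bx1 bx2 ht).
have hn : `|h| <= 2 * r.
 rewrite /h; have := ler_distD x0 x2 x1; rewrite (distrC x0 x1).
 by have := ltW bx1; have := ltW bx2; rewrite /nball/=; lra.
have h4C : 4 * C * r <= 1 by lra.
have rC : 0 <= r * C by apply: mulr_ge0; exact: ltW.
have r14 : r <= 1 / 4 by lra.
pose L k := x1 + k *: h.
have := @jet_control _ H H (fun t => F (L t) - L t) (fun t => 'd F (L t) h - h)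
 (fun t k => 'd F (L t) k - k) (fun t k => 'd (fun y => 'd F y k) (L t) h - 0) eta 0.
have L0 : L 0 = x1 by rewrite /L scale0r addr0.
have L1 : L 1 = x2 by rewrite /L scale1r addrC subrK.
rewrite !L0 !addr0 => /(_ _ _ _ _ _ hF1 hD1)-/(_ _ _ _ _ _ 1).
rewrite L1; apply; last by rewrite ler01 lexx.
- move=> t /seg[Vt _]; apply: cderB; last exact: cder_line.
 exact: (cder_along sF Vt).
- move=> t k /seg[Vt _]; apply: cderB; last exact: cder_cst.
 exact: (cder_along_diff k oV sF Vt).
- by move=> t a k _; rewrite diff_scale scalerBr.
- have [B hB] := diff_segment_bounded oV sF (fun t ht => (seg t ht).1).
 exists (B + (`|x1| + `|h|) + 1) => t ht; have [e1 e2] := hB t ht; split.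
  via (ler_normB _ _); have := ler_normD x1 (t *: h); rewrite normrZ.
  have : `|t| * `|h| <= `|h| by rewrite ler_piMl // ger0_norm; case/andP: ht.
  by move: e1; rewrite -/(L t); lra.
 move=> k; via (ler_normB _ _); have := e2 k; rewrite -/(L t) !mulrDl mul1r.
 have : 0 <= (`|x1| + `|h|) * `|k| by rewrite mulr_ge0 // addr_ge0.
 by rewrite mulrDl; lra.
move=> M t ht M0 hW hA; rewrite addr0; have [Vt bt] := seg t ht; split.
 apply: (le_trans (hA h)); have := ler_wpM2l M0 hn; have := ler_wpM2l M0 r14; lra.
move=> k; rewrite subr0.
have [_ /(_ M (surj _ Vt) hW hA h k) b] := hF V F _ iF Vt (bseg t ht) bt.
via b; apply: ler_wpM2r => //.
have := ler_wpM2l M0 h4C; have := ler_wpM2l (mulr_ge0 (ltW C0) M0) hn; lra.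
Qed.

End IsometryControl.

Section GlobalIsometry.
Context {R : realType}.

(** Values of charts off their domains are arbitrary, so coordinate expressions are only estimated
    on this set. *)
Definition rep_dom (H H' : hilbert R) (M : riemannian H) (M' : riemannian H')
  (U : set M) (a : M) (b : M') (f : M -> M') : set H :=
 chart M a @` (U `&` chart_dom M a `&` f @^-1` chart_dom M' b).

Lemma rep_dom_open (H H' : hilbert R) (M : riemannian H) (M' : riemannian H')
  (U : set M) a (b : M') (f : M -> M') : open U ->
 (forall q, U q -> {for q, continuous f}) -> open (rep_dom U a b f).
Proof.
move=> oU cf; apply: chart_image_open_sub; last by move=> r [[]].
rewrite openE => r [[Ur Dr] Fr]; apply: filterI; first apply: filterI.
- exact: open_nbhs_nbhs.
- exact: (open_nbhs_nbhs (conj (@chart_dom_open _ _ M a) Dr)).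
- exact: continuous_open_near (cf r Ur) (@chart_dom_open _ _ M' b) Fr.
Qed.

Lemma rep_isometry_dom (H H' : hilbert R) (M : riemannian H) (M' : riemannian H')
  (U : set M) (a : M) (b : M') (f : M -> M') : open U ->
 (forall q, U q -> isometric_at f q) -> rep_isometry a b f (rep_dom U a b f).
Proof.
move=> oU iU; have oW := rep_dom_open a b oU (fun q Uq => (iU q Uq).1).
have loc x : rep_dom U a b f x -> exists2 V : set H, V x & rep_isometry a b f V.
 move=> [q [[Uq Dq] Fq] <-]; have [_ /(_ a b Dq Fq)[r r0 iV]] := iU q Uq.
 by exists (nball (chart M a q) r) => //; exact: nballxx.
split=> //.
- by apply: smooth_union => x /loc[V Vx [_ sV _ _ _]]; exists V.
- by move=> x /loc[V Vx [_ _ VU _ _]]; exact: VU.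
- by move=> x /loc[V Vx [_ _ _ VU _]]; exact: VU.
- by move=> x u v /loc[V Vx [_ _ _ _ iV]]; exact: iV.
Qed.

(** The inverse isometry supplies the preimages, by differentiating the identity of [f] after [f'].
    The second-order identity for isometries asks for this surjectivity. *)
Lemma rep_surjective (H H' : hilbert R) (M : riemannian H) (M' : riemannian H')
  (U : set M) (V : set M') a (b : M') f f' : isometry_between U V f f' ->
 forall x, rep_dom U a b f x -> forall w, exists w', 'd (rep a b f) x w' = w.
Proof.
move=> iF x [q [[Uq Dq] Fq] <-] w; have [[oU oV] [hU hV] _ _] := iF.
have [_ sF _ _ _] := rep_isometry_dom a b oU (isometry_at iF).
have [_ sG _ _ _] := rep_isometry_dom b a oV (isometry_inv_at iF).
have [Vq eq] := hU q Uq.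
have Bq : rep_dom V b a f' (chart M' b (f q)) by exists (f q) => //; rewrite /= eq.
have eG : rep b a f' (chart M' b (f q)) = chart M a q by rewrite /rep chartK // eq.
have dF : differentiable (rep a b f) (rep b a f' (chart M' b (f q))).
 by rewrite eG; apply: (smooth_diff sF); exists q.
have oB := rep_dom_open b a oV (fun q Vq => (isometry_inv_at iF Vq).1).
have n : \forall z \near chart M' b (f q), z = (rep a b f \o rep b a f') z.
 apply: filterS (open_near oB Bq) => z [t [[Vt Dt] Ft] <-].
 by rewrite /= /rep chartK // chartK //; have [_ ->] := hV t Vt.
have d : is_diff (chart M' b (f q)) (@id H') (@id H').
 by apply: is_diff_linear => //; exists 1 => h; rewrite mul1r.
have [_ e] := is_diff_near n d.
exists ('d (rep b a f') (chart M' b (f q)) w).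
have e2 := congr1 (fun L : H' -> H' => L w) (diff_comp (smooth_diff sG Bq) dF).
have e3 : 'd (rep a b f) (chart M a q) ('d (rep b a f') (chart M' b (f q)) w) =
 'd (rep a b f) (rep b a f' (chart M' b (f q))) ('d (rep b a f') (chart M' b (f q)) w) by rewrite eG.
exact: etrans e3 (etrans (esym e2) (congr1 (fun L : H' -> H' => L w) e)).
Qed.

Lemma hausdorff_limit (T : topologicalType) (E : normedModType R) (h : E -> T) (k : R -> E)
  y z : hausdorff_space T -> {for z, continuous h} ->
 (forall A : set T, nbhs y A -> forall e : R, 0 < e -> exists2 s, A (h (k s)) & `|k s - z| < e) ->
 y = h z.
Proof.
move=> hT ch hk; apply: hT => A B yA zB.
have [r r0 hr] := (nbhs_nball _ _).1 (continuous_near ch zB).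
by have [s As ks] := hk A yA r r0; exists (h (k s)); split=> //; exact: hr.
Qed.

Context {H : hilbert R} {M : riemannian H}.

Definition global_isometry (f : M -> M) : Prop :=
 exists f', isometry_between setT setT f f'.

(* An isometry moving a point by little stays in the chart along a short segment:
  it is Lipschitz there, hence has a limit in the chart, equal to the value
  of the isometry because M is a Hausdorff space. *)
Lemma isometry_stays (a : M) (x0 : H) (r rho C : R) (f : M -> M) x1 x2 :
 let V := rep_dom setT a a f in let F := rep a a f in
 0 < r -> 0 < C -> r * (2 * C + 2) < rho -> nball x0 rho `<=` chart_image a ->
 global_isometry f ->
 (forall x, V x -> nball x0 rho x -> nball x0 rho (F x) -> forall k, `|'d F x k| <= C * `|k|) ->
 nball x0 r x1 -> nball x0 r x2 -> V x1 -> `|F x1 - x1| <= r ->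
 forall t : R, 0 <= t <= 1 -> V (x1 + t *: (x2 - x1)) /\ nball x0 rho (F (x1 + t *: (x2 - x1))).
Proof.
move=> V F r0 C0 hr rhoO [f' iF] hC b1 b2 V1 hF1.
have iV : rep_isometry a a f V.
 by apply: rep_isometry_dom => [|q _]; [exact: openT|exact: isometry_at iF _ _].
have [oV sF _ _ _] := iV; pose h := x2 - x1; pose L t := x1 + t *: h.
have rrho : r <= rho by apply: ltW; apply: le_lt_trans hr; rewrite ler_peMr //; lin.
have bL (t : R) : 0 <= t <= 1 -> nball x0 rho (L t).
 by move=> ht; apply: (lt_le_trans _ rrho); exact: (nball_segment b1 b2 ht).
have hn : `|h| <= 2 * r.
 rewrite /h; have := ler_distD x0 x2 x1; rewrite (distrC x0 x1).
 by have := ltW b1; have := ltW b2; rewrite /nball/=; lin.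
pose K := 2 * r * C.
have K0 : 0 <= K by apply: mulr_ge0; lin.
have Kh : C * `|h| <= K by rewrite mulrC; apply: ler_wpM2r => //; lin.
have L0 : L 0 = x1 by rewrite /L scale0r addr0.
have inrho t : t <= 1 -> forall y, `|y - F x1| <= K * t -> nball x0 rho y.
 move=> t1 y hy; have := ler_distD (F x1) y x0; have := ler_distD x1 (F x1) x0.
 have := ler_wpM2l K0 t1; move: b1; rewrite /nball/= => b1.
 have : r + r + K < rho by rewrite /K; lin.
 by lin.
have lip (s t : R) : 0 <= s -> s <= t -> t <= 1 ->
  (forall w, s <= w <= t -> V (L w) /\ nball x0 rho (F (L w))) ->
  `|F (L t) - F (L s)| <= K * (t - s).
 move=> s0 st t1 hw.
 apply: (@mean_value _ _ (fun t => F (L t)) (fun t => 'd F (L t) h)) => // w hws.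
  by have [Vw _] := hw w hws; exact: (cder_along sF Vw).
 have [Vw bw] := hw w hws; exact: (le_trans (hC _ Vw (bL w ltac:(lin)) bw h)) Kh.
(* Besides membership, the induction carries a quantitative bound, which keeps the image in the ball
   of radius [rho]. *)
pose P t := V (L t) /\ `|F (L t) - F x1| <= K * t.
suff PP t : 0 <= t <= 1 -> P t.
 by move=> t ht; have [Vt ht'] := PP t ht; split=> //; apply: (inrho t) ht'; lin.
move: t; apply: real_induction => [|t ht Pt|t ht Pt].
- by rewrite /P L0 subrr normr0 mulr0.
- have [Vt bt] := Pt t ltac:(lin).
 have cL : {for t, continuous L} by exact: cder_continuous (cder_line x1 h t).
 have n1 : \forall s \near t, V (L s) by exact: continuous_open_near cL oV Vt.
 have n2 : \forall s \near t, nball x0 rho (F (L s)).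
  apply: (continuous_open_near (h := F \o L)); last 1 first.
  - by apply: (inrho t) bt; lin.
  - by apply: continuous_comp cL _; exact: smooth_cont sF Vt.
  - exact: nball_open.
 have [d d0 hd] := (nbhs_nball _ _).1 (filterI n1 n2).
 exists (Num.min d (1 - t)); first by rewrite lt_min d0; lin.
 move=> s /andP[ts]; rewrite -ltrBlDl lt_min => /andP[h1 h2].
 have inb w : t <= w <= s -> V (L w) /\ nball x0 rho (F (L w)).
  by move=> hw; apply: hd; rewrite /nball/= ger0_norm; lin.
 split; first by apply: (inb s _).1; lin.
 have := lip t s ltac:(lin) ltac:(lin) ltac:(lin) inb.
 by have := ler_distD (F (L t)) (F (L s)) (F x1); rewrite !mulrBr; lin.
have good s : 0 <= s < t -> V (L s) /\ nball x0 rho (F (L s)).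
 by move=> hs; have [Vs bs] := Pt s hs; split=> //; apply: (inrho s) bs; lin.
(* Times increasing to [t] at geometric speed, so that the Lipschitz bound makes their images a
   Cauchy sequence. *)
pose u n := t - t * 2^-1 ^+ n.
have q0 n : 0 < 2^-1 ^+ n :> R by [].
have q1 n : 2^-1 ^+ n <= 1 :> R by apply: exprn_ile1; lin.
have ht0 : 0 < t by lin.
have u0 n : 0 <= u n < t.
 have := ler_wpM2l (ltW ht0) (q1 n); have : 0 < t * 2^-1 ^+ n by rewrite mulr_gt0.
 by rewrite /u; lin.
have uS n : u n.+1 - u n = t * 2^-1 ^+ n.+1 /\ t - u n = t * 2^-1 ^+ n.
 by rewrite /u exprS; split; move: (2^-1 ^+ n) => w; lin.
have [|z hz] := @complete_cauchy _ H (fun n => F (L (u n))) (K * t).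
 move=> n; have [e1 _] := uS n; have h1 := u0 n; have h2 := u0 n.+1.
 have p1 : 0 < t * 2^-1 ^+ n.+1 by rewrite mulr_gt0.
 apply: (le_trans (lip (u n) (u n.+1) _ _ _ _)); try lin.
  by move=> w hw; apply: good; lin.
 rewrite e1 exprS; have p2 : 0 <= K * (t * 2^-1 ^+ n) by rewrite mulr_ge0 // mulr_ge0 ?ltW.
 by move: p2; rewrite -!mulrA; move: (2^-1 ^+ n) => w p2; lin.
have small (e A : R) : 0 < e -> 0 <= A -> exists n, A * 2^-1 ^+ n < e.
 move=> e0 A0; have [n hn'] := half_expr_lt (divr_gt0 e0 (ltr_wpDl A0 ltr01)).
 exists n; rewrite ltr_pdivlMr // in hn'; last by lin.
 by have := q0 n; lin.
have Kt0 : 0 <= K * t by rewrite mulr_ge0 // ltW.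
have hzK : `|z - F x1| <= K * t.
 apply/ler_addgt0Pr => e e0; have [n hn'] := small e (2 * (K * t)) e0 ltac:(lin).
 have [_ h1] := Pt (u n) (u0 n); have := hz n.
 have := ler_distD (F (L (u n))) z (F x1); rewrite (distrC z (F (L (u n)))).
 have := ler_wpM2l K0 (ltW (proj2 (andP (u0 n)))); lin.
have bz : nball x0 rho z by apply: (inrho t) hzK; lin.
have Oz := rhoO _ bz; have OL := rhoO _ (bL t ltac:(lin)).
have [Dz ez] := chart_invP Oz; have [DL eL] := chart_invP OL.
have key : f (chart_inv M a (L t)) = chart_inv M a z.
 apply: (hausdorff_limit (k := fun s => F (L s)) (@manifold_hausdorff _ _ M)).
  exact: chart_inv_continuous.
 move=> A yA e e0; have cf := (isometry_at iF (q := chart_inv M a (L t)) I).1.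
 have cL : {for t, continuous L} by exact: cder_continuous (cder_line x1 h t).
 have [d d0 hd] := (nbhs_nball _ _).1 (continuous_near cL (continuous_near (chart_inv_continuous OL) (continuous_near cf yA))).
 have [n hn1] := small d t d0 (ltW ht0).
 have [m hm] := small e (2 * (K * t)) e0 ltac:(lin).
 pose p := maxn n m; have [Vp _] := good _ (u0 p).
 have mono (i j : nat) : (i <= j)%N -> 2^-1 ^+ j <= 2^-1 ^+ i :> R.
  by move=> ij; rewrite ler_wiXn2l //; lin.
 exists (u p).
  have -> : chart_inv M a (F (L (u p))) = f (chart_inv M a (L (u p))).
   have [q [[_ Dq] Fq] eq] := Vp; by rewrite -eq /F /rep (chartK Dq) (chartK Fq).
  apply: hd; rewrite /nball/= distrC; have [_ e2] := uS p; rewrite e2.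
  rewrite ger0_norm; last by rewrite mulr_ge0 ?ltW.
  by have := ler_wpM2l (ltW ht0) (mono n p (leq_maxl _ _)); lin.
 have := hz p; have := ler_wpM2l (ltac:(lin) : 0 <= 2 * (K * t)) (mono m p (leq_maxr _ _)); lin.
have eF : F (L t) = z by rewrite /F /rep key.
split; last by rewrite eF.
by exists (chart_inv M a (L t)) => //; rewrite /= key.
Qed.

End GlobalIsometry.

Section NearIdentity.
Context {R : realType} {H : hilbert R} {M : riemannian H}.

(** Measures, in one chart, the distance of the 1-jet of an isometry to that of the identity. The
    domain condition matters because chart values off the domain mean nothing. *)
Definition near_id (a : M) (x : H) (eta : R) (f : M -> M) : Prop :=
 [/\ rep_dom setT a a f x, `|rep a a f x - x| <= eta &
  forall k, `|'d (rep a a f) x k - k| <= eta * `|k|].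

Lemma near_id_local a x0 : chart_image a x0 -> exists2 r : R, 0 < r &
 nball x0 r `<=` chart_image a /\ forall f x1 x2 eta, global_isometry f ->
 nball x0 r x1 -> nball x0 r x2 -> eta <= r -> near_id a x1 eta f -> near_id a x2 (2 * eta) f.
Proof.
move=> Ox; have [r [rho [C [[r0 C0 hr rhoO] [hC hctl]]]]] := isometry_control (local_form_metric a) Ox.
exists r => //; split.
 move=> y hy; apply: rhoO; apply: (lt_trans hy); apply: le_lt_trans hr.
 by rewrite ler_peMr ?ltW //; lin.
move=> f x1 x2 eta gf b1 b2 her [V1 hF hD]; have [f' iF] := gf.
have iV : rep_isometry a a f (rep_dom setT a a f).
 by apply: rep_isometry_dom => [|q _]; [exact: openT|exact: isometry_at iF _ _].
have st := isometry_stays r0 C0 hr rhoO gf (fun x Vx bx bF => hC _ _ x iV Vx bx bF) b1 b2 V1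
 (le_trans hF her).
have [h1 h2] := hctl _ _ x1 x2 eta iV (rep_surjective iF) b1 b2 st hF hD.
have [V2 _] : rep_dom setT a a f x2 /\ nball x0 rho (rep a a f x2).
 have := st 1 ltac:(lin); rewrite scale1r addrC subrK; exact.
by split.
Qed.

(** The transition map and its differential are Lipschitz, so conjugating by it multiplies the
    distance to the identity by a constant; [eta <= d] keeps the image point in the domains of both
    charts. *)
Lemma near_id_chart a b q : chart_dom M a q -> chart_dom M b q ->
 exists d C : R, [/\ 0 < d, 0 < C & forall f eta, global_isometry f -> eta <= d ->
  near_id a (chart M a q) eta f -> near_id b (chart M b q) (C * eta) f].
Proof.
move=> Da Db; have oab := @overlap_open _ _ M a b; have Oq := overlapP Da Db.
have sk := @transition_smooth _ _ M a b.
have [r1 [C1 [r10 C10 r1U h1]]] := smooth_lipschitz oab sk Oq.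
have [r2 [C2 [r20 C20 _ h2]]] := @bilinear_bound _ _ _ _ _ (fun y v => 'd (transition a b) y v) _
 oab Oq (smooth_tangent sk) (fun y _ => linearP _).
have [C3 C30 h3] := diff_bounded (transition_diff Db Da).
pose d := Num.min r1 r2 / 2.
have d0 : 0 < d by rewrite divr_gt0 // lt_min r10.
have [d1 d2] : d < r1 /\ d < r2.
 have : Num.min r1 r2 <= r1 /\ Num.min r1 r2 <= r2 by rewrite !ge_min !lexx orbT.
 by rewrite /d in d0 *; lin.
have C230 : 0 < C2 * C3 by rewrite mulr_gt0.
exists d, (C1 + 2 * C2 * C3); split=> //; first by lin.
move=> f eta [f' iF] hd [[q' [[_ Dq'] Fq'] eq'] hF hD].
have eqq : q' = q by rewrite -(chartK Dq') eq' chartK.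
rewrite {q' eq'}eqq in Dq' Fq' *.
set x := chart M a q in hF hD *; have eta0 : 0 <= eta by apply: le_trans hF.
have bF1 : nball x r1 (rep a a f x) by apply: (le_lt_trans hF); lin.
have bF2 : nball x r2 (rep a a f x) by apply: (le_lt_trans hF); lin.
have eF : rep a a f x = chart M a (f q) by rewrite /rep chartK.
have Dbf : chart_dom M b (f q).
 by have := r1U _ bF1; rewrite eF => -[t [Dt Dt'] e]; rewrite -[f q](chartK Fq') -e chartK.
have cf := (isometry_at iF (q := q) I).1.
have dF : differentiable (rep a a f) (chart M a q).
 have iV : rep_isometry a a f (rep_dom setT a a f).
  by apply: rep_isometry_dom => [|t _]; [exact: openT|exact: isometry_at iF _ _].
 by have [_ sF _ _ _] := iV; apply: (smooth_diff sF); exists q.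
have [_ dch] := rep_diff_change cf Db Da Fq' Dbf dF.
have c1 : C1 * eta <= (C1 + 2 * C2 * C3) * eta by apply: ler_wpM2r => //; lin.
split; first by exists q.
 have -> : rep b b f (chart M b q) = transition a b (rep a a f x).
  by rewrite eF transition_chart // /rep chartK.
 have e : chart M b q = transition a b x by rewrite transition_chart.
 rewrite [in X in _ - X]e; apply: le_trans c1; apply: le_trans (h1 _ _ (nballxx x r10) bF1) _.
 by apply: ler_wpM2l => //; exact: ltW.
move=> k; set m := transport b a q k.
have em : k = 'd (transition a b) x m by have := transportK k Db Da.
have hm : `|m| <= C3 * `|k| by exact: h3.
have e1 : 'd (rep b b f) (chart M b q) k = 'd (transition a b) (rep a a f x) ('d (rep a a f) x m).
 by rewrite eF; exact: dch.
rewrite e1 [in X in _ - X]em; set y := rep a a f x in bF2 *.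
have [b1 _ _ _] := h2 y y bF2 bF2 ('d (rep a a f) x m - m).
have [_ b2 _ _] := h2 x y (nballxx x r20) bF2 m.
have s : 'd (transition a b) y ('d (rep a a f) x m) - 'd (transition a b) x m =
 'd (transition a b) y ('d (rep a a f) x m - m) + ('d (transition a b) y m - 'd (transition a b) x m).
 by apply: (etrans _ (congr1 (fun z => z + _) (esym (diff_sub (transition a b) y ('d (rep a a f) x m) m)))); rewrite addrA subrK.
rewrite s; via (ler_normD _ _).
have p2 : C2 * `|y - x| * `|m| <= C2 * eta * `|m|.
 by apply: ler_wpM2r => //; apply: ler_wpM2l => //; exact: ltW.
move: b1 b2 (ler_wpM2l (ltW C20) (hD m)) p2 (ler_wpM2l (mulr_ge0 (ltW C20) eta0) hm) (mulr_ge0 (mulr_ge0 (ltW C10) eta0) (normr_ge0 k)); move: (`|_ - _|) (`|'d _ _ (_ - _)|) (`|_ - x|) (`|'d _ _ _ - m|) => n1 n2 n3 n4.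
lin.
Qed.

(** The constants depend on the two points but not on the isometry. This makes the relation
    transitive, and it holds both ways between nearby points, so the points controlled by [p] form
    an open and closed set. *)
Definition controls (q1 q2 : M) : Prop := exists d C : R, [/\ 0 < d, 0 < C &
 forall f eta, global_isometry f -> eta <= d ->
  near_id q1 (chart M q1 q1) eta f -> near_id q2 (chart M q2 q2) (C * eta) f].

Let min_trans (P1 P2 P3 : R -> Prop) d1 C1 d2 C2 : 0 < d1 -> 0 < C1 -> 0 < d2 -> 0 < C2 ->
 (forall eta, eta <= d1 -> P1 eta -> P2 (C1 * eta)) ->
 (forall eta, eta <= d2 -> P2 eta -> P3 (C2 * eta)) ->
 forall eta, eta <= Num.min d1 (d2 / C1) -> P1 eta -> P3 (C2 * C1 * eta).
Proof.
move=> d10 C10 d20 C20 h1 h2 eta; rewrite le_min => /andP[e1 e2] p1.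
by rewrite -mulrA; apply: h2 (h1 _ e1 p1); rewrite mulrC -ler_pdivlMr.
Qed.

Lemma controls_trans q1 q2 q3 : controls q1 q2 -> controls q2 q3 -> controls q1 q3.
Proof.
move=> [d1 [C1 [d10 C10 h1]]] [d2 [C2 [d20 C20 h2]]].
exists (Num.min d1 (d2 / C1)), (C2 * C1); split; first by rewrite lt_min d10 divr_gt0.
 by rewrite mulr_gt0.
move=> f eta gf.
exact: (min_trans (P1 := fun e => near_id q1 (chart M q1 q1) e f)
 (P2 := fun e => near_id q2 (chart M q2 q2) e f) (P3 := fun e => near_id q3 (chart M q3 q3) e f)
 d10 C10 d20 C20 (fun e => h1 f e gf) (fun e => h2 f e gf)).
Qed.

Lemma controls_local q : \forall r \near q, controls r q /\ controls q r.
Proof.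
have Dq := chart_dom_center q; have [r r0 [rO hr]] := near_id_local (chart_imageP Dq).
suff key q1 q2 : chart_dom M q q1 -> chart_dom M q q2 ->
  nball (chart M q q) r (chart M q q1) -> nball (chart M q q) r (chart M q q2) -> controls q1 q2.
 by apply: filterS2 (chart_near Dq (nball_open _ r) (nballxx (chart M q q) r0)) (open_nbhs_nbhs (conj (@chart_dom_open _ _ M q) Dq)) => t b1 Dt; split; apply: key => //; exact: nballxx.
move=> D1 D2 b1 b2.
have [d1 [C1 [d10 C10 h1]]] := near_id_chart (chart_dom_center q1) D1.
have [d2 [C2 [d20 C20 h2]]] := near_id_chart D2 (chart_dom_center q2).
pose d3 := Num.min d1 (r / C1); have d30 : 0 < d3 by rewrite lt_min d10 divr_gt0.
exists (Num.min d3 (d2 / (2 * C1))), (C2 * (2 * C1)); split.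
- by rewrite lt_min d30 divr_gt0 // mulr_gt0.
- by rewrite !mulr_gt0.
move=> f eta gf.
apply: (min_trans (P1 := fun e => near_id q1 (chart M q1 q1) e f)
 (P2 := fun e => near_id q (chart M q q2) e f) (P3 := fun e => near_id q2 (chart M q2 q2) e f)
 d30 _ d20 C20 _ (fun e => h2 f e gf)); first by rewrite mulr_gt0.
move=> e; rewrite le_min => /andP[e1 e2] p1; rewrite -mulrA.
by apply: hr gf b1 b2 _ (h1 f e gf e1 p1); rewrite mulrC -ler_pdivlMr.
Qed.

Lemma controls_all p q : controls p q.
Proof.
suff e : [set q | controls p q] = setT by have : [set q | controls p q] q by rewrite e.
apply: (@manifold_connected _ _ M).
- by exists p; have [_] := nbhs_singleton (controls_local p).
- exists [set q | controls p q]; last by rewrite setTI.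
 rewrite openE => r pr; apply: filterS (controls_local r) => t [_ rt].
 exact: controls_trans rt.
- exists [set q | controls p q]; last by rewrite setTI.
 rewrite -openC openE => r pr; apply: filterS (controls_local r) => t [tr _] pt.
 by apply: pr; exact: controls_trans tr.
Qed.

Lemma near_id_uniform p q : exists r d C : R, [/\ 0 < r, 0 < d, 0 < C &
 forall f eta, global_isometry f -> eta <= d -> near_id p (chart M p p) eta f ->
  forall x, nball (chart M q q) r x -> near_id q x (C * eta) f].
Proof.
have [d [C [d0 C0 h]]] := controls_all p q.
have [r r0 [rO hr]] := near_id_local (chart_imageP (chart_dom_center q)).
exists r, (Num.min d (r / C)), (2 * C); split=> //; first by rewrite lt_min d0 divr_gt0.
 by rewrite mulr_gt0.
move=> f eta gf; rewrite le_min => /andP[e1 e2] np x xr; rewrite -mulrA.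
by apply: hr gf (nballxx _ r0) xr _ (h f eta gf e1 np); rewrite mulrC -ler_pdivlMr.
Qed.

Lemma near_id_eq a q eta f : eta <= 0 -> chart_dom M a q ->
 near_id a (chart M a q) eta f -> f q = q.
Proof.
move=> e0 Dq [[t [[_ Dt] Ft] et] h _].
have tq : t = q by rewrite -(chartK Dt) et chartK.
rewrite {t et}tq in Dt Ft.
have : `|rep a a f (chart M a q) - chart M a q| <= 0 by exact: le_trans e0.
rewrite normr_le0 subr_eq0 /rep chartK // => /eqP h'.
by rewrite -(chartK Ft) h' chartK.
Qed.

(** The case [eta = 0]: linear control turns a trivial 1-jet at [p] into zero displacement
    everywhere. *)
Lemma isometry_fix p f : global_isometry f -> near_id p (chart M p p) 0 f -> forall q, f q = q.
Proof.
move=> gf hf q; have [d [C [d0 C0 h]]] := controls_all p q.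
have := h f 0 gf (ltW d0) hf; rewrite mulr0; apply: near_id_eq => //.
exact: chart_dom_center.
Qed.

End NearIdentity.

Lemma continuous_pair {R : realType} (T : topologicalType) (E F : normedModType R)
  (f : T -> E) (h : T -> F) t : {for t, continuous f} -> {for t, continuous h} ->
 {for t, continuous (fun s => (f s, h s))}.
Proof. by apply: cvg_pair. Qed.

(** * Geodesics and products of symmetries *)
Section Gronwall.
Context {R : realType} (F : normedModType R).

(** The contraction estimate for a single curve without forcing, on an interval so short that
    [L * S <= 2^-1]; scaling time by [t - a] reduces it to [[0, 1]]. *)
Lemma gronwall_zero (D D' : R -> F) (a S L : R) :
 (forall t, `|t - a| <= S -> cder D t (D' t) /\ `|D' t| <= L * `|D t|) ->
 0 <= L -> L * S <= 2^-1 -> D a = 0 -> forall t, `|t - a| <= S -> D t = 0.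
Proof.
move=> hD L0 LS Da t ht; pose c := t - a.
have seg (s : R) : 0 <= s <= 1 -> `|a + c * s - a| <= S.
 move=> /andP[s0 s1]; rewrite addrC addKr normrM (ger0_norm s0).
 by apply: le_trans ht; rewrite ler_piMr.
have cd (s : R) : 0 <= s <= 1 -> cder (fun s => D (a + c * s)) s (c *: D' (a + c * s)).
 by move=> /seg /hD[h _]; exact: cder_reparam h.
have := @family_contraction _ F unit (fun _ s => D (a + c * s)) (fun _ s => c *: D' (a + c * s)) 0 0.
move=> /(_ _ _ _ _ tt 1) h.
have : `|D (a + c * 1)| <= 2 * (0 + 0).
 apply: h; last by rewrite ler01 lexx.
 - by move=> _; exact: cd.
 - have [||B hB] := @segment_bounded _ (fun s B => `|D (a + c * s)| <= B); last by exists B => _.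
   by move=> s B B' BB h1; exact: le_trans BB.
  move=> s hs; have /continuousP cont := cder_continuous (cd s hs).
  have [d d0 hd] := cont 1 ltr01; exists d => //; exists (1 + `|D (a + c * s)|) => s' _ /hd.
  by have := ler_normD (D (a + c * s') - D (a + c * s)) (D (a + c * s)); rewrite subrK; lin.
 - move=> M hM _ s hs; rewrite addr0 normrZ; have [_ h1] := hD _ (seg s hs).
  have h2 := hM tt s hs; have M0 : 0 <= M by apply: le_trans h2.
  have h4 := ler_wpM2r M0 LS.
  have h5 : `|c| * `|D' (a + c * s)| <= S * (L * M).
   by apply: ler_pM => //; exact: le_trans (ler_wpM2l L0 h2).
  by lin.
 - by move=> _; rewrite mulr0 addr0 Da normr0.
by rewrite addr0 mulr0 mulr1 addrC subrK normr_le0 => /eqP.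
Qed.

End Gronwall.

Section GeodesicFrames.
Context {R : realType} (H : hilbert R).
Variables (U : set H) (g : H -> H -> H -> R).
Hypothesis gU : local_metric U g.

Local Notation Gam := (christoffel_of g).

(* A geodesic y with velocity u, and a parallel vector field e along it. *)
Definition frame_at (y u e : R -> H) (t : R) : Prop :=
 [/\ cder y t (u t), cder u t (- Gam (y t) (u t) (u t)) & cder e t (- Gam (y t) (u t) (e t))].

(** Reversing time changes the sign of the velocity: the geodesic equation is quadratic in it, and
    in the equation of a parallel field the sign is compensated by that of the time derivative. *)
Lemma frame_reflect y u e a t : U (y (a - t)) -> frame_at y u e (a - t) ->
 frame_at (fun s => y (a - s)) (fun s => - u (a - s)) (fun s => e (a - s)) t.
Proof.
move=> Ua [hy hu he]; have [_ _ Gl Gr] := christoffel_family gU.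
have refl (w : R -> H) w' : cder w (a - t) w' -> cder (fun s => w (a - s)) t (- w').
 move=> hw; have e1 : a - t = a + (-1) * t by rewrite mulN1r.
 rewrite e1 in hw; have := cder_reparam hw; rewrite scaleN1r.
 by rewrite (_ : (fun s => w (a + -1 * s)) = fun s => w (a - s)) //; apply/funext => s; rewrite mulN1r.
split; first exact: refl.
- apply: (cder_eq (cderN (refl _ _ hu))); rewrite !opprK.
 by rewrite (lin_opp _ (Gl _ _ Ua)) (lin_opp _ (Gr _ _ Ua)) !opprK.
- by apply: (cder_eq (refl _ _ he)); rewrite (lin_opp _ (Gl _ _ Ua)).
Qed.

Lemma frame_opp y u e t : U (y t) -> frame_at y u e t -> frame_at y u (fun s => - e s) t.
Proof.
move=> Ua [hy hu he]; have [_ _ Gl Gr] := christoffel_family gU; split; [exact: hy|exact: hu|].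
by apply: (cder_eq (cderN he)); rewrite (lin_opp _ (Gr _ _ Ua)).
Qed.

Let dist3_le (a b c d : H) x1 x2 x3 :
 `|a - b| <= x1 -> `|b - c| <= x2 -> `|c - d| <= x3 -> `|a - d| <= x1 + x2 + x3.
Proof. by move: (ler_distD b a d) (ler_distD c b d); lin. Qed.

Lemma christoffel_lipschitz x0 : U x0 -> exists rho C : R, [/\ 0 < rho, 0 < C, nball x0 rho `<=` U,
 forall y u v, nball x0 rho y -> `|Gam y u v| <= C * `|u| * `|v| &
 forall y z u v w t, nball x0 rho y -> nball x0 rho z -> `|Gam y u v - Gam z w t| <=
  C * `|y - z| * `|u| * `|v| + C * `|u - w| * `|v| + C * `|w| * `|v - t|].
Proof.
move=> Ux; have fG := christoffel_family gU; have [_ _ Gl Gr] := fG.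
have [r [C [r0 C0 rU hG]]] := family2_bound fG Ux; exists r, C; split=> //.
 by move=> y u v hy; have [] := hG y y hy hy u v.
move=> y z u v w t hy hz.
have [_ b1 _ _] := hG z y hz hy u v.
have [b2 _ _ _] := hG z z hz hz (u - w) v; have [b3 _ _ _] := hG z z hz hz w (v - t).
have e2 : Gam z (u - w) v = Gam z u v - Gam z w v by exact: lin_sub _ _ (Gl z v (rU _ hz)).
have e3 : Gam z w (v - t) = Gam z w v - Gam z w t by exact: lin_sub _ _ (Gr z w (rU _ hz)).
rewrite e2 in b2; rewrite e3 in b3.
exact: dist3_le b1 b2 b3.
Qed.

(** The geodesic equation is only locally Lipschitz in the velocity, so uniqueness is stated for
    velocities bounded by [V] on an interval whose length depends on [V]. The parallel fields are
    compared once the geodesics agree. *)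
Lemma frame_unique x0 : U x0 -> exists rho C : R, [/\ 0 < rho, 0 < C, nball x0 rho `<=` U &
 forall (V S a : R) y u e y' u' e', 0 <= V -> (1 + C * V ^+ 2 + 2 * C * V) * S <= 2^-1 ->
 (forall t, `|t - a| <= S -> [/\ frame_at y u e t, frame_at y' u' e' t, nball x0 rho (y t),
   nball x0 rho (y' t) & `|u t| <= V /\ `|u' t| <= V]) ->
 y a = y' a -> u a = u' a -> e a = e' a ->
 forall t, `|t - a| <= S -> [/\ y t = y' t, u t = u' t & e t = e' t]].
Proof.
move=> Ux; have [rho [C [rho0 C0 rhoU hb hl]]] := christoffel_lipschitz Ux.
exists rho, C; split=> // V S a y u e y' u' e' V0 LS hf ya ua ea.
pose L := 1 + C * V ^+ 2 + 2 * C * V.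
have CV : 0 <= C * V by rewrite mulr_ge0 // ltW.
have CV2 : 0 <= C * V ^+ 2 by rewrite mulrA; exact: mulr_ge0.
have L0 : 0 <= L by rewrite /L; lin.
have yu t : `|t - a| <= S -> y t = y' t /\ u t = u' t.
 pose D s := (y s - y' s, u s - u' s).
 pose D' s := (u s - u' s, - Gam (y s) (u s) (u s) - - Gam (y' s) (u' s) (u' s)).
 have key s : `|s - a| <= S -> D s = 0.
  apply: (@gronwall_zero _ _ D D' a S L) => // [w hw|].
   have [[f1 f2 _] [f1' f2' _] b b' [hV hV']] := hf w hw.
   split; first by apply: cder_pair; exact: cderB.
   have n1 := norm_fst_le (D w); have n2 := norm_snd_le (D w); rewrite /= in n1 n2.
   rewrite norm_pair_le; apply/andP; split.
    by apply: (le_trans n2); rewrite ler_peMl // /L; lin.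
   have -> : - Gam (y w) (u w) (u w) - - Gam (y' w) (u' w) (u' w) =
     - (Gam (y w) (u w) (u w) - Gam (y' w) (u' w) (u' w)) by module R.
   rewrite normrN; via (hl _ _ _ _ _ _ b b').
   have [Cp u0] := (ltW C0, normr_ge0 (u w)).
   have q1 : C * `|y w - y' w| * `|u w| * `|u w| <= C * `|D w| * V * V.
    have := ler_wpM2l Cp n1 => q; do 2! (apply: ler_pM => //; first by rewrite ?mulr_ge0).
   have q2 : C * `|u w - u' w| * `|u w| <= C * `|D w| * V.
    by apply: ler_pM => //; [rewrite mulr_ge0|apply: ler_wpM2l].
   have q3 : C * `|u' w| * `|u w - u' w| <= C * V * `|D w|.
    by apply: ler_pM => //; [rewrite mulr_ge0|apply: ler_wpM2l].
   have Dn := normr_ge0 (D w); rewrite /L expr2; lin.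
  by rewrite /D ya ua !subrr.
 move=> ht; have := key t ht; rewrite /D => -[/eqP + /eqP]; rewrite !subr_eq0.
 by move=> /eqP-> /eqP->.
move=> t ht; have [e1 e2] := yu t ht; split=> //.
pose D s := e s - e' s.
pose D' s := - Gam (y s) (u s) (e s) - - Gam (y' s) (u' s) (e' s).
suff : D t = 0 by move=> /eqP; rewrite subr_eq0 => /eqP.
apply: (@gronwall_zero _ _ D D' a S L) => // [w hw|]; last by rewrite /D ea subrr.
have [[_ _ f3] [_ _ f3'] b b' [hV hV']] := hf w hw.
split; first exact: cderB.
have [e3 e4] := yu w hw; rewrite /D' -e3 -e4.
have -> : - Gam (y w) (u w) (e w) - - Gam (y w) (u w) (e' w) =
 - (Gam (y w) (u w) (e w) - Gam (y w) (u w) (e' w)) by module R.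
rewrite normrN; via (hl _ _ _ _ _ _ b b).
rewrite !subrr !normr0 !(mulr0, mul0r) !add0r.
apply: ler_wpM2r => //; have : C * `|u w| <= C * V by rewrite ler_wpM2l // ltW.
by rewrite /L; lin.
Qed.

(** Picard for the first-order system of position and velocity on [H * H]. The radius [r] is at most
    1, which gives the bound on the velocity. *)
Lemma geodesic_exists x0 v (s : R) : U x0 -> 0 < s -> exists (T : R) (y u : R -> H),
 [/\ 0 < T, y 0 = x0, u 0 = v & forall t, `|t| < T ->
  [/\ nball x0 s (y t), U (y t), `|u t| <= `|v| + 1, cder y t (u t) &
   cder u t (- Gam (y t) (u t) (u t))]].
Proof.
move=> Ux s0; have [rho [C [rho0 C0 rhoU hb hl]]] := christoffel_lipschitz Ux.
pose r := Num.min 1 (Num.min rho s / 2).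
have r0 : 0 < r by rewrite lt_min ltr01 divr_gt0 // lt_min rho0.
have [r1 r2] : r <= 1 /\ r <= Num.min rho s / 2 by rewrite !ge_min !lexx orbT.
have [r3 r4] : r < rho /\ r < s.
 have : Num.min rho s <= rho /\ Num.min rho s <= s by rewrite !ge_min !lexx orbT.
 lin.
pose V := `|v| + 1; have V1 : 1 <= V by rewrite /V; have := normr_ge0 v; lin.
pose K := V + C * V * V; pose L := 1 + C * V * V + 2 * (C * V).
have CV : 0 <= C * V by apply: mulr_ge0; lin.
have CVV : 0 <= C * V * V by apply: mulr_ge0; lin.
have K0 : 0 < K by rewrite /K; lin.
have L0 : 0 < L by rewrite /L; lin.
pose T := Num.min (r / K) (2^-1 / L).
have T0 : 0 < T by rewrite lt_min !divr_gt0.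
have [T1 T2] : T <= r / K /\ T <= 2^-1 / L by rewrite !ge_min !lexx orbT.
pose G (t : R) (z : H * H) := (z.2, - Gam z.1 z.2 z.2).
have inball (z : H * H) : `|z - (x0, v)| <= r -> nball x0 rho z.1 /\ `|z.2| <= V.
 case: z => z1 z2; rewrite -[(z1, z2) - (x0, v)]/(z1 - x0, z2 - v) norm_pair_le => /andP[a b].
 split; first exact: le_lt_trans r3.
 by have := ler_normD (z2 - v) v; rewrite subrK /V; lin.
have [|||||z [z0 hz]] := @picard _ (H * H)%type (cauchy_complete_prod (@complete_cauchy _ H) (@complete_cauchy _ H)) (has_primitives_prod (@hilbert_primitives _ H) (@hilbert_primitives _ H)) G (x0, v) T r K L T0 (ltW K0) (ltW L0).
- move=> z cz hz t.
 have cG : {for z t, continuous (fun z : H * H => Gam z.1 z.2 z.2)}.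
  have [oU sG _ _] := christoffel_family gU.
  have [b _] := inball _ (hz t).
  have oV : open (U `*` [set: H]) by exact: openXT.
  have sG' : smooth_on (U `*` [set: H]) (fun z : H * H => Gam z.1 z.2 z.2).
   move=> n; apply: (Ck_comp3 oV (sG n)); first by move=> w [].
   - by Ck_auto.
   - by Ck_auto.
   - by Ck_auto.
  by apply: (smooth_cont sG'); split=> //; exact: rhoU.
 apply: (@continuous_comp _ _ _ z (fun z : H * H => (z.2, - Gam z.1 z.2 z.2))); first exact: cz.
 apply: cvg_pair; first by apply: cvg_snd.
 by apply: cvgN; exact: cG.
- move=> t w hw; have [b hV] := inball w hw.
 rewrite norm_pair_le normrN; apply/andP; split; first by rewrite /K; lin.
 via (hb _ _ _ b); have w0 := normr_ge0 w.2.
 have : C * `|w.2| * `|w.2| <= C * V * V.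
  by apply: ler_pM => //; [rewrite mulr_ge0 // ltW|apply: ler_wpM2l => //; exact: ltW].
 by rewrite /K; lin.
- move=> t w w' hw hw'; have [b hV] := inball w hw; have [b' hV'] := inball w' hw'.
 have n1 := norm_fst_le (w - w'); have n2 := norm_snd_le (w - w'); rewrite /= in n1 n2.
 rewrite -[G t w - G t w']/(w.2 - w'.2, - Gam w.1 w.2 w.2 - - Gam w'.1 w'.2 w'.2).
 have -> : - Gam w.1 w.2 w.2 - - Gam w'.1 w'.2 w'.2 = - (Gam w.1 w.2 w.2 - Gam w'.1 w'.2 w'.2) by module R.
 rewrite norm_pair_le normrN; apply/andP; split.
  by apply: (le_trans n2); rewrite ler_peMl // /L; lin.
 via (hl _ _ _ _ _ _ b b'); have Cp := ltW C0.
 have q1 : C * `|w.1 - w'.1| * `|w.2| * `|w.2| <= C * `|w - w'| * V * V.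
  apply: ler_pM => //; first by rewrite !mulr_ge0.
  apply: ler_pM => //; first by rewrite mulr_ge0.
  exact: ler_wpM2l.
 have q2 : C * `|w.2 - w'.2| * `|w.2| <= C * `|w - w'| * V.
  by apply: ler_pM => //; [rewrite mulr_ge0|apply: ler_wpM2l].
 have q3 : C * `|w'.2| * `|w.2 - w'.2| <= C * V * `|w - w'|.
  by apply: ler_pM => //; [rewrite mulr_ge0|apply: ler_wpM2l].
 have wn := normr_ge0 (w - w'); rewrite /L; lin.
- by rewrite -ler_pdivlMl // mulrC.
- by rewrite -ler_pdivlMl // mulrC.
exists T, (fun t => (z t).1), (fun t => (z t).2); split=> //; try by rewrite z0.
move=> t /hz[h1 h2]; have [b hV] := inball _ h1.
have cfst (p q : H * H) : `|p - q| <= r -> `|p.1 - q.1| <= r.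
 by move=> h; apply: le_trans h; exact: (norm_fst_le (p - q)).
split=> //.
- by apply: le_lt_trans r4; exact: (cfst _ (x0, v)).
- exact: rhoU.
- apply: (cder_eq (@cder_linear _ _ _ fst z t _ _ _ h2)) => //.
 by exists 1 => w; rewrite mul1r; exact: norm_fst_le.
- apply: (cder_eq (@cder_linear _ _ _ snd z t _ _ _ h2)) => //.
 by exists 1 => w; rewrite mul1r; exact: norm_snd_le.
Qed.

(** All parallel fields must live on one interval. Their equation is linear, so [picard] is run for
    initial vectors of norm at most 1 and the solutions are scaled. *)
Lemma frame_exists x0 v (s : R) : U x0 -> 0 < s -> exists (T : R) (y u : R -> H) (e : H -> R -> H),
 [/\ 0 < T, y 0 = x0, u 0 = v, (forall k, e k 0 = k) & forall t, `|t| < T ->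
  [/\ nball x0 s (y t), U (y t), `|u t| <= `|v| + 1 & forall k, frame_at y u (e k) t]].
Proof.
move=> Ux s0; have [rho [C [rho0 C0 rhoU hb hl]]] := christoffel_lipschitz Ux.
have [T1 [y [u [T10 y0 u0 hyu]]]] := @geodesic_exists x0 v (Num.min rho s) Ux ltac:(by rewrite lt_min rho0).
have [m1 m2] : Num.min rho s <= rho /\ Num.min rho s <= s by rewrite !ge_min !lexx orbT.
pose V := `|v| + 1; have V1 : 1 <= V by rewrite /V; have := normr_ge0 v; lin.
have CV : 0 < C * V by apply: mulr_gt0; lin.
pose T := Num.min (T1 / 2) (2^-1 / (C * V)).
have T0 : 0 < T by rewrite lt_min !divr_gt0.
have [T2 T3] : T <= T1 / 2 /\ T <= 2^-1 / (C * V) by rewrite !ge_min !lexx orbT.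
have cl t : `|clamp T t| < T1 by apply: (le_lt_trans (clamp_le t (ltW T0))); lin.
pose G t w := - Gam (y (clamp T t)) (u (clamp T t)) w.
have ex k : exists e, e 0 = k /\ forall t, `|t| < T -> cder e t (- Gam (y t) (u t) (e t)).
 have unit_ex k1 : `|k1| <= 1 ->
   exists e, e 0 = k1 /\ forall t, `|t| < T -> cder e t (- Gam (y t) (u t) (e t)).
  move=> k11.
  (* The ball of [picard] around [k1] has radius 1, so its vectors have norm at most 2. *)
  have K0 : 0 <= 2 * (C * V) by lin.
  have [|||||e [e0 he]] := @picard _ H (@complete_cauchy _ H) (@hilbert_primitives _ H) G k1 T 1
   (2 * (C * V)) (C * V) T0 K0 (ltW CV).
  - move=> w cw hw t; have [b Ub _ cy cu] := hyu _ (cl t).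
   have [oU sG _ _] := christoffel_family gU.
   have c1 : {for t, continuous (fun t => (y (clamp T t), (u (clamp T t), w t)))}.
    have cc := @clamp_continuous _ T (ltW T0) t.
    exact: (continuous_pair (continuous_comp cc (cder_continuous cy)) (continuous_pair (continuous_comp cc (cder_continuous cu)) (cw t))).
   apply: cvgN; apply: (@continuous_comp _ _ _ (fun t => (y (clamp T t), (u (clamp T t), w t)))
     (fun z : H * (H * H) => Gam z.1 z.2.1 z.2.2)); first exact: c1.
   by apply: (smooth_cont sG).
  - move=> t w hw; have [b Ub hV _ _] := hyu _ (cl t).
   rewrite normrN; via (hb _ _ _ (lt_le_trans b m1)).
   have w2 : `|w| <= 2 by have := ler_normD (w - k1) k1; rewrite subrK; lin.
   have : C * `|u (clamp T t)| <= C * V by apply: ler_wpM2l => //; exact: ltW.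
   have Cu : 0 <= C * `|u (clamp T t)| by rewrite mulr_ge0 // ltW.
   by move=> h; rewrite [2 * _]mulrC; apply: ler_pM.
  - move=> t w w' _ _; have [b Ub hV _ _] := hyu _ (cl t).
   have [_ _ _ Gr] := christoffel_family gU.
   have s1 : G t w - G t w' = - Gam (y (clamp T t)) (u (clamp T t)) (w - w').
    have e1 : Gam (y (clamp T t)) (u (clamp T t)) (w - w') =
      Gam (y (clamp T t)) (u (clamp T t)) w - Gam (y (clamp T t)) (u (clamp T t)) w'.
     exact: (lin_sub _ _ (Gr _ _ Ub)).
    by rewrite e1 /G; module R.
   rewrite s1 normrN; via (hb _ _ _ (lt_le_trans b m1)).
   by apply: ler_wpM2r => //; apply: ler_wpM2l => //; exact: ltW.
  - by rewrite -mulrA; have := ler_wpM2l (ltW CV) T3; rewrite mulrCA mulfV ?gt_eqF //; lin.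
  - by have := ler_wpM2l (ltW CV) T3; rewrite mulrCA mulfV ?gt_eqF //; lin.
  exists e; split=> // t ht; have [_ h] := he t ht.
  by move: h; rewrite /G clamp_id // ltW.
 have [->|k0] := eqVneq k 0.
  by apply: unit_ex; rewrite normr0.
 have nk : 0 < `|k| by rewrite normr_gt0.
 have [|e [e0 he]] := unit_ex (`|k|^-1 *: k).
  by rewrite normrZ normfV normr_id mulVf ?gt_eqF.
 exists (fun t => `|k| *: e t); split; first by rewrite e0 scalerA mulfV ?gt_eqF // scale1r.
 move=> t ht; apply: (cder_eq (cderZ `|k| (he t ht))).
 have [_ Ub _ _ _] := hyu t ltac:(lin).
 have [_ _ _ Gr] := christoffel_family gU.
 by rewrite (lin_scale _ _ (Gr _ _ Ub)) scalerN.
have [e he] := choice ex.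
exists T, y, u, e; split=> //; first by move=> k; have [] := he k.
move=> t ht; have [b Ub hV cy cu] := hyu t ltac:(lin).
split; [exact: (lt_le_trans b m2)|exact: Ub|exact: hV|].
by move=> k; have [_ h] := he k; split; [exact: cy|exact: cu|exact: (h t ht)].
Qed.

End GeodesicFrames.

Section FrameImage.
Context {R : realType} (H H' : hilbert R).
Variables (U : set H) (g : H -> H -> H -> R) (U' : set H') (g' : H' -> H' -> H' -> R).
Hypotheses (gU : local_metric U g) (gU' : local_metric U' g').

(** By [local_isometry_second_diff] the derivative of the differential along the curve contributes a
    term that cancels the image of the old Christoffel symbol and leaves the new one. *)
Lemma frame_image (V : set H) (F : H -> H') y u e t : local_isometry U g U' g' V F ->
 (forall x, V x -> forall w, exists w', 'd F x w' = w) -> V (y t) ->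
 frame_at g y u e t ->
 frame_at g' (fun s => F (y s)) (fun s => 'd F (y s) (u s)) (fun s => 'd F (y s) (e s)) t.
Proof.
move=> iF surj Vt [hy hu he]; have [oV sF VU FU _] := iF.
have fF := diff_smooth_family oV sF.
have cancel (a b : H') : a - b + - a = - b by rewrite addrAC subrr add0r.
split; first by apply: (cder_comp (f := F) _ hy); exact: smooth_diff sF Vt.
- apply: (cder_eq (cder_family1 fF Vt hy hu)).
 by apply: (etrans (f_equal2 (fun a b : H' => a + b) (local_isometry_second_diff gU gU' (u t) (u t) iF Vt (surj _ Vt)) (diff_opp F (y t) (christoffel_of g (y t) (u t) (u t))))); exact: cancel.
apply: (cder_eq (cder_family1 fF Vt hy he)).
by apply: (etrans (f_equal2 (fun a b => a + b) (local_isometry_second_diff gU gU' (u t) (e t) iF Vt (surj _ Vt)) (diff_opp F (y t) (christoffel_of g (y t) (u t) (e t))))).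
Qed.

End FrameImage.

Section LocalGroups.
Context {R : realType} (T : Type) (tau : R -> T -> T) (eps : R).
Hypothesis eps0 : 0 < eps.
Hypothesis tau0 : forall q, tau 0 q = q.
Hypothesis tauD : forall s t, `|s| < eps -> `|t| < eps -> `|s + t| < eps ->
 forall q, tau (s + t) q = tau s (tau t q).

Let iter_tau (u : R) (m : nat) : (0 < m)%N -> `|u| < eps ->
 forall q, iter m (tau (u / m%:R)) q = tau u q.
Proof.
move=> m0 hu q; have mR : 0 < m%:R :> R by rewrite ltr0n.
suff h j : (j <= m)%N -> iter j (tau (u / m%:R)) q = tau (u * (j%:R / m%:R)) q.
 by rewrite h // mulfV ?mulr1 // gt_eqF.
elim: j => [|j IH] jm; first by rewrite mul0r mulr0.
rewrite iterS IH; last exact: ltnW.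
have small (i : nat) : (i <= m)%N -> `|u * (i%:R / m%:R)| < eps.
 move=> im; rewrite normrM; apply: le_lt_trans hu; rewrite ler_piMr // ger0_norm //.
 by rewrite ler_pdivrMr // mul1r ler_nat.
have e : u * (j.+1%:R / m%:R) = u / m%:R + u * (j%:R / m%:R) by lin.
rewrite e tauD //; [|exact/small/ltnW|by rewrite -e; exact: small].
by have := small 1%N (leq_trans (ltn0Sn j) jm); rewrite div1r.
Qed.

Let iter_indep (t : R) (n n' : nat) : (0 < n)%N -> (0 < n')%N -> `|t| < eps * n%:R -> `|t| < eps * n'%:R ->
 forall q, iter n (tau (t / n%:R)) q = iter n' (tau (t / n'%:R)) q.
Proof.
suff h (m k : nat) : (0 < m)%N -> (0 < k)%N -> `|t| < eps * m%:R ->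
  forall q, iter m (tau (t / m%:R)) q = iter (m * k) (tau (t / (m * k)%:R)) q.
 by move=> n0 n'0 hn hn' q; rewrite (h n n') // (h n' n) // mulnC.
move=> m0 k0 hm q; have mR : 0 < m%:R :> R by rewrite ltr0n.
have e q' : iter k (tau (t / (m * k)%:R)) q' = tau (t / m%:R) q'.
 rewrite natrM invfM mulrA; apply: iter_tau => //.
 by rewrite normrM normfV (ger0_norm (ltW mR)) ltr_pdivrMr.
elim: m {hm m0 mR} (t / m%:R) (t / (m * k)%:R) q e => [|m IH] u w q e //.
by rewrite iterD -(IH u w q e).
Qed.

(** The [n]-th iterate of [tau (t / n)] does not depend on [n] once [n] is large, by passing to a
    common multiple. The last clause presents each [Phi t] as a finite composition, hence an
    isometry if the [tau s] are. *)
Lemma local_group_extend : exists Phi : R -> T -> T,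
 [/\ forall s t q, Phi (s + t) q = Phi s (Phi t q),
  forall t, `|t| < eps -> forall q, Phi t q = tau t q &
  forall t, exists (n : nat) s, `|s| < eps /\ forall q, Phi t q = iter n (tau s) q].
Proof.
pose N (t : R) := Num.bound (`|t| / eps).
have NP t : (0 < N t)%N /\ `|t| < eps * (N t)%:R.
 have h := @archi_boundP R (`|t| / eps) (divr_ge0 (normr_ge0 _) (ltW eps0)).
 split; last by rewrite mulrC -ltr_pdivrMr.
 by rewrite -(ltr0n R); apply: le_lt_trans h; rewrite divr_ge0 // ltW.
pose Phi t q := iter (N t) (tau (t / (N t)%:R)) q.
have PhiE t n q : (0 < n)%N -> `|t| < eps * n%:R -> Phi t q = iter n (tau (t / n%:R)) q.
 by move=> n0 hn; have [h1 h2] := NP t; exact: iter_indep.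
exists Phi; split.
(* One [n] large enough for [s], [t] and [s + t]; the small steps commute, so their powers
   multiply. *)
- move=> s t q; pose n := N (`|s| + `|t|); have [n0 hn] := NP (`|s| + `|t|).
 rewrite -/n ger0_norm // in n0 hn.
 have nR : 0 < n%:R :> R by [].
 have [h1 h2] : `|s| < eps * n%:R /\ `|t| < eps * n%:R.
  by have := normr_ge0 s; have := normr_ge0 t; lin.
 have h3 : `|s + t| < eps * n%:R by apply: le_lt_trans hn; exact: ler_normD.
 rewrite (PhiE (s + t) n) // (PhiE s n) // (PhiE t n) //.
 have small w : `|w| < eps * n%:R -> `|w / n%:R| < eps.
  by move=> hw; rewrite normrM normfV (ger0_norm (ltW nR)) ltr_pdivrMr.
 move: (small _ h3) (small _ h2) (small _ h1); rewrite mulrDl.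
 move: (s / n%:R) (t / n%:R) => a b hab hb ha.
 have comm r : tau a (tau b r) = tau b (tau a r) by rewrite -!tauD ?[b + a]addrC.
 have commn m r : tau b (iter m (tau a) r) = iter m (tau a) (tau b r).
  by elim: m r => [|m IH] r //; rewrite !iterS -comm IH.
 suff h m r : iter m (tau (a + b)) r = iter m (tau a) (iter m (tau b) r) by [].
 by elim: m r => [|m IH] r //; rewrite !iterS IH tauD // commn.
- move=> t ht q; rewrite (PhiE t 1%N) //; last by rewrite mulr1.
 by rewrite /= divr1.
- move=> t; exists (N t), (t / (N t)%:R); split=> //; have [h1 h2] := NP t.
 have nR : 0 < (N t)%:R :> R by [].
 by rewrite normrM normfV (ger0_norm (ltW nR)) ltr_pdivrMr.
Qed.

End LocalGroups.

Section IsometryComposition.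
Context {R : realType} {H : hilbert R} {M : riemannian H}.

Lemma global_isometry_at (f : M -> M) q : global_isometry f -> isometric_at f q.
Proof. by move=> [f' iF]; exact: (isometry_at iF I). Qed.

Lemma global_isometry_rep (f : M -> M) a : global_isometry f -> rep_isometry a a f (rep_dom setT a a f).
Proof. by move=> gf; apply: rep_isometry_dom => [|q _]; [exact: openT|exact: global_isometry_at]. Qed.

Lemma global_isometry_surj (f : M -> M) a x : global_isometry f -> rep_dom setT a a f x ->
 forall w, exists w', 'd (rep a a f) x w' = w.
Proof. by move=> [f' iF]; exact: rep_surjective iF _. Qed.

Lemma global_isometry_comp (f h : M -> M) : global_isometry f -> global_isometry h ->
 global_isometry (f \o h).
Proof. by move=> [f' iF] [h' iH]; exists (h' \o f'); exact: isometry_comp iH iF. Qed.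

Lemma global_isometry_id : global_isometry (@id M).
Proof.
by exists id; apply: isometric_between => //; [exact: openT|exact: openT|..];
 move=> q _; exact: isometric_at_id.
Qed.

Lemma rep_comp (f h : M -> M) a x : global_isometry f -> global_isometry h ->
 rep_dom setT a a h x -> rep_dom setT a a f (rep a a h x) ->
 [/\ rep_dom setT a a (f \o h) x, rep a a (f \o h) x = rep a a f (rep a a h x) &
  forall k, 'd (rep a a (f \o h)) x k = 'd (rep a a f) (rep a a h x) ('d (rep a a h) x k)].
Proof.
move=> gf gh Vx Vhx; have [oF sF _ _ _] := global_isometry_rep a gf.
have [oH sH _ _ _] := global_isometry_rep a gh.
have pt y : rep_dom setT a a h y -> rep_dom setT a a f (rep a a h y) ->
  rep_dom setT a a (f \o h) y /\ rep a a (f \o h) y = rep a a f (rep a a h y).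
 move=> [q [[_ Dq] Fq] <-]; rewrite {1 3}/rep (chartK Dq) => -[q' [[_ Dq'] Fq'] e].
 have eq : q' = h q by rewrite -(chartK Dq') e chartK.
 rewrite {q' Dq' e}eq in Fq'.
 by split; [exists q|rewrite /rep /= (chartK Dq) (chartK Fq)].
have [h1 h2] := pt x Vx Vhx; split=> // k.
have dH := smooth_diff sH Vx; have dF := smooth_diff sF Vhx.
have n : \forall y \near x, (rep a a f \o rep a a h) y = rep a a (f \o h) y.
 apply: filterS2 (open_near oH Vx) (continuous_open_near (smooth_cont sH Vx) oF Vhx) => y Vy Vhy.
 by have [_ ->] := pt y Vy Vhy.
have [_ e] := diff_near n (differentiable_comp dH dF).
exact: etrans (congr1 (fun L => L k) e) (congr1 (fun L => L k) (diff_comp dH dF)).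
Qed.

(** The composite [h' \o f] has a trivial 1-jet at [p], so [isometry_fix] applies to it. *)
Lemma isometry_eq (f h : M -> M) p : global_isometry f -> global_isometry h ->
 let x := chart M p p in
 rep_dom setT p p f x -> rep_dom setT p p h x -> rep p p f x = rep p p h x ->
 (forall k, 'd (rep p p f) x k = 'd (rep p p h) x k) -> forall q, f q = h q.
Proof.
move=> gf gh x Vf Vh exf edf; have [h' iH] := gh; have [_ [_ hK] _ _] := iH.
have gh' : global_isometry h' by exists h; exact: isometry_sym.
have [_ [hh' h'h] _ _] := iH.
have Dp := chart_dom_center p.
have domP (t : M -> M) : rep_dom setT p p t x -> chart_dom M p (t p).
 move=> [q [[_ Dq] Fq] e].
 have eq : q = p by rewrite -(chartK Dq) e chartK.
 by rewrite eq in Fq.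
have [Df Dh] := (domP _ Vf, domP _ Vh).
have eV : rep p p h x = chart M p (h p) by rewrite /rep chartK.
have Vh' : rep_dom setT p p h' (rep p p h x).
 by rewrite eV; exists (h p) => //; split=> //=; rewrite (hh' p I).2.
have Vh'f : rep_dom setT p p h' (rep p p f x) by rewrite exf.
have [c1 c2 c3] := rep_comp gh' gf Vf Vh'f.
have [d1 d2 d3] := rep_comp gh' gh Vh Vh'.
have fh : forall q, (h' \o f) q = q.
 apply: (isometry_fix (p := p)); first exact: global_isometry_comp.
 split=> //.
  by rewrite c2 exf eV /rep chartK // (hh' p I).2 subrr normr0.
 move=> k; rewrite mul0r normr_le0 subr_eq0; apply/eqP.
 have e1 : 'd (rep p p (h' \o h)) x k = k.
  have n : \forall y \near x, y = rep p p (h' \o h) y.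
   apply: filterS (open_near (@chart_image_open _ _ M p) (chart_imageP Dp)) => y Oy.
   by rewrite /rep /= (hh' _ I).2; have [_ ->] := chart_invP Oy.
  have d : is_diff x (@id H) (@id H).
   by apply: is_diff_linear => //; exists 1 => w; rewrite mul1r.
  by have [_ e] := is_diff_near n d; exact: (congr1 (fun L : H -> H => L k) e).
 apply: (etrans (c3 k)); rewrite exf edf; exact: (etrans (esym (d3 k)) e1).
by move=> q; rewrite -[f q](h'h _ I).2 -[h' (f q)]/((h' \o f) q) fh.
Qed.

End IsometryComposition.

Section SymmetricFlow.
Context {R : realType} {H : hilbert R} {M : riemannian H}.

(** The action of a flow of transvections: the orbit of [a] is a geodesic, and the differentials at
    [a] are parallel transport along it. *)
Definition moved_frame (a : M) (T : R) (y u : R -> H) (e : H -> R -> H) (f : R -> M -> M) : Prop :=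
 [/\ 0 < T, y 0 = chart M a a, forall k, e k 0 = k,
  forall t, `|t| < T -> chart_image a (y t) /\ forall k, frame_at (local_form (metric M) a) y u (e k) t &
  forall t, `|t| < T -> [/\ rep_dom setT a a (f t) (y 0), rep a a (f t) (y 0) = y t &
   forall k, 'd (rep a a (f t)) (y 0) k = e k t]].

(** The condition on [tangent_map] refers to the chart around [c]; conjugation by a transition map
    leaves minus the identity unchanged. *)
Lemma symmetry_rep (p c : M) (s : M -> M) : isometry_between setT setT s s -> s c = c ->
 (forall v, tangent_map s c v = - v) -> chart_dom M p c ->
 let x := chart M p c in
 [/\ rep_dom setT p p s x, rep p p s x = x & forall k, 'd (rep p p s) x k = - k].
Proof.
move=> iS sc ds Dc x; have Dcc := chart_dom_center c.
have gs : global_isometry s by exists s.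
split; first by exists c => //; split=> //=; rewrite sc.
 by rewrite /rep /x chartK // sc.
move=> k; have [cs _] := global_isometry_at c gs.
have Dsc : chart_dom M c (s c) by rewrite sc.
have Dps : chart_dom M p (s c) by rewrite sc.
have dS : differentiable (rep c c s) (chart M c c).
 have [_ sS _ _ _] := global_isometry_rep c gs; apply: (smooth_diff sS).
 by exists c.
have [_ ->] := rep_diff_change cs Dc Dcc Dsc Dps dS.
have e : 'd (rep c c s) (chart M c c) (transport p c c k) = - transport p c c k.
 by have := ds (transport p c c k); rewrite /tangent_map sc.
rewrite e sc.
have e2 : transport c p c (- transport p c c k) = - transport c p c (transport p c c k).
 exact: diff_opp.
by rewrite e2 transportK.
Qed.

Hypothesis symM : symmetric_space M.

(** The image of the frame under the reflection at [y a], with the sign of the parallel fields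
    changed, and the frame run backwards from [a] agree at time [a]; uniqueness identifies them
    nearby. *)
Lemma symmetry_reflects (p : M) v : exists (s : M -> M -> M) (T : R) (y u : R -> H) (e : H -> R -> H),
 [/\ 0 < T, y 0 = chart M p p, u 0 = v, forall k, e k 0 = k &
  [/\ forall t, `|t| < T -> chart_image p (y t) /\ forall k, frame_at (local_form (metric M) p) y u (e k) t,
   forall c, isometry_between setT setT (s c) (s c) &
   forall a t, `|a| < T / 4 -> `|t| < T / 4 -> let f := s (chart_inv M p (y a)) in
   [/\ rep_dom setT p p f (y t), rep p p f (y t) = y (a + a - t) &
    forall k, 'd (rep p p f) (y t) (e k t) = - e k (a + a - t)]]].
Proof.
have [s hs] := choice symM.
have gU := local_form_metric p; set g := local_form (metric M) p in gU *.
have Ox := chart_imageP (chart_dom_center p); set x0 := chart M p p in Ox *.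
have [r1 [rho1 [C1 [[r10 C10 hr1 rho1O] [hC1 _]]]]] := isometry_control gU Ox.
have [rho2 [C2 [rho20 C20 rho2O huniq]]] := frame_unique gU Ox.
(* Small enough that the reflected geodesic stays in the ball of [frame_unique]: the differential of
   the reflection is bounded by [C1]. *)
pose r := Num.min r1 (rho2 / (2 * C1 + 2)).
have r0 : 0 < r by rewrite lt_min divr_gt0 //; lin.
have [rr1 rrho] : r <= r1 /\ r * (2 * C1 + 1) < rho2.
 split; first by rewrite ge_min lexx.
 have : r <= rho2 / (2 * C1 + 2) by rewrite /r ge_min lexx orbT.
 by rewrite ler_pdivlMr; lin.
have rC : 0 <= r * C1 by apply: mulr_ge0; exact: ltW.
have [T1 [y [u [e [T10 y0 u0 e0 hye]]]]] := frame_exists gU v Ox r0.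
(* Dominates the velocities of the geodesic and of its image under the reflection. *)
pose V := (1 + C1) * (`|v| + 1); pose L := 1 + C2 * V ^+ 2 + 2 * C2 * V.
have vn := normr_ge0 v.
have V0 : 0 <= V by apply: mulr_ge0; lin.
have V1 : `|v| + 1 <= V by rewrite /V ler_peMl; lin.
have C1V : C1 * (`|v| + 1) <= V by rewrite /V; lin.
have L0 : 0 < L.
 have : 0 <= C2 * V ^+ 2 by apply: mulr_ge0; [exact: ltW|exact: exprn_ge0].
 have : 0 <= C2 * V by apply: mulr_ge0 => //; exact: ltW.
 by rewrite /L; lin.
pose T := Num.min T1 L^-1.
have T0 : 0 < T by rewrite lt_min T10 invr_gt0.
have [TT1 TL] : T <= T1 /\ T <= L^-1 by rewrite !ge_min !lexx orbT.
have LT : L * (T / 2) <= 2^-1.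
 by have := ler_wpM2l (ltW L0) TL; rewrite mulfV ?gt_eqF //; lin.
have hy t : `|t| < T -> [/\ nball x0 r (y t), chart_image p (y t), `|u t| <= `|v| + 1 &
  forall k, frame_at g y u (e k) t].
 by move=> ht; apply: hye; lin.
exists s, T, y, u, e; split=> //; split.
- by move=> t /hy[].
- by move=> c; have [] := hs c.
move=> a t ha ht f.
have aT : `|a| < T by have := normr_ge0 a; lin.
have [ba Oa hua _] := hy a aT; pose c := chart_inv M p (y a).
have [Dc xc] := chart_invP Oa; have [iS sc ds] := hs c.
have [Va Fa DFa] := symmetry_rep iS sc ds Dc; rewrite xc in Va Fa DFa.
have gf : global_isometry f by exists f.
set F := rep p p f in Fa DFa *; set W := rep_dom setT p p f in Va *.
have iW : local_isometry (chart_image p) g (chart_image p) g W F := global_isometry_rep p gf.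
have [oW sF _ _ _] := iW.
have inr z : nball x0 r z -> nball x0 r1 z by move=> h; exact: lt_le_trans rr1.
have hCW x (Wx : W x) (b : nball x0 rho1 x) (b' : nball x0 rho1 (F x)) := hC1 W F x iW Wx b b'.
have rrho1 : r1 <= rho1 by apply: ltW; apply: le_lt_trans hr1; rewrite ler_peMr ?ltW //; lin.
have stays z : nball x0 r z -> [/\ W z, nball x0 rho1 (F z) & nball x0 rho2 (F z)].
 move=> bz.
 have st := isometry_stays r10 C10 hr1 rho1O gf (fun x Vx b b' => hCW x Vx b b') (inr _ ba) (inr _ bz) Va
  ltac:(rewrite -/F Fa subrr normr0; exact: ltW).
 have [Wz Fz] : W z /\ nball x0 rho1 (F z).
  by have := st 1 ltac:(lin); rewrite scale1r addrC subrK.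
 split=> //.
 have lip : `|F z - F (y a)| <= C1 * `|z - y a|.
  pose D (t : R) := F (y a + t *: (z - y a)).
  have := @mean_value _ _ D (fun t => 'd F (y a + t *: (z - y a)) (z - y a)) 0 1 (C1 * `|z - y a|) ler01.
  rewrite /D scale1r scale0r addr0 [y a + _]addrC subrK subr0 mulr1; apply.
   by move=> w /st[Ww _]; exact: cder_along sF Ww.
  move=> w hw; have [Ww bw] := st w hw; apply: hCW => //.
  by apply: (lt_le_trans _ rrho1); exact: (nball_segment (inr _ ba) (inr _ bz) hw).
 rewrite Fa in lip.
 have h1 := ler_distD x0 z (y a); rewrite (distrC x0) in h1.
 have h2 := ler_distD (y a) (F z) x0; have b1 := ltW ba; have b2 := ltW bz; rewrite /nball/= in b1 b2 *.
 have h3 : `|z - y a| <= 2 * r by lin.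
 have := ler_wpM2l (ltW C10) h3; lin.
have surj : forall x, W x -> forall w, exists w', 'd F x w' = w.
 by move=> x Wx; exact: (global_isometry_surj gf Wx).
have near_a w : `|w - a| <= T / 2 -> `|w| < T /\ `|a + a - w| < T.
 move=> hw; have := ler_normD (w - a) a; rewrite subrK.
 have := ler_normB a (w - a); rewrite opprB addrA; lin.
have key k w : `|w - a| <= T / 2 ->
  [/\ F (y w) = y (a + a - w), 'd F (y w) (u w) = - u (a + a - w) & - 'd F (y w) (e k w) = e k (a + a - w)].
 apply: (huniq V (T / 2) a (fun s => F (y s)) (fun s => 'd F (y s) (u s)) (fun s => - 'd F (y s) (e k s))
   (fun s => y (a + a - s)) (fun s => - u (a + a - s)) (fun s => e k (a + a - s)) V0 LT).
 - move=> z hz; have [hz1 hz2] := near_a z hz.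
  have [b1 O1 u1 f1] := hy _ hz1; have [b2 O2 u2 f2] := hy _ hz2; have [Wz Fz1 Fz2] := stays _ b1.
  split; [ | |exact: Fz2| | ].
  + by apply: (frame_opp gU); [exact: rho1O|exact: (frame_image gU gU iW surj Wz (f1 k))].
  + exact: (frame_reflect gU O2 (f2 k)).
  + by apply: (lt_trans b2); apply: le_lt_trans rrho; lin.
  + split; last by rewrite normrN; lin.
   by apply: (le_trans (hCW _ Wz (lt_le_trans (inr _ b1) rrho1) Fz1 (u z))); apply: le_trans C1V; apply: ler_wpM2l => //; exact: ltW.
 - by rewrite addrK Fa.
 - by rewrite addrK DFa.
 - by rewrite addrK DFa opprK.
have tT : `|t - a| <= T / 2 by have := ler_normB t a; lin.
have [bt Ot _ _] := hy t ltac:(have := normr_ge0 t; lin).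
have [Wt _ _] := stays _ bt; split=> //; first by have [] := key 0 t tT.
by move=> k; have [_ _ <-] := key k t tT; rewrite opprK.
Qed.

(** The reflection at [y 0] followed by that at [y (t / 2)] translates by [t] along the geodesic and
    carries its parallel fields to themselves. Hence [tau (w + t)] and [tau w \o tau t] have the
    same 1-jet at [p] and coincide. *)
Lemma symmetric_flow (p : M) v : exists (Phi : R -> M -> M) (T : R) (y u : R -> H) (e : H -> R -> H),
 [/\ forall s t q, Phi (s + t) q = Phi s (Phi t q),
  forall t, isometry_between setT setT (Phi t) (Phi (- t)),
  moved_frame p T y u e Phi & u 0 = v].
Proof.
have [s [T [y [u [e [T0 y0 u0 e0 [hy hs hrefl]]]]]]] := symmetry_reflects p v.
have gs c : global_isometry (s c) by exists (s c).
pose sig a := s (chart_inv M p (y a)).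
pose tau t := sig (t / 2) \o sig 0.
have gtau t : global_isometry (tau t) by exact: (global_isometry_comp (gs _) (gs _)).
have n00 : `|0 : R| < T / 4 by rewrite normr0; lin.
have move_tau w t : `|w| < T / 4 -> `|t| < T / 4 ->
  [/\ rep_dom setT p p (tau t) (y w), rep p p (tau t) (y w) = y (t + w) &
  forall k, 'd (rep p p (tau t)) (y w) (e k w) = e k (t + w)].
 move=> hw ht; have [a1 a2 a3] := hrefl 0 w n00 hw.
 rewrite !addr0 sub0r in a1 a2 a3.
 have ht2 : `|t / 2| < T / 4 by rewrite normrM (ger0_norm (_ : 0 <= 2^-1)); lin.
 have hw' : `|- w| < T / 4 by rewrite normrN.
 have [b1 b2 b3] := hrefl (t / 2) (- w) ht2 hw'.
 have et : t / 2 + t / 2 - - w = t + w by lin.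
 rewrite et in b2 b3; rewrite -a2 in b1.
 have [c1 c2 c3] := rep_comp (gs _) (gs _) a1 b1.
 split; [exact: c1|by rewrite c2 a2 b2|].
 move=> k; apply: (etrans (c3 (e k w))); rewrite a2 a3.
 by apply: (etrans (diff_opp _ _ _)); rewrite b3 opprK.
have e_surj w k : `|w| < T / 4 -> 'd (rep p p (tau w)) (y 0) k = e k w.
 by move=> hw; have [_ _ h] := move_tau 0 w n00 hw; have := h k; rewrite e0 addr0.
have tauD w t : `|w| < T / 4 -> `|t| < T / 4 -> `|w + t| < T / 4 ->
  forall q, tau (w + t) q = tau w (tau t q).
 move=> hw ht hwt; have [a1 a2 _] := move_tau 0 (w + t) n00 hwt.
 have [b1 b2 _] := move_tau 0 t n00 ht; have [c1 c2 c3] := move_tau t w ht hw.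
 rewrite !addr0 in a2 b2; rewrite -b2 in c1.
 have [d1 d2 d3] := rep_comp (gtau w) (gtau t) b1 c1.
 rewrite b2 in d2 d3.
 have dd k : 'd (rep p p (tau (w + t))) (y 0) k = 'd (rep p p (tau w \o tau t)) (y 0) k.
  apply: (etrans (e_surj (w + t) k hwt)); apply/esym/(etrans (d3 k)).
  exact: (etrans (congr1 (fun z => 'd (rep p p (tau w)) (y t) z) (e_surj t k ht)) (c3 k)).
 have := isometry_eq (p := p) (gtau (w + t)) (global_isometry_comp (gtau w) (gtau t)).
 rewrite -y0 => h; exact: (h a1 d1 (etrans a2 (esym (etrans d2 c2))) dd).
have tau0 q : tau 0 q = q.
 have [a1 a2 _] := move_tau 0 0 n00 n00; rewrite addr0 in a2.
 apply: (isometry_fix (p := p) (gtau 0)); rewrite -y0; split=> //.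
  by rewrite a2 subrr normr0.
 by move=> k; rewrite e_surj // e0 subrr normr0 mul0r.
have [Phi [PhiD Phit Phin]] := local_group_extend (ltac:(lin) : 0 < T / 4) tau0 tauD.
have Phi0 q : Phi 0 q = q by rewrite Phit.
have gPhi t : global_isometry (Phi t).
 have [n [w [_ hn]]] := Phin t.
 have -> : Phi t = iter n (tau w) by apply/funext => q.
 by elim: n {hn} => [|n IH]; [exact: global_isometry_id|exact: (global_isometry_comp (gtau w) IH)].
exists Phi, (T / 4), y, u, e; split=> //.
- move=> t; have inv w q : Phi (- w) (Phi w q) = q by rewrite -PhiD addNr.
 apply: isometric_between => //; try exact: openT.
 + by move=> q _; split=> //; rewrite -[X in Phi X _ = _]opprK.
 + by move=> q _; exact: global_isometry_at.
 + by move=> q _; exact: global_isometry_at.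
split=> //; first by lin.
- by move=> t ht; apply: hy; have := normr_ge0 t; lin.
move=> t ht; have -> : Phi t = tau t by apply/funext => q; exact: Phit.
by have [a1 a2 _] := move_tau 0 t n00 ht; rewrite addr0 in a2; split=> // k; exact: e_surj.
Qed.

End SymmetricFlow.

(** * Lifting flows to the covering *)
Section FlowContinuity.
Context {R : realType} {H : hilbert R} {M : riemannian H}.

(** The geodesic and its parallel fields have bounded derivatives, so the 1-jet at [a] leaves that
    of the identity at most linearly in time. *)
Lemma moved_frame_near_id (a : M) T y u e (f : R -> M -> M) : (forall t, global_isometry (f t)) ->
 moved_frame a T y u e f -> exists d C : R, [/\ 0 < d, 0 < C & forall t, `|t| < d ->
  near_id a (chart M a a) (C * `|t|) (f t)].
Proof.
move=> gf [T0 y0 e0 hy hf].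
have [rho [C [rho0 C0 rhoO hG hD]]] := isometry_bounds (local_form_metric a) (chart_imageP (chart_dom_center a)).
have n00 : `|0 : R| < T by rewrite normr0.
have [_ f0] := hy 0 n00; have [cy0 cu0 _] := f0 0.
have by0 : nball (chart M a a) rho (y 0) by rewrite y0; exact: nballxx.
have bu0 : nball (u 0) 1 (u 0) by exact: nballxx.
have [d0 d00 hd0] := (nbhs_nball _ _).1 (filterI (continuous_open_near (cder_continuous cy0) (nball_open _ rho) by0) (continuous_open_near (cder_continuous cu0) (nball_open _ 1) bu0)).
pose d := Num.min T d0; have dd : 0 < d by rewrite lt_min T0.
pose V := `|u 0| + 1; have V1 : 1 <= V by rewrite /V; have := normr_ge0 (u 0); lin.
have small t : `|t| < d -> [/\ `|t| < T, nball (chart M a a) rho (y t) & `|u t| <= V].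
 rewrite lt_min => /andP[tT td]; have [] := hd0 t; first by rewrite /nball/= subr0.
 move=> b1 b2; split=> //; have := ler_normD (u t - u 0) (u 0); rewrite subrK /V.
 by move: b2; rewrite /nball/= => /ltW; lin.
have CV : 0 <= C * V * C by apply: mulr_ge0; [apply: mulr_ge0; lin|exact: ltW].
(* Parallel fields are images of fixed vectors under differentials of isometries, which bounds them
   uniformly in [k]. *)
have eb k t : `|t| < d -> `|e k t| <= C * `|k|.
 move=> ht; have [tT bt _] := small t ht; have [Vt Ft De] := hf t tT.
 have [hdf _] := hD _ _ _ (global_isometry_rep a (gf t)) Vt ltac:(by rewrite y0; exact: nballxx)
  ltac:(by rewrite Ft).
 by rewrite -De; exact: hdf.
exists d, (V + C * V * C); split=> //; first by lin.
move=> t ht; have [tT bt _] := small t ht; have [Vt Ft De] := hf t tT; rewrite -y0.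
have sm (s : R) : `|s| <= `|t| -> `|s| < d by move=> hs; exact: le_lt_trans ht.
have tn := normr_ge0 t; split=> //.
 rewrite Ft; via (@mean_value0 _ _ y u V t _ _).
 - by move=> s /sm /small[sT _ _]; have [_ fs] := hy s sT; have [] := fs 0.
 - by move=> s /sm /small[].
 - by apply: ler_wpM2r => //; lin.
move=> k; rewrite De -[in X in _ - X](e0 k).
have kn := normr_ge0 k.
via (@mean_value0 _ _ (e k) (fun s => - christoffel_of (local_form (metric M) a) (y s) (u s) (e k s))
  (C * V * C * `|k|) t _ _).
- by move=> s /sm /small[sT _ _]; have [_ fs] := hy s sT; have [] := fs k.
- move=> s hs; have [sT bs us] := small s (sm s hs); rewrite normrN; via (hG _ _ _ bs).
 rewrite -[C * V * C * _]mulrA; apply: ler_pM => //; last by apply: eb; exact: sm.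
  by apply: mulr_ge0 => //; exact: ltW.
 by apply: ler_wpM2l => //; exact: ltW.
- rewrite -!mulrA [`|k| * _]mulrC !mulrA; rewrite ler_wpM2r // ler_wpM2r //.
 by rewrite -!mulrA; lin.
Qed.

Lemma flow_near (Phi : R -> M -> M) (p : M) (d0 C0 : R) :
 (forall s t q, Phi (s + t) q = Phi s (Phi t q)) -> (forall t, global_isometry (Phi t)) ->
 0 < d0 -> 0 < C0 -> (forall t, `|t| < d0 -> near_id p (chart M p p) (C0 * `|t|) (Phi t)) ->
 forall q, exists r d C : R, [/\ 0 < r, 0 < d, 0 < C & forall t x, `|t| < d ->
  nball (chart M q q) r x -> near_id q x (C * `|t|) (Phi t)].
Proof.
move=> PhiD gPhi d00 C00 hn q; have [r [d [C [r0 dd CC h]]]] := near_id_uniform p q.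
exists r, (Num.min d0 (d / C0)), (C * C0); split=> //; first by rewrite lt_min d00 divr_gt0.
 by rewrite mulr_gt0.
move=> t x; rewrite lt_min => /andP[t1 t2] hx; rewrite -mulrA; apply: h => //; last exact: hn.
by rewrite mulrC -ler_pdivlMr // ltW.
Qed.

(** Since [Phi t] is [Phi t0] after [Phi (t - t0)], joint continuity reduces to short times, when
    points near [q] move by at most a multiple of the time. *)
Lemma flow_continuous (Phi : R -> M -> M) :
 (forall s t q, Phi (s + t) q = Phi s (Phi t q)) -> (forall t, global_isometry (Phi t)) ->
 (forall q, exists r d C : R, [/\ 0 < r, 0 < d, 0 < C & forall t x, `|t| < d ->
  nball (chart M q q) r x -> near_id q x (C * `|t|) (Phi t)]) ->
 forall t0 q (A : set M), nbhs (Phi t0 q) A -> exists2 d : R, 0 < d &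
  \forall r \near q, forall t, `|t - t0| < d -> A (Phi t r).
Proof.
move=> PhiD gPhi hn t0 q A /(continuous_near (global_isometry_at q (gPhi t0)).1) hA.
have Dq := chart_dom_center q; have Oq := chart_imageP Dq.
have [r [d [C [r0 dd C0 h]]]] := hn q.
have n1 : \forall x \near chart M q q, chart_image q x /\ A (Phi t0 (chart_inv M q x)).
 apply: filterI; first exact: (open_near (@chart_image_open _ _ M q) Oq).
 by apply: (continuous_near (chart_inv_continuous Oq) (A := fun r => A (Phi t0 r))); rewrite chartK.
have [s s0 hs] := (nbhs_nball _ _).1 n1.
pose s1 := Num.min r (s / 2); have s10 : 0 < s1 by rewrite lt_min r0 divr_gt0.
have [sr ss] : s1 <= r /\ s1 <= s / 2 by rewrite !ge_min !lexx orbT.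
exists (Num.min d (s / 2 / C)); first by rewrite lt_min dd !divr_gt0.
apply: filterS2 (chart_near Dq (nball_open _ s1) (nballxx (chart M q q) s10)) (open_nbhs_nbhs (conj (@chart_dom_open _ _ M q) Dq)) => z bz Dz t; rewrite lt_min => /andP[t1 t2].
have [[z' [[_ Dz'] Fz'] ez'] hF _] := h (t - t0) (chart M q z) t1 (lt_le_trans bz sr).
have ez : z' = z by rewrite -(chartK Dz') ez' chartK.
rewrite {z' ez' Dz'}ez in Fz'.
have eF : rep q q (Phi (t - t0)) (chart M q z) = chart M q (Phi (t - t0) z) by rewrite /rep chartK.
rewrite eF in hF.
have b2 : nball (chart M q q) s (chart M q (Phi (t - t0) z)).
 rewrite ltr_pdivlMr // mulrC in t2.
 have := ler_distD (chart M q z) (chart M q (Phi (t - t0) z)) (chart M q q).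
 by move: bz; rewrite /nball/= => bz; lin.
have [_] := hs _ b2; rewrite chartK // -PhiD.
by rewrite addrC subrK.
Qed.

End FlowContinuity.

Section Lifting.
Context {R : realType} {H : hilbert R} {N M : riemannian H} (pi : N -> M).
Hypothesis covpi : riemannian_covering pi.
Variable Phi : R -> M -> M.
Hypothesis Phi0 : forall q, Phi 0 q = q.
Hypothesis PhiD : forall s t q, Phi (s + t) q = Phi s (Phi t q).
Hypothesis gPhi : forall t, global_isometry (Phi t).
Hypothesis cPhi : forall t0 q (A : set M), nbhs (Phi t0 q) A -> exists2 d : R, 0 < d &
  \forall r \near q, forall t, `|t - t0| < d -> A (Phi t r).

Local Notation sheet U V s := (isometry_between V U pi s).

Lemma covering_sheets x : exists U : set M, [/\ open U, U x &
 forall z, U (pi z) -> exists V s, V z /\ sheet U V s].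
Proof.
have [_ /(_ x)[U [I [V [s [Ux pV _ hV]]]]]] := covpi; exists U.
have hz z : U (pi z) -> exists i, V i z.
 by move=> Uz; have : (pi @^-1` U) z by []; rewrite pV => -[i _ Viz]; exists i.
split=> //; last by move=> z /hz[i Viz]; exists (V i), (s i); split=> //; exact: hV.
have [z ez] := covpi.1 x; rewrite -ez in Ux; have [i _] := hz z Ux.
by have [[_ oU]] := hV i.
Qed.

Lemma covering_at z : isometric_at pi z.
Proof.
have [U [_ Uz hU]] := covering_sheets (pi z); have [V [s [Vz iV]]] := hU z Uz.
exact: (isometry_at iV Vz).
Qed.

(** Continuity is relative to [[- T, T]], as the values of [c] outside are arbitrary. *)
Definition lift (T : R) (c : R -> N) (r : N) : Prop :=
 [/\ c 0 = r, forall s, `|s| <= T -> pi (c s) = Phi s (pi r) &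
  forall s A, `|s| <= T -> nbhs (c s) A ->
   exists2 d : R, 0 < d & forall s', `|s'| <= T -> `|s' - s| < d -> A (c s')].

Lemma lift_sub T T' c r : T' <= T -> lift T c r -> lift T' c r.
Proof.
move=> TT [c0 cp cc]; split=> // [s hs|s A hs hA]; first by apply: cp; exact: le_trans TT.
have [d d0 hd] := cc s A (le_trans hs TT) hA; exists d => // s' hs'; apply: hd; exact: le_trans TT.
Qed.

(** Two lifts agree on an open set of times because [pi] is injective on a sheet, and on a closed
    one because [N] is Hausdorff. Positive and negative times advance together in one induction. *)
Lemma lift_unique T c c' r : lift T c r -> lift T c' r -> forall t, `|t| <= T -> c t = c' t.
Proof.
move=> [c0 cp cc] [c0' cp' cc'].
suff h (b : R) : 0 <= b <= T -> c b = c' b /\ c (- b) = c' (- b).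
 move=> t ht; have [t0|t0] := leP 0 t.
  by rewrite ger0_norm // in ht; apply: (h t _).1; rewrite t0.
 have := (h (- t) _).2; rewrite opprK; apply.
 by rewrite ltr0_norm // in ht; rewrite ht oppr_ge0 ltW.
have loc s : `|s| <= T -> c s = c' s -> exists2 d : R, 0 < d &
  forall s', `|s'| <= T -> `|s' - s| < d -> c s' = c' s'.
 move=> hs es; have [U [_ Us hU]] := covering_sheets (pi (c s)); have [V [k [Vs iV]]] := hU _ Us.
 have [[oV _] [Vk _] _ _] := iV.
 have [d1 d10 h1] := cc s V hs (open_nbhs_nbhs (conj oV Vs)).
 have [d2 d20 h2] : exists2 d : R, 0 < d & forall s', `|s'| <= T -> `|s' - s| < d -> V (c' s').
  by apply: cc' => //; rewrite -es; exact: open_nbhs_nbhs.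
 exists (Num.min d1 d2); first by rewrite lt_min d10.
 move=> s' hs'; rewrite lt_min => /andP[a1 a2].
 by rewrite -(Vk _ (h1 s' hs' a1)).2 -(Vk _ (h2 s' hs' a2)).2 cp // cp'.
have lim s : `|s| <= T -> (forall d : R, 0 < d -> exists s', [/\ `|s'| <= T, `|s' - s| < d & c s' = c' s']) ->
  c s = c' s.
 move=> hs hl; apply: (@manifold_hausdorff _ _ N) => A B hA hB.
 have [d1 d10 h1] := cc s A hs hA; have [d2 d20 h2] := cc' s B hs hB.
 have [|s' [hs' e1 e2]] := hl (Num.min d1 d2); first by rewrite lt_min d10.
 move: e1; rewrite lt_min => /andP[a1 a2].
 by exists (c s'); split; [exact: h1|rewrite e2; exact: h2].
have nrm (t : R) : 0 <= t -> `|t| = t /\ `|- t| = t by move=> t0; rewrite normrN ger0_norm.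
move: b; apply: real_induction => [|t ht Pt|t ht Pt].
- by rewrite oppr0 c0 c0'.
- have [e1 e2] := Pt t ltac:(lra); have [n1 n2] := nrm t ltac:(lra).
 have [d1 d10 h1] := loc t ltac:(lra) e1; have [d2 d20 h2] := loc (- t) ltac:(lra) e2.
 exists (Num.min (T - t) (Num.min d1 d2)); first by rewrite !lt_min d10 d20 !andbT; lra.
 move=> s /andP[ts]; rewrite -ltrBlDl !lt_min => /and3P[b1 b2 b3].
 have [m1 m2] := nrm s ltac:(lra).
 split; first by apply: h1; rewrite ?ger0_norm; lra.
 by apply: h2; rewrite ?opprK; [lra|rewrite ltr0_norm; lra].
- have [n1 n2] := nrm t ltac:(lra).
 have wit d : 0 < d -> exists s' : R, [/\ 0 <= s', s' < t & t - s' < d].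
  move=> d0; exists (Num.max 0 (t - d / 2)).
  have [a1 a2] : 0 <= Num.max 0 (t - d / 2) /\ t - d / 2 <= Num.max 0 (t - d / 2) by rewrite !le_max !lexx orbT.
  by split=> //; [rewrite gt_max; apply/andP; split; lra|lra].
 have wit' (d : R) : 0 < d -> exists s' : R, [/\ 0 <= s' < t, `|s'| <= T, `|s' - t| < d,
   `|- s'| <= T & `|- s' - - t| < d].
  move=> d0; have [s' [a1 a2 a3]] := wit d d0; have [m1 m2] := nrm s' a1.
  exists s'; rewrite a1 a2 m1 m2; split=> //; try lra; first by rewrite ltr0_norm; lra.
  by rewrite opprK ger0_norm; lra.
 have [tT tT'] : `|t| <= T /\ `|- t| <= T by lra.
 split; apply: lim => // d /wit'[s' [a1 a2 a3 a4 a5]]; have [e1 e2] := Pt s' a1.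
  by exists s'.
 by exists (- s').
Qed.

(** Lifts for all points near [q], with time maps continuous at [q]: together they allow an
    extension of all these lifts through one sheet. *)
Definition liftable (q : N) (T : R) : Prop := exists l : R -> N -> N,
 (\forall r \near q, lift T (l^~ r) r) /\ forall s, `|s| <= T -> {for q, continuous (l s)}.

(** A gluing tool: a time outside the closed interval has positive distance to it. Three such
    pieces, for early, middle and late times, make up an extended lift. *)
Let piece (c f : R -> N) (a b T : R) : a <= b ->
 (forall s, a <= s <= b -> c s = f s) -> (forall s A, a <= s <= b -> nbhs (f s) A ->
   exists2 d : R, 0 < d & forall s', a <= s' <= b -> `|s' - s| < d -> A (f s')) ->
 forall s A, nbhs (c s) A -> exists2 d : R, 0 < d & forall s', a <= s' <= b -> `|s' - s| < d -> A (c s').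
Proof.
move=> ab cf hf s A hA; have [sab|] := boolP (a <= s <= b).
 rewrite cf // in hA; have [d d0 hd] := hf s A sab hA.
 by exists d => // s' hs' hd'; rewrite cf //; exact: hd.
rewrite negb_and -!ltNge => /orP[sa|bs].
 exists (a - s); first by lra.
 by move=> s' /andP[h1 h2] h3; exfalso; have := ler_norm (s' - s); lra.
exists (s - b); first by lra.
by move=> s' /andP[h1 h2] h3; have := ler_norm (s - s'); rewrite distrC; lra.
Qed.

(** After [t0] the lift is continued by the inverse [k] of the sheet through [l t0 q], and before
    [- t0] by [k']. Continuity in the point puts [l t0 r] in the same sheet for all [r] near [q]. *)
Lemma liftable_extend q (t0 t1 : R) (U U' : set M) : 0 <= t0 -> t0 <= t1 ->
 (forall z, U (pi z) -> exists V s, V z /\ sheet U V s) ->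
 (forall z, U' (pi z) -> exists V s, V z /\ sheet U' V s) ->
 (\forall r \near q, forall s, t0 <= s <= t1 -> U (Phi s (pi r)) /\ U' (Phi (- s) (pi r))) ->
 liftable q t0 -> liftable q t1.
Proof.
move=> t00 t01 hU hU' near_q [l [ll cl]].
have nq := nbhs_singleton near_q.
have [t0n t0n'] : `|t0| <= t0 /\ `|- t0| <= t0 by rewrite normrN ger0_norm.
have [l0 lp lc] := nbhs_singleton ll.
have [V [k [Vq iV]]] : exists V s, V (l t0 q) /\ sheet U V s.
 by apply: hU; rewrite lp //; apply: (nq t0 _).1; rewrite lexx.
have [V' [k' [Vq' iV']]] : exists V s, V (l (- t0) q) /\ sheet U' V s.
 by apply: hU'; rewrite lp //; apply: (nq t0 _).2; rewrite lexx.
have [[oV _] [Vk kV] _ _] := iV; have [[oV' _] [Vk' kV'] _ _] := iV'.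
pose l' s r := if `|s| <= t0 then l s r else if 0 < s then k (Phi s (pi r)) else k' (Phi s (pi r)).
have ck r s : U (Phi s (pi r)) -> {for Phi s (pi r), continuous k}.
 by move=> Us; exact: (isometry_inv_at iV Us).1.
have ck' r s : U' (Phi s (pi r)) -> {for Phi s (pi r), continuous k'}.
 by move=> Us; exact: (isometry_inv_at iV' Us).1.
exists l'; split; last first.
 move=> s hs; have [h|h] := boolP (`|s| <= t0).
  by have := cl s h; rewrite /l' h.
 have cphi : {for q, continuous (fun r => Phi s (pi r))}.
  by apply: (continuous_comp (covering_at q).1); exact: (global_isometry_at _ (gPhi s)).1.
 have [s0|s0] := ltP 0 s.
  apply: (near_continuous_at (f := fun r => k (Phi s (pi r)))).
   by apply: nearW => r; rewrite /l' (negbTE h) s0.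
  rewrite -ltNge ger0_norm ?(ltW s0) // in h hs.
  exact: (continuous_comp cphi (ck q s (nq s ltac:(lra)).1)).
 apply: (near_continuous_at (f := fun r => k' (Phi s (pi r)))).
  by apply: nearW => r; rewrite /l' (negbTE h) ltNge s0.
 rewrite -ltNge ler0_norm in h; rewrite ler0_norm // in hs.
 apply: (continuous_comp cphi (ck' q s _)).
 by have := (nq (- s) ltac:(lra)).2; rewrite opprK.
apply: filterS3 (filterI near_q ll) (continuous_open_near (cl t0 t0n) oV Vq) (continuous_open_near (cl (- t0) t0n') oV' Vq') => r [hr [lr0 lrp lrc]] Vr Vr'.
have e1 s : t0 <= s <= t1 -> l' s r = k (Phi s (pi r)).
 move=> hs; rewrite /l'; case: ifP => [h|/negbT h]; last first.
  rewrite -ltNge in h; have s0 : 0 <= s by lra.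
  by rewrite ger0_norm // in h; rewrite ifT //; lra.
 have est : s = t0 by move: h; rewrite ger0_norm; lra.
 by rewrite est -lrp //; exact: (esym (Vk _ Vr).2).
have e2 s : - t1 <= s <= - t0 -> l' s r = k' (Phi s (pi r)).
 move=> hs; rewrite /l'; case: ifP => [h|].
  have est : s = - t0 by move: h; rewrite ler0_norm; lra.
  by rewrite est -lrp //; exact: (esym (Vk' _ Vr').2).
 by rewrite ler0_norm; [move=> h; rewrite ifF //; apply/negbTE; rewrite -leNgt; lra|lra].
have e3 s : - t0 <= s <= t0 -> l' s r = l s r by move=> hs; rewrite /l' ler_norml hs.
have hr' s : - t1 <= s <= - t0 -> U' (Phi s (pi r)).
 by move=> hs; have := (hr (- s) ltac:(lra)).2; rewrite opprK.
have cPhi' s A : nbhs (Phi s (pi r)) A -> exists2 d : R, 0 < d & forall t, `|t - s| < d -> A (Phi t (pi r)).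
 by move=> hA; have [d d0 hd] := cPhi hA; exists d => //; exact: nbhs_singleton hd.
split.
- by rewrite e3 ?lr0 //; lra.
- move=> s; rewrite ler_norml => hs; have [h|h] := leP s (- t0).
  by rewrite e2 ?(kV' _ (hr' _ _)).2 //; lra.
 have [h'|h'] := leP t0 s.
  by rewrite e1 ?(kV _ (hr _ _).1).2 //; lra.
 by rewrite e3 ?lrp // ?ler_norml; lra.
move=> s A hs hA.
have [d1 d10 h1] := @piece (l'^~ r) (fun s => k (Phi s (pi r))) t0 t1 0 t01 e1
 ltac:(move=> w B hw hB; have [d d0 hd] := cPhi' w _ (continuous_near (ck r w (hr w hw).1) hB);
    by exists d => // s' _; exact: hd) s A hA.
have [d2 d20 h2] := @piece (l'^~ r) (fun s => k' (Phi s (pi r))) (- t1) (- t0) 0 ltac:(lra) e2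
 ltac:(move=> w B hw hB; have [d d0 hd] := cPhi' w _ (continuous_near (ck' r w (hr' w hw)) hB);
    by exists d => // s' _; exact: hd) s A hA.
have [d3 d30 h3] := @piece (l'^~ r) (l^~ r) (- t0) t0 0 ltac:(lra) e3
 ltac:(move=> w B hw hB; have [d d0 hd] := lrc w B ltac:(by rewrite ler_norml) hB;
    by exists d => // s' hs'; apply: hd; rewrite ler_norml) s A hA.
exists (Num.min d1 (Num.min d2 d3)); first by rewrite !lt_min d10 d20.
move=> s'; rewrite ler_norml !lt_min => hs' /and3P[b1 b2 b3].
have [h|h] := leP s' (- t0); first by apply: h2 => //; lra.
by have [h'|h'] := leP t0 s'; [apply: h1 => //; lra|apply: h3 => //; lra].
Qed.

Lemma liftable_all q T : 0 <= T -> liftable q T.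
Proof.
move=> T0; suff h (b : R) : 0 <= b <= T -> liftable q b by apply: h; rewrite T0 lexx.
have step (t : R) : 0 <= t -> exists2 d : R, 0 < d & forall s0 s1, 0 <= s0 -> t - d < s0 -> s0 <= s1 ->
  s1 < t + d -> liftable q s0 -> liftable q s1.
 move=> t0.
 have [U [oU Ux hU]] := covering_sheets (Phi t (pi q)).
 have [U' [oU' Ux' hU']] := covering_sheets (Phi (- t) (pi q)).
 have [d1 d10 n1] := cPhi (open_nbhs_nbhs (conj oU Ux)).
 have [d2 d20 n2] := cPhi (open_nbhs_nbhs (conj oU' Ux')).
 have cpi := (covering_at q).1.
 exists (Num.min d1 d2); first by rewrite lt_min d10.
 move=> s0 s1 s00 h1 h2 h3; apply: (liftable_extend s00 h2 hU hU').
 have [md1 md2] : Num.min d1 d2 <= d1 /\ Num.min d1 d2 <= d2 by rewrite !ge_min !lexx orbT.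
 apply: filterS2 (continuous_near cpi n1) (continuous_near cpi n2) => r k1 k2 s hs; split.
  by apply: k1; rewrite ltr_norml; apply/andP; split; lra.
 by apply: k2; rewrite ltr_norml; apply/andP; split; lra.
move: b; apply: real_induction => [|t ht Pt|t ht Pt].
- exists (fun _ r => r); split; last by move=> s _; exact: (fun A => id).
 apply: nearW => r; split=> // [s|s A hs hA].
  by rewrite normr_le0 => /eqP->; rewrite Phi0.
 by exists 1 => // s' _ _; exact: nbhs_singleton hA.
- have [d d0 hd] := step t ltac:(lra); exists d => // s hs.
 by apply: (hd t s) (Pt t _); lra.
- have [d d0 hd] := step t ltac:(lra).
 pose s0 := Num.max 0 (t - d / 2).
 have [a1 a2] : 0 <= s0 /\ t - d / 2 <= s0 by rewrite !le_max !lexx orbT.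
 have a3 : s0 < t by rewrite gt_max; lra.
 by apply: (hd s0 t) (Pt s0 _); lra.
Qed.

(** The group law is uniqueness of lifts. The isometry property is local: near each point [phi t]
    equals [k \o (Phi t \o pi)] for the inverse [k] of a sheet. *)
Lemma lift_flow : exists phi : R -> N -> N,
 [/\ forall q, phi 0 q = q, forall s t q, phi (s + t) q = phi s (phi t q),
  forall t, isometry_between setT setT (phi t) (phi (- t)),
  forall q, continuous (fun t => phi t q) &
  [/\ forall t q, pi (phi t q) = Phi t (pi q) &
   forall T c q t, lift T c q -> `|t| <= T -> c t = phi t q]].
Proof.
have ex (tq : R * N) : exists c, lift (`|tq.1| + 1) c tq.2.
 have [l [ll _]] := liftable_all tq.2 (ltac:(have := normr_ge0 tq.1; lra) : 0 <= `|tq.1| + 1).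
 by exists (l^~ tq.2); exact: nbhs_singleton ll.
have [cc hcc] := choice ex.
pose phi t q := cc (t, q) t.
have tn (t : R) : `|t| <= `|t| + 1 by lra.
have uniq T c q t : lift T c q -> `|t| <= T -> c t = phi t q.
 move=> hl ht; apply: (@lift_unique `|t| _ _ q); last exact: lexx.
  exact: lift_sub hl.
 exact: lift_sub (tn t) (hcc (t, q)).
have phip t q : pi (phi t q) = Phi t (pi q) by have [_ h _] := hcc (t, q); apply: h => /=.
have phil T q : 0 <= T -> lift T (phi^~ q) q.
 move=> T0; have [l [ll _]] := liftable_all q T0; have lq := nbhs_singleton ll.
 have e s : `|s| <= T -> l s q = phi s q by exact: (uniq T (l^~ q)).
 have [a1 a2 a3] := lq; split.
 - by rewrite -e // normr0.
 - by move=> s hs; rewrite -e // a2.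
 - move=> s A hs; rewrite -e // => hA; have [d d0 hd] := a3 s A hs hA.
  by exists d => // s' hs' hd'; rewrite -e //; exact: hd.
have phi0 q : phi 0 q = q by have [] := phil 0 q (lexx _).
have contt q : continuous (fun t => phi t q).
 (* An interval strictly larger than [[- |t|, |t|]], so that continuity at [t] is two-sided. *)
 move=> t A hA; have [_ _ h] := phil (`|t| + 1) q ltac:(have := normr_ge0 t; lra).
 have [d d0 hd] := h t A (tn t) hA; apply/nbhs_nball; exists (Num.min d 1); first by rewrite lt_min d0 ltr01.
 move=> s; rewrite /nball/= lt_min => /andP[b1 b2]; apply: hd => //.
 by have := ler_normD (s - t) t; rewrite subrK; lra.
have phiD s t q : phi (s + t) q = phi s (phi t q).
 apply: (uniq `|s| (fun w => phi (w + t) q)); last exact: lexx.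
 split=> [|w hw|w A hw hA]; first by rewrite add0r.
  by rewrite !phip -PhiD.
 have [d d0 hd] := (nbhs_nball _ _).1 (contt q (w + t) A hA).
 by exists d => // w' _ hw'; apply: hd; rewrite /nball/= opprD addrACA subrr addr0.
have at_q t q : isometric_at (phi t) q.
 have [l [ll cl]] := liftable_all q (normr_ge0 t).
 have cphi : {for q, continuous (phi t)}.
  apply: (near_continuous_at _ (cl t (lexx _))).
  by apply: filterS ll => r hl; exact: (uniq `|t| (l^~ r)).
 have [U [oU Ux hU]] := covering_sheets (Phi t (pi q)).
 rewrite -phip in Ux; have [V [k [Vq iV]]] := hU _ Ux.
 have [[oV _] [Vk _] _ _] := iV; rewrite phip in Ux.
 apply: (@isometric_at_near _ _ _ _ _ (k \o (Phi t \o pi))).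
  apply: filterS (continuous_open_near cphi oV Vq) => r Vr.
  by rewrite /= -phip (Vk _ Vr).2.
 apply: isometric_at_comp; last exact: (isometry_inv_at iV Ux).
 apply: isometric_at_comp; [exact: covering_at|exact: global_isometry_at].
exists phi; split=> // t; apply: isometric_between => //; try exact: openT.
 by move=> q _; split=> //; rewrite -phiD addNr phi0.
by split=> //; rewrite -phiD subrr.
Qed.

End Lifting.

Section LiftedFrame.
Context {R : realType}.

Lemma rep_comp_diff (H H' H'' : hilbert R) (M : riemannian H) (M' : riemannian H')
  (M'' : riemannian H'') (f : M -> M') (h : M' -> M'') a b c q : {for q, continuous f} ->
 chart_dom M a q -> chart_dom M' b (f q) ->
 differentiable (rep a b f) (chart M a q) -> differentiable (rep b c h) (chart M' b (f q)) ->
 differentiable (rep a c (h \o f)) (chart M a q) /\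
 forall k, 'd (rep a c (h \o f)) (chart M a q) k =
  'd (rep b c h) (chart M' b (f q)) ('d (rep a b f) (chart M a q) k).
Proof.
move=> cf Da Db df dh.
have e0 : rep a b f (chart M a q) = chart M' b (f q) by rewrite /rep chartK.
have dh' : differentiable (rep b c h) (rep a b f (chart M a q)) by rewrite e0.
have n : \forall x \near chart M a q, (rep b c h \o rep a b f) x = rep a c (h \o f) x.
 have n1 : \forall x \near chart M a q, chart_dom M' b (f (chart_inv M a x)).
  apply: (continuous_near (chart_inv_continuous (chart_imageP Da)) (A := fun r => chart_dom M' b (f r))).
  by rewrite chartK //; exact: (continuous_open_near cf (@chart_dom_open _ _ M' b) Db).
 by apply: filterS n1 => x Dx; rewrite /rep /= chartK.
have [dc ec] := diff_near n (differentiable_comp df dh'); split=> // k.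
have e1 := congr1 (fun L : H -> H'' => L k) ec.
have e2 := congr1 (fun L : H -> H'' => L k) (diff_comp df dh').
apply/(etrans e1)/(etrans e2); by rewrite e0.
Qed.

Lemma isometric_at_differentiable (H H' : hilbert R) (M : riemannian H) (M' : riemannian H')
  (f : M -> M') a b q : isometric_at f q -> chart_dom M a q -> chart_dom M' b (f q) ->
 differentiable (rep a b f) (chart M a q).
Proof.
move=> [_ hf] Da Db; have [r r0 [_ sF _ _ _]] := hf a b Da Db.
exact: smooth_diff sF (nballxx _ r0).
Qed.

Lemma rep_near_eq (H H' : hilbert R) (M : riemannian H) (M' : riemannian H') (f h : M -> M') a b q :
 chart_dom M a q -> (\forall r \near q, f r = h r) -> differentiable (rep a b f) (chart M a q) ->
 forall k, 'd (rep a b h) (chart M a q) k = 'd (rep a b f) (chart M a q) k.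
Proof.
move=> Da fh df k.
have n : \forall x \near chart M a q, rep a b f x = rep a b h x.
 have : \forall x \near chart M a q, f (chart_inv M a x) = h (chart_inv M a x).
  by apply: (continuous_near (chart_inv_continuous (chart_imageP Da)) (A := fun r => f r = h r)); rewrite chartK.
 by apply: filterS => x e; rewrite /rep e.
have [_ e] := diff_near n df; exact: (congr1 (fun L : H -> H' => L k) e).
Qed.

Lemma rep_id_diff (H : hilbert R) (M : riemannian H) a q : chart_dom M a q ->
 forall k, 'd (rep a a (@id M)) (chart M a q) k = k.
Proof. by move=> Da k; exact: transport_id. Qed.

(** The flow on [M] is built for the image of [v] under the differential of [pi], then lifted. For
    short times the lifted orbit of [p] stays in one sheet, whose inverse [k] carries the moved
    frame of [M] to one of [N]. *)
Lemma covering_flow (H : hilbert R) (N M : riemannian H) (pi : N -> M) (p : N) v :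
 symmetric_space M -> riemannian_covering pi ->
 exists (phi : R -> N -> N) T y u (e : H -> R -> H),
 [/\ forall q, phi 0 q = q, forall s t q, phi (s + t) q = phi s (phi t q),
  forall t, isometry_between setT setT (phi t) (phi (- t)),
  forall q, continuous (fun t => phi t q) & moved_frame p T y u e phi /\ u 0 = v].
Proof.
move=> symM covpi; set a := pi p.
have Da := chart_dom_center a; have Dp := chart_dom_center p.
have [U [oU Ua hU]] := covering_sheets covpi a.
have [V [k [Vp iV]]] := hU p Ua; have [[oV _] [Vk kV] _ _] := iV.
have ka : k a = p by exact: (Vk p Vp).2.
have Dka : chart_dom N p (k a) by rewrite ka.
pose F := rep p a pi; pose G := rep a p k; pose W := rep_dom U a p k.
have iG : rep_isometry a p k W by apply: rep_isometry_dom => // q; exact: (isometry_inv_at iV).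
have [oW sG _ _ _] := iG.
have atpi := covering_at covpi p.
have dF := isometric_at_differentiable atpi Dp Da.
have GF w : 'd G (chart M a a) ('d F (chart N p p) w) = w.
 have [dgf egf] := rep_comp_diff (c := p) atpi.1 Dp Da dF (isometric_at_differentiable (isometry_inv_at iV Ua) Da Dka).
 apply: (etrans (esym (egf w))).
 apply: etrans _ (@rep_id_diff _ N p p Dp w); apply: esym; apply: rep_near_eq => //.
 by apply: filterS (open_nbhs_nbhs (conj oV Vp)) => r Vr; exact: (Vk r Vr).2.
have [Phi [T [y [u [e [PhiD iPhi mf u0]]]]]] := symmetric_flow symM a ('d F (chart N p p) v).
have gPhi t : global_isometry (Phi t) by exists (Phi (- t)).
have Phi0 q : Phi 0 q = q.
 have [_ [/(_ q I)[_ h] _] _ _] := iPhi 0; rewrite oppr0 -PhiD addr0 in h.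
 exact: h.
have [d0 [C0 [d00 C00 hn]]] := moved_frame_near_id gPhi mf.
have cPhi := flow_continuous PhiD gPhi (flow_near PhiD gPhi d00 C00 hn).
have [phi [phi0 phiD iphi cphi [piphi uphi]]] := lift_flow covpi Phi0 PhiD gPhi cPhi.
have [T0 y0 e0 hy hf] := mf.
have n00 : `|0 : R| < T by rewrite normr0.
have Wy0 : W (y 0) by exists a.
have cy0 : {for 0, continuous y}.
 by have [_ h] := hy 0 n00; have [c _ _] := h 0; exact: cder_continuous c.
have [d1 d10 hd1] := (nbhs_nball _ _).1 (continuous_open_near cy0 oW Wy0).
pose T1 := Num.min T d1.
have T10 : 0 < T1 by rewrite lt_min T0.
have small t : `|t| < T1 -> [/\ `|t| < T, W (y t), U (Phi t a), chart_dom M a (Phi t a) &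
  y t = chart M a (Phi t a) /\ chart_dom N p (k (Phi t a))].
 rewrite lt_min => /andP[tT td]; have Wt : W (y t) by apply: hd1; rewrite /nball/= subr0.
 have [[q [[_ Dq] Fq] eq] Ft _] := hf t tT.
 have qa : q = a by rewrite -(chartK Dq) eq y0 chartK.
 rewrite {q eq Dq}qa in Fq.
 have yt : y t = chart M a (Phi t a) by rewrite -Ft y0 /rep chartK.
 have [q [[Uq Dq] Kq] eq] := Wt.
 have qt : q = Phi t a by rewrite -(chartK Dq) eq yt chartK.
 by rewrite -qt; split=> //; split=> //; rewrite qt.
(* The orbit below, transported by the inverse of the sheet, is a lift, hence the lifted orbit. *)
have phip t : `|t| < T1 -> phi t p = k (Phi t a).
 move=> ht; apply/esym; apply: (uphi `|t| (fun s => k (Phi s a))); last exact: lexx.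
 have sm s : `|s| <= `|t| -> U (Phi s a).
  by move=> hs; have [] := small s (le_lt_trans hs ht).
 split; first by rewrite Phi0.
  by move=> s /sm Us; exact: (kV _ Us).2.
 move=> s A hs hA; have ck := (isometry_inv_at iV (sm s hs)).1.
 have [d dd hd] := cPhi s a _ (continuous_near ck hA).
 by exists d => // s' _; exact: (nbhs_singleton hd s').
exists phi, T1, (fun t => G (y t)), (fun t => 'd G (y t) (u t)),
 (fun w t => 'd G (y t) (e ('d F (chart N p p) w) t)); split=> //; split; last first.
 by rewrite y0 u0; exact: GF.
have G0 : G (y 0) = chart N p p by rewrite y0 /G /rep chartK // ka.
split=> //.
- by move=> w; rewrite e0 y0; exact: GF.
- move=> t ht; have [tT Wt Ut Dt [yt Kt]] := small t ht; split.
  by rewrite yt /G /rep chartK //; exact: chart_imageP.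
 move=> w; have [_ fr] := hy t tT.
 by apply: (frame_image (local_form_metric a) (local_form_metric p) iG (rep_surjective (isometry_sym iV)) Wt (fr _)).
move=> t ht; have [tT Wt Ut Dt [yt Kt]] := small t ht; have [_ Ft De] := hf t tT.
have pt := phip t ht; split.
- by rewrite G0; exists p => //; split=> //=; rewrite pt.
- by rewrite G0 {1}/rep chartK // pt yt /G /rep chartK.
move=> w; rewrite G0.
have at1 := global_isometry_at a (gPhi t).
have [dd1 ee1] := rep_comp_diff (c := a) atpi.1 Dp Da dF (isometric_at_differentiable at1 Da Dt).
have c1 : {for p, continuous (Phi t \o pi)} by exact: continuous_comp atpi.1 at1.1.
have [dd2 ee2] := rep_comp_diff (c := p) c1 Dp Dt dd1 (isometric_at_differentiable (isometry_inv_at iV Ut) Dt Kt).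
have near_p : \forall r \near p, (k \o (Phi t \o pi)) r = phi t r.
 have cp := (isometry_at (iphi t) (q := p) I).1.
 have Vpt : V (phi t p) by rewrite pt; exact: (kV _ Ut).1.
 by apply: filterS (continuous_open_near cp oV Vpt) => r Vr; rewrite /= -piphi (Vk _ Vr).2.
apply/(etrans (rep_near_eq Dp near_p dd2 w))/(etrans (ee2 w)).
have ee3 : 'd (rep p a (Phi t \o pi)) (chart N p p) w = e ('d F (chart N p p) w) t.
 by apply: (etrans (ee1 w)); rewrite -y0; exact: De.
by apply: (etrans (congr1 (fun z => 'd (rep a p k) (chart M a ((Phi t \o pi) p)) z) ee3)); rewrite -yt.
Qed.

End LiftedFrame.

(** * Generators of isometric flows *)
Section ApproximateAdditivity.
Context {R : realType} (E : normedModType R).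

Lemma small_square_zero (z : E) (C d : R) : 0 < d ->
 (forall t, 0 < t -> t < d -> `|t *: z| <= C * t ^+ 2) -> z = 0.
Proof.
move=> d0 h; apply/eqP; rewrite -normr_le0; apply/ler_addgt0Pr => e e0; rewrite add0r.
pose C1 : R := `|C| + 1; have C10 : 0 < C1 by rewrite /C1.
pose t := Num.min (d / 2) (e / C1).
have t0 : 0 < t by rewrite lt_min !divr_gt0.
have [td te] : t <= d / 2 /\ t <= e / C1 by rewrite !ge_min !lexx orbT.
have hz : `|z| <= C * t.
 have := h t t0 ltac:(lin); rewrite normrZ gtr0_norm // expr2 mulrCA ler_pM2l //; exact.
have hC := ler_norm C; rewrite ler_pdivlMr // in te.
via hz; apply: le_trans te; rewrite mulrC; apply: ler_wpM2l; first exact: ltW.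
by rewrite /C1; lin.
Qed.

(** After division by [t] the quadratic term disappears in the limit; this transfers estimates from
    a flow to its generator. *)
Lemma small_square_le (z : E) (C d K : R) : 0 < d ->
 (forall t, 0 < t -> t < d -> `|t *: z| <= C * t ^+ 2 + K * t) -> `|z| <= K.
Proof.
move=> d0 h; apply/ler_addgt0Pr => e e0.
pose C1 : R := `|C| + 1; have C10 : 0 < C1 by rewrite /C1.
pose t := Num.min (d / 2) (e / C1).
have t0 : 0 < t by rewrite lt_min !divr_gt0.
have [td te] : t <= d / 2 /\ t <= e / C1 by rewrite !ge_min !lexx orbT.
have hz : `|z| <= C * t + K.
 have := h t t0 ltac:(lin); rewrite normrZ gtr0_norm //.
 rewrite (_ : C * t ^+ 2 + K * t = t * (C * t + K)); last by rewrite expr2; ring.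
 by rewrite ler_pM2l.
have hC := ler_norm C; rewrite ler_pdivlMr // in te.
have : C * t <= t * C1 by rewrite mulrC; apply: ler_wpM2l; [exact: ltW|rewrite /C1; lin].
lin.
Qed.

Let additive_algebra (C s d X w r kw u e m1 m2 m3 m4 m5 : R) :
 0 <= C -> 0 <= s -> 0 < d -> 0 <= X -> 0 <= w -> 0 <= r -> r <= w -> 0 <= kw -> kw <= s -> 0 <= u ->
 w = u * (d / 2) -> u * (2 * (C * s * d) + C * d + d * X + 1) < e ->
 m1 <= C * kw * r -> m2 <= C * kw ^+ 2 -> m3 <= C * r -> m4 <= kw * (C * d * u) -> m5 <= w * X ->
 m1 + m2 + m3 + m4 + m5 <= C * s ^+ 2 + e.
Proof.
move=> C0 s0 d0 X0 w0 r0 rw kw0 ks u0 wE he h1 h2 h3 h5 h6.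
have c1 : C * kw * r <= C * s * w.
 by apply: ler_pM => //; [exact: mulr_ge0|exact: ler_wpM2l].
have c2 : C * kw ^+ 2 <= C * s ^+ 2 by apply: ler_wpM2l => //; rewrite lerXn2r.
have c3 : C * r <= C * w by apply: ler_wpM2l.
have Cdu : 0 <= C * d * u by rewrite mulr_ge0 // mulr_ge0 //; exact: ltW.
have c4 : kw * (C * d * u) <= s * (C * d * u) by apply: ler_wpM2r.
have p1 := mulr_ge0 s0 Cdu; have p2 := mulr_ge0 (mulr_ge0 u0 (ltW d0)) X0.
rewrite wE in c1 c3 h6; lin.
Qed.

(** Dyadic quotients converge because halving costs a quadratic error. An arbitrary [s] is a
    multiple of a dyadic step plus a small remainder, and the error [multi] stays quadratic in [s].
    A flow whose regularity in time is unknown thus gets a derivative at 0. *)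
Lemma approximately_additive (psi : R -> E) (d C : R) : cauchy_complete E -> 0 < d -> 0 <= C ->
 (forall t, `|t| < d -> `|psi t| <= C * `|t|) ->
 (forall s t, `|s| < d -> `|t| < d -> `|s + t| < d -> `|psi (s + t) - psi s - psi t| <= C * `|s| * `|t|) ->
 exists X, forall t, `|t| < d -> `|psi t - t *: X| <= 4 * C * t ^+ 2.
Proof.
move=> cE d0 C0 bpsi apsi.
have multi (n : nat) (s : R) : `|n%:R * s| < d -> `|s| < d ->
  `|psi (n%:R * s) - n%:R *: psi s| <= C * (n%:R * s) ^+ 2.
 move=> hn hs; elim: n hn => [|n IH] hn.
  have := bpsi 0; rewrite normr0 mulr0 => /(_ d0) h.
  by rewrite mul0r scale0r subr0 expr0n mulr0.
 have nS : `|n%:R * s| <= `|n.+1%:R * s|.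
  by rewrite !normrM ler_wpM2r // !ger0_norm ?ler0n // ler_nat.
 have hn' : `|n%:R * s| < d by apply: le_lt_trans hn.
 have e : n.+1%:R * s = n%:R * s + s by rewrite -natr1 mulrDl mul1r.
 have := apsi (n%:R * s) s hn' hs ltac:(by rewrite -e); rewrite -e => h1.
 have h2 := IH hn'.
 have -> : psi (n.+1%:R * s) - n.+1%:R *: psi s =
  (psi (n.+1%:R * s) - psi (n%:R * s) - psi s) + (psi (n%:R * s) - n%:R *: psi s).
  by rewrite -natr1; module R.
 apply: (le_trans (ler_normD _ _)).
 have ns : `|n%:R * s| * `|s| = n%:R * s ^+ 2.
  by rewrite normrM (ger0_norm (ler0n _ _)) -mulrA -expr2 real_normK ?num_real.
 rewrite -mulrA ns in h1; apply: (le_trans (lerD h1 h2)); rewrite -mulrDr ler_wpM2l //.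
 by rewrite -natr1 !exprMn; have n0 := ler0n R n; have s0 := sqr_ge0 s; nra.
pose q n := 2^-1 ^+ n * (d / 2).
have q0 n : 0 < q n by rewrite mulr_gt0 ?exprn_gt0 ?divr_gt0.
have qd n : q n < d.
 have : 2^-1 ^+ n <= 1 :> R by apply: exprn_ile1; lin.
 by rewrite /q => h; nra.
pose f n := (q n)^-1 *: psi (q n).
have [|X hX] := cE f (C * (d / 2)).
 move=> n; have e : q n = 2%:R * q n.+1 by rewrite /q exprS; lin.
 have hn : `|2%:R * q n.+1| < d by rewrite -e ger0_norm // ltW.
 have hm : `|q n.+1| < d by rewrite ger0_norm // ltW.
 have := multi 2%N (q n.+1) hn hm; rewrite -e => h.
 have -> : f n.+1 - f n = - ((q n)^-1 *: (psi (q n) - 2%:R *: psi (q n.+1))).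
  have e2 : (q n)^-1 * 2%:R = (q n.+1)^-1.
   by rewrite e invfM mulrAC mulVf ?mul1r // pnatr_eq0.
  by rewrite scalerBr scalerA e2 opprB.
 rewrite normrN normrZ gtr0_norm ?invr_gt0 // ler_pdivrMl //; apply: (le_trans h).
 by rewrite /q expr2; have := q0 n; rewrite /q; move: (2^-1 ^+ n) => w; lin.
exists X => t ht; have p0 : psi 0 = 0.
 by have := bpsi 0; rewrite normr0 mulr0 => /(_ d0); rewrite normr_le0 => /eqP.
have Xb n : `|psi (q n) - q n *: X| <= q n * (C * d * 2^-1 ^+ n).
 have -> : psi (q n) - q n *: X = q n *: (f n - X).
  by rewrite /f scalerBr scalerA mulfV ?gt_eqF // scale1r.
 rewrite normrZ gtr0_norm //; apply: ler_wpM2l; first exact: ltW.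
 by apply: (le_trans (hX n)); rewrite le_eqVlt; apply/orP; left; apply/eqP; lin.
have pos s : 0 <= s -> s < d -> `|psi s - s *: X| <= C * s ^+ 2.
 move=> s0 sd; apply/ler_addgt0Pr => e e0.
 (* [B] collects the errors proportional to the dyadic step; the choice of [n] makes their sum at
    most [e]. *)
 pose B := 2 * (C * s * d) + C * d + d * `|X|.
 have [CS Cd dX] : [/\ 0 <= C * s * d, 0 <= C * d & 0 <= d * `|X|].
  by split; rewrite ?mulr_ge0 // ltW.
 have B1 : 0 < B + 1 by rewrite /B; lin.
 have [n hn] := half_expr_lt (divr_gt0 e0 B1).
 rewrite ltr_pdivlMr // in hn.
 have [w [w0 wd h4 wE]] : exists w, [/\ 0 < w, w < d, `|psi w - w *: X| <= w * (C * d * 2^-1 ^+ n) &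
   w = 2^-1 ^+ n * (d / 2)] by exists (q n).
 pose k := Num.truncn (s / w).
 have /andP[k1 k2] : k%:R <= s / w < k.+1%:R by apply: truncn_itv; rewrite divr_ge0 // ltW.
 rewrite ler_pdivlMr // in k1; rewrite ltr_pdivrMr // -natr1 mulrDl mul1r in k2.
 pose r := s - k%:R * w; have [r0 rw] : 0 <= r /\ r < w by rewrite /r; lin.
 have kw0 : 0 <= k%:R * w by rewrite mulr_ge0 // ltW.
 have sE : s = k%:R * w + r by rewrite /r; lin.
 have [n1 n2] : `|k%:R * w| < d /\ `|r| < d by rewrite !ger0_norm //; lin.
 have h1 := apsi (k%:R * w) r n1 n2 ltac:(rewrite -sE ger0_norm; lin).
 have h2 := multi k w n1 ltac:(rewrite gtr0_norm; lin).
 have h3 := bpsi r n2.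
 have eD : psi s - s *: X = (psi (k%:R * w + r) - psi (k%:R * w) - psi r)
   + (psi (k%:R * w) - k%:R *: psi w) + psi r + k%:R *: (psi w - w *: X) - r *: X.
  by rewrite -sE {2}sE; module R.
 rewrite eD; rewrite !ger0_norm // in h1 h3.
 have h5 : `|k%:R *: (psi w - w *: X)| <= k%:R * w * (C * d * 2^-1 ^+ n).
  by rewrite normrZ ger0_norm // -mulrA; apply: ler_wpM2l.
 have h6 : `|r *: X| <= w * `|X| by rewrite normrZ ger0_norm //; rewrite ler_wpM2r // ltW.
 have tri (a b c a' b' : E) : `|a + b + c + a' - b'| <= `|a| + `|b| + `|c| + `|a'| + `|b'|.
  have := ler_normB (a + b + c + a') b'; have := ler_normD (a + b + c) a'.
  by have := ler_normD (a + b) c; have := ler_normD a b; lin.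
 apply: (le_trans (tri _ _ _ _ _)).
 have u0 : 0 < 2^-1 ^+ n :> R by rewrite exprn_gt0.
 exact: (additive_algebra C0 s0 d0 (normr_ge0 X) (ltW w0) r0 (ltW rw) kw0 k1 (ltW u0) wE
  hn h1 h2 h3 h5 h6).
have [t0|t0] := leP 0 t.
 rewrite ger0_norm // in ht; apply: (le_trans (pos t t0 ht)).
 by have := mulr_ge0 C0 (sqr_ge0 t); lin.
(* Negative times follow from positive ones, as [psi t + psi (- t)] is quadratically small. *)
rewrite ltr0_norm // in ht; have := pos (- t) ltac:(lin) ht.
have htn : `|t| < d by rewrite ltr0_norm.
have := apsi t (- t) htn; rewrite normrN subrr normr0 p0 sub0r => /(_ htn d0) h1.
rewrite sqrrN => h2.
have tt : `|t| * `|t| = t ^+ 2 by rewrite -expr2 real_normK ?num_real.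
rewrite -mulrA tt in h1.
have -> : psi t - t *: X = - (- psi t - psi (- t)) - (psi (- t) - - t *: X) by module R.
apply: (le_trans (ler_normB _ _)); rewrite normrN.
by have := mulr_ge0 C0 (sqr_ge0 t); lin.
Qed.

End ApproximateAdditivity.

Lemma le_norm_eq {R : realType} (E : normedModType R) (a b : E) : a = b -> `|a| <= `|b|.
Proof. by move=> ->. Qed.

(** * Regularity of 1-jets of Killing fields by prolongation *)

Section Prolongation.
Context {R : realType} (H : hilbert R) (G : normedModType R).
Variables (U : set H) (g : H -> H -> H -> R).
Hypothesis gU : local_metric U g.
Local Notation Gam := (christoffel_of g).

(* The second derivative of a Killing field, in terms of its 1-jet (X, A). *)
Definition prolongation (X : H -> G -> H) (A : H -> G -> H -> H) (x : H) (v : G) (h k : H) : H :=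
 A x v (Gam x h k) - Gam x (A x v h) k - Gam x h (A x v k) - 'd (fun y => Gam y h k) x (X x v).

Variables (x0 : H) (r C C' : R) (X : H -> G -> H) (A : H -> G -> H -> H).
Let B := nball x0 r.
Local Notation Psi := (prolongation X A).
Hypotheses (C0 : 0 < C) (BU : B `<=` U).
Hypothesis bGam : forall y z, B y -> B z -> forall u v,
  [/\ `|Gam y u v| <= C * `|u| * `|v|, `|Gam z u v - Gam y u v| <= C * `|z - y| * `|u| * `|v| &
   forall h, `|'d (fun y => Gam y u v) y h| <= C * `|h| * `|u| * `|v|].
Hypothesis bdGam : forall y z, B y -> B z -> forall u v h,
  `|'d (fun y => Gam y u v) z h - 'd (fun y => Gam y u v) y h| <= C * `|z - y| * `|h| * `|u| * `|v|.
Hypothesis X_linear : forall x, B x -> linear (X x).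
Hypothesis A_linearl : forall x k, B x -> linear (fun v => A x v k).
Hypothesis A_linearr : forall x v, B x -> linear (A x v).
Hypothesis X_bound : forall x v, B x -> `|X x v| <= C * `|v|.
Hypothesis A_bound : forall x v k, B x -> `|A x v k| <= C * `|v| * `|k|.
Hypothesis X_lip : forall x y v, B x -> B y -> `|X y v - X x v| <= C * `|v| * `|y - x|.
Hypothesis A_lip : forall x y v k, B x -> B y -> `|A y v k - A x v k| <= C * `|v| * `|y - x| * `|k|.

Let Gam_linl x v : B x -> linear (fun u => Gam x u v).
Proof. by move=> bx; have [_ _ h _] := christoffel_family gU; exact: h x v (BU bx). Qed.

Let Gam_linr x u : B x -> linear (Gam x u).
Proof. by move=> bx; have [_ _ _ h] := christoffel_family gU; exact: h x u (BU bx). Qed.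

Let norm4_le (v1 v2 v3 v4 : H) b : `|v1| <= b -> `|v2| <= b -> `|v3| <= b -> `|v4| <= b ->
 `|v1 - v2 - v3 - v4| <= 4 * b.
Proof.
by move: (ler_normB v1 v2) (ler_normB (v1 - v2) v3) (ler_normB (v1 - v2 - v3) v4); lra.
Qed.

Let norm2_le (v w1 z : H) b c : `|v - w1| <= b -> `|w1 - z| <= c -> `|v - z| <= b + c.
Proof. by have := ler_distD w1 v z; lra. Qed.

Let Psi_alg (n m h k : R) : [/\
 C * m * n * (C * h * k) + C * m * (C * n * h * k) <= 2 * C ^+ 2 * (m * n * h * k),
 C * n * (C * m * h) * k + C * (C * m * n * h) * k <= 2 * C ^+ 2 * (m * n * h * k),
 C * n * h * (C * m * k) + C * h * (C * m * n * k) <= 2 * C ^+ 2 * (m * n * h * k) &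
 C * n * (C * m) * h * k + C * (C * m * n) * h * k <= 2 * C ^+ 2 * (m * n * h * k)].
Proof.
have e (a b : R) : a = b -> a <= b by lra.
by split; apply: e; ring.
Qed.

(** Each of the four terms combines two factors that are bounded and Lipschitz with constant [C],
    and contributes [2 * C ^+ 2]. *)
Lemma prolongation_lipschitz x y v h k : B x -> B y ->
 `|Psi y v h k - Psi x v h k| <= 8 * C ^+ 2 * `|v| * `|y - x| * `|h| * `|k|.
Proof.
move=> bx by_; have Cn := ltW C0.
pose n := `|v| * `|y - x| * `|h| * `|k|; pose b := 2 * C ^+ 2 * n.
have Cn2 : 0 <= C * C by exact: mulr_ge0.
have Cv : 0 <= C * `|v| by exact: mulr_ge0.
have m1 : `|A y v (Gam y h k) - A x v (Gam x h k)| <= b.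
 have p1 := A_lip v (Gam y h k) bx by_.
 have p2 : `|A x v (Gam y h k) - A x v (Gam x h k)| <= C * `|v| * (C * `|y - x| * `|h| * `|k|).
  have s1 : A x v (Gam y h k) - A x v (Gam x h k) = A x v (Gam y h k - Gam x h k).
   exact: (esym (lin_sub _ _ (A_linearr v bx))).
  rewrite s1; via (A_bound _ _ bx); apply: ler_wpM2l => //.
  by have [_ q _] := bGam bx by_ h k.
 have p3 : C * `|v| * `|y - x| * `|Gam y h k| <= C * `|v| * `|y - x| * (C * `|h| * `|k|).
  by apply: ler_wpM2l; [exact: mulr_ge0|have [q _ _] := bGam by_ by_ h k; exact: q].
 have [q _ _ _] := Psi_alg `|y - x| `|v| `|h| `|k|.
 exact: (le_trans (norm2_le (le_trans p1 p3) p2) q).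
have m2 : `|Gam y (A y v h) k - Gam x (A x v h) k| <= b.
 have [_ p1 _] := bGam bx by_ (A y v h) k.
 have p2 : `|Gam x (A y v h) k - Gam x (A x v h) k| <= C * (C * `|v| * `|y - x| * `|h|) * `|k|.
  have s1 : Gam x (A y v h) k - Gam x (A x v h) k = Gam x (A y v h - A x v h) k.
   exact: (esym (lin_sub _ _ (Gam_linl k bx))).
  rewrite s1; have [q _ _] := bGam bx bx (A y v h - A x v h) k; via q.
  by apply: ler_wpM2r => //; apply: ler_wpM2l => //; exact: A_lip.
 have p3 : C * `|y - x| * `|A y v h| * `|k| <= C * `|y - x| * (C * `|v| * `|h|) * `|k|.
  by apply: ler_wpM2r => //; apply: ler_wpM2l; [exact: mulr_ge0|exact: A_bound].
 have [_ q _ _] := Psi_alg `|y - x| `|v| `|h| `|k|.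
 exact: (le_trans (norm2_le (le_trans p1 p3) p2) q).
have m3 : `|Gam y h (A y v k) - Gam x h (A x v k)| <= b.
 have [_ p1 _] := bGam bx by_ h (A y v k).
 have p2 : `|Gam x h (A y v k) - Gam x h (A x v k)| <= C * `|h| * (C * `|v| * `|y - x| * `|k|).
  have s1 : Gam x h (A y v k) - Gam x h (A x v k) = Gam x h (A y v k - A x v k).
   exact: (esym (lin_sub _ _ (Gam_linr h bx))).
  rewrite s1; have [q _ _] := bGam bx bx h (A y v k - A x v k); via q.
  by apply: ler_wpM2l; [exact: mulr_ge0|exact: A_lip].
 have p3 : C * `|y - x| * `|h| * `|A y v k| <= C * `|y - x| * `|h| * (C * `|v| * `|k|).
  by apply: ler_wpM2l; [rewrite !mulr_ge0|exact: A_bound].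
 have [_ _ q _] := Psi_alg `|y - x| `|v| `|h| `|k|.
 exact: (le_trans (norm2_le (le_trans p1 p3) p2) q).
have m4 : `|'d (fun z => Gam z h k) y (X y v) - 'd (fun z => Gam z h k) x (X x v)| <= b.
 have p2 : `|'d (fun z => Gam z h k) x (X y v) - 'd (fun z => Gam z h k) x (X x v)| <=
   C * (C * `|v| * `|y - x|) * `|h| * `|k|.
  have s1 : 'd (fun z => Gam z h k) x (X y v) - 'd (fun z => Gam z h k) x (X x v) =
   'd (fun z => Gam z h k) x (X y v - X x v) by exact: esym (diff_sub _ _ _ _).
  rewrite s1; have [_ _ q] := bGam bx bx h k; via (q _).
  by rewrite !ler_wpM2r // ler_wpM2l //; exact: X_lip.
 have p3 : C * `|y - x| * `|X y v| * `|h| * `|k| <= C * `|y - x| * (C * `|v|) * `|h| * `|k|.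
  by rewrite !ler_wpM2r // ler_wpM2l ?mulr_ge0 //; exact: X_bound.
 have [_ _ _ q] := Psi_alg `|y - x| `|v| `|h| `|k|.
 exact: (le_trans (norm2_le (le_trans (bdGam bx by_ h k (X y v)) p3) p2) q).
have alg (a1 a2 a3 a4 b1 b2 b3 b4 : H) : a1 - a2 - a3 - a4 - (b1 - b2 - b3 - b4) =
 (a1 - b1) - (a2 - b2) - (a3 - b3) - (a4 - b4) by module R.
via (le_norm_eq (alg _ _ _ _ _ _ _ _)).
via (norm4_le m1 m2 m3 m4).
apply: le_of_eq; rewrite /b /n; ring.
Qed.

Lemma prolongation_bound x v h k : B x -> `|Psi x v h k| <= 4 * C ^+ 2 * `|v| * `|h| * `|k|.
Proof.
move=> bx; have Cn := ltW C0; have [q1 _ q4] := bGam bx bx h k.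
have [q2 _ _] := bGam bx bx (A x v h) k; have [q3 _ _] := bGam bx bx h (A x v k).
have e (a b : R) : a = b -> a <= b by move=> ->.
have m1 : `|A x v (Gam x h k)| <= C ^+ 2 * `|v| * `|h| * `|k|.
 via (A_bound _ _ bx).
 apply: (le_trans (ler_wpM2l (mulr_ge0 Cn (normr_ge0 v)) q1)); apply: e; ring.
have m2 : `|Gam x (A x v h) k| <= C ^+ 2 * `|v| * `|h| * `|k|.
 via q2.
 by apply: (le_trans (ler_wpM2r (normr_ge0 k) (ler_wpM2l Cn (A_bound v h bx)))); apply: e; ring.
have m3 : `|Gam x h (A x v k)| <= C ^+ 2 * `|v| * `|h| * `|k|.
 via q3.
 by apply: (le_trans (ler_wpM2l (mulr_ge0 Cn (normr_ge0 h)) (A_bound v k bx))); apply: e; ring.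
have m4 : `|'d (fun z => Gam z h k) x (X x v)| <= C ^+ 2 * `|v| * `|h| * `|k|.
 via (q4 _).
 by apply: (le_trans (ler_wpM2r (normr_ge0 k) (ler_wpM2r (normr_ge0 h) (ler_wpM2l Cn (X_bound v bx))))); apply: e; ring.
by via (norm4_le m1 m2 m3 m4); apply: e; ring.
Qed.

Let sub4_linear a (p1 p2 p3 p4 a1 a2 a3 a4 b1 b2 b3 b4 : H) :
 p1 = a *: a1 + b1 -> p2 = a *: a2 + b2 -> p3 = a *: a3 + b3 -> p4 = a *: a4 + b4 ->
 p1 - p2 - p3 - p4 = a *: (a1 - a2 - a3 - a4) + (b1 - b2 - b3 - b4).
Proof. by move=> -> -> -> ->; module R. Qed.

Lemma prolongation_linear x v k : B x -> linear (fun h => Psi x v h k).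
Proof.
move=> bx a u w; apply: sub4_linear.
- exact: (etrans (congr1 (A x v) (Gam_linl k bx a u w)) (A_linearr v bx a _ _)).
- exact: (etrans (congr1 (fun z => Gam x z k) (A_linearr v bx a u w)) (Gam_linl k bx a _ _)).
- exact: (Gam_linl (A x v k) bx a u w).
-
 by have [_ _ h _] := family1_diff (family2_fix k (christoffel_family gU)); exact: h x (X x v) (BU bx) a u w.
Qed.

Lemma prolongation_linear_param x h k : B x -> linear (fun v => Psi x v h k).
Proof.
move=> bx a u w; apply: sub4_linear.
- exact: A_linearl.
- exact: (etrans (congr1 (fun z => Gam x z k) (A_linearl h bx a u w)) (Gam_linl k bx a _ _)).
- exact: (etrans (congr1 (Gam x h) (A_linearl k bx a u w)) (Gam_linr h bx a _ _)).
-
 apply: (etrans (congr1 (fun z => 'd (fun y => Gam y h k) x z) (X_linear bx a u w))).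
 by apply: (etrans (diff_add _ _ _ _)); congr (_ + _); exact: diff_scale.
Qed.

Hypothesis X_quad : forall x v h, B x -> B (x + h) ->
 `|X (x + h) v - X x v - A x v h| <= C * `|v| * `|h| ^+ 2.
Hypothesis A_quad : forall x v h k, B x -> B (x + h) ->
 `|A (x + h) v k - A x v k - Psi x v h k| <= C' * `|v| * `|h| ^+ 2 * `|k|.

Let near_ball x : B x -> exists2 e : R, 0 < e & forall h, `|h| < e -> B (x + h).
Proof.
move=> bx; exists (r - `|x - x0|); first by move: bx; rewrite /B /nball/=; lra.
by move=> h hh; rewrite /B /nball/= addrAC; have := ler_normD (x - x0) h; lra.
Qed.

Lemma prolongation_diff x v : B x ->
 is_diff (x, v) (fun z => X z.1 z.2) (fun z => A x v z.1 + X x z.2).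
Proof.
move=> bx; have [e e0 he] := near_ball bx; have Cn := ltW C0.
apply: (is_diff_quadratic (C := C * `|v| + C) (r := e)) => //.
- move=> a [h w] [h' w'] /=; rewrite (A_linearr v bx) (X_linear bx).
 by move: (A x v h) (A x v h') (X x w) (X x w') => *; module R.
- exists (C * `|v| + C) => -[h w] /=; via (ler_normD _ _); rewrite mulrDl.
 apply: lerD; [via (A_bound v h bx)|via (X_bound w bx)].
  by apply: ler_wpM2l; [exact: mulr_ge0|exact: (norm_fst_le (h, w))].
 by apply: ler_wpM2l => //; exact: (norm_snd_le (h, w)).
move=> [h w]; rewrite norm_pair_lt => /andP[hh hw] /=; have bxh := he h hh.
have eq : X (x + h) (v + w) - X x v - (A x v h + X x w) =
  (X (x + h) v - X x v - A x v h) + (X (x + h) w - X x w).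
 rewrite (lin_add _ _ (X_linear bxh)).
 by move: (X (x + h) v) (X (x + h) w) (X x v) (X x w) (A x v h) => *; module R.
rewrite eq; via (ler_normD _ _).
have n1 := norm_fst_le (h, w); have n2 := norm_snd_le (h, w); rewrite /= in n1 n2.
have q := X_lip w bx bxh; rewrite [x + h]addrC addrK [h + x]addrC in q.
rewrite mulrDl; apply: lerD.
 apply/(le_trans (X_quad v bx bxh))/ler_wpM2l; first exact: mulr_ge0.
 by rewrite lerXn2r ?nnegrE.
via q; rewrite -mulrA; apply: ler_wpM2l => //; rewrite expr2.
by apply: ler_pM.
Qed.

Let diff2_algebra (v w h k l n : R) : 0 <= v -> 0 <= w -> 0 <= h -> 0 <= k -> 0 <= l ->
 h <= n -> w <= n -> l <= n ->
 `|C'| * v * h ^+ 2 * k + C * w * h * k + C * v * h * l + C * w * l <=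
 (`|C'| * v * k + C * k + C * v + C) * n ^+ 2.
Proof.
move=> v0 w0 h0 k0 l0 hn wn ln; have Cn := ltW C0; rewrite !mulrDl.
have hh : h ^+ 2 <= n ^+ 2 by rewrite lerXn2r //; apply: le_trans hn.
have wh : w * h <= n ^+ 2 by exact: ler_pM.
have hl : h * l <= n ^+ 2 by exact: ler_pM.
have wl : w * l <= n ^+ 2 by rewrite expr2; exact: ler_pM.
have a1 := ler_wpM2l (mulr_ge0 (mulr_ge0 (normr_ge0 C') v0) k0) hh.
have a3 := ler_wpM2l (mulr_ge0 Cn v0) hl.
have a4 := ler_wpM2l Cn wl.
by apply: lerD; [apply: lerD; [apply: lerD|]|];
 [rewrite mulrAC|apply: le_trans (ler_wpM2l (mulr_ge0 Cn k0) wh); apply: le_of_eq; ring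
 |rewrite -mulrA|rewrite -mulrA].
Qed.

Lemma prolongation_diff2 x v k : B x ->
 is_diff (x, (v, k)) (fun z => A z.1 z.2.1 z.2.2)
  (fun z => Psi x v z.1 k + A x z.2.1 k + A x v z.2.2).
Proof.
move=> bx; have [e e0 he] := near_ball bx; have Cn := ltW C0.
have Cq : 0 <= 4 * C ^+ 2 by have := sqr_ge0 C; lra.
apply: (is_diff_quadratic (C := `|C'| * `|v| * `|k| + C * `|k| + C * `|v| + C) (r := e)) => //.
- move=> a [h [w l]] [h' [w' l']] /=.
 apply: (etrans (f_equal3 (fun a b c => a + b + c) (prolongation_linear v k bx a h h') (A_linearl k bx a w w') (A_linearr v bx a l l'))).
 move: (Psi x v h k) (Psi x v h' k) (A x w k) (A x w' k) (A x v l) (A x v l') => *.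
 by module R.
- exists (4 * C ^+ 2 * `|v| * `|k| + C * `|k| + C * `|v|) => -[h [w l]] /=.
 have tri (a b c : H) : `|a + b + c| <= `|a| + `|b| + `|c|.
  by have := ler_normD (a + b) c; have := ler_normD a b; lra.
 have dist (a b c n : R) : (a + b + c) * n = a * n + b * n + c * n by ring.
 via (tri _ _ _); rewrite dist.
 have n0 := norm_fst_le (h, (w, l)); have n1 := norm_fst_le (w, l); have n2 := norm_snd_le (w, l).
 have n3 := norm_snd_le (h, (w, l)); rewrite /= in n0 n1 n2 n3.
 apply: lerD; [apply: lerD|].
 + via (prolongation_bound v h k bx).
  by rewrite mulrAC; apply: ler_wpM2l => //; rewrite !mulr_ge0.
 + via (A_bound w k bx); rewrite mulrAC; apply: ler_wpM2l => //.
   exact: mulr_ge0.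
  exact: (le_trans n1 n3).
 + via (A_bound v l bx); apply: ler_wpM2l => //; first exact: mulr_ge0.
  exact: (le_trans n2 n3).
move=> [h [w l]]; rewrite !norm_pair_lt => /andP[hh _] /=; have bxh := he h hh.
have q2 := A_lip w k bx bxh; have q3 := A_lip v l bx bxh.
have q4 := A_bound w l bxh.
rewrite [x + h]addrC addrK [h + x]addrC in q2; rewrite [x + h]addrC addrK [h + x]addrC in q3.
have e1 : A (x + h) (v + w) (k + l) = A (x + h) v k + A (x + h) v l + (A (x + h) w k + A (x + h) w l).
 apply: (etrans (lin_add _ _ (A_linearl (k + l) bxh))).
 by congr (_ + _); exact: (lin_add _ _ (A_linearr _ bxh)).
have E : A (x + h) (v + w) (k + l) - A x v k - (Psi x v h k + A x w k + A x v l) =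
  (A (x + h) v k - A x v k - Psi x v h k) + (A (x + h) w k - A x w k) + (A (x + h) v l - A x v l)
  + A (x + h) w l.
 apply: (etrans (congr1 (fun z => z - A x v k - (Psi x v h k + A x w k + A x v l)) e1)).
 move: (A (x + h) v k) (A (x + h) v l) (A (x + h) w k) (A (x + h) w l) (A x v k) (Psi x v h k).
 by move: (A x w k) (A x v l) => *; module R.
have tri (a b c d : H) : `|a + b + c + d| <= `|a| + `|b| + `|c| + `|d|.
 by have := ler_normD (a + b + c) d; have := ler_normD (a + b) c; have := ler_normD a b; lra.
apply/(le_trans (le_norm_eq E))/(le_trans (tri _ _ _ _)).
have n0 := norm_fst_le (h, (w, l)); have n1 := norm_fst_le (w, l); have n2 := norm_snd_le (w, l).
have n3 := norm_snd_le (h, (w, l)); rewrite /= in n0 n1 n2 n3.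
apply: le_trans (diff2_algebra (normr_ge0 v) (normr_ge0 w) (normr_ge0 h) (normr_ge0 k) (normr_ge0 l)
 n0 (le_trans n1 n3) (le_trans n2 n3)).
apply: lerD => //; apply: lerD => //; apply: lerD => //; via (A_quad v k bx bxh).
by do ! apply: ler_wpM2r => //; exact: ler_norm.
Qed.

(** [A] is the derivative of [X], and the derivative of [A] is an expression in [X], [A] and the
    Christoffel symbols, so the pair gains one derivative at each turn. The parameter space [G] is
    the line for the generator of one flow, and [H] for the frame of all transvections. *)
Lemma prolongation_smooth : family1 B X /\ family2 B A.
Proof.
have oB : open B by exact: nball_open.
suff cXA n : Ck n (B `*` setT) (fun z => X z.1 z.2) /\
  Ck n (B `*` setT) (fun z => A z.1 z.2.1 z.2.2).
 split; split; [exact: oB|by move=> n; have [] := cXA n|exact: X_linear|exact: oB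
  |by move=> n; have [] := cXA n|by move=> x k; exact: A_linearl|by move=> x v; exact: A_linearr].
have oB1 := openXT oB (G := G); have oB2 := openXT oB (G := (G * H)%type).
elim: n => [|n [cX cA]].
 split=> [[x v] [/= bx _]|[x [v k]] [/= bx _]].
  by have [d _] := prolongation_diff v bx; exact: differentiable_continuous d.
 by have [d _] := prolongation_diff2 v k bx; exact: differentiable_continuous d.
split; split.
- by move=> [x v] [/= bx _]; have [] := prolongation_diff v bx.
- apply: (@Ck_congr _ _ _ _ _ (fun z => A z.1.1 z.1.2 z.2.1 + X z.1.1 z.2.2)).
 + exact: openXT.
 + by move=> [[x v] z] [[/= bx _] _]; have [_ ->] := prolongation_diff v bx.
 + have oBB := openXT oB1 (G := (H * G)%type).
  apply: Ck_add => //.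
   by apply: (Ck_comp3 oBB cA); [move=> z [[]]|Ck_auto..].
  by apply: (Ck_comp2 oBB cX); [move=> z [[]]|Ck_auto..].
- by move=> [x [v k]] [/= bx _]; have [] := prolongation_diff2 v k bx.
have oBB := openXT oB2 (G := (H * (G * H))%type).
have [oU sG lG1 lG2] := christoffel_family gU.
have cG := Ck_sub (V := B `*` setT) (fun z hz => conj (BU hz.1) I) (sG n).
have fG := family2_uncurry (christoffel_family gU).
have [_ sD _ _] := family1_diff fG.
apply: (@Ck_congr _ _ _ _ _ (fun z => (A z.1.1 z.1.2.1 (Gam z.1.1 z.2.1 z.1.2.2)
  - Gam z.1.1 (A z.1.1 z.1.2.1 z.2.1) z.1.2.2 - Gam z.1.1 z.2.1 (A z.1.1 z.1.2.1 z.1.2.2)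
  - 'd (fun y : H * H => Gam y.1 y.2 z.1.2.2) (z.1.1, z.2.1) (X z.1.1 z.1.2.1, 0))
  + A z.1.1 z.2.2.1 z.1.2.2 + A z.1.1 z.1.2.1 z.2.2.2)).
- exact: openXT.
- move=> [[x [v k]] [h [w l]]] [[/= bx _] _]; have [_ e] := prolongation_diff2 v k bx.
 apply: esym; apply: (etrans (congr1 (fun L => L (h, (w, l))) e)) => /=.
 congr (_ + _ + _); congr (_ - _).
 have dG : differentiable (fun y : H * H => Gam y.1 y.2 k) (x, h).
  exact: (@family1_differentiable _ _ _ _ _ _ (x, h) k fG (conj (BU bx) I)).
 have [_ e2] := is_diff_partial dG.
 exact: (congr1 (fun L => L (X x v)) e2).
have cA' (f : H * (G * H) * (H * (G * H)) -> H) : Ck n ((B `*` setT) `*` setT) f ->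
  Ck n ((B `*` setT) `*` setT) (fun z => A z.1.1 z.1.2.1 (f z)).
 by move=> hf; apply: (Ck_comp3 oBB cA); [move=> z [[]]|Ck_auto..].
have cG' (f1 f2 : H * (G * H) * (H * (G * H)) -> H) : Ck n ((B `*` setT) `*` setT) f1 ->
  Ck n ((B `*` setT) `*` setT) f2 ->
  Ck n ((B `*` setT) `*` setT) (fun z => Gam z.1.1 (f1 z) (f2 z)).
 by move=> h1 h2; apply: (Ck_comp3 oBB cG); [move=> z [[]]|Ck_auto..].
apply: Ck_add => //; first apply: Ck_add => //; first apply: Ck_sub_fun => //;
 first apply: Ck_sub_fun => //; first apply: Ck_sub_fun => //.
- by apply: cA'; apply: cG'; Ck_auto.
- by apply: cG'; [apply: cA'|]; Ck_auto.
- by apply: cG'; [|apply: cA']; Ck_auto.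
- have cX' : Ck n ((B `*` setT) `*` setT)
   (fun z : H * (G * H) * (H * (G * H)) => X z.1.1 z.1.2.1).
  by apply: (Ck_comp2 oBB cX); [move=> z [[]]|Ck_auto..].
 apply: (@Ck_comp3 R n _ (H * H)%type H (H * H)%type H _ ((U `*` setT) `*` setT)
  (fun z => (z.1.1, z.2.1)) (fun z => z.1.2.2) (fun z => (X z.1.1 z.1.2.1, 0))
  (fun y k h => 'd (fun y : H * H => Gam y.1 y.2 k) y h) oBB (sD n));
  [by move=> z [[/BU]]|Ck_auto..].
- by apply: (Ck_comp3 oBB cA); [move=> z [[]]|Ck_auto..].
- by apply: (Ck_comp3 oBB cA); [move=> z [[]]|Ck_auto..].
Qed.

End Prolongation.

Section UniformLimit.
Context {R : realType} (E F : normedModType R).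

(** [psi t] divided by [t] converges to [f] and its differentials to [L], both at rate [t]. Since
    [L] is Lipschitz, the mean value inequality for [psi t] survives division by [t] and passage to
    the limit. *)
Lemma limit_diff (x0 : E) (r d C K : R) (psi : R -> E -> F) (f : E -> F) (L : E -> E -> F) :
 0 < d ->
 (forall t x, 0 < t -> t < d -> nball x0 r x -> differentiable (psi t) x /\
  `|psi t x - t *: f x| <= C * t ^+ 2 /\
  forall h, `|'d (psi t) x h - t *: L x h| <= C * t ^+ 2 * `|h|) ->
 (forall x y h, nball x0 r x -> nball x0 r y -> `|L y h - L x h| <= K * `|y - x| * `|h|) ->
 0 <= K -> 0 <= C ->
 forall x h, nball x0 r x -> nball x0 r (x + h) -> `|f (x + h) - f x - L x h| <= K * `|h| ^+ 2.
Proof.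
move=> d0 hpsi hL K0 C0 x h bx bxh.
apply: (@small_square_le _ _ _ (2 * C + C * `|h|) d) => // t t0 td.
have [_ [b1 _]] := hpsi t x t0 td bx; have [_ [b2 _]] := hpsi t (x + h) t0 td bxh.
have seg (s : R) : 0 <= s <= 1 -> nball x0 r (x + s *: h).
 by move=> hs; have := nball_segment bx bxh hs; rewrite [x + h]addrC addrK.
pose D s := psi t (x + s *: h) - s *: (t *: L x h).
pose D' s := 'd (psi t) (x + s *: h) h - t *: L x h.
have b3 : `|psi t (x + h) - psi t x - t *: L x h| <= (C * t ^+ 2 + K * t * `|h|) * `|h|.
 have -> : psi t (x + h) - psi t x - t *: L x h = D 1 - D 0.
  by rewrite /D !scale1r scale0r addr0 scale0r subr0 addrAC.
 rewrite -[X in _ <= X]mulr1 -[X in _ * X](subr0 1); apply: (@mean_value _ _ D D' 0 1 ((C * t ^+ 2 + K * t * `|h|) * `|h|) ler01) => s hs; have bs := seg s hs.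
  have [ds _] := hpsi t _ t0 td bs.
  have c1 : cder (fun s => psi t (x + s *: h)) s ('d (psi t) (x + s *: h) h).
   exact: (cder_comp (f := psi t) ds (cder_line x h s)).
  have c2 : cder (fun s => s *: (t *: L x h)) s (t *: L x h).
   have := cder_line 0 (t *: L x h) s; apply: cder_near; apply: filterE => w; by rewrite add0r.
  exact: cderB c1 c2.
 have [_ [_ bD]] := hpsi t _ t0 td bs; have hb := bD h.
 have lb := hL _ _ h bx bs; rewrite [x + s *: h]addrC addrK [_ + x]addrC in lb.
 have sh : `|s *: h| <= `|h| by rewrite normrZ ler_piMl // ger0_norm; case/andP: hs.
 have -> : D' s = ('d (psi t) (x + s *: h) h - t *: L (x + s *: h) h)
   + t *: (L (x + s *: h) h - L x h) by rewrite scalerBr addrA subrK.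
 via (ler_normD _ _); rewrite normrZ gtr0_norm //.
 have q1 : K * `|s *: h| * `|h| <= K * `|h| * `|h| by rewrite ler_wpM2r // ler_wpM2l.
 have q2 := ler_wpM2l (ltW t0) (le_trans lb q1); lin.
have -> : t *: (f (x + h) - f x - L x h) = (psi t (x + h) - psi t x - t *: L x h)
  - (psi t (x + h) - t *: f (x + h)) + (psi t x - t *: f x) by module R.
have tri (a b c : F) : `|a - b + c| <= `|a| + `|b| + `|c|.
 by have := ler_normD (a - b) c; have := ler_normB a b; lin.
via (tri _ _ _); lin.
Qed.

Lemma cder_quadratic (f : R -> F) (a : F) (K d : R) : 0 < d ->
 (forall t, `|t| < d -> `|f t - f 0 - t *: a| <= K * t ^+ 2) -> cder f 0 a.
Proof.
move=> d0 hf; apply: (is_diff_quadratic (C := K) (r := d)) => //.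
- by move=> b s t; rewrite scalerDl scalerA.
- by exists `|a| => t; rewrite normrZ mulrC.
- by move=> t ht; rewrite add0r real_normK ?num_real //; exact: hf.
Qed.

End UniformLimit.

(** * The generator of a local flow of isometries *)

Section LocalFlow.
Context {R : realType} (H : hilbert R).
Variables (U : set H) (g : H -> H -> H -> R).
Hypothesis gU : local_metric U g.
Local Notation Gam := (christoffel_of g).
Variables (x0 : H) (rho d C : R) (V : R -> set H) (Phi : R -> H -> H).
Hypotheses (rho0 : 0 < rho) (d0 : 0 < d) (C0 : 0 < C).
Hypothesis rhoU : nball x0 (2 * rho) `<=` U.
Hypothesis iPhi : forall t, `|t| < d -> local_isometry U g U g (V t) (Phi t).
Hypothesis sPhi : forall t x, `|t| < d -> V t x -> forall w, exists w', 'd (Phi t) x w' = w.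
Hypothesis dom : forall t x, `|t| < d -> nball x0 (2 * rho) x -> V t x.
Hypothesis bPhi : forall t x, `|t| < d -> nball x0 (2 * rho) x -> [/\ `|Phi t x - x| <= C * `|t|,
 forall k, `|'d (Phi t) x k - k| <= C * `|t| * `|k| &
 forall h k, `|'d (fun y => 'd (Phi t) y k) x h| <= C * `|t| * `|h| * `|k|].
Hypothesis Cd : C * d <= rho.
Hypothesis PhiD : forall s t x, `|s| < d -> `|t| < d -> `|s + t| < d -> nball x0 rho x ->
 Phi (s + t) x = Phi s (Phi t x) /\ forall k, 'd (Phi (s + t)) x k = 'd (Phi s) (Phi t x) ('d (Phi t) x k).
Hypothesis bGam : forall y z, nball x0 (2 * rho) y -> nball x0 (2 * rho) z -> forall u v,
  [/\ `|Gam y u v| <= C * `|u| * `|v|, `|Gam z u v - Gam y u v| <= C * `|z - y| * `|u| * `|v|,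
   forall h, `|'d (fun y => Gam y u v) y h| <= C * `|h| * `|u| * `|v| &
   `|Gam z u v - Gam y u v - 'd (fun y => Gam y u v) y (z - y)| <= C * `|z - y| ^+ 2 * `|u| * `|v|].
Hypothesis bdGam : forall y z, nball x0 (2 * rho) y -> nball x0 (2 * rho) z -> forall u v h,
  `|'d (fun y => Gam y u v) z h - 'd (fun y => Gam y u v) y h| <= C * `|z - y| * `|h| * `|u| * `|v|.

Let B := nball x0 rho.
Let B2 := nball x0 (2 * rho).

Let BB2 x : B x -> B2 x.
Proof. by move=> bx; apply: (lt_trans bx); have := rho0; lra. Qed.

Let Phi_in t x : `|t| < d -> B x -> B2 (Phi t x).
Proof.
move=> ht bx; have [h _ _] := bPhi ht (BB2 bx).
have := ler_distD x (Phi t x) x0; have := ler_wpM2l (ltW C0) (ltW ht); have := Cd.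
by move: bx; rewrite /B /B2 /nball/= => bx; lra.
Qed.

Let sV t : `|t| < d -> open (V t) /\ smooth_on (V t) (Phi t).
Proof. by move=> /iPhi[]. Qed.

Let seg x y (s : R) : B2 x -> B2 y -> 0 <= s <= 1 -> B2 (x + s *: (y - x)).
Proof. exact: nball_segment. Qed.

(** The derivative bounds on [Phi s - id] along a segment give the Lipschitz constant [C * |s|], the
    source of the bilinear error in approximate additivity. *)
Let Phi_lip s x y : `|s| < d -> B2 x -> B2 y ->
 `|(Phi s y - y) - (Phi s x - x)| <= C * `|s| * `|y - x| /\
 forall k, `|'d (Phi s) y k - 'd (Phi s) x k| <= C * `|s| * `|y - x| * `|k|.
Proof.
move=> hs bx by_; have [oV sF] := sV hs.
have Vz (w : R) : 0 <= w <= 1 -> V s (x + w *: (y - x)) by move=> hw; apply: dom => //; exact: seg.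
have e1 : x + 1 *: (y - x) = y by rewrite scale1r addrC subrK.
split.
 pose D w := Phi s (x + w *: (y - x)) - (x + w *: (y - x)).
 have := @mean_value _ _ D (fun w => 'd (Phi s) (x + w *: (y - x)) (y - x) - (y - x)) 0 1
  (C * `|s| * `|y - x|) ler01.
 rewrite /D e1 scale0r addr0 subr0 mulr1; apply => w hw.
  by apply: cderB; [exact: (cder_along sF (Vz w hw))|exact: cder_line].
 by have [_ h _] := bPhi hs (seg bx by_ hw); exact: h.
move=> k.
have := @mean_value _ _ (fun w => 'd (Phi s) (x + w *: (y - x)) k)
 (fun w => 'd (fun z => 'd (Phi s) z k) (x + w *: (y - x)) (y - x)) 0 1 (C * `|s| * `|y - x| * `|k|) ler01.
rewrite e1 scale0r addr0 subr0 mulr1; apply => w hw.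
 exact: (cder_along_diff k oV sF (Vz w hw)).
by have [_ _ h] := bPhi hs (seg bx by_ hw).
Qed.

(** [C] bounds the displacement linearly; twice [C ^+ 2] bounds the two parts of the additivity
    defect of the differentials. *)
Let K0 := C + C ^+ 2 + C ^+ 2.
Let K0_ge : [/\ 0 < K0, C <= K0 & C ^+ 2 + C ^+ 2 <= K0].
Proof. by rewrite /K0; move: C0 (sqr_ge0 C); split; lra. Qed.

Let Xex x : exists X : H, B x -> forall t, `|t| < d -> `|Phi t x - x - t *: X| <= 4 * K0 * t ^+ 2.
Proof.
have [bx|nb] := pselect (B x); last by exists 0.
have [k0 k1 k2] := K0_ge.
have [||X hX] := @approximately_additive _ _ (fun t => Phi t x - x) d K0 (@complete_cauchy _ H) d0 (ltW k0).
- move=> t ht; have [h _ _] := bPhi ht (BB2 bx); via h; exact: ler_wpM2r.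
- move=> s t hs ht hst; have [e _] := PhiD hs ht hst bx; rewrite e.
 have [h _] := Phi_lip hs (BB2 bx) (Phi_in ht bx); have [h2 _ _] := bPhi ht (BB2 bx).
 have -> : Phi s (Phi t x) - x - (Phi s x - x) - (Phi t x - x) =
  Phi s (Phi t x) - Phi t x - (Phi s x - x) by module R.
 via h; have h3 := ler_wpM2l (mulr_ge0 (ltW C0) (normr_ge0 s)) h2.
 have h4 : (C ^+ 2 + C ^+ 2) * (`|s| * `|t|) <= K0 * (`|s| * `|t|).
  by apply: ler_wpM2r => //; exact: mulr_ge0.
 have h5 : 0 <= C ^+ 2 * (`|s| * `|t|) by apply: mulr_ge0; [exact: sqr_ge0|exact: mulr_ge0].
 by rewrite expr2 in h4 h5; lra.
by exists X => _.
Qed.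

Let X x := sval (cid (Xex x)).
Let XE x t : B x -> `|t| < d -> `|Phi t x - x - t *: X x| <= 4 * K0 * t ^+ 2.
Proof. by move=> bx; exact: (svalP (cid (Xex x)) bx). Qed.

Let Aex x k : exists A : H, B x -> forall t, `|t| < d ->
 `|'d (Phi t) x k - k - t *: A| <= 4 * (K0 * `|k|) * t ^+ 2.
Proof.
have [bx|nb] := pselect (B x); last by exists 0.
have [k0 k1 k2] := K0_ge.
have Kk : 0 <= K0 * `|k| by rewrite mulr_ge0 // ltW.
have [||A hA] := @approximately_additive _ _ (fun t => 'd (Phi t) x k - k) d (K0 * `|k|)
 (@complete_cauchy _ H) d0 Kk.
- move=> t ht; have [_ h _] := bPhi ht (BB2 bx); via (h k).
 by rewrite mulrAC; apply: ler_wpM2r => //; apply: ler_wpM2r.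
- move=> s t hs ht hst; have [_ e] := PhiD hs ht hst bx.
 have [_ h] := Phi_lip hs (BB2 bx) (Phi_in ht bx); have [h2 h2' _] := bPhi ht (BB2 bx).
 have [_ h3 _] := bPhi hs (Phi_in ht bx).
 have s1 a b : 'd (Phi s) (Phi t x) b = 'd (Phi s) (Phi t x) a + 'd (Phi s) (Phi t x) (b - a).
  have e2 := diff_add (Phi s) (Phi t x) a (b - a); rewrite addrC subrK in e2; exact: e2.
 have q p a b c f : p = a + b -> p - k - (c - k) - (f - k) = (a - c) + (b - (f - k)).
  by move=> ->; module R.
 via (le_norm_eq (q _ _ _ ('d (Phi s) x k) ('d (Phi t) x k) (etrans (e k) (s1 k _)))).
 via (ler_normD _ _).
 have p0 := mulr_ge0 (ltW C0) (normr_ge0 s).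
 have h4 : (C ^+ 2 + C ^+ 2) * (`|s| * `|t| * `|k|) <= K0 * (`|s| * `|t| * `|k|).
  by apply: ler_wpM2r => //; rewrite !mulr_ge0.
 rewrite expr2 in h4; via (lerD (h k) (h3 ('d (Phi t) x k - k))).
 apply: (le_trans (lerD (ler_wpM2r (normr_ge0 k) (ler_wpM2l p0 h2)) (ler_wpM2l p0 (h2' k)))); lra.
by exists A => _.
Qed.

Let A x k := sval (cid (Aex x k)).
Let AE x k t : B x -> `|t| < d -> `|'d (Phi t) x k - k - t *: A x k| <= 4 * K0 * t ^+ 2 * `|k|.
Proof.
move=> bx ht; have := svalP (cid (Aex x k)) bx t ht; rewrite -/(A x k).
by lra.
Qed.

Let pos_abs (t : R) : 0 < t -> t < d -> `|t| < d.
Proof. by move=> t0 td; rewrite gtr0_norm. Qed.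

Let A_linear x : B x -> linear (A x).
Proof.
move=> bx a u v; apply: subr0_eq.
apply: (@small_square_zero _ _ _ (4 * K0 * `|a *: u + v| + `|a| * (4 * K0 * `|u|) + 4 * K0 * `|v|) d d0).
move=> t t0 td; have ht := pos_abs t0 td.
have h1 := AE (a *: u + v) bx ht; have h2 := AE u bx ht; have h3 := AE v bx ht.
have e : 'd (Phi t) x (a *: u + v) = a *: 'd (Phi t) x u + 'd (Phi t) x v.
 by rewrite (diff_add (Phi t)) diff_scale.
rewrite e in h1.
move: h1 h2 h3; move: ('d (Phi t) x u) ('d (Phi t) x v) (A x (a *: u + v)) (A x u) (A x v) => p q a1 a2 a3 h1 h2 h3.
have -> : t *: (a1 - (a *: a2 + a3)) = a *: (p - u - t *: a2) + (q - v - t *: a3)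
 - (a *: p + q - (a *: u + v) - t *: a1) by module R.
have tri (b1 b2 b3 : H) : `|b1 + b2 - b3| <= `|b1| + `|b2| + `|b3|.
 by have := ler_normB (b1 + b2) b3; have := ler_normD b1 b2; lra.
via (tri _ _ _); rewrite normrZ.
by have := ler_wpM2l (normr_ge0 a) h2; lra.
Qed.

Let X_bound x : B x -> `|X x| <= C.
Proof.
move=> bx; apply: (@small_square_le _ _ _ (4 * K0) d) => // t t0 td; have ht := pos_abs t0 td.
have h1 := XE bx ht; have [h2 _ _] := bPhi ht (BB2 bx); rewrite gtr0_norm // in h2.
by have := ler_distD (Phi t x - x) 0 (t *: X x); rewrite !sub0r !normrN; lra.
Qed.

Let A_bound x k : B x -> `|A x k| <= C * `|k|.
Proof.
move=> bx; apply: (@small_square_le _ _ _ (4 * K0 * `|k|) d) => // t t0 td; have ht := pos_abs t0 td.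
have h1 := AE k bx ht; have [_ h2 _] := bPhi ht (BB2 bx); have {}h2 := h2 k; rewrite gtr0_norm // in h2.
by have := ler_distD ('d (Phi t) x k - k) 0 (t *: A x k); rewrite !sub0r !normrN; lra.
Qed.

Let lip_limit (t e1 e2 n : R) (a a' b b' : H) : 0 < t ->
 `|a - t *: a'| <= e1 -> `|b - t *: b'| <= e2 -> `|b - a| <= n -> `|t *: (b' - a')| <= e1 + e2 + n.
Proof.
move=> t0 h1 h2 h3.
have -> : t *: (b' - a') = (b - a) - (b - t *: b') + (a - t *: a') by module R.
by move: (ler_normD (b - a - (b - t *: b')) (a - t *: a')) (ler_normB (b - a) (b - t *: b')); lra.
Qed.

Let X_lip x y : B x -> B y -> `|X y - X x| <= C * `|y - x|.
Proof.
move=> bx by_; apply: (@small_square_le _ _ _ (8 * K0) d) => // t t0 td; have ht := pos_abs t0 td.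
have [h3 _] := Phi_lip ht (BB2 bx) (BB2 by_); rewrite gtr0_norm // in h3.
by have := lip_limit t0 (XE bx ht) (XE by_ ht) h3; lra.
Qed.

Let A_lip x y k : B x -> B y -> `|A y k - A x k| <= C * `|y - x| * `|k|.
Proof.
move=> bx by_; apply: (@small_square_le _ _ _ (8 * K0 * `|k|) d) => // t t0 td; have ht := pos_abs t0 td.
have [_ /(_ k) h3] := Phi_lip ht (BB2 bx) (BB2 by_); rewrite gtr0_norm // in h3.
have h4 : `|'d (Phi t) y k - k - ('d (Phi t) x k - k)| <= C * t * `|y - x| * `|k|.
 by rewrite opprB addrA subrK.
by have := lip_limit t0 (AE k bx ht) (AE k by_ ht) h4; lra.
Qed.

Let X_quad x h : B x -> B (x + h) -> `|X (x + h) - X x - A x h| <= C * `|h| ^+ 2.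
Proof.
move=> bx bxh; apply: (@limit_diff _ _ _ x0 rho d (4 * K0) C (fun t x => Phi t x - x) X A d0 _ _ (ltW C0)) => //.
- move=> t y t0 td by_; have ht := pos_abs t0 td; have [oV sF] := sV ht.
 have dI : is_diff y (@id H) (@id H) by apply: is_diff_linear => //; exists 1 => w; rewrite mul1r.
 have [dD eD] := is_diffB (differentiableP (smooth_diff sF (dom ht (BB2 by_)))) dI.
 split; [exact: dD|split; first exact: XE].
 by move=> k; have e := congr1 (fun L : H -> H => L k) eD; rewrite e /=; exact: AE.
- by have [k0] := K0_ge; lra.
Qed.

Let X_diff x : B x -> is_diff x X (A x).
Proof.
move=> bx; have r0 : 0 < rho - `|x - x0| by move: bx; rewrite /B /nball/=; lra.
apply: (is_diff_quadratic (C := C) (r := rho - `|x - x0|)) => //; first exact: A_linear.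
 by exists C => h; exact: A_bound.
move=> h hh; apply: X_quad => //.
by rewrite /B /nball/= addrAC; have := ler_normD (x - x0) h; lra.
Qed.

(** The generator and its derivative become families over the line, linear in the parameter, to fit
    the section on prolongation. *)
Let XR (x : H) (s : R^o) := s *: X x.
Let AR (x : H) (s : R^o) (k : H) := s *: A x k.
Let Psi x h k := prolongation g XR AR x (1 : R^o) h k.

Let sub4_congr (a a' b b' c c' e e' : H) : a = a' -> b = b' -> c = c' -> e = e' ->
 a - b - c - e = a' - b' - c' - e'.
Proof. by move=> -> -> -> ->. Qed.

Let PsiE x h k : Psi x h k =
 A x (Gam x h k) - Gam x (A x h) k - Gam x h (A x k) - 'd (fun y => Gam y h k) x (X x).
Proof.
apply: sub4_congr; first exact: scale1r.
- exact: (congr1 (fun z => Gam x z k) (scale1r _)).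
- exact: (congr1 (Gam x h) (scale1r _)).
- exact: (congr1 (fun z => 'd (fun y => Gam y h k) x z) (scale1r _)).
Qed.

Let Gam_linl x v : B2 x -> linear (fun u => Gam x u v).
Proof. by move=> bx; have [_ _ h _] := christoffel_family gU; exact: h x v (rhoU bx). Qed.

Let Gam_linr x u : B2 x -> linear (Gam x u).
Proof. by move=> bx; have [_ _ _ h] := christoffel_family gU; exact: h x u (rhoU bx). Qed.

Let lin_subZ (L : H -> H) s a b : linear L -> L a - s *: L b = L (a - s *: b).
Proof. by move=> l; rewrite (lin_sub _ _ l) (lin_scale _ _ l). Qed.

Let diff_linear (f : H -> H) x : linear ('d f x).
Proof. by move=> a u v; rewrite diff_add diff_scale. Qed.

Let norm_sub (a b : H) p q : `|a| <= p -> `|b| <= q -> `|a - b| <= p + q.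
Proof. by have := ler_normB a b; lra. Qed.

Let C3 := 16 * K0 * C + 4 * C ^+ 3.

Let second_order_algebra (a h k t : R) : 0 <= t -> 0 <= a -> 0 <= h -> 0 <= k ->
 (4 * K0 * t ^+ 2) * (C * h * k) + C * (C * t) ^+ 2 * h * k + C * (4 * K0 * t ^+ 2) * h * k
 + C * (C * t) * (C * t * h) * k + C * (4 * K0 * t ^+ 2 * h) * k
 + C * (C * t) * h * (C * t * k) + C * h * (4 * K0 * t ^+ 2 * k)
 + C * (C * t * h) * (C * t * k) <= C3 * t ^+ 2 * h * k.
Proof. by move=> *; apply: le_of_eq; rewrite /C3; ring. Qed.

(** [local_isometry_second_diff] is expanded around [x] to first order in [t]. The linear part is
    the prolongation formula; the eight errors [v1] to [v8], each of order [t ^+ 2], are summed in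
    [second_order_algebra]. *)
Let second_order x t h k : B x -> 0 < t -> t < d ->
 `|'d (fun y => 'd (Phi t) y k) x h - t *: Psi x h k| <= C3 * t ^+ 2 * `|h| * `|k|.
Proof.
move=> bx t0 td; have ht := pos_abs t0 td; have bx2 := BB2 bx; have by2 := Phi_in ht bx.
have Vx := dom ht bx2; set y := Phi t x in by2.
have e := local_isometry_second_diff gU gU h k (iPhi ht) Vx (sPhi ht Vx).
have [bP bD _] := bPhi ht bx2; rewrite gtr0_norm // -/y in bP bD.
have [tn hn kn] : [/\ 0 <= t, 0 <= `|h| & 0 <= `|k|] by split=> //; exact: ltW.
have Cn := ltW C0; have Ct : 0 <= C * t by exact: mulr_ge0.
set G := Gam x h k in e *.
have bG : `|G| <= C * `|h| * `|k| by have [b] := bGam bx2 bx2 h k.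
have [h' eh'] : exists h', 'd (Phi t) x h = h' by exists ('d (Phi t) x h).
have [k' ek'] : exists k', 'd (Phi t) x k = k' by exists ('d (Phi t) x k).
have bh' : `|h' - h| <= C * t * `|h| by rewrite -eh'.
have bk' : `|k' - k| <= C * t * `|k| by rewrite -ek'.
have ah : `|h' - h - t *: A x h| <= 4 * K0 * t ^+ 2 * `|h| by rewrite -eh'; exact: AE.
have ak : `|k' - k - t *: A x k| <= 4 * K0 * t ^+ 2 * `|k| by rewrite -ek'; exact: AE.
have k4 : 0 <= 4 * K0 by have [q] := K0_ge; lra.
have [eD eDP] : exists D : H -> H, D = 'd (fun z => Gam z h k) x by exists ('d (fun z => Gam z h k) x).
have v1 : `|'d (Phi t) x G - G - t *: A x G| <= 4 * K0 * t ^+ 2 * (C * `|h| * `|k|).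
 by apply: (le_trans (AE G bx ht)); apply: ler_wpM2l => //; apply: mulr_ge0 => //; exact: sqr_ge0.
have y2 : `|y - x| ^+ 2 <= (C * t) ^+ 2 by rewrite lerXn2r ?nnegrE.
have v2 : `|Gam y h k - G - eD (y - x)| <= C * (C * t) ^+ 2 * `|h| * `|k|.
 have [_ _ _ b] := bGam bx2 by2 h k; rewrite eDP; via b.
 by rewrite !ler_wpM2r // ler_wpM2l.
have v3 : `|eD (y - x) - t *: eD (X x)| <= C * (4 * K0 * t ^+ 2) * `|h| * `|k|.
 rewrite eDP; via (le_norm_eq (lin_subZ t (y - x) (X x) (diff_linear _ _))).
 have [_ _ b _] := bGam bx2 bx2 h k; via (b _); rewrite !ler_wpM2r // ler_wpM2l //; exact: XE.
have v4 : `|Gam y (h' - h) k - Gam x (h' - h) k| <= C * (C * t) * (C * t * `|h|) * `|k|.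
 by have [_ b _ _] := bGam bx2 by2 (h' - h) k; via b; rewrite ler_wpM2r // ler_pM3.
have v5 : `|Gam x (h' - h) k - t *: Gam x (A x h) k| <= C * (4 * K0 * t ^+ 2 * `|h|) * `|k|.
 via (le_norm_eq (lin_subZ t (h' - h) (A x h) (Gam_linl k bx2))).
 have [b _ _ _] := bGam bx2 bx2 (h' - h - t *: A x h) k; via b; exact: ler_pM3.
have v6 : `|Gam y h (k' - k) - Gam x h (k' - k)| <= C * (C * t) * `|h| * (C * t * `|k|).
 have [_ b _ _] := bGam bx2 by2 h (k' - k); via b.
 by rewrite ler_pM ?mulr_ge0 // ler_pM3.
have v7 : `|Gam x h (k' - k) - t *: Gam x h (A x k)| <= C * `|h| * (4 * K0 * t ^+ 2 * `|k|).
 via (le_norm_eq (lin_subZ t (k' - k) (A x k) (Gam_linr h bx2))).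
 have [b _ _ _] := bGam bx2 bx2 h (k' - k - t *: A x k); via b; exact: ler_pM3.
have v8 : `|Gam y (h' - h) (k' - k)| <= C * (C * t * `|h|) * (C * t * `|k|).
 by have [b _ _ _] := bGam by2 by2 (h' - h) (k' - k); via b; exact: ler_pM3.
have E0 : Gam y h' k' = Gam y h k + Gam y (h' - h) k + Gam y h (k' - k) + Gam y (h' - h) (k' - k).
 have l w := lin_sub h' h (Gam_linl w by2); have r w := lin_sub k' k (Gam_linr w by2).
 rewrite (r (h' - h)) (r h) (l k') (l k); move: (Gam y h k) (Gam y h' k) (Gam y h k') (Gam y h' k').
 by move=> a1 a2 a3 a4; module R.
have EE : 'd (fun y => 'd (Phi t) y k) x h - t *: Psi x h k =
  ('d (Phi t) x G - G - t *: A x G) - (Gam y h k - G - eD (y - x)) - (eD (y - x) - t *: eD (X x))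
  - (Gam y (h' - h) k - Gam x (h' - h) k) - (Gam x (h' - h) k - t *: Gam x (A x h) k)
  - (Gam y h (k' - k) - Gam x h (k' - k)) - (Gam x h (k' - k) - t *: Gam x h (A x k))
  - Gam y (h' - h) (k' - k).
 have e1 : 'd (fun y => 'd (Phi t) y k) x h = 'd (Phi t) x G -
   (Gam y h k + Gam y (h' - h) k + Gam y h (k' - k) + Gam y (h' - h) (k' - k)).
  exact: (etrans e (congr1 (fun z => 'd (Phi t) x G - z) (etrans (f_equal2 (Gam y) eh' ek') E0))).
 have e2 : Psi x h k = A x G - Gam x (A x h) k - Gam x h (A x k) - eD (X x).
  by rewrite eDP; exact: PsiE.
 apply: (etrans (f_equal2 (fun a b => a - t *: b) e1 e2)).
 move: ('d (Phi t) x G) (A x G) (Gam x (A x h) k) (Gam x h (A x k)) (eD (X x)) (eD (y - x)).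
 move: (Gam y h k) (Gam y (h' - h) k) (Gam x (h' - h) k) (Gam y h (k' - k)) (Gam x h (k' - k)).
 move: (Gam y (h' - h) (k' - k)) => c1 c2 c3 c4 c5 c6 c7 c8 c9 c10 c11 c12.
 by module R.
via (le_norm_eq EE); apply: le_trans (second_order_algebra tn tn hn kn).
by do 7! (apply: norm_sub => //).
Qed.

Let bG y z : B y -> B z -> forall u v,
  [/\ `|Gam y u v| <= C * `|u| * `|v|, `|Gam z u v - Gam y u v| <= C * `|z - y| * `|u| * `|v| &
   forall h, `|'d (fun y => Gam y u v) y h| <= C * `|h| * `|u| * `|v|].
Proof. by move=> by_ bz u v; have [h1 h2 h3] := bGam (BB2 by_) (BB2 bz) u v. Qed.

Let bdG y z : B y -> B z -> forall u v h,
  `|'d (fun y => Gam y u v) z h - 'd (fun y => Gam y u v) y h| <= C * `|z - y| * `|h| * `|u| * `|v|.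
Proof. by move=> by_ bz; exact: bdGam (BB2 by_) (BB2 bz). Qed.

Let BU : B `<=` U.
Proof. by move=> x /BB2/rhoU. Qed.

Let XR_linear x : B x -> linear (XR x).
Proof. by move=> _ a u v; rewrite /XR scalerDl scalerA. Qed.

Let AR_linearl x k : B x -> linear (fun s => AR x s k).
Proof. by move=> _ a u v; rewrite /AR scalerDl scalerA. Qed.

Let AR_linearr x s : B x -> linear (AR x s).
Proof. by move=> bx a u v; rewrite /AR (A_linear bx) scalerDr !scalerA mulrC. Qed.

Let XR_bound x v : B x -> `|XR x v| <= C * `|v|.
Proof. by move=> bx; rewrite normrZ mulrC ler_wpM2r // X_bound. Qed.

Let AR_bound x v k : B x -> `|AR x v k| <= C * `|v| * `|k|.
Proof.
move=> bx; rewrite normrZ; have -> : C * `|v| * `|k| = `|v| * (C * `|k|) by ring.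
by rewrite ler_wpM2l // A_bound.
Qed.

Let XR_lip x y v : B x -> B y -> `|XR y v - XR x v| <= C * `|v| * `|y - x|.
Proof.
move=> bx by_; rewrite -scalerBr normrZ.
have -> : C * `|v| * `|y - x| = `|v| * (C * `|y - x|) by ring.
by rewrite ler_wpM2l // X_lip.
Qed.

Let AR_lip x y v k : B x -> B y -> `|AR y v k - AR x v k| <= C * `|v| * `|y - x| * `|k|.
Proof.
move=> bx by_; rewrite -scalerBr normrZ.
have -> : C * `|v| * `|y - x| * `|k| = `|v| * (C * `|y - x| * `|k|) by ring.
by rewrite ler_wpM2l // A_lip.
Qed.

Let one1 : `|1 : R^o| = 1.
Proof. exact: normr1. Qed.

(** [limit_diff] applied to the differentials of the flow: their derivatives converge to [Psi] by
    [second_order], and [Psi] is Lipschitz in the point. *)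
Let A_quad x h k : B x -> B (x + h) ->
 `|A (x + h) k - A x k - Psi x h k| <= 8 * C ^+ 2 * `|k| * `|h| ^+ 2.
Proof.
move=> bx bxh; have [k0 _ _] := K0_ge; have C30 : 0 <= C3.
 by rewrite /C3; apply: addr_ge0; rewrite !mulr_ge0 ?exprn_ge0 //; exact: ltW.
have n0 := normr_ge0 k; have s0 := sqr_ge0 C.
apply: (@limit_diff _ _ _ x0 rho d ((4 * K0 + C3) * `|k|) (8 * C ^+ 2 * `|k|)
 (fun t y => 'd (Phi t) y k - k) (fun y => A y k) (fun y h => Psi y h k) d0) => //.
- move=> t y t0 td by_; have ht := pos_abs t0 td; have [oV sF] := sV ht.
 have dP : differentiable (fun z => 'd (Phi t) z k) y.
  exact: (family1_differentiable k (diff_smooth_family oV sF) (dom ht (BB2 by_))).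
 have [dD eD] := is_diffB (differentiableP dP) (is_diff_cst k y).
 have n1 : 0 <= t ^+ 2 by exact: sqr_ge0.
 split; [exact: dD|split].
  via (AE k by_ ht); rewrite mulrAC; apply: ler_wpM2r => //.
  by apply: ler_wpM2r => //; lra.
 move=> w; have e := congr1 (fun L => L w) eD.
 have e' : 'd (fun z => 'd (Phi t) z k - k) y w = 'd (fun z => 'd (Phi t) z k) y w.
  by apply: (etrans e); rewrite /= subr0.
 via (le_norm_eq (congr1 (fun z => z - t *: Psi y w k) e')).
 via (second_order w k by_ t0 td).
 have -> : (4 * K0 + C3) * `|k| * t ^+ 2 * `|w| = (4 * K0 + C3) * t ^+ 2 * `|w| * `|k| by ring.
 by apply: ler_wpM2r => //; apply: ler_wpM2r => //; apply: ler_wpM2r => //; lra.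
- move=> y z w by_ bz.
 have := prolongation_lipschitz gU C0 BU bG bdG AR_linearr XR_bound AR_bound XR_lip AR_lip
  1 w k by_ bz.
 move=> h1; apply: (le_trans h1); rewrite one1 le_eqVlt; apply/orP; left; apply/eqP; ring.
- by rewrite mulr_ge0 //; lra.
- by rewrite mulr_ge0; lra.
Qed.

Let X_smooth : smooth_on B X.
Proof.
have hAq x (s) h k : B x -> B (x + h) ->
  `|AR (x + h) s k - AR x s k - prolongation g XR AR x s h k| <= 8 * C ^+ 2 * `|s| * `|h| ^+ 2 * `|k|.
 move=> bx bxh.
 have e : prolongation g XR AR x s h k = s *: Psi x h k.
  by have := lin_scale s (1 : R^o) (prolongation_linear_param gU BU XR_linear AR_linearl h k bx); rewrite [s *: (1 : R^o)]mulr1.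
 have -> : AR (x + h) s k - AR x s k - prolongation g XR AR x s h k =
   s *: (A (x + h) k - A x k - Psi x h k).
  apply: (etrans (congr1 (fun z => AR (x + h) s k - AR x s k - z) e)).
  by rewrite /AR; move: (A (x + h) k) (A x k) (Psi x h k) => *; module R.
 rewrite normrZ.
 have -> : 8 * C ^+ 2 * `|s| * `|h| ^+ 2 * `|k| = `|s| * (8 * C ^+ 2 * `|k| * `|h| ^+ 2) by ring.
 by apply: ler_wpM2l => //; exact: A_quad.
have hXq x (s) h : B x -> B (x + h) ->
  `|XR (x + h) s - XR x s - AR x s h| <= C * `|s| * `|h| ^+ 2.
 move=> bx bxh; rewrite -!scalerBr normrZ.
 have -> : C * `|s| * `|h| ^+ 2 = `|s| * (C * `|h| ^+ 2) by ring.
 by apply: ler_wpM2l => //; exact: X_quad.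
have [[oB sX _] _] := prolongation_smooth gU C0 BU bG XR_linear AR_linearl AR_linearr XR_bound AR_bound
 XR_lip AR_lip hXq hAq.
have h n : Ck n B (fun x => XR x 1).
 by apply: (@Ck_comp2 R n H H R^o H B (B `*` setT) (fun x => x) (fun=> 1) XR oB (sX n));
  [|Ck_auto..].
by move=> n; apply: (Ck_congr oB _ (h n)) => x _; exact: scale1r.
Qed.

(** The Killing equation is the derivative at time 0 of the isometry equation; by the quadratic
    bounds, [X] and [A] are the derivatives of the flow and of its differential there. *)
Lemma local_flow_killing : exists X, killing_on U g B X /\
 forall x t, B x -> `|t| < d -> `|Phi t x - x - t *: X x| <= 4 * K0 * t ^+ 2 /\
  forall k, `|'d (Phi t) x k - k - t *: 'd X x k| <= 4 * K0 * t ^+ 2 * `|k|.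
Proof.
have dXE x k : B x -> 'd X x k = A x k.
 by move=> bx; have [_ e] := X_diff bx; exact: (congr1 (fun L : H -> H => L k) e).
exists X; split; last first.
 move=> x t bx ht; split; first exact: XE.
 move=> k; apply: le_trans (AE k bx ht).
 exact: (le_norm_eq (congr1 (fun z => 'd (Phi t) x k - k - t *: z) (dXE x k bx))).
have oB : open B by exact: nball_open.
split; [exact: oB|exact: X_smooth|exact: BU|move=> x u v bx].
have d0' : `|0 : R| < d by rewrite normr0.
have [P0 D0] : Phi 0 x = x /\ forall k, 'd (Phi 0) x k = k.
 have [h1 h2 _] := bPhi d0' (BB2 bx); rewrite normr0 mulr0 in h1 h2; split.
  by apply/eqP; rewrite -subr_eq0 -normr_le0.
 by move=> k; apply/eqP; rewrite -subr_eq0 -normr_le0; have := h2 k; rewrite mul0r.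
have [k0 _ _] := K0_ge.
have cX : cder (fun t => Phi t x) 0 (X x).
 by apply: (@cder_quadratic _ _ _ _ (4 * K0) _ d0) => t ht; rewrite P0; exact: XE.
have cA k : cder (fun t => 'd (Phi t) x k) 0 (A x k).
 apply: (@cder_quadratic _ _ _ _ (4 * K0 * `|k|) _ d0) => t ht.
 via (le_norm_eq (congr1 (fun z => 'd (Phi t) x k - z - t *: A x k) (D0 k))).
 by apply: (le_trans (AE k bx ht)); rewrite [leRHS]mulrAC.
have [fg _ _] := gU.
have Ux : U (Phi 0 x) by rewrite P0; exact: BU.
have c2 : cder (fun t => g (Phi t x) ('d (Phi t) x u) ('d (Phi t) x v)) 0 0.
 apply: (@cder_near _ _ (fun=> g x u v)); last exact: cder_cst.
 have n0 : \forall t \near (0 : R), `|t| < d.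
  by apply/nbhs_normP; exists d => //= t; rewrite /ball_/= sub0r normrN.
 apply: filterS n0 => t ht; have [_ _ _ _ iso] := iPhi ht.
 by rewrite iso //; exact: dom ht (BB2 bx).
pose E z a b a' b' := dmetric g z (X x) a b + g z a' b + g z a b'.
have e : E (Phi 0 x) ('d (Phi 0) x u) ('d (Phi 0) x v) (A x u) (A x v) = 0 := cder_unique (cder_family2 fg Ux cX (cA u) (cA v)) c2.
have e1 := f_equal3 (fun z a b => E z a b (A x u) (A x v)) P0 (D0 u) (D0 v).
have e2 := f_equal2 (fun a' b' => E x u v a' b') (dXE x u bx) (dXE x v bx).
exact: etrans e2 (etrans (esym e1) e).
Qed.

End LocalFlow.

Lemma le_sum4 {R : realType} (a b c d : R) : 0 < a -> 0 < b -> 0 < c -> 0 < d ->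
 [/\ a <= a + b + c + d, b <= a + b + c + d, c <= a + b + c + d, d <= a + b + c + d & 0 < a + b + c + d].
Proof. by split; lin. Qed.

Lemma killing_congr {R : realType} (H : hilbert R) (U : set H) g (V : set H) (W W' : H -> H) :
 (forall x, V x -> W x = W' x) -> killing_on U g V W -> killing_on U g V W'.
Proof.
move=> eW [oV sW VU kW]; split; [exact: oV|exact: (smooth_congr oV eW sW)|exact: VU|].
move=> x a b Vx; have n : \forall z \near x, W z = W' z by exact: filterS (open_near oV Vx).
have [_ ed] := diff_near n (smooth_diff sW Vx).
by rewrite -(eW x Vx) ed; exact: kW.
Qed.

Section FlowField.
Context {R : realType} {H : hilbert R} {N : riemannian H}.
Variables (p : N) (phi : R -> N -> N) (T : R) (y u : R -> H) (e : H -> R -> H).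
Hypothesis phi0 : forall q, phi 0 q = q.
Hypothesis phiD : forall s t q, phi (s + t) q = phi s (phi t q).
Hypothesis iphi : forall t, isometry_between setT setT (phi t) (phi (- t)).
Hypothesis cphi : forall q, continuous (fun t => phi t q).
Hypothesis mphi : moved_frame p T y u e phi.

Let gphi t : global_isometry (phi t).
Proof. by exists (phi (- t)). Qed.

(** Control at [p] is moved to [q], then to the chart around [a], then spread over a ball; on a
    smaller ball all constants are merged into one [C], as the section on local flows demands. *)
Let flow_local a q : chart_dom N a q -> exists W, exists rho d K : R,
 [/\ 0 < rho, 0 < d, killing_on (chart_image a) (local_form (metric N) a) (nball (chart N a q) rho) W &
  forall x t, nball (chart N a q) rho x -> `|t| < d ->
  `|rep a a (phi t) x - x - t *: W x| <= K * t ^+ 2 /\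
  forall k, `|'d (rep a a (phi t)) x k - k - t *: 'd W x k| <= K * t ^+ 2 * `|k|].
Proof.
move=> Da; have [d0 [C0 [d00 C00 h0]]] := moved_frame_near_id gphi mphi.
have [r5 [d5 [C5 [r50 d50 C50 h5]]]] := flow_near phiD gphi d00 C00 h0 q.
have [d6 [C6 [d60 C60 h6]]] := near_id_chart (chart_dom_center q) Da.
set x0 := chart N a q; have x0q : chart_image a x0 by exact: chart_imageP.
have [r1 r10 [_ h7]] := near_id_local x0q.
pose C1 := 2 * (C6 * C5); have C10 : 0 < C1 by rewrite !mulr_gt0.
pose d1 := Num.min d5 (Num.min (d6 / C5) (r1 / (C6 * C5))).
have d10 : 0 < d1 by rewrite !lt_min d50 !divr_gt0 ?mulr_gt0.
have h1 t x : `|t| < d1 -> nball x0 r1 x -> near_id a x (C1 * `|t|) (phi t).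
 rewrite !lt_min => /and3P[t1 t2 t3] bx; rewrite ltr_pdivlMr // in t2.
 rewrite ltr_pdivlMr ?mulr_gt0 // in t3; rewrite -!mulrA.
 apply: (h7 _ x0) => //; [exact: nballxx|by rewrite mulrA mulrC ltW|].
 apply: h6 => //; first by rewrite mulrC ltW.
 by apply: h5 => //; exact: nballxx.
clearbody d1 C1.
have gU := local_form_metric a; have fG := christoffel_family gU.
have [r2 [C2 [r20 C20 r2U _ h2]]] := isometry_bounds gU x0q.
have [r3 [C3 [r30 C30 r3U h3]]] := family2_bound fG x0q.
have [r4 [C4 [r40 C40 r4U h4]]] := family2_diff_lipschitz fG x0q.
pose r := Num.min (Num.min r1 r2) (Num.min r3 r4).
have [m1 m2 m3 m4] : [/\ r <= r1, r <= r2, r <= r3 & r <= r4].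
 by rewrite /r !ge_min !lexx !orbT.
have r0 : 0 < r by rewrite !lt_min r10 r20 r30.
(* The ball of radius [2 * rho] is half of the ball where the estimates hold, which leaves room for
   the images of its points. *)
pose C := C1 + C2 * C1 + C3 + C4; pose rho := r / 4.
have C21 : 0 < C2 * C1 by exact: mulr_gt0.
have [n1 n2 n3 n4 Cp] := le_sum4 C10 C21 C30 C40; rewrite -/C in n1 n2 n3 n4 Cp.
have rho0 : 0 < rho by exact: divr_gt0.
pose d := Num.min d1 (rho / C).
have dp : 0 < d by rewrite lt_min d10 divr_gt0.
have [dd1 dC] : d <= d1 /\ d <= rho / C by rewrite !ge_min !lexx orbT.
have Cd : C * d <= rho by rewrite mulrC -ler_pdivlMr.
have sub s x : 2 * rho <= s / 2 -> nball x0 (2 * rho) x -> nball x0 s x.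
 by rewrite /nball/= => h hx; apply: (lt_le_trans hx); have := rho0; lin.
have hr s : r <= s -> 2 * rho <= s / 2 by rewrite /rho; lin.
have nid t x : `|t| < d -> nball x0 (2 * rho) x -> near_id a x (C1 * `|t|) (phi t).
 by move=> ht bx; apply: h1; [exact: lt_le_trans dd1|exact: sub (hr _ m1) bx].
have C1t (t : R) : C1 * `|t| <= C * `|t| by apply: ler_wpM2r.
have bphi t x : `|t| < d -> nball x0 (2 * rho) x -> [/\ `|rep a a (phi t) x - x| <= C * `|t|,
  forall k, `|'d (rep a a (phi t)) x k - k| <= C * `|t| * `|k| &
  forall h k, `|'d (fun y => 'd (rep a a (phi t)) y k) x h| <= C * `|t| * `|h| * `|k|].
 move=> ht bx; have [Vx b1 b2] := nid t x ht bx; split.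
 - exact: le_trans b1 (C1t t).
 - by move=> k; apply: (le_trans (b2 k)); apply: ler_wpM2r.
 - move=> h k.
  have by_ : nball x0 r2 (rep a a (phi t) x).
   have htd : C1 * `|t| <= rho.
    by apply: (le_trans (C1t t)); apply: le_trans Cd; apply: ler_wpM2l; exact: ltW.
   have := ler_distD x (rep a a (phi t) x) x0; have := hr _ m2.
   by move: bx; rewrite /nball/= => bx; lin.
  have [_ b] := h2 _ _ x (global_isometry_rep a (gphi t)) Vx (sub _ _ (hr _ m2) bx) by_.
  via (b _ (global_isometry_surj (gphi t) Vx) b1 b2 h k).
  by rewrite mulrA; do 3 (apply: ler_wpM2r => //).
have bG y1 z1 : nball x0 (2 * rho) y1 -> nball x0 (2 * rho) z1 -> forall u1 v1,
  [/\ `|christoffel_of (local_form (metric N) a) y1 u1 v1| <= C * `|u1| * `|v1|,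
   `|christoffel_of (local_form (metric N) a) z1 u1 v1 - christoffel_of (local_form (metric N) a) y1 u1 v1|
     <= C * `|z1 - y1| * `|u1| * `|v1|,
   forall h, `|'d (fun y => christoffel_of (local_form (metric N) a) y u1 v1) y1 h|
     <= C * `|h| * `|u1| * `|v1| &
   `|christoffel_of (local_form (metric N) a) z1 u1 v1 - christoffel_of (local_form (metric N) a) y1 u1 v1
     - 'd (fun y => christoffel_of (local_form (metric N) a) y u1 v1) y1 (z1 - y1)|
     <= C * `|z1 - y1| ^+ 2 * `|u1| * `|v1|].
 move=> b1 b2 u1 v1.
 have [a1 a2 a3 a4] := h3 _ _ (sub _ _ (hr _ m3) b1) (sub _ _ (hr _ m3) b2) u1 v1.
 have w (c b s t : R) : 0 <= b -> 0 <= s -> 0 <= t -> c <= C3 * b * s * t -> c <= C * b * s * t.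
  move=> b0 s0 t1 h; via h; do 3 (apply: ler_wpM2r => //).
 split.
 + by apply: (le_trans a1); do 2 (apply: ler_wpM2r => //).
 + exact: w a2.
 + by move=> h; exact: w (a3 h).
 + by apply: w a4 => //; exact: sqr_ge0.
have bdG y1 z1 : nball x0 (2 * rho) y1 -> nball x0 (2 * rho) z1 -> forall u1 v1 h,
  `|'d (fun y => christoffel_of (local_form (metric N) a) y u1 v1) z1 h
   - 'd (fun y => christoffel_of (local_form (metric N) a) y u1 v1) y1 h|
  <= C * `|z1 - y1| * `|h| * `|u1| * `|v1|.
 move=> b1 b2 u1 v1 h.
 via (h4 _ _ (sub _ _ (hr _ m4) b1) (sub _ _ (hr _ m4) b2) u1 v1 h).
 by do 4 (apply: ler_wpM2r => //).
have rU : nball x0 (2 * rho) `<=` chart_image a by move=> x /(sub _ _ (hr _ m2))/r2U.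
have domV t x : `|t| < d -> nball x0 (2 * rho) x -> rep_dom setT a a (phi t) x.
 by move=> ht bx; have [] := nid t x ht bx.
have cD s t x : `|s| < d -> `|t| < d -> `|s + t| < d -> nball x0 rho x ->
  rep a a (phi (s + t)) x = rep a a (phi s) (rep a a (phi t) x) /\
  forall k, 'd (rep a a (phi (s + t))) x k = 'd (rep a a (phi s)) (rep a a (phi t) x) ('d (rep a a (phi t)) x k).
 move=> hs ht _ bx; have bx2 : nball x0 (2 * rho) x by apply: (lt_trans bx); lin.
 have by_ : nball x0 (2 * rho) (rep a a (phi t) x).
  have [b _ _] := bphi t x ht bx2; have := ler_distD x (rep a a (phi t) x) x0.
  have := ler_wpM2l (ltW Cp) (ltW ht); have := Cd.
  by move: bx; rewrite /nball/= => bx; lin.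
 have -> : phi (s + t) = phi s \o phi t by apply/funext => z.
 by have [] := rep_comp (gphi s) (gphi t) (domV t x ht bx2) (domV s _ hs by_).
have [W [kW hW]] := local_flow_killing gU rho0 dp Cp rU
 (fun t _ => global_isometry_rep a (gphi t))
 (fun t x _ Vx => global_isometry_surj (gphi t) Vx) domV bphi Cd cD bG bdG.
by exists W, rho, d; eexists; split; [exact: rho0|exact: dp|exact: kW|exact: hW].
Qed.

Let W q := sval (cid (flow_local (chart_dom_center q))).

(** Read in the chart around [q], as the encoding of vector fields requires. Local generators in
    other charts agree with it because the time derivative of the flow is unique. *)
Definition flow_field (q : N) : H := W q (chart N q q).

Let flow_near_cder a q (rho d K : R) (w : H -> H) : 0 < d ->
  (forall x t, nball (chart N a q) rho x -> `|t| < d ->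
  `|rep a a (phi t) x - x - t *: w x| <= K * t ^+ 2 /\
  forall k, `|'d (rep a a (phi t)) x k - k - t *: 'd w x k| <= K * t ^+ 2 * `|k|) ->
 (forall x, nball (chart N a q) rho x -> cder (fun t => rep a a (phi t) x) 0 (w x)) /\
 forall x k, nball (chart N a q) rho x -> cder (fun t => 'd (rep a a (phi t)) x k) 0 ('d w x k).
Proof.
move=> d0 hW.
have e0 x : nball (chart N a q) rho x -> rep a a (phi 0) x = x.
 move=> bx; have [h _] := hW x 0 bx (ltac:(by rewrite normr0) : `|0 : R| < d).
 by move: h; rewrite scale0r subr0 expr0n mulr0 normr_le0 subr_eq0 => /eqP.
split=> [x bx|x k bx].
 apply: (@cder_quadratic _ _ _ _ K _ d0) => t ht; rewrite e0 //.
 by have [h _] := hW x t bx ht.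
have D0 : 'd (rep a a (phi 0)) x k = k.
 have [_ h] := hW x 0 bx (ltac:(by rewrite normr0) : `|0 : R| < d); have {}h := h k.
 apply/eqP; rewrite -subr_eq0 -normr_le0.
 by move: h; rewrite expr0n mulr0 mul0r scale0r subr0.
apply: (@cder_quadratic _ _ _ _ (K * `|k|) _ d0) => t ht.
have [_ h] := hW x t bx ht.
via (le_norm_eq (congr1 (fun z => 'd (rep a a (phi t)) x k - z - t *: 'd w x k) D0)).
by rewrite mulrAC.
Qed.

Lemma flow_cder a q : chart_dom N a q ->
 cder (fun t => chart N a (phi t q)) 0 (local_field a flow_field (chart N a q)).
Proof.
move=> Da; have Dq := chart_dom_center q.
have [rho [d [K [rho0 d0 kW hW]]]] := svalP (cid (flow_local (chart_dom_center q))).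
have [cW _] := flow_near_cder d0 hW.
have n : \forall t \near (0 : R), chart_dom N q (phi t q) /\ chart_dom N a (phi t q).
 have c0 : {for (0 : R), continuous (fun t => phi t q)} by exact: cphi.
 apply: filterI; apply: (continuous_open_near c0); rewrite ?phi0 //; exact: chart_dom_open.
have e0 : rep q q (phi 0) (chart N q q) = chart N q q by rewrite /rep chartK // phi0.
have dt : differentiable (transition q a) (rep q q (phi 0) (chart N q q)).
 by rewrite e0; exact: transition_diff.
have c' := cder_comp dt (cW _ (nballxx _ rho0)); rewrite e0 in c'.
have ev : 'd (transition q a) (chart N q q) (W q (chart N q q)) = local_field a flow_field (chart N a q).
 by rewrite /local_field chartK.
apply: cder_eq ev; apply: cder_near c'; apply: filterS n => t [D1 D2].
by rewrite /rep chartK //= transition_chart.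
Qed.

Let local_fieldE a q : chart_dom N a q -> exists2 rho : R, 0 < rho &
 killing_on (chart_image a) (local_form (metric N) a) (nball (chart N a q) rho) (local_field a flow_field) /\
 forall k, cder (fun t => 'd (rep a a (phi t)) (chart N a q) k) 0
  ('d (local_field a flow_field) (chart N a q) k).
Proof.
move=> Da; have [w [rho [d [K [rho0 d0 kW hW]]]]] := flow_local Da.
have [cW cD] := flow_near_cder d0 hW; have [oB sW BU _] := kW.
have eW x : nball (chart N a q) rho x -> w x = local_field a flow_field x.
 move=> bx; have [Dx ex] := chart_invP (BU x bx).
 have c1 := flow_cder Dx; rewrite ex in c1.
 exact: (cder_unique (cW x bx) c1).
exists rho; [exact: rho0|split; first exact: killing_congr kW].
have b0 := nballxx (chart N a q) rho0 => k.
have n : \forall z \near chart N a q, w z = local_field a flow_field z by exact: filterS (open_near oB b0).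
have [_ ed] := diff_near n (smooth_diff sW b0).
exact: cder_eq (cD _ k b0) (esym (congr1 (fun L => L k) ed)).
Qed.

Lemma flow_field_killing_on a :
 killing_on (chart_image a) (local_form (metric N) a) (chart_image a) (local_field a flow_field).
Proof.
have loc x : chart_image a x -> exists2 V : set H, V x &
  killing_on (chart_image a) (local_form (metric N) a) V (local_field a flow_field).
 move=> [q Da <-]; have [rho rho0 [k _]] := local_fieldE Da.
 by exists (nball (chart N a q) rho) => //; exact: nballxx.
split=> [|||x b c /loc[V Vx [_ _ _ k]]]; [exact: chart_image_open| |by []|exact: k].
by apply: smooth_union => x /loc[V Vx [_ s]]; exists V.
Qed.

Let field_killing : killing_field flow_field.
Proof.
split; first by move=> a; have [] := flow_field_killing_on a.
exists phi; split=> // t q; apply/cder_is_derive.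
have Dt := chart_dom_center (phi t q).
have c := flow_cder Dt; rewrite /local_field chartK // transport_id // in c.
have c' : cder (fun s => chart N (phi t q) (phi (- t + 1 * s) (phi t q))) t (1 *: flow_field (phi t q)).
 by apply: (@cder_reparam _ _ (fun s => chart N (phi t q) (phi s (phi t q)))); rewrite mul1r addNr.
rewrite scale1r in c'; apply: cder_near c'; apply: filterE => s.
by rewrite mul1r -phiD addrAC addNr add0r.
Qed.

(** The differentials of the flow at [p] are parallel transport, whose time derivative at 0 is minus
    the Christoffel symbol of [u 0] and [k]; it cancels the other term of the covariant
    derivative. *)
Lemma flow_field_transvection : transvection p flow_field /\ flow_field p = u 0.
Proof.
have Dp := chart_dom_center p.
have [T0 y0 ek0 fr mv] := mphi; have T00 : `|0 : R| < T by rewrite normr0.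
have nT : \forall t \near (0 : R), `|t| < T.
 by apply/nbhs_normP; exists T => //= t; rewrite /ball_/= sub0r normrN.
have [_ _ [_ cD]] := local_fieldE Dp.
have ep : flow_field p = u 0.
 have c := flow_cder Dp; rewrite /local_field chartK // transport_id // in c.
 have [_ fr0] := fr 0 T00; have [cy _ _] := fr0 0.
 apply: (cder_unique c); apply: cder_near cy; apply: filterS nT => t ht.
 by have [_ <- _] := mv t ht; rewrite /rep y0 chartK.
split; [split; [exact: field_killing|]|exact: ep] => k; rewrite /covariant_derivative.
have [_ fr0] := fr 0 T00; have [_ _ ce] := fr0 k.
have c1 : cder (e k) 0 ('d (local_field p flow_field) (chart N p p) k).
 apply: cder_near (cD k); apply: filterS nT => t ht; have [_ _ h] := mv t ht.
 exact: (etrans (congr1 (fun z => 'd (rep p p (phi t)) z k) (esym y0)) (h k)).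
have e2 := cder_unique c1 ce; rewrite ek0 y0 in e2.
apply: (etrans (f_equal2 (fun a b => a + b) e2 (congr1 (christoffel p (chart N p p) k) ep))).
by rewrite christoffel_local (christoffel_sym (local_form_metric p) k (u 0) (chart_imageP Dp)) addNr.
Qed.

End FlowField.

Lemma transvection_exists {R : realType} (H : hilbert R) (N M : riemannian H) (pi : N -> M) (p : N) v :
 symmetric_space M -> riemannian_covering pi -> exists X : N -> H,
 [/\ transvection p X, X p = v &
  killing_on (chart_image p) (local_form (metric N) p) (chart_image p) (local_field p X)].
Proof.
move=> symM cov; have [phi [T [y [u [e [phi0 phiD iphi cphi [mphi u0]]]]]]] := covering_flow p v symM cov.
have [tX eX] := flow_field_transvection phi0 phiD iphi cphi mphi.
by eexists; split; [exact: tX|rewrite eX|exact: (flow_field_killing_on phi0 phiD iphi cphi mphi p)].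
Qed.

(** * Frames of transvections *)
Section BallEstimates.
Context {R : realType} (E F : normedModType R).

Lemma ball_lipschitz x0 (r K : R) (f : E -> F) :
 (forall x, nball x0 r x -> differentiable f x /\ forall h, `|'d f x h| <= K * `|h|) ->
 forall x y, nball x0 r x -> nball x0 r y -> `|f y - f x| <= K * `|y - x|.
Proof.
move=> hf x y bx by_.
have := @mean_value _ _ (fun s => f (x + s *: (y - x))) (fun s => 'd f (x + s *: (y - x)) (y - x)) 0 1
 (K * `|y - x|) ler01.
rewrite scale1r scale0r addr0 subr0 mulr1 [x + _]addrC subrK; apply => s hs;
 have [df bf] := hf _ (nball_segment bx by_ hs); last exact: bf.
exact: cder_comp df (cder_line x (y - x) s).
Qed.

Lemma ball_quadratic x0 (r K : R) (f : E -> F) : 0 <= K ->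
 (forall x, nball x0 r x -> differentiable f x) ->
 (forall x y h, nball x0 r x -> nball x0 r y -> `|'d f y h - 'd f x h| <= K * `|y - x| * `|h|) ->
 forall x h, nball x0 r x -> nball x0 r (x + h) -> `|f (x + h) - f x - 'd f x h| <= K * `|h| ^+ 2.
Proof.
move=> K0 df hf x h bx bxh.
have seg (s : R) : 0 <= s <= 1 -> nball x0 r (x + s *: h).
 by move=> hs; have := nball_segment bx bxh hs; rewrite [x + h]addrC addrK.
have := @mean_value _ _ (fun s => f (x + s *: h) - s *: 'd f x h)
 (fun s => 'd f (x + s *: h) h - 'd f x h) 0 1 (K * `|h| ^+ 2) ler01.
rewrite !scale1r !scale0r addr0 !subr0 mulr1 [f (x + h) - _ - _]addrAC; apply => s hs; have bs := seg s hs.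
 apply: cderB; first exact: (cder_comp (df _ bs) (cder_line x h s)).
 by have := cder_line 0 ('d f x h) s; apply: cder_near; apply: filterE => w; rewrite add0r.
via (hf x _ h bx bs); rewrite [x + _]addrC addrK normrZ expr2 -mulrA.
rewrite ler_wpM2l // ler_wpM2r //; apply: ler_piMl => //.
by rewrite ger0_norm; case/andP: hs.
Qed.

End BallEstimates.

Section KillingFrame.
Context {R : realType} (H : hilbert R).
Variables (U : set H) (g : H -> H -> H -> R).
Hypothesis gU : local_metric U g.
Local Notation Gam := (christoffel_of g).

Lemma killing_linear (V : set H) W W' a :
 killing_on U g V W -> killing_on U g V W' -> killing_on U g V (fun x => a *: W x + W' x) /\
 forall x k, V x -> 'd (fun x => a *: W x + W' x) x k = a *: 'd W x k + 'd W' x k.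
Proof.
move=> [oV sW VU kW] [_ sW' _ kW'].
have dE x k : V x -> 'd (fun x => a *: W x + W' x) x k = a *: 'd W x k + 'd W' x k.
 move=> Vx.
 have [_ e] := is_diffD (is_diffZ a (differentiableP (smooth_diff sW Vx))) (differentiableP (smooth_diff sW' Vx)).
 exact: (congr1 (fun L : H -> H => L k) e).
split; [split; [exact: oV| |exact: VU|move=> x u v Vx]|exact: dE].
 by move=> n; apply: Ck_add => //; apply: Ck_scale => //.
have Ux := VU x Vx.
have alg s1 s2 t1 t2 w1 w2 : s1 + t1 + w1 = 0 -> s2 + t2 + w2 = 0 ->
 (a * s1 + s2) + (a * t1 + t2) + (a * w1 + w2) = 0.
 move=> q1 q2; have -> : a * s1 + s2 + (a * t1 + t2) + (a * w1 + w2) =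
  a * (s1 + t1 + w1) + (s2 + t2 + w2) by ring.
 by rewrite q1 q2 mulr0 addr0.
apply: etrans (alg _ _ _ _ _ _ (kW x u v Vx) (kW' x u v Vx)).
apply: (f_equal3 (fun s t w => s + t + w)); first exact: dmetricDd.
- exact: (etrans (congr1 (fun z => g x z v) (dE x u Vx)) (metric_linl gU v Ux a _ _)).
- exact: etrans (congr1 (g x u) (dE x v Vx)) (metric_linr gU u Ux a _ _).
Qed.

Variables (x0 : H) (X : H -> H -> H).
Hypotheses (Ux0 : U x0) (kX : forall v, killing_on U g U (X^~ v)).
Hypotheses (X0 : forall v, X x0 v = v) (DX0 : forall v k, 'd (X^~ v) x0 k = - Gam x0 k v).

(** [killing_bound] with [eta = 0]; one radius serves all fields. *)
Lemma killing_zero : exists2 r : R, 0 < r & nball x0 r `<=` U /\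
 forall W, killing_on U g U W -> W x0 = 0 -> (forall k, 'd W x0 k = 0) ->
 forall x, nball x0 r x -> W x = 0 /\ forall k, 'd W x k = 0.
Proof.
have [r r0 [rU hr]] := killing_bound gU Ux0; exists r => //; split=> // W kW W0 DW0 x bx.
have [||h1 h2] := hr U W 0 kW rU _ _ x bx; first by rewrite W0 normr0.
 by move=> k; rewrite DW0 normr0 mul0r.
rewrite mulr0 normr_le0 in h1; split; first exact/eqP.
by move=> k; have := h2 k; rewrite mulr0 mul0r normr_le0 => /eqP.
Qed.

(** Linearity in [v] holds because a Killing field with zero 1-jet at [x0] vanishes nearby. Each
    field is smooth in the point; joint smoothness in the point and [v] comes from
    [prolongation_smooth] with [G = H]. *)
Lemma killing_frame_smooth : exists2 r : R, 0 < r & nball x0 r `<=` U /\ family1 (nball x0 r) X.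
Proof.
have [r1 r10 [r1U z1]] := killing_zero; have [r2 r20 [r2U b2]] := killing_bound gU Ux0.
have fG := christoffel_family gU; have [_ _ Gl Gr] := fG.
have [r3 [C3 [r30 C30 r3U h3]]] := family2_bound fG Ux0.
have [r4 [C4 [r40 C40 r4U h4]]] := family2_diff_lipschitz fG Ux0.
pose r := Num.min (Num.min r1 r2) (Num.min r3 r4).
have [m1 m2 m3 m4] : [/\ r <= r1, r <= r2, r <= r3 & r <= r4] by rewrite !ge_min !lexx !orbT.
have r0 : 0 < r by rewrite !lt_min r10 r20 r30.
have sub s x : r <= s -> nball x0 r x -> nball x0 s x by move=> rs bx; exact: lt_le_trans rs.
(* [C0] bounds the 1-jets and the Christoffel symbols; [4 * C0 ^+ 2] bounds the prolongation, which
   is the Lipschitz constant of [A]. *)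
pose C0 := 2 * (1 + C3) + C3 + C4; pose C := C0 + 4 * C0 ^+ 2.
have [c1 c2 c3 c4] : [/\ 2 * (1 + C3) <= C0, C3 <= C0, C4 <= C0 & 0 < C0] by rewrite /C0; split; lin.
have C0C : C0 <= C by rewrite /C; have := sqr_ge0 C0; lin.
have Cp : 0 < C by exact: lt_le_trans C0C.
have BU : nball x0 r `<=` U by move=> x /(sub _ _ m1)/r1U.
pose A x v k := 'd (X^~ v) x k.
have lin1 x : nball x0 r x -> linear (X x) /\ forall k, linear (fun v => A x v k).
 move=> bx.
 have red a v w : let V := fun x => (-1) *: X x (a *: v + w) + (a *: X x v + X x w) in
   V x = 0 /\ forall k, -1 *: A x (a *: v + w) k + (a *: A x v k + A x w k) = 0.
  have [k1 e1] := killing_linear a (kX v) (kX w).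
  have [k2 e2] := killing_linear (-1) (kX (a *: v + w)) k1.
  have [||hV hD] := z1 _ k2 _ _ x (sub _ _ m1 bx); first by rewrite !X0 scaleN1r addNr.
   move=> k; have l := Gr x0 k Ux0 a v w.
   apply: (etrans (e2 x0 k Ux0)); apply: (etrans (f_equal2 (fun p q => -1 *: p + q) (DX0 _ k) (e1 x0 k Ux0))).
   apply: (etrans (f_equal3 (fun p q s => -1 *: - p + (a *: q + s)) l (DX0 v k) (DX0 w k))).
   by move: (Gam x0 k v) (Gam x0 k w) => p q; module R.
  split=> // k; apply: etrans (hD k); apply/esym/(etrans (e2 x k (BU x bx))).
  exact: (congr1 (fun z => -1 *: A x (a *: v + w) k + z) (e1 x k (BU x bx))).
 have fin (p q : H) : -1 *: p + q = 0 -> p = q.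
  by rewrite scaleN1r => /eqP; rewrite addr_eq0 eqr_oppLR opprK => /eqP.
 split=> [a v w|k a v w]; have [h1 h2] := red a v w; apply: fin; [exact: h1|exact: h2].
have bnd x v : nball x0 r x -> `|X x v| <= C0 * `|v| /\ forall k, `|A x v k| <= C0 * `|v| * `|k|.
 move=> bx; have eta0 : `|v| <= (1 + C3) * `|v|.
  by rewrite mulrDl mul1r lerDl mulr_ge0 // ltW.
 have [||q1 q2] := b2 U (X^~ v) ((1 + C3) * `|v|) (kX v) r2U _ _ x (sub _ _ m2 bx).
 - by rewrite X0.
 - move=> k; rewrite DX0 normrN; have bx0 := nballxx x0 r30.
  have [q _ _ _] := h3 _ _ bx0 bx0 k v; via q.
  rewrite mulrAC; apply: ler_wpM2r => //; apply: ler_wpM2r => //; lin.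
 have e (p : R) : 0 <= p -> 2 * ((1 + C3) * p) <= C0 * p by move=> p0; rewrite mulrA; apply: ler_wpM2r.
 split; first exact: le_trans q1 (e _ (normr_ge0 v)).
 move=> k; via (q2 k); by rewrite ler_wpM2r // e.
have bG (K : R) y z : C0 <= K -> nball x0 r y -> nball x0 r z -> forall u v,
  [/\ `|Gam y u v| <= K * `|u| * `|v|, `|Gam z u v - Gam y u v| <= K * `|z - y| * `|u| * `|v| &
   forall h, `|'d (fun y => Gam y u v) y h| <= K * `|h| * `|u| * `|v|].
 move=> hK by_ bz u v; have C3K := le_trans c2 hK.
 have [a1 a2 a3 _] := h3 _ _ (sub _ _ m3 by_) (sub _ _ m3 bz) u v; split.
 - by apply: (le_trans a1); do 2 (apply: ler_wpM2r => //).
 - by apply: (le_trans a2); do 3 (apply: ler_wpM2r => //).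
 - by move=> h; apply: (le_trans (a3 h)); do 3 (apply: ler_wpM2r => //).
have bdG y z : nball x0 r y -> nball x0 r z -> forall u v h,
  `|'d (fun y => Gam y u v) z h - 'd (fun y => Gam y u v) y h| <= C * `|z - y| * `|h| * `|u| * `|v|.
 move=> by_ bz u v h; via (h4 _ _ (sub _ _ m4 by_) (sub _ _ m4 bz) u v h).
 by have C4K := le_trans c3 C0C; do 4 (apply: ler_wpM2r => //).
have dA x v k h : nball x0 r x -> differentiable (fun y => A y v k) x /\
  'd (fun y => A y v k) x h = prolongation g X A x v h k.
 move=> bx; have [oU sX _ _] := kX v; split; last exact: (killing_second_diff gU h k (kX v) (BU x bx)).
 exact: (family1_differentiable k (diff_smooth_family oU sX) (BU x bx)).
have dX x v : nball x0 r x -> differentiable (X^~ v) x.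
 by move=> bx; have [_ sX _ _] := kX v; exact: smooth_diff sX (BU x bx).
have Al x v : nball x0 r x -> linear (A x v) by move=> bx; exact: linearP.
have C0n : 0 <= C0 := ltW c4.
have pb x v h k : nball x0 r x -> `|prolongation g X A x v h k| <= 4 * C0 ^+ 2 * `|v| * `|h| * `|k|.
 move=> bx; apply: (prolongation_bound c4 (fun y z hy hz => bG C0 y z (lexx _) hy hz)) bx => //.
 - by move=> y w hy; have [] := bnd y w hy.
 - by move=> y w l hy; have [_ ] := bnd y w hy.
have XB x v : nball x0 r x -> `|X x v| <= C * `|v|.
 by move=> bx; have [b _] := bnd x v bx; apply: (le_trans b); apply: ler_wpM2r.
have AB x v k : nball x0 r x -> `|A x v k| <= C * `|v| * `|k|.
 by move=> bx; have [_ b] := bnd x v bx; apply: (le_trans (b k)); do 2 (apply: ler_wpM2r => //).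
have XL x y v : nball x0 r x -> nball x0 r y -> `|X y v - X x v| <= C * `|v| * `|y - x|.
 move=> bx by_; apply: (@ball_lipschitz _ _ _ x0 r _ (X^~ v)) => // z bz; split; first exact: dX.
 by move=> h; exact: AB.
have AL x y v k : nball x0 r x -> nball x0 r y -> `|A y v k - A x v k| <= C * `|v| * `|y - x| * `|k|.
 move=> bx by_; rewrite mulrAC.
 apply: (@ball_lipschitz _ _ _ x0 r _ (fun y => A y v k)) => // z bz; split; first by have [] := dA z v k 0 bz.
 move=> h; have [_ e] := dA z v k h bz; via (le_norm_eq e).
 via (pb z v h k bz); rewrite [leRHS]mulrAC; do 3 (apply: ler_wpM2r => //).
 by rewrite /C; lin.
have Xq x v h : nball x0 r x -> nball x0 r (x + h) -> `|X (x + h) v - X x v - A x v h| <= C * `|v| * `|h| ^+ 2.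
 move=> bx bxh; apply: (@ball_quadratic _ _ _ x0 r _ (X^~ v)) => //.
 - by apply: mulr_ge0 => //; exact: ltW.
 - by move=> y; exact: dX.
 - by move=> y z k; exact: AL.
have Aq x v h k : nball x0 r x -> nball x0 r (x + h) ->
  `|A (x + h) v k - A x v k - prolongation g X A x v h k| <= 8 * C ^+ 2 * `|v| * `|h| ^+ 2 * `|k|.
 move=> bx bxh; have [_ e] := dA x v k h bx; rewrite [leRHS]mulrAC.
 via (le_norm_eq (congr1 (fun z => A (x + h) v k - A x v k - z) (esym e))).
 apply: (@ball_quadratic _ _ _ x0 r _ (fun y => A y v k)) => //.
 - by apply: mulr_ge0 => //; apply: mulr_ge0 => //; have := sqr_ge0 C; lin.
 - by move=> y by_; have [] := dA y v k 0 by_.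
 - move=> y z l by_ bz; have [_ e1] := dA y v k l by_; have [_ e2] := dA z v k l bz.
  via (le_norm_eq (f_equal2 (fun a b => a - b) e2 e1)).
  have q := prolongation_lipschitz gU Cp BU (fun y z => bG C y z C0C) bdG Al XB AB XL AL v l k by_ bz.
  by apply: (le_trans q); rewrite le_eqVlt; apply/orP; left; apply/eqP; ring.
have [fX _] := prolongation_smooth gU Cp BU (fun y z => bG C y z C0C) (fun x bx => (lin1 x bx).1)
 (fun x k bx => (lin1 x bx).2 k) Al XB AB XL AL Xq Aq.
by exists r.
Qed.

(** Both sides are Killing fields with the same 1-jet at [x0], as the triple bracket is parallel
    there. *)
Lemma killing_frame_bracket : exists2 r : R, 0 < r & nball x0 r `<=` U /\
 forall v w z x, nball x0 r x ->
  local_bracket (local_bracket (X^~ v) (X^~ w)) (X^~ z) x =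
  X x (local_bracket (local_bracket (X^~ v) (X^~ w)) (X^~ z) x0).
Proof.
have [r r0 [rU hr]] := killing_zero; exists r => //; split=> // v w z x bx.
have kW := bracket_killing gU (bracket_killing gU (kX v) (kX w)) (kX z).
have par a k : 'd (X^~ a) x0 k = - Gam x0 k (X x0 a).
 by rewrite X0; exact: DX0.
have pW := triple_bracket_parallel gU Ux0 (kX v) (kX w) (kX z) (par v) (par w) (par z).
move: kW pW; move: (local_bracket _ _) => W kW pW.
have [kD eD] := killing_linear (-1) (kX (W x0)) kW.
have [||h _] := hr _ kD _ _ x bx.
- by rewrite /= X0 scaleN1r addNr.
- move=> k; apply: (etrans (eD x0 k Ux0)).
 apply: (etrans (f_equal2 (fun p q => -1 *: p + q) (DX0 (W x0) k) (pW k))).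
 by rewrite scaleN1r opprK addrN.
by move: h; rewrite scaleN1r => /eqP; rewrite addr_eq0 eqr_oppLR opprK => /eqP.
Qed.

End KillingFrame.

Section BracketNaturality.
Context {R : realType}.

(** Differentiates the relation between two fields matched by [tau]. In a bracket the second
    derivatives of [tau] then cancel by symmetry. *)
Lemma pushforward_diff (E F : normedModType R) (V : set E) (tau : E -> F) (W : E -> E) (W' : F -> F) z h :
 open V -> smooth_on V tau -> smooth_on V W -> V z -> differentiable W' (tau z) ->
 (forall y, V y -> W' (tau y) = 'd tau y (W y)) ->
 'd W' (tau z) ('d tau z h) = 'd (fun y => 'd tau y (W z)) z h + 'd tau z ('d W z h).
Proof.
move=> oV sT sW Vz dW' eW.
have famT : family1 V (fun x u => 'd tau x u).
 by split=> [||x _]; [exact: oV|exact: smooth_tangent sT|exact: linearP].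
have l0 : z + 0 *: h = z by rewrite scale0r addr0.
have cl := cder_line z h 0.
have cT : cder (fun s => tau (z + s *: h)) 0 ('d tau z h).
 have := cder_comp (f := tau) (y := fun s : R => z + s *: h) (t := 0).
 by rewrite l0; apply => //; exact: smooth_diff sT Vz.
have c1 : cder (fun s => W' (tau (z + s *: h))) 0 ('d W' (tau z) ('d tau z h)).
 have := cder_comp (f := W') (y := fun s : R => tau (z + s *: h)) (t := 0).
 by rewrite l0; apply.
have cW : cder (fun s => W (z + s *: h)) 0 ('d W z h).
 have := cder_comp (f := W) (y := fun s : R => z + s *: h) (t := 0).
 by rewrite l0; apply => //; exact: smooth_diff sW Vz.
have Vl : V (z + 0 *: h) by rewrite l0.
have c2 := cder_family1 famT (x := fun s => z + s *: h) (t := 0) Vl cl cW.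
rewrite l0 in c2; apply: (cder_unique c1); apply: cder_near c2.
have cc : {for (0 : R), continuous (fun s : R => z + s *: h)} by exact: cder_continuous cl.
by apply: filterS (continuous_open_near cc oV _) => [s Vs|]; rewrite // eW.
Qed.

Context {H : hilbert R} {N : riemannian H}.

Lemma local_field_change a b q (X : N -> H) : chart_dom N a q -> chart_dom N b q ->
 local_field b X (chart N b q) = 'd (transition a b) (chart N a q) (local_field a X (chart N a q)).
Proof.
by move=> Da Db; rewrite /local_field !chartK // -transportE transport_comp //; exact: chart_dom_center.
Qed.

(** [field_bracket] uses a different chart at each point, so its expression in a fixed chart rests
    on the naturality of brackets under transition maps. *)
Lemma field_bracket_local a (X Y : N -> H) : smooth_field X -> smooth_field Y ->
 forall x, chart_image a x ->
 local_field a (field_bracket X Y) x = local_bracket (local_field a X) (local_field a Y) x.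
Proof.
move=> sX sY x [q Da <-]; have Dq := chart_dom_center q.
set z := chart N q q; have Oz := overlapP Dq Da.
pose tau := transition q a; have tz : tau z = chart N a q by exact: transition_chart.
have oV := @overlap_open _ _ N q a; have sT := @transition_smooth _ _ N q a.
have VO : overlap q a `<=` chart_image q by move=> _ [r [Dr _] <-]; exact: chart_imageP.
have pf (W : N -> H) : smooth_field W -> forall h,
  'd (local_field a W) (tau z) ('d tau z h) = 'd (fun y => 'd tau y (W q)) z h
   + 'd tau z ('d (local_field q W) z h).
 move=> sW h; have eq : local_field q W z = W q by rewrite /local_field chartK // transport_id.
 rewrite -eq; apply: (pushforward_diff h oV sT) => //.
 - exact: smooth_sub VO (sW q).
 - by rewrite -/tau tz; apply: smooth_diff (sW a) (chart_imageP Da).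
 - by move=> _ [r [Dr Dar] <-]; rewrite /tau transition_chart //; exact: local_field_change.
have ev (W : N -> H) : local_field a W (tau z) = 'd tau z (W q).
 by rewrite tz /local_field chartK.
have e1 : local_field a (field_bracket X Y) (tau z) = 'd tau z ('d (local_field q Y) z (X q))
  - 'd tau z ('d (local_field q X) z (Y q)).
 by apply: (etrans (ev _)); exact: diff_sub.
rewrite -tz; apply/(etrans e1)/esym; apply: (etrans (f_equal2 (fun p q => p - q) (etrans (congr1 ('d (local_field a Y) (tau z)) (ev X)) (pf Y sY (X q))) (etrans (congr1 ('d (local_field a X) (tau z)) (ev Y)) (pf X sX (Y q))))).
have := diff_sym (X q) (Y q) oV sT Oz; rewrite -/tau -/z => es.
apply: (etrans (congr1 (fun w => w + _ - _) es)).
by rewrite opprD addrACA subrr add0r.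
Qed.

Lemma field_bracket2_local p (X Y Z : N -> H) :
 smooth_field X -> smooth_field Y -> smooth_field Z ->
 let x0 := chart N p p in
 field_bracket (field_bracket X Y) Z p =
 local_bracket (local_bracket (local_field p X) (local_field p Y)) (local_field p Z) x0.
Proof.
move=> sX sY sZ x0; have Dp := chart_dom_center p; have Ox := chart_imageP Dp.
have oU := @chart_image_open _ _ N p.
have e x : chart_image p x -> local_bracket (local_field p X) (local_field p Y) x =
  local_field p (field_bracket X Y) x by move=> hx; rewrite field_bracket_local.
have n : \forall x \near x0, local_bracket (local_field p X) (local_field p Y) x =
  local_field p (field_bracket X Y) x by exact: filterS (open_near oU Ox).
have [_ ed] := diff_near n (smooth_diff (bracket_smooth oU (sX p) (sY p)) Ox).
have ev (W : N -> H) : local_field p W x0 = W p by rewrite /local_field chartK // transport_id.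
apply: (f_equal2 (fun a b => a - b)).
 by apply: congr1; apply: (etrans (esym (ev _))); rewrite e.
apply: (etrans (congr1 (fun L => L (Z p)) ed)).
exact: congr1 _ (esym (ev Z)).
Qed.

End BracketNaturality.

Section FamilyComposition.
Context {R : realType}.
Implicit Types E F G : normedModType R.

Lemma cder_dir E F (f : E -> F) x k : differentiable f x ->
 cder (fun s => f (x + s *: k)) 0 ('d f x k).
Proof.
move=> df; have := cder_comp (f := f) (y := fun s : R => x + s *: k) (t := 0).
by rewrite scale0r addr0; apply => //; exact: cder_line.
Qed.

Lemma family2_sub E G1 G2 F (U V : set E) (b : E -> G1 -> G2 -> F) : open V -> V `<=` U ->
 family2 U b -> family2 V b.
Proof.
move=> oV VU [oU sb l1 l2]; split; [exact: oV| |by move=> x v /VU; exact: l1|by move=> x u /VU; exact: l2].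
by apply: smooth_sub sb => z [/VU ?].
Qed.

Lemma family1_sub E G1 F (U V : set E) (b : E -> G1 -> F) : open V -> V `<=` U ->
 family1 U b -> family1 V b.
Proof.
move=> oV VU [oU sb l1]; split; [exact: oV| |by move=> x /VU; exact: l1].
by apply: smooth_sub sb => z [/VU ?].
Qed.

Lemma diff_family1_comp E G1 F (U : set E) (b : E -> G1 -> F) (a : E -> G1) x k : family1 U b -> U x ->
 differentiable a x ->
 'd (fun y => b y (a y)) x k = 'd (b^~ (a x)) x k + b x ('d a x k).
Proof.
move=> fb Ux da; have [_ sb _] := fb.
have dc : differentiable (fun y => b y (a y)) x.
 have [dp _] := is_diff_pair (is_diff_id x) (differentiableP da).
 exact: (@differentiable_comp _ _ _ _ (fun y => (y, a y)) (fun z => b z.1 z.2) x dp (smooth_diff sb (conj Ux I : (U `*` setT) (x, a x)))).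
have l0 : x + 0 *: k = x by rewrite scale0r addr0.
have Ul : U (x + 0 *: k) by rewrite l0.
have c := cder_family1 fb (x := fun s => x + s *: k) (t := 0) Ul (cder_line x k 0) (cder_dir k da).
by rewrite l0 in c; exact: cder_unique (cder_dir k dc) c.
Qed.

Lemma diff_family2_comp E G1 G2 F (U : set E) (b : E -> G1 -> G2 -> F) (a : E -> G1) (c : E -> G2) x k :
 family2 U b -> U x -> differentiable a x -> differentiable c x ->
 'd (fun y => b y (a y) (c y)) x k =
 'd (fun y => b y (a x) (c x)) x k + b x ('d a x k) (c x) + b x (a x) ('d c x k).
Proof.
move=> fb Ux da dc; have [_ sb _ _] := fb.
have dC : differentiable (fun y => b y (a y) (c y)) x.
 have [dp _] := is_diff_pair (is_diff_id x) (is_diff_pair (differentiableP da) (differentiableP dc)).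
 exact: (@differentiable_comp _ _ _ _ (fun y => (y, (a y, c y))) (fun z => b z.1 z.2.1 z.2.2) x dp
  (smooth_diff sb (conj Ux I : (U `*` setT) (x, (a x, c x))))).
have l0 : x + 0 *: k = x by rewrite scale0r addr0.
have Ul : U (x + 0 *: k) by rewrite l0.
have h := cder_family2 fb (x := fun s => x + s *: k) (t := 0) Ul (cder_line x k 0)
 (cder_dir k da) (cder_dir k dc).
by rewrite l0 in h; exact: cder_unique (cder_dir k dC) h.
Qed.

End FamilyComposition.

Section Frames.
Context {R : realType}.

(** A Neumann series: the iteration for [v = k - (L v - v)] contracts by one half. *)
Lemma near_identity_onto (E : normedModType R) (L : E -> E) (k : E) : cauchy_complete E -> linear L ->
 (forall v, `|L v - v| <= 2^-1 * `|v|) -> exists v, L v = k.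
Proof.
move=> cE lL hL; pose s n := iter n (fun v => k - (L v - v)) 0.
have sE n : s n.+1 = k - (L (s n) - s n) by [].
have st n : `|s n.+1 - s n| <= `|k| * 2^-1 ^+ n.
 elim: n => [|n IH]; first by rewrite /= (lin_zero lL) !subr0 mulr1.
 have e : s n.+2 - s n.+1 = - (L (s n.+1 - s n) - (s n.+1 - s n)).
  have ek : k = s n.+1 + (L (s n) - s n) by rewrite subrK.
  rewrite (lin_sub _ _ lL) (sE n.+1) ek.
  by move: (L (s n.+1)) (L (s n)) (s n.+1) (s n) => *; module R.
 rewrite e normrN; apply: (le_trans (hL _)); rewrite exprS; lin.
have [l hl] := cE s _ st; exists l; apply/esym/eqP; rewrite -subr_eq0 -normr_eq0; apply/eqP.
apply/eqP; rewrite eq_le normr_ge0 andbT; apply/ler_addgt0Pr => e e0; rewrite add0r.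
have K0 : 0 < 4 * `|k| + 1 by [].
have [n hn] := half_expr_lt (divr_gt0 e0 K0); rewrite ltr_pdivlMr // in hn.
have eq : k - L l = (s n.+1 - l) + (L (s n - l) - (s n - l)).
 rewrite (lin_sub _ _ lL) sE.
 by move: (L (s n)) (L l) (s n) => *; module R.
rewrite eq; via (ler_normD _ _).
have h1 := hl n.+1; have h2 := hL (s n - l); have h3 := hl n; rewrite exprS in h1.
have p : 0 <= 2^-1 ^+ n :> R by [].
by nra.
Qed.

(* b trivializes the tangent bundle by transvections, bi is its inverse; m expresses the brackets
  [b v, b w] and gam the metric in this trivialization, and T is the triple bracket at x0. *)
Record frame (H : hilbert R) (x0 : H) (r C : R) (b bi : H -> H -> H) (m T : H -> H -> H -> H)
  (gam : H -> H -> H -> R) : Prop := Frame {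
 frame_gt0 : 0 < r /\ 0 < C;
 frame_family : family1 (nball x0 r) b;
 frame_inv_family : family1 (nball x0 r) bi;
 frame_K : forall x v, nball x0 r x -> bi x (b x v) = v;
 frame_invK : forall x k, nball x0 r x -> b x (bi x k) = k;
 frame_center : forall v, b x0 v = v;
 frame_bracket_family : family2 (nball x0 r) m;
 frame_metric_family : family2 (nball x0 r) (gam : H -> H -> H -> R^o);
 frame_bound : forall x v w, nball x0 r x -> [/\ `|b x v| <= C * `|v|, `|bi x v| <= C * `|v|,
  `|m x v w| <= C * `|v| * `|w| & `|gam x v w| <= C * `|v| * `|w|];
 frame_bracket_center : forall v w, m x0 v w = 0;
 frame_bracketE : forall x v c, nball x0 r x ->
  'd (b^~ v) x (b x c) - 'd (b^~ c) x (b x v) = b x (m x c v);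
 frame_bracket_diff : forall x v w c, nball x0 r x ->
  'd (fun y => m y v w) x (b x c) = - m x c (m x v w) - T v w c;
 frame_metric_diff : forall x v w c, nball x0 r x ->
  'd (fun y => gam y v w : R^o) x (b x c) = gam x (m x c v) w + gam x v (m x c w) }.

(** The Maurer-Cartan equation of the coframe [bi], dual to [frame_bracketE]: it results from
    differentiating [b y (bi y a) = a]. *)
Lemma frame_inv_diff (H : hilbert R) x0 r C b bi m T gam : @frame H x0 r C b bi m T gam ->
 forall x h k, nball x0 r x ->
 'd (bi^~ h) x k - 'd (bi^~ k) x h = - m x (bi x k) (bi x h).
Proof.
move=> fr x h k bx; have fb := frame_family fr; have fi := frame_inv_family fr.
have [oB sb lb] := fb; have [_ _ li] := fi.
have d a l : 'd (b^~ (bi x a)) x l + b x ('d (bi^~ a) x l) = 0.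
 rewrite -(diff_family1_comp l fb bx (family1_differentiable a fi bx)).
 have n : \forall y \near x, cst a y = b y (bi y a).
  by apply: filterS (open_near oB bx) => y yB; rewrite (frame_invK fr).
 have [_ e] := diff_near n (differentiable_cst a x).
 exact: (etrans (congr1 (fun L : H -> H => L l) e) (congr1 (fun L : H -> H => L l) (diff_cst a x))).
have e := frame_bracketE fr (bi x h) (bi x k) bx.
rewrite !(frame_invK fr _ bx) in e.
have q : b x ('d (bi^~ h) x k - 'd (bi^~ k) x h) = - b x (m x (bi x k) (bi x h)).
 apply: (etrans (lin_sub _ _ (lb x bx))); rewrite -e.
 have alg (p p' q q' : H) : p + p' = 0 -> q + q' = 0 -> p' - q' = - (p - q).
  by move=> /eqP; rewrite addr_eq0 => /eqP-> /eqP; rewrite addr_eq0 => /eqP->; rewrite !opprK opprD !opprK.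
 exact: (alg _ _ _ _ (d h k) (d k h)).
have q' := congr1 (bi x) q; rewrite -(lin_opp _ (lb x bx)) !(frame_K fr _ bx) in q'; exact: q'.
Qed.

End Frames.

Section FrameExistence.
Context {R : realType} (H : hilbert R).
Variables (U : set H) (g : H -> H -> H -> R).
Hypothesis gU : local_metric U g.
Local Notation Gam := (christoffel_of g).
Variables (x0 : H) (X : H -> H -> H).
Hypotheses (Ux0 : U x0) (kX : forall v, killing_on U g U (X^~ v)).
Hypotheses (X0 : forall v, X x0 v = v) (DX0 : forall v k, 'd (X^~ v) x0 k = - Gam x0 k v).

Let T v w z := local_bracket (local_bracket (X^~ v) (X^~ w)) (X^~ z) x0.
Let gam x v w := g x (X x v) (X x w).

Let metric_algebra (t P P' Q Q' : R) : t + P' + Q' = 0 -> t + P + Q = (P - P') + (Q - Q').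
Proof. by lra. Qed.

(** [m] is the bracket of two frame fields, written in the frame. Its derivative comes from the
    triple brackets, which are constant in the frame, and that of [gam] from the Killing
    equation. *)
Lemma killing_frame : exists r C bi m, nball x0 r `<=` U /\ frame x0 r C X bi m T gam.
Proof.
have [r1 r10 [r1U fX1]] := killing_frame_smooth gU Ux0 kX X0 DX0.
have [r2 r20 [_ bT]] := killing_frame_bracket gU Ux0 kX X0 DX0.
have [oB1 sX1 lX1] := fX1.
have [r3 [C3 [r30 C30 _ h3]]] := bilinear_bound oB1 (nballxx x0 r10) sX1 lX1.
(* [s <= (2 * C3)^-1] puts [X x] within one half of the identity, so it is invertible with inverse
   bounded by 2. *)
pose s := Num.min (Num.min r1 r2) (Num.min r3 (2 * C3)^-1).
have s0 : 0 < s by rewrite !lt_min r10 r20 r30 invr_gt0 mulr_gt0.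
have [m1 m2 m3 m4] : [/\ s <= r1, s <= r2, s <= r3 & s <= (2 * C3)^-1].
 by rewrite /s !ge_min !lexx !orbT.
clearbody s; have sub a b x : a <= b -> nball x0 a x -> nball x0 b x by move=> ab bx; exact: lt_le_trans ab.
have oB : open (nball x0 s) by exact: nball_open.
have fX : family1 (nball x0 s) X by apply: family1_sub fX1 => // x; exact: sub m1.
have [_ sX lX] := fX; have BU : nball x0 s `<=` U by move=> x /(sub _ _ _ m1)/r1U.
have near1 x v : nball x0 s x -> `|X x v - v| <= 2^-1 * `|v|.
 move=> bx; have [_ b _ _] := h3 _ _ (nballxx x0 r30) (sub _ _ _ m3 bx) v.
 rewrite X0 in b; via b; apply: ler_wpM2r => //.
 have q : `|x - x0| <= (2 * C3)^-1 by apply: ltW; exact: lt_le_trans m4.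
 by have := ler_wpM2l (ltW C30) q; rewrite invfM mulrCA divff ?lt0r_neq0 // mulr1.
have low x v : nball x0 s x -> `|v| <= 2 * `|X x v|.
 by move=> bx; have := near1 x v bx; have := ler_distD (X x v) v 0; rewrite !subr0 (distrC v); lra.
have onto (xk : H * H) : exists v, nball x0 s xk.1 -> X xk.1 v = xk.2.
 have [bx|nb] := pselect (nball x0 s xk.1); last by exists 0.
 have [v e] := near_identity_onto xk.2 (@complete_cauchy _ H) (lX _ bx) (fun v => near1 _ v bx).
 by exists v.
have [inv hinv] := choice onto; pose bi x k := inv (x, k).
have biK x k : nball x0 s x -> X x (bi x k) = k by exact: hinv (x, k).
have Kbi x v : nball x0 s x -> bi x (X x v) = v.
 move=> bx; apply/eqP; rewrite -subr_eq0 -normr_le0; via (low x _ bx).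
 by rewrite (lin_sub _ _ (lX x bx)) biK // subrr normr0 mulr0.
have bib x k : nball x0 s x -> `|bi x k| <= 2 * `|k|.
 by move=> bx; have := low x (bi x k) bx; rewrite biK.
have lbi x : nball x0 s x -> linear (bi x).
 move=> bx a u v; rewrite -[RHS](Kbi x _ bx); apply: congr1.
 by rewrite (lX x bx) !biK.
have fbi : family1 (nball x0 s) bi.
 split=> //; apply: (inverse_smooth oB sX) => // x bx.
 by exists s, 2; split=> // y k _ by_; exact: bib.
pose D x w h := 'd (X^~ w) x h; pose u x v w := D x w (X x v) - D x v (X x w).
have fD : family2 (nball x0 s) D := family1_diff fX; have [_ sD Dl Dr] := fD; have [_ sbi _] := fbi.
pose m x v w := bi x (u x v w).
have oBB := openXT oB (G := (H * H)%type).
have fm : family2 (nball x0 s) m.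
 split=> //.
 - move=> n.
  have c1 : Ck n (nball x0 s `*` setT) (fun z : H * (H * H) => X z.1 z.2.1).
   by apply: (Ck_comp2 oBB (sX n)); [move=> z []|Ck_auto..].
  have c2 : Ck n (nball x0 s `*` setT) (fun z : H * (H * H) => X z.1 z.2.2).
   by apply: (Ck_comp2 oBB (sX n)); [move=> z []|Ck_auto..].
  apply: (Ck_comp2 oBB (sbi n)); [by move=> z []|by Ck_auto|].
  apply: Ck_sub_fun; first exact: oBB.
   by apply: (Ck_comp3 oBB (sD n)); [move=> z []|Ck_auto..].
  by apply: (Ck_comp3 oBB (sD n)); [move=> z []|Ck_auto..].
 - move=> x w bx a v v'; apply: (etrans (congr1 (bi x) _) (lbi x bx a (u x v w) (u x v' w))).
  have e1 : D x w (X x (a *: v + v')) = a *: D x w (X x v) + D x w (X x v').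
   by rewrite (lX x bx) /D diff_add diff_scale.
  apply: (etrans (f_equal2 (fun p q => p - q) e1 (Dl x (X x w) bx a v v'))); rewrite /u /=.
  by move: (D x w (X x v)) (D x w (X x v')) (D x v (X x w)) (D x v' (X x w)) => *; module R.
 - move=> x v bx a w w'; apply: (etrans (congr1 (bi x) _) (lbi x bx a (u x v w) (u x v w'))).
  have e1 : D x v (X x (a *: w + w')) = a *: D x v (X x w) + D x v (X x w').
   by rewrite (lX x bx) /D diff_add diff_scale.
  apply: (etrans (f_equal2 (fun p q : H => p - q) (Dl x (X x v) bx a w w') e1)); rewrite /u.
  by move: (D x w (X x v)) (D x w' (X x v)) (D x v (X x w)) (D x v (X x w')) => *; module R.
have [fg _ _] := gU; have [_ sg gl gr] := fg.
have fgam : family2 (nball x0 s) (gam : H -> H -> H -> R^o).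
 split=> //.
 - move=> n; apply: (Ck_comp3 oBB (sg n)); [by move=> z [/BU]|by Ck_auto| |].
   by apply: (Ck_comp2 oBB (sX n)); [move=> z []|Ck_auto..].
  by apply: (Ck_comp2 oBB (sX n)); [move=> z []|Ck_auto..].
 - by move=> x w bx a v v'; rewrite /gam (lX x bx); exact: (gl x (X x w) (BU x bx)).
 - by move=> x v bx a w w'; rewrite /gam (lX x bx); exact: (gr x (X x v) (BU x bx)).
have [r4 [C4 [r40 C40 _ h4]]] := family2_bound fm (nballxx x0 s0).
have [r5 [C5 [r50 C50 _ h5]]] := family2_bound fgam (nballxx x0 s0).
pose r := Num.min s (Num.min r4 r5); pose C := C3 + 2 + C4 + C5.
have r0 : 0 < r by rewrite !lt_min s0 r40.
have [k1 k2 k3] : [/\ r <= s, r <= r4 & r <= r5].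
 by rewrite /r !ge_min !lexx !orbT.
have two : (0 : R) < 2 by [].
have [j1 j2 j3 j4 Cp] := le_sum4 C30 two C40 C50; rewrite -/C in j1 j2 j3 j4 Cp.
have oBr : open (nball x0 r) by exact: nball_open.
have Bs x : nball x0 r x -> nball x0 s x := sub _ _ x k1.
have br x v c : nball x0 s x -> 'd (X^~ v) x (X x c) - 'd (X^~ c) x (X x v) = X x (m x c v).
 by move=> bx; rewrite biK.
exists r, C, bi, m; split; first by move=> x /Bs/BU.
split; first by split; [exact: r0|exact: Cp].
- exact: family1_sub Bs fX.
- exact: family1_sub Bs fbi.
- by move=> x v /Bs; exact: Kbi.
- by move=> x k /Bs; exact: biK.
- exact: X0.
- exact: family2_sub Bs fm.
- exact: family2_sub Bs fgam.
- move=> x v w bx; have bs := Bs _ bx.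
 have [a1 _ _ _] := h3 _ _ (sub _ _ _ m3 bs) (sub _ _ _ m3 bs) v.
 have [a4 _ _ _] := h4 _ _ (sub _ _ _ k2 bx) (sub _ _ _ k2 bx) v w.
 have [a5 _ _ _] := h5 _ _ (sub _ _ _ k3 bx) (sub _ _ _ k3 bx) v w.
 split; [via a1|via (bib x v bs)|via a4|via a5];
  by do ! (apply: ler_wpM2r => //).
- move=> v w; apply: (etrans (congr1 (bi x0) _) (lin_zero (lbi x0 (nballxx x0 s0)))).
 rewrite /u /D !X0 !DX0 (christoffel_sym gU v w Ux0); exact: subrr.
- by move=> x v c /Bs; exact: br.
- move=> x v w c bx; have bs := Bs _ bx; rewrite -[LHS](Kbi x _ bs) -[RHS](Kbi x _ bs); apply: congr1.
 have n : \forall y \near x, local_bracket (X^~ v) (X^~ w) y = X y (m y v w).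
  by apply: filterS (open_near oB bs) => y yB; exact: (esym (biK y (u y v w) yB)).
 have [_ sv _ _] := kX v; have [_ sw _ _] := kX w; have [oU _ _ _] := kX v.
 have [_ e2] := diff_near n (smooth_diff (bracket_smooth oU sv sw) (BU x bs)).
 have e3 := bT v w c x (sub _ _ _ m2 bs); rewrite -/(T v w c) in e3.
 have e6 := congr1 (fun L => L (X x c)) e2.
 (* The field [X y (m y v w)] varies through the frame and through its coefficient: the first part
    gives the bracket of [c] with [m x v w], the second is the derivative sought. *)
 have alg (du dx bDm xT xm p : H) : du = dx + bDm -> p - du = xT -> dx - p = xm -> bDm = - xm - xT.
  by move=> h <- <-; rewrite h; module R.
 rewrite (lin_sub _ _ (lX x bs)) (lin_opp _ (lX x bs)).
 apply: (alg _ _ _ _ _ ('d (X^~ c) x (X x (m x v w))) (etrans (esym e6) (diff_family1_comp (X x c) fX bs (family2_differentiable v w fm bs))) _ (br x (m x v w) c bs)).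
 apply: etrans e3; rewrite /local_bracket; congr (_ - _); exact/congr1/(biK x (u x v w) bs).
- move=> x v w c bx; have bs := Bs _ bx; have Ux := BU x bs.
 have [_ _ _ /(_ x (X x v) (X x w) Ux) e2] := kX c.
 have el := etrans (esym (lin_sub ('d (X^~ v) x (X x c)) ('d (X^~ c) x (X x v)) (gl x (X x w) Ux)))
  (congr1 (fun z => g x z (X x w) : R^o) (br x v c bs)).
 have er := etrans (esym (lin_sub ('d (X^~ w) x (X x c)) ('d (X^~ c) x (X x w)) (gr x (X x v) Ux)))
  (congr1 (fun z => g x (X x v) z : R^o) (br x w c bs)).
 exact: etrans (diff_family2_comp (X x c) fg Ux (family1_differentiable v fX bs) (family1_differentiable w fX bs)) (etrans (metric_algebra _ _ e2) (f_equal2 (fun p q => p + q) el er)).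
Qed.

End FrameExistence.

Lemma cder_scale {R : realType} (F : normedModType R) (w : R -> F) t w' : cder w t w' ->
 cder (fun s => s *: w s) t (t *: w' + w t).
Proof.
move=> cw; have cid : cder (fun s => s) t (1).
 apply: cder_near (cder_line (0 : R^o) (1 : R^o) t); apply: filterE => s.
 by rewrite add0r; exact: mulr1.
have d : is_diff ((t), w t) (fun z : R^o * F => (z.1 : R) *: z.2) (fun z => t *: z.2 + (z.1 : R) *: w t).
 apply: (is_diff_quadratic (C := 1) (r := 1)) => //.
 - move=> a [p u] [q v] /=; rewrite -[a *: p]/(a * p); module R.
 - exists (`|t| + `|w t|) => -[p u] /=; via (ler_normD _ _); rewrite !normrZ mulrDl.
  apply: lerD; first by apply: ler_wpM2l => //; exact: (norm_snd_le (p, u)).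
  by rewrite mulrC; apply: ler_wpM2l => //; exact: (norm_fst_le (p, u)).
 - move=> [p u] _; have -> : (t + p) *: (w t + u) - t *: w t - (t *: u + p *: w t) = p *: u by module R.
  rewrite normrZ mul1r; apply: ler_pM => //; [exact: (norm_fst_le (p, u))|exact: (norm_snd_le (p, u))].
apply: cder_eq (cder_is_diff d (cder_pair cid cw)) _.
by rewrite scale1r.
Qed.

(** * Isometries from frames *)
Section Development.
Context {R : realType} (H H' : hilbert R).
Variables (x0 : H) (r C : R) (b bi : H -> H -> H) (m T : H -> H -> H -> H) (gam : H -> H -> H -> R).
Variables (x0' : H') (r' C' : R) (b' bi' : H' -> H' -> H') (m' T' : H' -> H' -> H' -> H')
 (gam' : H' -> H' -> H' -> R).
Variables (phi : H -> H') (Cp : R).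
Hypotheses (fr : frame x0 r C b bi m T gam) (fr' : frame x0' r' C' b' bi' m' T' gam').
Hypotheses (lphi : linear phi) (bphi : forall v, `|phi v| <= Cp * `|v|) (Cp0 : 0 <= Cp).
Hypothesis phiT : forall v w z, phi (T v w z) = T' (phi v) (phi w) (phi z).
Hypothesis phig : forall v w, gam' x0' (phi v) (phi w) = gam x0 v w.

(** The differential at [z.2] that a map with value [z.1] must have if it carries the frame [b] to
    the frame [b'] through [phi]. *)
Definition dev (z : H' * H) (a : H) : H' := b' z.1 (phi (bi z.2 a)).

Let z0 := (x0', x0).
Let rr := Num.min r' r.

Let inball z : nball z0 rr z -> nball x0' r' z.1 /\ nball x0 r z.2.
Proof.
rewrite /nball/=; case: z => [y x]; rewrite norm_pair_lt !lt_min /=.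
by lra.
Qed.

Let Cs : 0 < C /\ 0 < C'.
Proof. by have [_ h] := frame_gt0 fr; have [_ h'] := frame_gt0 fr'. Qed.

Lemma dev_family : family1 (nball z0 rr) dev.
Proof.
have [_ sb lb] := frame_family fr'; have [_ sbi lbi] := frame_inv_family fr.
have oB : open (nball z0 rr) by exact: nball_open.
have oBB := openXT oB (G := H); split=> // [n|z /inball[B1 B2] a u v].
 have c : Ck n (nball z0 rr `*` setT) (fun z : (H' * H) * H => bi z.1.2 z.2).
  apply: (Ck_comp2 oBB (sbi n)); [|by Ck_auto..].
  by move=> z [/inball[_ ?] _]; split.
 have c' := Ck_lin_comp oBB lphi (ex_intro _ Cp bphi) c.
 apply: (Ck_comp2 oBB (sb n)); [|by Ck_auto..].
 by move=> z [/inball[? _] _]; split.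
exact/(etrans (congr1 (b' z.1) (etrans (congr1 phi (lbi _ B2 a u v)) (lphi a _ _))))/lb.
Qed.

(* The integrability condition of Df = dev (f, .). *)
Lemma dev_integrable z h k : nball z0 rr z ->
 (forall v w, m' z.1 (phi v) (phi w) = phi (m z.2 v w)) ->
 'd (dev^~ h) z (dev z k, k) = 'd (dev^~ k) z (dev z h, h).
Proof.
move=> bz hm; have [B1 B2] := inball bz; case: z bz hm B1 B2 => [y x] /= bz hm B1 B2.
have fb := frame_family fr'; have [_ _ lb] := fb.
have de a p q : 'd (dev^~ a) (y, x) (p, q) =
  'd (b'^~ (phi (bi x a))) y p + b' y (phi ('d (bi^~ a) x q)).
 have y0 : y + 0 *: p = y by rewrite scale0r addr0.
 have B1' : nball x0' r' (y + 0 *: p) by rewrite y0.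
 have c2 := cder_family1 fb (x := fun s => y + s *: p) (t := 0) B1' (cder_line y p 0) (cder_linear lphi (ex_intro _ Cp bphi) (cder_dir q (family1_differentiable a (frame_inv_family fr) B2))).
 by rewrite /= y0 scale0r addr0 in c2; exact: (cder_unique (cder_dir (p, q) (family1_differentiable a dev_family bz)) c2).
have e1 := frame_bracketE fr' (phi (bi x h)) (phi (bi x k)) B1; rewrite hm in e1.
have e2 := congr1 phi (frame_inv_diff fr h k B2).
rewrite (lin_sub _ _ lphi) (lin_opp _ lphi) in e2; have e3 := congr1 (b' y) e2.
rewrite (lin_sub _ _ (lb y B1)) (lin_opp _ (lb y B1)) in e3.
rewrite !de /dev /=.
have alg (p1 p2 q1 q2 u : H') : p1 - p2 = u -> q1 - q2 = - u -> p1 + q1 = p2 + q2.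
 move=> /eqP; rewrite subr_eq => /eqP-> /eqP; rewrite subr_eq => /eqP->.
 by move: p2 q2 u => *; module R.
exact: alg e1 e3.
Qed.

Variables (rho K s : R).
Hypotheses (rho0 : 0 < rho) (K0 : 0 < K) (s0 : 0 < s) (rhor : nball z0 rho `<=` nball z0 rr).
Hypothesis dev_bound : forall y z, nball z0 rho y -> nball z0 rho z -> forall v,
  [/\ `|dev y v| <= K * `|v|, `|dev z v - dev y v| <= K * `|z - y| * `|v|,
   forall h, `|'d (fun y => dev y v) y h| <= K * `|h| * `|v| &
   `|dev z v - dev y v - 'd (fun y => dev y v) y (z - y)| <= K * `|z - y| ^+ 2 * `|v|].
Hypotheses (s1 : s <= rho / 4) (s2 : K * s <= rho / 4) (s3 : K * s <= 4^-1).
Hypothesis (s4 : (C' * Cp * C + C * C + C * C) * s <= 2^-1).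

(** The equation is solved along each ray separately. Times run up to 2, so that [[0, 1]] lies
    inside the open interval given by [picard]; a long ray gets a dummy curve. *)
Let curve (h : H) : exists y : R -> H', `|h| < s -> y 0 = x0' /\ forall t : R, 0 <= t <= 1 ->
 nball z0 rho (y t, x0 + t *: h) /\ cder y t (dev (y t, x0 + t *: h) h).
Proof.
have [hs|nh] := boolP (`|h| < s); last by exists (fun=> x0').
have two0 : (0 : R) <= 2 by [].
have hcl t : `|clamp 2 t *: h| < rho.
 rewrite normrZ; have := clamp_le t two0; have := normr_ge0 h; have := normr_ge0 (clamp 2 t : R).
 by move=> c1 c2 c3; have := ler_wpM2r c2 c3; have := s1; have := rho0; lra.
have bz t y : `|y - x0'| <= rho / 2 -> nball z0 rho (y, x0 + clamp 2 t *: h).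
 move=> hy; rewrite /nball/= norm_pair_lt /= [x0 + _]addrC addrK hcl andbT.
 by have := rho0; lra.
have Kh : K * `|h| <= K * s by apply: ler_wpM2l; exact: ltW.
have Ks0 : 0 <= K * s by rewrite mulr_ge0 // ltW.
have dz t (y z : H') : `|(z, x0 + clamp 2 t *: h) - (y, x0 + clamp 2 t *: h)| <= `|z - y|.
 by rewrite norm_pair_le /= subrr normr0 lexx normr_ge0.
have [|||||y [y0 hy]] := @picard _ _ (@complete_cauchy _ H') (@hilbert_primitives _ H')
  (fun t y => dev (y, x0 + clamp 2 t *: h) h) x0' 2 (rho / 2) (K * s) (K * s) ltac:(by []) Ks0 Ks0.
- move=> y cy hy t.
 have [_ sd _] := dev_family.
 have c := smooth_cont sd (conj (rhor (bz t _ (hy t))) I : (nball z0 rr `*` setT) (_, h)).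
 apply: (@continuous_comp _ _ _ (fun t => ((y t, x0 + clamp 2 t *: h), h)) (fun z => dev z.1 z.2)); last exact: c.
 apply: continuous_pair; last exact: cvg_cst.
 apply: continuous_pair; first exact: cy.
 by apply: cvgD; [exact: cvg_cst|apply: cvgZr_tmp; exact: clamp_continuous].
- move=> t y hy; have [q _ _ _] := dev_bound (bz t y hy) (bz t y hy) h.
 exact: (le_trans q Kh).
- move=> t y z hy hz; have [_ q _ _] := dev_bound (bz t z hz) (bz t y hy) h.
 via q; rewrite mulrAC; apply: ler_pM => //.
 by apply: mulr_ge0 => //; exact: ltW.
- by have := s2; lra.
- by have := s3; lra.
exists y => _; split=> // t ht; have t2 : `|t| < 2 by rewrite ger0_norm; lra.
have [q c] := hy t t2; have e : clamp 2 t = t by exact/clamp_id/ltW.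
have bzt := bz t (y t) q; rewrite e in bzt; rewrite e in c; by split.
Qed.

Let Y := projT1 (choice curve).
Let Y0 h : `|h| < s -> Y h 0 = x0'.
Proof. by move=> /(projT2 (choice curve) h)[]. Qed.
Let Yball h (t : R) : `|h| < s -> 0 <= t <= 1 -> nball z0 rho (Y h t, x0 + t *: h).
Proof. by move=> /(projT2 (choice curve) h)[_ q] /q[]. Qed.
Let Yder h (t : R) : `|h| < s -> 0 <= t <= 1 -> cder (Y h) t (dev (Y h t, x0 + t *: h) h).
Proof. by move=> /(projT2 (choice curve) h)[_ q] /q[]. Qed.

Let bih h (t : R) : `|h| < s -> 0 <= t <= 1 -> `|bi (x0 + t *: h) h| <= C * s.
Proof.
move=> hs ht; have [_ B2] := inball (rhor (Yball hs ht)); have [_ q _ _] := frame_bound fr h h B2.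
by via q; have [c _] := Cs; apply: ler_wpM2l; exact: ltW.
Qed.

Let hE h (t : R) : `|h| < s -> 0 <= t <= 1 -> b (x0 + t *: h) (bi (x0 + t *: h) h) = h.
Proof. by move=> hs ht; have [_ B2] := inball (rhor (Yball hs ht)); exact: (frame_invK fr). Qed.

Let bilinear_scale (F : normedModType R) (f : H -> H -> F) M :
 (forall w, linear (f^~ w)) -> (forall v, linear (f v)) ->
 (forall v w, `|v| <= 1 -> `|w| <= 1 -> `|f v w| <= M) -> forall v w, `|f v w| <= M * `|v| * `|w|.
Proof.
move=> l1 l2 h v w; apply: unit_ball_bound => [a u|{}w w1]; first exact: (lin_scale a u (l2 v)).
apply: (@unit_ball_bound _ _ _ (f^~ w)) => [a u|u u1]; first exact: (lin_scale a u (l1 w)).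
exact: h.
Qed.

Let unit_pair := {p : H * H | `|p.1| <= 1 /\ `|p.2| <= 1}.

(** Uniqueness for linear equations on bilinear maps: [family_contraction] over pairs of vectors in
    the unit ball, with no forcing and zero initial value. *)
Let bilinear_zero (F : normedModType R) (f f' : H -> H -> R -> F) :
 (forall v w (t : R), 0 <= t <= 1 -> cder (f v w) t (f' v w t)) ->
 (forall (t : R) w, 0 <= t <= 1 -> linear (fun v => f v w t)) ->
 (forall (t : R) v, 0 <= t <= 1 -> linear (fun w => f v w t)) ->
 (exists B, forall v w (t : R), `|v| <= 1 -> `|w| <= 1 -> 0 <= t <= 1 -> `|f v w t| <= B) ->
 (forall M : R, (forall v w (t : R), 0 <= t <= 1 -> `|f v w t| <= M * `|v| * `|w|) ->
   forall v w (t : R), 0 <= M -> `|v| <= 1 -> `|w| <= 1 -> 0 <= t <= 1 -> `|f' v w t| <= M / 2) ->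
 (forall v w, f v w 0 = 0) -> forall v w (t : R), 0 <= t <= 1 -> f v w t = 0.
Proof.
move=> cf l1 l2 [B hB] hM f0 v w t ht.
have z (p : unit_pair) (t' : R) : 0 <= t' <= 1 -> `|f (sval p).1 (sval p).2 t'| <= 2 * (0 + 0).
 apply: (@family_contraction _ _ unit_pair (fun p => f (sval p).1 (sval p).2)
  (fun p => f' (sval p).1 (sval p).2)) => [{}p t1|||{}p].
 - exact: cf.
 - by exists B => -[a [? ?]] t1 ht1; exact: hB.
 - move=> M hM0 [a0 [p1 p2]] t1 ht1 /=; rewrite addr0.
  have z1 : (0 : R) <= (0 : R) <= 1 by rewrite lexx ler01.
  have M0 : 0 <= M.
   have q0 : `|(0 : H)| <= 1 by rewrite normr0.
   exact/(le_trans _ (hM0 (exist _ ((0 : H), (0 : H)) (conj q0 q0) : unit_pair) 0 z1))/normr_ge0.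
  apply: (hM M) => // a c t2 ht2; apply: (@bilinear_scale _ (fun a c => f a c t2)) => [d|d|a1 c1 h1 h2].
  + exact: l1.
  + exact: l2.
  + exact: (hM0 (exist _ (a1, c1) (conj h1 h2) : unit_pair) t2 ht2).
 - by rewrite /= f0 normr0.
have q : `|f v w t| <= 0 * `|v| * `|w|.
 apply: (@bilinear_scale _ (fun v w => f v w t)) => [d|d|a c h1 h2]; [exact: l1|exact: l2|].
 by have := z (exist _ (a, c) (conj h1 h2) : unit_pair) t ht; rewrite addr0 mulr0.
by apply/eqP; rewrite -normr_le0; via q.
Qed.

(** By [s4] the coefficients of both transport equations, for brackets and for metrics, are at most
    one half. *)
Let bracket_algebra (M : R) : 0 <= M -> C' * (Cp * (C * s)) * M + M * (C * s) * C <= M / 2 /\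
 M * (C * (C * s)) * 1 + M * 1 * (C * (C * s)) <= M / 2.
Proof.
have [c0 c0'] := Cs; move=> M0; have q5 := ler_wpM2l M0 s4.
have q6 : 0 <= M * (C' * Cp * C * s) by rewrite !mulr_ge0 // ltW.
have q7 : 0 <= M * (C * C * s) by rewrite !mulr_ge0 // ltW.
by lra.
Qed.

Let sub_linear (F : normedModType R) (f' : H' -> F) (f : H -> F) :
 linear f' -> linear f -> linear (fun v => f' (phi v) - f v).
Proof. by move=> l' l k u v; rewrite lphi l' l scalerBr opprD addrACA. Qed.

Let phi1 v : `|v| <= 1 -> `|phi v| <= Cp.
Proof. by move=> v1; via (bphi v); rewrite ler_piMr. Qed.

Let along h (t : R) : `|h| < s -> 0 <= t <= 1 -> nball x0' r' (Y h t) /\ nball x0 r (x0 + t *: h).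
Proof. by move=> hs ht; exact: inball (rhor (Yball hs ht)). Qed.

(** The discrepancy [f] vanishes at the centre, where both brackets are zero, and satisfies a linear
    equation along the ray, since the triple brackets cancel through [phiT]. *)
Let bracket_transport h (t : R) v w : `|h| < s -> 0 <= t <= 1 ->
 m' (Y h t) (phi v) (phi w) = phi (m (x0 + t *: h) v w).
Proof.
move=> hs ht; pose x t := x0 + t *: h; have Bt a := along (t := a) hs.
have [_ _ l1 l2] := frame_bracket_family fr; have [_ _ l1' l2'] := frame_bracket_family fr'.
apply: subr0_eq; move: v w t ht; have [/ltW c0 /ltW c0'] := Cs.
pose f v w t := m' (Y h t) (phi v) (phi w) - phi (m (x t) v w).
pose c t := bi (x t) h.
apply: (@bilinear_zero _ f
 (fun v w t => - m' (Y h t) (phi (c t)) (f v w t) - f (c t) (m (x t) v w) t)).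
- move=> v w a ha; have [B1 B2] := Bt a ha.
 apply: cder_eq (cderB (cder_comp (family2_differentiable (phi v) (phi w) (frame_bracket_family fr') B1) (Yder hs ha)) (cder_linear lphi (ex_intro _ Cp bphi) (cder_comp (family2_differentiable v w (frame_bracket_family fr) B2) (cder_line x0 h a)))) _.
 have e2 := frame_bracket_diff fr v w (c a) B2; rewrite (hE hs ha) in e2.
 have e3 := etrans (congr1 phi e2) (lin_sub _ _ lphi); rewrite (lin_opp _ lphi) phiT in e3.
 apply: (etrans (f_equal2 (fun p q => p - q) (frame_bracket_diff fr' (phi v) (phi w) (phi (c a)) B1) e3)).
 rewrite /f (lin_sub _ _ (l2' _ (phi (c a)) B1)).
 by move: (m' (Y h a) (phi (c a))) (T' _ _ _) (phi (m (x a) (c a) _)) => M' u1 u2; module R.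
- move=> a w ha; have [B1 B2] := Bt a ha; apply: (sub_linear (l1' _ _ B1)) => k u v.
 by rewrite (l1 _ _ B2) lphi.
- move=> a v ha; have [B1 B2] := Bt a ha; apply: (sub_linear (l2' _ _ B1)) => k u w.
 by rewrite (l2 _ _ B2) lphi.
- exists (C' * Cp * Cp + Cp * (C * 1 * 1)) => v w a hv hw ha; have [B1 B2] := Bt a ha.
 have [_ _ q1 _] := frame_bound fr' (phi v) (phi w) B1; have [_ _ q2 _] := frame_bound fr v w B2.
 have pv := phi1 hv; have pw := phi1 hw; apply/(le_trans (ler_normB _ _))/lerD.
  by via q1; exact: ler_pM3.
 by via (bphi _); apply: ler_wpM2l => //; via q2; exact: ler_pM3.
- move=> M hM v w a M0 hv hw ha; have [B1 B2] := Bt a ha; have hc := bih hs ha.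
 have [_ _ q1 _] := frame_bound fr' (phi (c a)) (f v w a) B1; have [_ _ q2 _] := frame_bound fr v w B2.
 have fb : `|f v w a| <= M * 1 * 1 by via (hM v w a ha); exact: ler_pM3.
 have m1 : `|m (x a) v w| <= C * 1 * 1 by via q2; exact: ler_pM3.
 have q3 : `|f (c a) (m (x a) v w) a| <= M * (C * s) * (C * 1 * 1) by via (hM _ _ a ha); exact: ler_pM3.
 have q4 : `|m' (Y h a) (phi (c a)) (f v w a)| <= C' * (Cp * (C * s)) * (M * 1 * 1).
  via q1; apply: ler_pM3 => //; via (bphi _); exact: ler_wpM2l.
 have tri (p q : H') : `|- p - q| <= `|p| + `|q| by rewrite -opprD normrN ler_normD.
 apply/(le_trans (tri _ _))/(le_trans (lerD q4 q3)); rewrite !mulr1; exact: (bracket_algebra M0).1.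
- by move=> v w; rewrite /f Y0 // /x scale0r addr0 (frame_bracket_center fr') (frame_bracket_center fr)
  (lin_zero lphi) subrr.
Qed.

(** Once the brackets correspond, the discrepancy of the metrics satisfies a linear equation along
    the ray; it starts at zero because [phi] is isometric at the centre. *)
Let metric_transport h (t : R) v w : `|h| < s -> 0 <= t <= 1 ->
 gam' (Y h t) (phi v) (phi w) = gam (x0 + t *: h) v w.
Proof.
move=> hs ht; pose x t := x0 + t *: h; have Bt a := along (t := a) hs.
have [_ _ l1 l2] := frame_metric_family fr; have [_ _ l1' l2'] := frame_metric_family fr'.
apply: subr0_eq; move: v w t ht; have [/ltW c0 /ltW c0'] := Cs.
pose f v w t : R^o := gam' (Y h t) (phi v) (phi w) - gam (x t) v w.
pose c t := bi (x t) h.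
apply: (@bilinear_zero _ f
 (fun v w t => f (m (x t) (c t) v) w t + f v (m (x t) (c t) w) t)).
- move=> v w a ha; have [B1 B2] := Bt a ha.
 apply: cder_eq (cderB (cder_comp (family2_differentiable (phi v) (phi w) (frame_metric_family fr') B1) (Yder hs ha)) (cder_comp (family2_differentiable v w (frame_metric_family fr) B2) (cder_line x0 h a))) _.
 have e2 := frame_metric_diff fr v w (c a) B2; rewrite (hE hs ha) in e2.
 apply: (etrans (f_equal2 (fun p q => p - q) (frame_metric_diff fr' (phi v) (phi w) (phi (c a)) B1) e2)).
 by rewrite !(bracket_transport _ _ hs ha) /f -/(x a) opprD addrACA.
- by move=> a w ha; have [B1 B2] := Bt a ha; exact: (sub_linear (F := R^o) (l1' _ _ B1) (l1 _ _ B2)).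
- by move=> a v ha; have [B1 B2] := Bt a ha; exact: (sub_linear (F := R^o) (l2' _ _ B1) (l2 _ _ B2)).
- exists (C' * Cp * Cp + C * 1 * 1) => v w a hv hw ha; have [B1 B2] := Bt a ha.
 have [_ _ _ q1] := frame_bound fr' (phi v) (phi w) B1; have [_ _ _ q2] := frame_bound fr v w B2.
 have pv := phi1 hv; have pw := phi1 hw; apply/(le_trans (ler_normB _ _))/lerD.
  by via q1; exact: ler_pM3.
 by via q2; exact: ler_pM3.
- move=> M hM v w a M0 hv hw ha; have [B1 B2] := Bt a ha; have hc := bih hs ha.
 have mb u : `|u| <= 1 -> `|m (x a) (c a) u| <= C * (C * s) * 1.
  by move=> hu; have [_ _ q _] := frame_bound fr (c a) u B2; via q; exact: ler_pM3.
 have q1 : `|f (m (x a) (c a) v) w a| <= M * (C * (C * s) * 1) * 1.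
  by via (hM _ _ a ha); apply: ler_pM3 => //; exact: mb.
 have q2 : `|f v (m (x a) (c a) w) a| <= M * 1 * (C * (C * s) * 1).
  by via (hM _ _ a ha); apply: ler_pM3 => //; exact: mb.
 by apply/(le_trans (ler_normD _ _))/(le_trans (lerD q1 q2)); have := (bracket_algebra M0).2; lra.
- by move=> v w; rewrite /f Y0 // /x scale0r addr0 phig subrr.
Qed.

Let Fx (x : H) := Y (x - x0) 1.
Let one01 : (0 : R) <= (1 : R) <= 1.
Proof. by lra. Qed.

Let sub_ball x : nball x0 s x -> `|x - x0| < s /\ x0 + 1 *: (x - x0) = x.
Proof. by split=> //; rewrite scale1r addrC subrK. Qed.

(** [t *: dev (z1 t) k] is the expected variation of the solution along the ray. By integrability it
    satisfies the linearized equation, so its difference [D] from the actual variation has a forcing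
    of order [|k| ^+ 2] only. *)
Let taylor h k : `|h| < s -> `|h + k| < s ->
 `|Y (h + k) 1 - Y h 1 - dev (Y h 1, x0 + h) k| <= 2 * (K * (4 * K + 4) + K * s * (4 * K + 4) ^+ 2) * `|k| ^+ 2.
Proof.
(* A generous Lipschitz constant for the dependence of solutions on the ray, as [Zn] confirms. *)
move=> hs hks; pose Q := 4 * K + 4.
pose z1 t := (Y h t, x0 + t *: h); pose z2 t := (Y (h + k) t, x0 + t *: (h + k)).
have B1 (t : R) : 0 <= t <= 1 -> nball z0 rho (z1 t) by exact: Yball.
have B2 (t : R) : 0 <= t <= 1 -> nball z0 rho (z2 t) by exact: Yball.
have Kn := ltW K0; have sn := ltW s0; have k0 := normr_ge0 k.
have hsn : `|h| <= s := ltW hs.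
have dz t : z2 t - z1 t = (Y (h + k) t - Y h t, t *: k).
 rewrite -[LHS]/(Y (h + k) t - Y h t, x0 + t *: (h + k) - (x0 + t *: h)).
 by congr (_, _); module R.
have zn (t D : R) : 0 <= t <= 1 -> 0 <= D -> `|Y (h + k) t - Y h t| <= D -> `|z2 t - z1 t| <= D + `|k|.
 move=> /andP[t0 t1] D0 hD; rewrite dz norm_pair_le normrZ ger0_norm //.
 by apply/andP; split; [lra|have := ler_wpM2r k0 t1; lra].
have L2 (t : R) : 0 <= t <= 1 -> linear (dev (z2 t)).
 by move=> ht; have [_ _ l] := dev_family; exact: l (rhor (B2 t ht)).
have dY (t : R) : 0 <= t <= 1 -> cder (fun t => Y (h + k) t - Y h t) t (dev (z2 t) (h + k) - dev (z1 t) h).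
 by move=> ht; apply: cderB; exact: Yder.
have Y00 : Y (h + k) 0 - Y h 0 = 0 by rewrite !Y0 // subrr.
have split2 (t : R) : 0 <= t <= 1 -> dev (z2 t) (h + k) - dev (z1 t) h =
  (dev (z2 t) h - dev (z1 t) h) + dev (z2 t) k.
 by move=> ht; rewrite (lin_add h k (L2 t ht)) addrAC.
have Ynear (t : R) : 0 <= t <= 1 -> `|Y (h + k) t - Y h t| <= 2 * (0 + (4^-1 * `|k| + K * `|k|)).
 move=> ht; apply: (fun h1 h2 h3 h4 => @family_contraction _ _ unit (fun _ t => Y (h + k) t - Y h t)
  (fun _ t => dev (z2 t) (h + k) - dev (z1 t) h) _ _ h1 h2 h3 h4 tt t ht).
 - by move=> _; exact: dY.
 - exists (rho + rho) => _ t1 ht1; have b1 := B1 t1 ht1; have b2 := B2 t1 ht1.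
  rewrite /nball/= norm_pair_lt in b1; rewrite /nball/= norm_pair_lt in b2.
  move: b1 b2 => /andP[b1 _] /andP[b2 _]; rewrite /= in b1 b2.
  by have := ler_distD x0' (Y (h + k) t1) (Y h t1); rewrite (distrC x0'); lra.
 - move=> M hM _ t1 ht1; have M0 : 0 <= M := le_trans (normr_ge0 _) (hM tt t1 ht1).
  rewrite split2 //; via (ler_normD _ _).
  have [_ q1 _ _] := dev_bound (B1 t1 ht1) (B2 t1 ht1) h; have [q2 _ _ _] := dev_bound (B2 t1 ht1) (B2 t1 ht1) k.
  have q3 := zn t1 M ht1 M0 (hM tt t1 ht1).
  have q4 : K * `|z2 t1 - z1 t1| * `|h| <= 4^-1 * (M + `|k|).
   rewrite mulrAC; apply: ler_pM => //; first exact: mulr_ge0.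
   by apply: le_trans s3; apply: ler_wpM2l.
  lra.
 - by move=> _; rewrite Y00 normr0.
have Zn (t : R) : 0 <= t <= 1 -> `|z2 t - z1 t| <= Q * `|k|.
 move=> ht; have D0 : 0 <= 2 * (0 + (4^-1 * `|k| + K * `|k|)) by exact: le_trans (Ynear t ht).
 by apply: (le_trans (zn t _ ht D0 (Ynear t ht))); have := mulr_ge0 Kn k0; rewrite /Q; lra.
have Q0 : 0 <= Q by rewrite /Q; lra.
pose D t := Y (h + k) t - Y h t - t *: dev (z1 t) k.
pose err t := (dev (z2 t) h - dev (z1 t) h - 'd (dev^~ h) (z1 t) (z2 t - z1 t)) + (dev (z2 t) k - dev (z1 t) k).
pose D' t := 'd (dev^~ h) (z1 t) (D t, 0) + err t.
have cD (t : R) : 0 <= t <= 1 -> cder D t (D' t).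
 move=> ht; have cz : cder z1 t (dev (z1 t) h, h) by apply: cder_pair; [exact: Yder|exact: cder_line].
 have c1 := cder_comp (family1_differentiable k dev_family (rhor (B1 t ht))) cz.
 have c2 : cder (fun t => t *: dev (z1 t) k) t (t *: 'd (dev^~ k) (z1 t) (dev (z1 t) h, h) + dev (z1 t) k).
  exact: cder_scale.
 apply: cder_eq (cderB (dY t ht) c2) _.
 have e := dev_integrable h k (rhor (B1 t ht)) (fun v w => bracket_transport v w hs ht).
 have e2 : 'd (dev^~ h) (z1 t) (z2 t - z1 t) = 'd (dev^~ h) (z1 t) (D t, 0)
   + t *: 'd (dev^~ k) (z1 t) (dev (z1 t) h, h).
  have ez : z2 t - z1 t = (D t, 0) + t *: (dev (z1 t) k, k).
   rewrite dz -[RHS]/(D t + t *: dev (z1 t) k, 0 + t *: k) /D.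
   by congr (_, _); rewrite ?add0r ?subrK.
  apply/(etrans (congr1 ('d (dev^~ h) (z1 t)) ez))/(etrans (diff_add _ _ _ _)).
  by apply: congr1; apply: (etrans (diff_scale _ _ _ _)); exact: (congr1 (fun w => t *: w) e).
 have alg (p q u v w : H') : u + v - (q + w) = p + (u - (p + q) + (v - w)) by module R.
 rewrite /D' /err e2 split2 //; exact: alg.
have errb (t : R) : 0 <= t <= 1 -> `|err t| <= (K * Q + K * s * Q ^+ 2) * `|k| ^+ 2.
 move=> ht; have [_ _ _ q1] := dev_bound (B1 t ht) (B2 t ht) h.
 have [_ q2 _ _] := dev_bound (B1 t ht) (B2 t ht) k; have q3 := Zn t ht.
 apply/(le_trans (ler_normD _ _))/(le_trans (lerD q1 q2)).
 have q4 : `|z2 t - z1 t| ^+ 2 <= (Q * `|k|) ^+ 2 by rewrite lerXn2r ?nnegrE ?mulr_ge0.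
 have q5 : K * `|z2 t - z1 t| ^+ 2 * `|h| <= K * (Q * `|k|) ^+ 2 * s.
  by apply: ler_pM => //; [apply: mulr_ge0 => //; exact: sqr_ge0|exact: ler_wpM2l].
 have q6 : K * `|z2 t - z1 t| * `|k| <= K * (Q * `|k|) * `|k|.
  by apply: ler_wpM2r => //; exact: ler_wpM2l.
 by apply: (le_trans (lerD q5 q6)); rewrite le_eqVlt; apply/orP; left; apply/eqP; ring.
have [q _] : `|D 1| <= 2 * (0 + (K * Q + K * s * Q ^+ 2) * `|k| ^+ 2) /\ True.
 split=> //; apply: (fun h1 h2 h3 h4 => @family_contraction _ _ unit (fun _ => D) (fun _ => D') _ _ h1 h2 h3 h4 tt 1 one01).
 - by move=> _; exact: cD.
 - exists (2 * (0 + (4^-1 * `|k| + K * `|k|)) + K * `|k|) => _ t ht.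
  apply/(le_trans (ler_normB _ _))/lerD; first exact: Ynear.
  have [q _ _ _] := dev_bound (B1 t ht) (B1 t ht) k; rewrite normrZ; move/andP: ht => [t0 t1].
  by rewrite ger0_norm // -[leRHS]mul1r; apply: ler_pM.
 - move=> M hM _ t ht; via (ler_normD _ _); apply: lerD (errb t ht).
  have [_ _ q1 _] := dev_bound (B1 t ht) (B1 t ht) h; via (q1 _).
  have n : `|(D t, (0 : H))| <= M.
   by rewrite norm_pair_le normr0 hM //=; exact: le_trans (normr_ge0 _) (hM tt t ht).
  have M0 : 0 <= M := le_trans (normr_ge0 _) n.
  have q2 : K * `|(D t, (0 : H))| * `|h| <= 4^-1 * M.
   rewrite mulrAC; apply: ler_pM => //; first exact: mulr_ge0.
   by apply: le_trans s3; exact: ler_wpM2l.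
  lra.
 - by move=> _; rewrite /D Y00 scale0r subrr normr0.
by move: q; rewrite /D /z1 !scale1r add0r mulrA.
Qed.

(** The value at [x] is the endpoint of the solution along the ray to [x]. Its differential, given
    by [taylor], is an expression in the map itself, so smoothness bootstraps. *)
Lemma development_aux : exists f : H -> H', [/\ f x0 = x0',
 forall x, nball x0 s x -> nball z0 rho (f x, x) /\ is_diff x f (dev (f x, x)),
 forall x v w, nball x0 s x -> gam' (f x) (phi v) (phi w) = gam x v w & smooth_on (nball x0 s) f].
Proof.
exists Fx.
have Bx x : nball x0 s x -> nball z0 rho (Fx x, x).
 by move=> /sub_ball[hs e]; have := Yball hs one01; rewrite e.
have sn : `|(0 : H)| < s by rewrite normr0.
have dF x : nball x0 s x -> is_diff x Fx (dev (Fx x, x)).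
 move=> bx; have [hs e] := sub_ball bx; have [_ _ l] := dev_family; have bz := Bx x bx.
 apply: (is_diff_quadratic (C := 2 * (K * (4 * K + 4) + K * s * (4 * K + 4) ^+ 2)) (r := s - `|x - x0|)).
 - exact: l (rhor bz).
 - by exists K => k; have [q _ _ _] := dev_bound bz bz k.
 - by rewrite subr_gt0.
 - move=> k hk; have hsk : `|x - x0 + k| < s by have := ler_normD (x - x0) k; lra.
  have := taylor hs hsk; rewrite -[X in Y X 1 - _ - _](addrAC x k) -/(Fx (x + k)) -/(Fx x).
  by rewrite [x0 + _]addrC subrK.
split.
- have h0 : x0 - x0 = 0 by rewrite subrr.
 have c0 (t : R) : 0 <= t <= 1 -> cder (Y 0) t 0.
  move=> ht; apply: cder_eq (Yder sn ht) _; have [_ _ l] := dev_family.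
  exact: lin_zero (l _ (rhor (Yball sn ht))).
 have := @mean_value _ _ (Y 0) (fun=> 0) 0 1 0 ler01 c0 (fun t _ => _).
 rewrite mul0r => /(_ ltac:(by rewrite normr0)); rewrite normr_le0 subr_eq0 => /eqP q.
 by rewrite /Fx h0 q; exact: Y0.
- by move=> x bx; split; [exact: Bx|exact: dF].
- by move=> x v w /sub_ball[hs e]; have := metric_transport v w hs one01; rewrite e.
- have oB : open (nball x0 s) by exact: nball_open.
 apply: Ck_from_tangent => [x /dF[]//|n cF]; have [_ sd _] := dev_family.
 apply: (@Ck_congr _ _ _ _ _ (fun z => dev (Fx z.1, z.1) z.2)); first exact: openXT.
  by move=> [x v] [/= bx _]; have [_ e] := dF x bx; rewrite /tangent e.
 have oBB := openXT oB (G := H).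
 apply: (Ck_comp2 oBB (sd n)); [|apply: Ck_pair => //|by Ck_auto].
 + by move=> z [/Bx/rhor ? _].
 + by apply: (Ck_comp oBB _ _ cF); [move=> z []|Ck_auto].
 + by Ck_auto.
Qed.

End Development.

Section LocalIsometryOfFrames.
Context {R : realType}.

Lemma development (H H' : hilbert R) x0 r C b bi m T gam x0' r' C' b' bi' m' T' gam' (phi : H -> H') Cp :
 @frame R H x0 r C b bi m T gam -> @frame R H' x0' r' C' b' bi' m' T' gam' -> linear phi ->
 (forall v, `|phi v| <= Cp * `|v|) -> 0 <= Cp ->
 (forall v w z, phi (T v w z) = T' (phi v) (phi w) (phi z)) ->
 (forall v w, gam' x0' (phi v) (phi w) = gam x0 v w) ->
 exists (s : R) (f : H -> H'), [/\ 0 < s, f x0 = x0', smooth_on (nball x0 s) f &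
  forall x, nball x0 s x -> [/\ nball x0 r x, nball x0' r' (f x),
  is_diff x f (fun k => b' (f x) (phi (bi x k))) &
  forall v w, gam' (f x) (phi v) (phi w) = gam x v w]].
Proof.
move=> fr fr' lphi bphi Cp0 phiT phig.
have [r0 C0] := frame_gt0 fr; have [r0' C0'] := frame_gt0 fr'.
have [oB sd ld] := dev_family fr fr' lphi bphi.
have rr0 : 0 < Num.min r' r by rewrite lt_min r0'.
have [rho [K [rho0 K0 rhor hK]]] := bilinear_bound oB (nballxx (x0', x0) rr0) sd ld.
pose Q := C' * Cp * C + C * C + C * C; have Q0 : 0 < Q.
 by rewrite /Q; have := mulr_gt0 C0 C0; have : 0 <= C' * Cp * C by [rewrite !mulr_ge0 // ltW]; lin.
(* In order: the rays stay in the ball, so do the solutions, the integral operator contracts, and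
   the transport equations contract. *)
pose s := Num.min (Num.min (rho / 4) (rho / 4 / K)) (Num.min (4^-1 / K) (2^-1 / Q)).
have s0 : 0 < s by rewrite !lt_min !divr_gt0.
have [s1 s2 s3 s4] : [/\ s <= rho / 4, s <= rho / 4 / K, s <= 4^-1 / K & s <= 2^-1 / Q].
 by rewrite /s !ge_min !lexx !orbT.
have mv (a c : R) : 0 < a -> s <= c / a -> a * s <= c by move=> a0 h; rewrite mulrC -ler_pdivlMr.
have [f [f0 fB fg sf]] := development_aux fr fr' lphi bphi Cp0 phiT phig rho0 K0 s0 rhor hK
 s1 (mv _ _ K0 s2) (mv _ _ K0 s3) (mv _ _ Q0 s4).
exists s, f; split; [exact: s0|exact: f0|exact: sf|move=> x bx].
have [/rhor bz df] := fB x bx; move: bz; rewrite /nball/= norm_pair_lt !lt_min /=.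
by move=> /andP[/andP[h1 h2] /andP[h3 h4]]; split; [exact: h4|exact: h1|exact: df|move=> v w; exact: fg].
Qed.

(** Along a ray, [f' (f x)] and [x] both move with the velocity that the frame [b] assigns to the
    same coefficients [c t]; as [b] is Lipschitz in the point, their difference stays zero. This
    takes the place of an inverse function theorem. *)
Lemma development_inverse (H H' : hilbert R) x0 r C b bi m T gam x0' r' C' b' bi' m' T' gam'
  (phi : H -> H') (psi : H' -> H) s s' (f : H -> H') (f' : H' -> H) :
 @frame R H x0 r C b bi m T gam -> @frame R H' x0' r' C' b' bi' m' T' gam' -> cancel phi psi ->
 0 < s -> 0 < s' -> f x0 = x0' -> f' x0' = x0 ->
 (forall x, nball x0 s x -> [/\ nball x0 r x, nball x0' r' (f x) &
   is_diff x f (fun k => b' (f x) (phi (bi x k)))]) ->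
 (forall y, nball x0' s' y -> [/\ nball x0' r' y, nball x0 r (f' y) &
   is_diff y f' (fun k => b (f' y) (psi (bi' y k)))]) ->
 exists2 s1 : R, 0 < s1 & forall x, nball x0 s1 x ->
  [/\ nball x0 s x, nball x0' s' (f x) & f' (f x) = x].
Proof.
move=> fr fr' phiK s0 s0' f0 f0' hf hf'.
have [r0 C0] := frame_gt0 fr; have [oB sb lb] := frame_family fr.
have [r3 [L [r30 L0 _ hL]]] := bilinear_bound oB (nballxx x0 r0) sb lb.
have cf : {for x0, continuous f}.
 by have [_ _ [d _]] := hf _ (nballxx x0 s0); exact: differentiable_continuous.
have cf' : {for f x0, continuous f'}.
 by rewrite f0; have [_ _ [d _]] := hf' _ (nballxx x0' s0'); exact: differentiable_continuous.
have n1 : \forall x \near x0, nball x0' s' (f x).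
 by apply: (continuous_open_near cf); [exact: nball_open|rewrite f0; exact: nballxx].
have n2 : \forall x \near x0, nball x0 r3 (f' (f x)).
 have c : {for x0, continuous (fun x => f' (f x))} by exact: continuous_comp cf cf'.
 by apply: (continuous_open_near c); [exact: nball_open|rewrite f0 f0'; exact: nballxx].
have [r4 r40 h4] := (nbhs_nball _ _).1 (filterI n1 n2).
have LC : 0 < L * C by exact: mulr_gt0.
pose s1 := Num.min (Num.min r4 s) (Num.min r3 (2^-1 / (L * C))).
have s10 : 0 < s1 by rewrite !lt_min r40 s0 r30 divr_gt0.
have [a1 a2 a3 a4] : [/\ s1 <= r4, s1 <= s, s1 <= r3 & s1 <= 2^-1 / (L * C)].
 by rewrite /s1 !ge_min !lexx !orbT.
rewrite ler_pdivlMr // in a4.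
exists s1 => // x bx; have bxs : nball x0 s x := lt_le_trans bx a2.
have [b1 _] := h4 x (lt_le_trans bx a1); split=> //.
pose h := x - x0; have xh : x0 + 1 *: h = x by rewrite scale1r addrC subrK.
have B (t : R) : 0 <= t <= 1 -> nball x0 s1 (x0 + t *: h) by exact: nball_segment (nballxx x0 s10) bx.
pose c t := bi (x0 + t *: h) h; pose D t := f' (f (x0 + t *: h)) - (x0 + t *: h).
have one01 : (0 : R) <= (1 : R) <= 1 by rewrite ler01 lexx.
suff q : `|D 1| <= 2 * (0 + 0).
 by move: q; rewrite addr0 mulr0 normr_le0 /D xh subr_eq0 => /eqP.
apply: (fun h1 h2 h3 h4 => @family_contraction _ _ unit (fun _ => D)
 (fun _ t => b (f' (f (x0 + t *: h))) (c t) - b (x0 + t *: h) (c t)) 0 0 h1 h2 h3 h4 tt 1 one01).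
- move=> _ t /B bt; have [br bf df] := hf _ (lt_le_trans bt a2).
 have [by_ _] := h4 _ (lt_le_trans bt a1); have [br' bf' df'] := hf' _ by_.
 apply: cder_eq (cderB (cder_is_diff df' (cder_is_diff df (cder_line x0 h t))) (cder_line x0 h t)) _.
 by rewrite (frame_K fr' _ bf) phiK /c (frame_invK fr _ br).
- exists (r3 + r3) => _ t /B bt; have [_ b3] := h4 _ (lt_le_trans bt a1).
 have b4 : nball x0 r3 (x0 + t *: h) := lt_le_trans bt a3.
 have := ler_distD x0 (f' (f (x0 + t *: h))) (x0 + t *: h).
 by rewrite (distrC x0) /D; move: b3 b4; rewrite /nball/=; lin.
- move=> M hM _ t ht; have bt := B t ht; have [_ b3] := h4 _ (lt_le_trans bt a1).
 have b4 : nball x0 r3 (x0 + t *: h) := lt_le_trans bt a3.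
 have [_ q _ _] := hL _ _ b4 b3 (c t); rewrite addr0; via q.
 have [br _ _] := hf _ (lt_le_trans bt a2); have [_ q2 _ _] := frame_bound fr h h br.
 have hn : `|h| <= s1 := ltW bx.
 have q3 : `|c t| <= C * s1 by via q2; rewrite ler_wpM2l // ltW.
 have q4 : L * `|f' (f (x0 + t *: h)) - (x0 + t *: h)| * `|c t| <= L * M * (C * s1).
  apply: ler_pM => //; first by apply: mulr_ge0 => //; exact: ltW.
  by apply: ler_wpM2l; [exact: ltW|exact: (hM tt t ht)].
 by apply: (le_trans q4); have := ler_wpM2l (le_trans (normr_ge0 _) (hM tt t ht)) a4; lin.
- by rewrite /D scale0r addr0 f0 f0' subrr normr0.
Qed.

Variables (H H' : hilbert R) (U : set H) (g : H -> H -> H -> R) (U' : set H') (g' : H' -> H' -> H' -> R).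

(** The developments of [phi] and of [psi] are inverse to each other near the centres. Each is
    isometric, since its differential carries one frame to the other and the metrics agree in the
    frames. *)
Lemma frames_local_isometry x0 r C b bi m T gam x0' r' C' b' bi' m' T' gam'
  (phi : H -> H') (psi : H' -> H) Cp :
 frame x0 r C b bi m T gam -> frame x0' r' C' b' bi' m' T' gam' ->
 nball x0 r `<=` U -> nball x0' r' `<=` U' ->
 (forall x v w, gam x v w = g x (b x v) (b x w)) ->
 (forall x v w, gam' x v w = g' x (b' x v) (b' x w)) ->
 linear phi -> linear psi -> cancel phi psi -> cancel psi phi -> 0 <= Cp ->
 (forall v, `|phi v| <= Cp * `|v|) -> (forall v, `|psi v| <= Cp * `|v|) ->
 (forall v w z, phi (T v w z) = T' (phi v) (phi w) (phi z)) ->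
 (forall v w, gam' x0' (phi v) (phi w) = gam x0 v w) ->
 exists (V : set H) (V' : set H') (f : H -> H') (f' : H' -> H), [/\ V x0,
  forall x, V x -> V' (f x) /\ f' (f x) = x, forall y, V' y -> V (f' y) /\ f (f' y) = y,
  local_isometry U g U' g' V f & local_isometry U' g' U g V' f'].
Proof.
move=> fr fr' rU rU' gE gE' lphi lpsi phiK psiK Cp0 bphi bpsi phiT phig.
have [s [f [s0 f0 sf hf]]] := development fr fr' lphi bphi Cp0 phiT phig.
have psiT v w z : psi (T' v w z) = T (psi v) (psi w) (psi z).
 by rewrite -[LHS](congr1 psi (etrans (phiT (psi v) (psi w) (psi z)) (f_equal3 T' (psiK v) (psiK w) (psiK z)))) phiK.
have psig v w : gam x0 (psi v) (psi w) = gam' x0' v w by rewrite -phig !psiK.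
have [s' [f' [s0' f0' sf' hf']]] := development fr' fr lpsi bpsi Cp0 psiT psig.
have iso (K K' : hilbert R) y0 q D e ei n S ga y0' q' D' e' ei' n' S' ga' (W : set K) k (W' : set K') k'
  (ph : K -> K') t F : @frame R K y0 q D e ei n S ga -> @frame R K' y0' q' D' e' ei' n' S' ga' ->
  nball y0 q `<=` W -> nball y0' q' `<=` W' ->
  (forall x v w, ga x v w = k x (e x v) (e x w)) -> (forall x v w, ga' x v w = k' x (e' x v) (e' x w)) ->
  smooth_on (nball y0 t) F -> (forall x, nball y0 t x -> [/\ nball y0 q x, nball y0' q' (F x),
  is_diff x F (fun k => e' (F x) (ph (ei x k))) & forall v w, ga' (F x) (ph v) (ph w) = ga x v w]) ->
  local_isometry W k W' k' (nball y0 t) F.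
 move=> fq fq' qW qW' kE kE' sF hF; split; [exact: nball_open|exact: sF| | |].
 - by move=> x /hF[/qW].
 - by move=> x /hF[_ /qW'].
 - move=> x u v /hF[bx _ [_ e1] eg]; rewrite e1 -kE' eg kE.
  by rewrite !(frame_invK fq _ bx).
have hf1 x : nball x0 s x -> [/\ nball x0 r x, nball x0' r' (f x) &
   is_diff x f (fun k => b' (f x) (phi (bi x k)))] by move=> /hf[].
have hf2 y : nball x0' s' y -> [/\ nball x0' r' y, nball x0 r (f' y) &
   is_diff y f' (fun k => b (f' y) (psi (bi' y k)))] by move=> /hf'[].
have [s1 s10 h1] := development_inverse fr fr' phiK s0 s0' f0 f0' hf1 hf2.
have [s2 s20 h2] := development_inverse fr' fr psiK s0' s0 f0' f0 hf2 hf1.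
(* Cutting each ball by the preimage of the other makes the two maps exact inverses. *)
pose V := nball x0 s1 `&` f @^-1` nball x0' s2; pose V' := nball x0' s2 `&` f' @^-1` nball x0 s1.
have op (K K' : hilbert R) (y0 : K) t (y0' : K') t' q (F : K -> K') : smooth_on (nball y0 q) F ->
  (forall x, nball y0 t x -> nball y0 q x) -> open (nball y0 t `&` F @^-1` nball y0' t').
 move=> sF hq; rewrite openE => x [bx bF]; apply: filterI.
  by apply: open_near bx; exact: nball_open.
 by apply: (continuous_open_near (smooth_cont sF (hq x bx))) bF; exact: nball_open.
exists V, V', f, f'; split.
- by split; [exact: nballxx|rewrite /= f0; exact: nballxx].
- by move=> x [bx bF]; have [_ _ e] := h1 x bx; split=> //; split=> //=; rewrite e.
- by move=> y [bx bF]; have [_ _ e] := h2 y bx; split=> //; split=> //=; rewrite e.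
- apply: local_isometry_sub (iso _ _ _ _ _ _ _ _ _ _ _ _ _ _ _ _ _ _ U g U' g' _ _ _ fr fr' rU rU' gE gE' sf hf); first by apply: op sf _ => x /h1[].
 by move=> x [/h1[]].
- apply: local_isometry_sub (iso _ _ _ _ _ _ _ _ _ _ _ _ _ _ _ _ _ _ U' g' U g _ _ _ fr' fr rU' rU gE' gE sf' hf'); first by apply: op sf' _ => x /h2[].
 by move=> x [/h2[]].
Qed.

End LocalIsometryOfFrames.

(** * The isometry of tangent spaces and the descent to the base manifolds *)

Section Final.
Context {R : realType}.

(** The transvections are picked by choice for each [v]; their common form of 1-jet at [p] is what
    makes them a frame. *)
Lemma transvection_frame (H : hilbert R) (N M : riemannian H) (pi : N -> M) (p : N) :
 symmetric_space M -> riemannian_covering pi -> exists (X : H -> N -> H) r C bi m,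
 [/\ forall v, transvection p (X v) /\ X v p = v, nball (chart N p p) r `<=` chart_image p &
  frame (chart N p p) r C (fun x v => local_field p (X v) x) bi m
  (fun v w z => field_bracket (field_bracket (X v) (X w)) (X z) p)
  (fun x v w => local_form (metric N) p x (local_field p (X v) x) (local_field p (X w) x))].
Proof.
move=> symM cov; have Dp := chart_dom_center p.
have [X hX] := choice (fun v => transvection_exists p v symM cov).
have ev v : local_field p (X v) (chart N p p) = v.
 by rewrite /local_field chartK // transport_id //; have [_ ->] := hX v.
have DX v k : 'd (local_field p (X v)) (chart N p p) k = - christoffel_of (local_form (metric N) p) (chart N p p) k v.
 have [[_ /(_ k) h] e _] := hX v; rewrite /covariant_derivative e christoffel_local in h.
 by apply/eqP; rewrite -addr_eq0; apply/eqP.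
have kX v : killing_on (chart_image p) (local_form (metric N) p) (chart_image p) (local_field p (X v)).
 by have [] := hX v.
have [r [C [bi [m [rU fr]]]]] := @killing_frame _ _ _ _ (local_form_metric p) (chart N p p)
 (fun x v => local_field p (X v) x) (chart_imageP Dp) kX ev DX.
exists X, r, C, bi, m; split=> [v||]; [by have [] := hX v|exact: rU|].
have eT : (fun v w z => field_bracket (field_bracket (X v) (X w)) (X z) p) =
  (fun v w z => local_bracket (local_bracket (local_field p (X v)) (local_field p (X w))) (local_field p (X z)) (chart N p p)).
 apply/funext => v; apply/funext => w; apply/funext => z.
 by apply: field_bracket2_local; [have [[[]]] := hX v|have [[[]]] := hX w|have [[[]]] := hX z].
rewrite eT; exact: fr.
Qed.

Section Embedding.
Variables (H : hilbert R) (N : riemannian H) (p : N) (L : hilbert R) (J : H -> L).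
Hypothesis innerJ : forall v w, inner L (J v) (J w) = metric N p v w.

Lemma inner_zero (z : L) : inner L z z = 0 -> z = 0.
Proof. by rewrite inner_norm => /eqP; rewrite expf_eq0 normr_eq0 => /eqP. Qed.

(** The squared norm of the linearity defect expands into scalar products, which are preserved, and
    so it vanishes. Thus a choice of transvections becomes linear once mapped into [L]. *)
Lemma isometric_linear : linear J.
Proof.
move=> a v w; apply/subr0_eq/inner_zero.
have l1 := dot_linear (inner L); have l2 := dot_linear (metric N p).
have s1 := dot_sym (inner L); have s2 := dot_sym (metric N p).
rewrite (form_subl l1) !(form_subr l1 s1) !(form_addl l1) !(form_addr l1 s1).
rewrite !(form_scalel l1) !(form_scaler l1 s1) !innerJ.
rewrite !(form_addl l2) !(form_addr l2 s2) !(form_scalel l2) !(form_scaler l2 s2) (s2 w v).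
by lin.
Qed.

Lemma isometric_inj v w : J v = J w -> v = w.
Proof.
move=> e; have z : J (v - w) = 0 by rewrite (lin_sub _ _ isometric_linear) e subrr.
have [c c0 hc] := metric_strong p; have := hc (v - w).
rewrite -innerJ z (form0l (dot_linear (inner L))) pmulr_rle0 // => h.
by apply/eqP; rewrite -subr_eq0 -normr_eq0 -sqrf_eq0 eq_le h sqr_ge0.
Qed.

End Embedding.

Lemma transvection_brackets0 (H : hilbert R) (N : riemannian H) (p : N) :
 transvection_brackets p (0 : N -> H).
Proof. by exists 0%N, (fun _ => 0), (fun _ => 0); split=> [[]//|]; rewrite big_ord0. Qed.

Lemma transvection_bracket (H : hilbert R) (N : riemannian H) (p : N) X Y :
 transvection p X -> transvection p Y -> transvection_brackets p (field_bracket X Y).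
Proof.
by exists 1%N, (fun _ => X), (fun _ => Y); rewrite big_ord1.
Qed.

Lemma metric_le (H : hilbert R) (N : riemannian H) p : exists2 C : R, 0 < C &
 forall u, metric N p u u <= C * `|u| ^+ 2.
Proof.
have Dp := chart_dom_center p.
have [r [c [C [r0 c0 C0 _ h]]]] := metric_bound (local_form_metric p) (chart_imageP Dp).
exists C => // u; have [_ q] := h _ (nballxx _ r0) u u.
rewrite local_form_chart // !transport_id // in q.
by via (ler_norm _); rewrite mulrA.
Qed.

(** [J] and [J'] parametrize [P] and [P'], so [F] induces [phi]. Tested against a vector [t], a
    triple bracket becomes, up to sign, the scalar product of two brackets of elements of [P], which
    [F] preserves. *)
Lemma tangent_isometry (H H' : hilbert R) (N : riemannian H) (N' : riemannian H') (p : N) (p' : N')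
  (L L' : Lstar_algebra R) (K P : set L) (K' P' : set L') (F : L -> L')
  (X : H -> N -> H) (X' : H' -> N' -> H') :
 associated_Lstar p K P -> associated_Lstar p' K' P' -> Lstar_isomorphism F -> F @` P = P' ->
 (forall v, transvection p (X v) /\ X v p = v) -> (forall v, transvection p' (X' v) /\ X' v p' = v) ->
 exists (phi : H -> H') (psi : H' -> H), [/\ linear phi /\ linear psi, cancel phi psi, cancel psi phi,
  forall v w, metric N' p' (phi v) (phi w) = metric N p v w &
  forall v w z, phi (field_bracket (field_bracket (X v) (X w)) (X z) p) =
   field_bracket (field_bracket (X' (phi v)) (X' (phi w))) (X' (phi z)) p'].
Proof.
move=> [eps [iota [_ [il [ib _]] [KE PE _ _] [ig iT] st]]].
move=> [eps' [iota' [_ [il' [ib' _]] [KE' PE' _ _] [ig' iT'] st']]].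
move=> [[lF [Fi FK FiK]] Fb Fg Fs] FP hX hX'.
pose J v := iota (X v); pose J' v := iota' (X' v).
have gJ v w : inner L (J v) (J w) = metric N p v w.
 by have [t1 e1] := hX v; have [t2 e2] := hX w; rewrite /J ig // e1 e2.
have gJ' v w : inner L' (J' v) (J' w) = metric N' p' v w.
 by have [t1 e1] := hX' v; have [t2 e2] := hX' w; rewrite /J' ig' // e1 e2.
(* The image of a transvection in the algebra depends only on its value at the point, because scalar
   products are prescribed by these values. *)
have same (K1 : hilbert R) (N1 : riemannian K1) (p1 : N1) (L1 : hilbert R) (i : (N1 -> K1) -> L1) A B :
  (forall X Y, transvection p1 X -> transvection p1 Y -> inner L1 (i X) (i Y) = metric N1 p1 (X p1) (Y p1)) ->
  transvection p1 A -> transvection p1 B -> A p1 = B p1 -> i A = i B.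
 move=> ii tA tB e; apply/subr0_eq/inner_zero.
 have l1 := dot_linear (inner L1).
 by rewrite (form_subl l1) !(form_subr l1 (dot_sym (inner L1))) !ii // e subrr.
have ex v : exists w, J' w = F (J v).
 have : P' (F (J v)) by rewrite -FP; exists (J v) => //; rewrite PE; exists (X v) => //; have [] := hX v.
 rewrite PE' => -[Y tY e]; exists (Y p'); rewrite -e.
 by have [t' e'] := hX' (Y p'); apply: same ig' t' tY e'.
have ex' w : exists v, F (J v) = J' w.
 have : P' (J' w) by rewrite PE'; exists (X' w) => //; have [] := hX' w.
 rewrite -FP => -[z]; rewrite PE => -[Y tY <-] e; exists (Y p); rewrite -e; congr F.
 by have [t' e'] := hX (Y p); apply: same ig t' tY e'.
have [phi hphi] := choice ex; have [psi hpsi] := choice ex'.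
have lJ := isometric_linear gJ.
have jJ := isometric_inj gJ; have jJ' := isometric_inj gJ'.
have phiK : cancel phi psi.
 by move=> v; apply: jJ; rewrite -[LHS]FK -[RHS]FK hpsi hphi.
have psiK : cancel psi phi by move=> w; apply: jJ'; rewrite hphi.
have lphi : linear phi.
 by move=> a v w; apply: jJ'; rewrite hphi lJ lF (isometric_linear gJ') !hphi.
have lpsi : linear psi.
 by move=> a v w; rewrite -[LHS](congr1 psi (congr2 (fun u t => a *: u + t) (psiK v) (psiK w))) -lphi phiK.
have gphi v w : metric N' p' (phi v) (phi w) = metric N p v w by rewrite -gJ' !hphi Fg.
exists phi, psi; split=> // v w z.
have alg v1 : transvection_algebra p (X v1).
 by exists 0, (X v1); split; [exact: transvection_brackets0|have [] := hX v1|rewrite add0r].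
have alg' v1 : transvection_algebra p' (X' v1).
 by exists 0, (X' v1); split; [exact: transvection_brackets0|have [] := hX' v1|rewrite add0r].
pose sg e (c : R) := match e with Nonpositive => - c | Nonnegative => c end.
set T := field_bracket _ _ p; set T' := field_bracket _ _ p'.
have key t : sg eps (metric N p T t) = sg eps' (metric N' p' T' (phi t)).
 have [tv _] := hX v; have [tw _] := hX w; have [tz _] := hX z; have [tt et] := hX t.
 have [tv' _] := hX' (phi v); have [tw' _] := hX' (phi w).
 have [tz' _] := hX' (phi z); have [tt' et'] := hX' (phi t).
 have h := iT _ _ _ (transvection_bracket tv tw) tz tt.
 have h' := iT' _ _ _ (transvection_bracket tv' tw') tz' tt'.
 rewrite et -/T in h; rewrite et' -/T' in h'.
 apply/(etrans (esym h))/esym; apply: (etrans (esym h')).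
 rewrite !ib' // !ib // -!/(J' _) !hphi -!Fb; exact: Fg.
have [e|ne] := pselect (eps = eps').
 have q t : metric N p T t = metric N' p' T' (phi t).
  by have := key t; rewrite e; case: (eps') => //= /oppr_inj.
 have d : metric N' p' (phi T - T') (phi T - T') = 0.
  have pp u : metric N' p' (phi T) u = metric N' p' T' u.
   by rewrite -(psiK u) gphi q.
  by rewrite (form_subl (dot_linear (metric N' p'))) pp subrr.
 have [c c0 hc] := metric_strong p'; have := hc (phi T - T'); rewrite d pmulr_rle0 // => h.
 by apply/eqP; rewrite -subr_eq0 -normr_eq0 -sqrf_eq0 eq_le h sqr_ge0.
(* With opposite signs F would intertwine the identity and its opposite on P, so P = 0. *)
have i0 : iota 0 = 0.
 have a0 : transvection_algebra p (X 0) := alg 0.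
 have := il (-1) _ _ a0 a0; rewrite scaleN1r addNr => e.
 by rewrite e scaleN1r addNr.
have i0' : iota' 0 = 0.
 have a0 : transvection_algebra p' (X' 0) := alg' 0.
 have := il' (-1) _ _ a0 a0; rewrite scaleN1r addNr => e.
 by rewrite e scaleN1r addNr.
have K0 : K 0 by rewrite KE; apply: subset_closure; exists 0 => //; exact: transvection_brackets0.
have K0' : K' 0 by rewrite KE'; apply: subset_closure; exists 0 => //; exact: transvection_brackets0.
have z0 (u : H) : u = 0.
 have Pu : P (J u) by rewrite PE; exists (X u) => //; have [] := hX u.
 have Pu' : P' (F (J u)) by rewrite -FP.
 have e1 := st 0 (J u) K0 Pu; have e2 := st' 0 (F (J u)) K0' Pu'; rewrite [0 + J u]add0r in e1; rewrite [0 + F _]add0r in e2.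
 have e3 := Fs (J u); rewrite e1 e2 in e3.
 have dbl (x : L') : x = - x -> x = 0.
  by move=> /eqP; rewrite -addr_eq0 -mulr2n -scaler_nat scaler_eq0 pnatr_eq0 /= => /eqP.
 apply: jJ; rewrite (lin_zero lJ) -[LHS]FK -[RHS]FK (lin_zero lF); congr Fi; apply: dbl.
 move: ne e3; case: (eps); case: (eps') => // _; rewrite !oppr0 !add0r ?(lin_opp _ lF) => e3; first exact: e3.
 by rewrite e3.
by rewrite -[RHS]psiK (z0 (psi T')) (z0 T).
Qed.

Lemma chart_isometry (H H' : hilbert R) (N : riemannian H) (N' : riemannian H') p (p' : N')
  (V : set H) (V' : set H') f f' : V (chart N p p) ->
 (forall x, V x -> V' (f x) /\ f' (f x) = x) -> (forall y, V' y -> V (f' y) /\ f (f' y) = y) ->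
 local_isometry (chart_image p) (local_form (metric N) p) (chart_image p') (local_form (metric N') p') V f ->
 local_isometry (chart_image p') (local_form (metric N') p') (chart_image p) (local_form (metric N) p) V' f' ->
 exists (A : set N) (A' : set N') (h : N -> N') (h' : N' -> N), A p /\ isometry_between A A' h h'.
Proof.
move=> Vp hf hf' if1 if2.
pose dom (K : hilbert R) (Q : riemannian K) (a : Q) (W : set K) := chart_dom Q a `&` chart Q a @^-1` W.
pose mp (K K' : hilbert R) (Q : riemannian K) (Q' : riemannian K') (a : Q) (a' : Q') (k : K -> K') q :=
 chart_inv Q' a' (k (chart Q a q)).
have op (K : hilbert R) (Q : riemannian K) (a : Q) W : open W -> open (dom K Q a W).
 move=> oW; rewrite openE => q [Dq Wq]; apply: filterI; last exact: (chart_near Dq oW Wq).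
 exact: open_nbhs_nbhs (conj (chart_dom_open _) Dq).
have at_ (K K' : hilbert R) (Q : riemannian K) (Q' : riemannian K') (a : Q) (a' : Q') W k :
  local_isometry (chart_image a) (local_form (metric Q) a) (chart_image a') (local_form (metric Q') a') W k ->
  forall q, dom K Q a W q -> isometric_at (mp K K' Q Q' a a' k) q /\ chart_dom Q' a' (mp K K' Q Q' a a' k q) /\
   chart Q' a' (mp K K' Q Q' a a' k q) = k (chart Q a q).
 move=> ik q [Dq Wq]; have [oW sk WU kW _] := ik; have [D' e'] := chart_invP (kW _ Wq).
 split; last by split.
 have cq : {for q, continuous (mp K K' Q Q' a a' k)}.
  apply: (@continuous_comp _ _ _ (fun q => k (chart Q a q)) (chart_inv Q' a')).
   apply: (@continuous_comp _ _ _ (chart Q a) k); first exact: chart_continuous.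
   exact: smooth_cont sk Wq.
  exact: chart_inv_continuous (kW _ Wq).
 apply: (isometric_at_one cq Dq D' Wq); apply: local_isometry_congr ik => x Wx.
 have [Dx ex] := chart_invP (WU _ Wx); have [_ ek] := chart_invP (kW _ Wx).
 by rewrite /rep /mp ex ek.
have [oV _ _ _ _] := if1; have [oV' _ _ _ _] := if2.
exists (dom _ N p V), (dom _ N' p' V'), (mp _ _ N N' p p' f), (mp _ _ N' N p' p f').
split; first by split=> //; exact: chart_dom_center.
apply: isometric_between; [exact: op|exact: op| | | |].
- move=> q Vq; have [_ [D e]] := at_ _ _ _ _ _ p' _ _ if1 q Vq; have [Dq Wq] := Vq.
 have [h1 h2] := hf _ Wq; split; first by split=> //; rewrite /= e.
 by rewrite {1}/mp e h2 chartK.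
- move=> q Vq; have [_ [D e]] := at_ _ _ _ _ _ p _ _ if2 q Vq; have [Dq Wq] := Vq.
 have [h1 h2] := hf' _ Wq; split; first by split=> //; rewrite /= e.
 by rewrite {1}/mp e h2 chartK.
- by move=> q Vq; have [] := at_ _ _ _ _ _ p' _ _ if1 q Vq.
- by move=> q Vq; have [] := at_ _ _ _ _ _ p _ _ if2 q Vq.
Qed.

(** The isometry is restricted until its source and its target each lie in one sheet, then
    conjugated by the two coverings. *)
Lemma covered_isometry (H H' : hilbert R) (M N : riemannian H) (M' N' : riemannian H') (pi : N -> M)
  (pi' : N' -> M') (A : set N) (A' : set N') h h' p : riemannian_covering pi -> riemannian_covering pi' ->
 A p -> isometry_between A A' h h' -> locally_isomorphic M M'.
Proof.
move=> cov cov' Ap ih; have [[oA oA'] [hA hA'] [[ch _] _] _] := ih.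
have [U [oU Up hU]] := covering_sheets cov (pi p); have [W [s [Wp iW]]] := hU p Up.
have [U' [oU' Up' hU']] := covering_sheets cov' (pi' (h p)); have [W' [s' [Wp' iW']]] := hU' (h p) Up'.
have [[oW _] [hW _] _ _] := iW; have [[oW' _] _ _ _] := iW'.
pose A1 := (A `&` W) `&` h @^-1` W'.
have oA1 : open A1.
 rewrite openE => q [[Aq Wq] W'q]; apply: filterI; first exact: open_nbhs_nbhs (conj (openI oA oW) (conj Aq Wq)).
 by apply: (continuous_open_near (ch q Aq)) W'q.
have i1 := isometry_sub oA1 (fun q (hq : A1 q) => hq.1.1) ih.
have i2 := isometry_sym (isometry_sub oA1 (fun q (hq : A1 q) => hq.1.2) iW).
have [[_ oA2] _ _ _] := i1.
have A2W' : A' `&` h' @^-1` A1 `<=` W'.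
 by move=> y [Ay [_ /=]]; have [_ ->] := hA' y Ay.
exists (U `&` s @^-1` A1); eexists; eexists; eexists; split; last exact: (isometry_comp (isometry_comp i2 i1) (isometry_sub oA2 A2W' iW')).
have [Upp ep] := hW p Wp; exists (pi p); split=> //=; rewrite ep.
by split.
Qed.

End Final.

Theorem theorem1p3 (R : realType) (H H' : hilbert R)
    (M : riemannian H) (M' : riemannian H')
    (symM : symmetric_space M) (symM' : symmetric_space M')
    (signM : fixed_sign M) (signM' : fixed_sign M')
    (N : riemannian H) (pi : N -> M) (covN : universal_covering pi)
    (N' : riemannian H') (pi' : N' -> M') (covN' : universal_covering pi')
    (p : N) (L : Lstar_algebra R) (K P : set L)
    (assL : associated_Lstar p K P)
    (p' : N') (L' : Lstar_algebra R) (K' P' : set L')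
    (assL' : associated_Lstar p' K' P')
    (isoL : exists F : L -> L',
       [/\ Lstar_isomorphism F, F @` K = K' & F @` P = P']) :
  locally_isomorphic M M'.
Proof.
have [F [isoF FK FP]] := isoL; have [_ cov] := covN; have [_ cov'] := covN'.
have [X [r [C [bi [m [hX rU fr]]]]]] := transvection_frame p symM cov.
have [X' [r' [C' [bi' [m' [hX' rU' fr']]]]]] := transvection_frame p' symM' cov'.
have [phi [psi [[lphi lpsi] phiK psiK gphi phiT]]] := tangent_isometry assL assL' isoF FP hX hX'.
have gpsi v w : metric N p (psi v) (psi w) = metric N' p' v w by rewrite -gphi !psiK.
(* A metric at a point is equivalent to the squared norm, so a map preserving the metrics is bounded
   for the norms. *)
have bnd (K1 K2 : hilbert R) (N1 : riemannian K1) (N2 : riemannian K2) (q1 : N1) (q2 : N2) (f : K1 -> K2) :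
  (forall v w, metric N2 q2 (f v) (f w) = metric N1 q1 v w) ->
  exists2 D : R, 0 <= D & forall v, `|f v| <= D * `|v|.
 move=> hf; have [D D0 hD] := metric_le q1; have [c c0 hc] := metric_strong q2.
 exists (D / c + 1) => [|v]; first by rewrite addr_ge0 // divr_ge0 // ltW.
 have h : c * `|f v| ^+ 2 <= D * `|v| ^+ 2.
  by apply: (le_trans (hc (f v))); rewrite hf; exact: hD.
 have q0 : 0 <= D / c by rewrite divr_ge0 // ltW.
 rewrite -[_ <= _]ler_sqr ?nnegrE ?mulr_ge0 //; last by rewrite addr_ge0.
 rewrite exprMn; apply: (@le_trans _ _ (D / c * `|v| ^+ 2)).
  by rewrite mulrAC ler_pdivlMr // mulrC.
 by apply: ler_wpM2r; [exact: sqr_ge0|nra].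
have [D D0 hD] := bnd _ _ _ _ _ _ _ gphi; have [D' D0' hD'] := bnd _ _ _ _ _ _ _ gpsi.
have ef (K1 : hilbert R) (N1 : riemannian K1) (q : N1) (Y : K1 -> N1 -> K1) v w :
  (forall v, transvection q (Y v) /\ Y v q = v) ->
  local_form (metric N1) q (chart N1 q q) (local_field q (Y v) (chart N1 q q))
   (local_field q (Y w) (chart N1 q q)) = metric N1 q v w.
 move=> hY; have Dq := chart_dom_center q; rewrite local_form_chart // /local_field chartK //.
 by rewrite !transport_id //; have [_ ->] := hY v; have [_ ->] := hY w.
(* [D + D'] bounds both [phi] and [psi], for which a single constant is expected. *)
have [V [V' [f [f' [Vx hf hf' if1 if2]]]]] := @frames_local_isometry _ _ _ (chart_image p)
 (local_form (metric N) p) (chart_image p') (local_form (metric N') p') _ _ _ _ _ _ _ _ _ _ _ _ _ _ _ _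
 phi psi (D + D') fr fr' rU rU' (fun x v w => erefl) (fun x v w => erefl) lphi lpsi phiK psiK (addr_ge0 D0 D0')
 (fun v => le_trans (hD v) (ler_wpM2r (normr_ge0 v) (ler_wpDr D0' (lexx D))))
 (fun v => le_trans (hD' v) (ler_wpM2r (normr_ge0 v) (ler_wpDl D0 (lexx D'))))
 phiT (fun v w => etrans (ef _ _ _ X' _ _ hX') (etrans (gphi v w) (esym (ef _ _ _ X _ _ hX)))).
have [A [A' [h [h' [Ap ih]]]]] := chart_isometry Vx hf hf' if1 if2.
exact: covered_isometry cov cov' Ap ih.
Qed.
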